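(* Let $X$, $\Theta$, $R'$, $d$, $\mathcal{S}$, $S$, $b_{m,k}$, $d_{m,k}$ be as in the context. Assume that there exists a real number $b>1$ such that, for all $k\in\mathcal{S}$, $$S\ge k+1+\max\big(b(d_{1,k}+2)+3,\; d+1+b(d+d_{1,k}+1)\big),\qquad S\ge k+3+b(2+d_{2,k}),$$ $$S\ge k+1+b\max(d_{1,k},d_{2,k}),\qquad S\ge k+b\,d_{3,k}.$$ For all $0\le j\le S-1$, let $\omega_j(t,z)$ be a function which is holomorphic and bounded on $D(0,R')^2$. Then there exist constants $\sigma,\bar W,C_{12}>0$ such that the problem $$\partial_w^SY(t,z,w)=\sum_{k\in\mathcal{S}}\Big(b_{1,k}(t,z,X(t,z),w)\,\partial_t\partial_w^kY(t,z,w)+b_{2,k}(t,z,X(t,z),w)\,\partial_z\partial_w^kY(t,z,w)+b_{3,k}(t,z,X(t,z),w)\,\partial_w^kY(t,z,w)\Big)$$ with initial data $(\partial_w^jY)(t,z,0)=\omega_j(t,z)$, $0\le j\le S-1$, has a solution $Y(t,z,w)$ which is holomorphic on $\mathrm{Int}(K)\times D(0,\bar W/2)$ and which fulfills the estimates $$\sup_{(t,z)\in\mathrm{Int}(K),\,w\in D(0,\bar W/2)}|Y(t,z,w)|\le C_{12}\exp(\sigma\zeta(b)\rho)+\sum_{j=0}^{S-1}\ \sup_{(t,z)\in\mathrm{Int}(K)}|\omega_j(t,z)|\,\frac{(\bar W/2)^j}{j!},$$ where $\zeta(b)=\sum_{n\ge0}1/(n+1)^b$, for any compact set $K\subset D(0,R)^2\setminus\Theta$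 with non-empty interior $\mathrm{Int}(K)$, for some $R<R'$, and any $\rho>1$ which satisfies $$\sup_{(t,z)\in \mathrm{Int}(K)}\frac{|\partial_z^hX(t,z)|}{h!\,\nu^h}\le \frac{\rho}{2}\qquad\text{for all integers }h\ge 0,\qquad( * )$$ where $\nu>0$ is the real number attached to $K$ as in the context. The constants $\sigma,\bar W,C_{12}>0$ depend neither on $K$ nor on $\rho>1$.
   Context: $D(0,r)$ is the disc in $\mathbb{C}$ centered at $0$ with radius $r$; $\mathbb{N}=\{0,1,2,\dots\}$. The function $X$: let $d\ge2$ be an integer, let $a(t,z)$ and $a_p(t,z)$, $0\le p\le d$, be holomorphic on $D(0,R')^2$ with $a_d$ not identically zero, and let $f$ be holomorphic on $D(0,R')$. It is assumed that the Cauchy problem $$\partial_tX(t,z)=a(t,z)\partial_zX(t,z)+\sum_{p=0}^da_p(t,z)X^p(t,z),\qquad X(0,z)=f(z),$$ has a holomorphic solution $X(t,z)$ on $D(0,R')^2\setminus\Theta$, where $\Theta$ is an analytic variety of $D(0,R')^2$ (every point of $D(0,R')^2$ has a neighborhood $\mathcal{U}$ such that $\mathcal{U}\cap\Theta$ is the common zero locus of finitely many holomorphic functions on $\mathcal{U}$). The number $\nu$: given a compact set $K_0\subset D(0,R)^2\setminus\Theta$ with non-empty interior, a real number $\rho>1$ with $\sup_{K_0}|X|\le\rho/2$, and a compact set $K\subsetneq K_0$ with non-empty interior $\mathrm{Int}(K)$, the Cauchy formula provides a real number $\nu>0$ such that $( * )$ holds for all integers $h\ge0$. The coefficients: $\mathcal{S}$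 is a finite subset of $\mathbb{N}$ and $S\ge1$ is an integer with $S>k$ for all $k\in\mathcal{S}$. For $m=1,2,3$ and $k\in\mathcal{S}$, $b_{m,k}(t,z,u_0,w)$ is a holomorphic function on $D(0,R')^2\times\mathbb{C}\times D(0,\bar w)$, for some $\bar w>0$, which is polynomial in $u_0$ of degree $d_{m,k}\ge0$. *)

(* Defs.v *)
From HB Require Import structures.
From mathcomp Require Import all_boot all_order all_algebra finmap.
From mathcomp Require Import all_classical all_reals all_analysis.
From mathcomp Require Import complex.

Set Implicit Arguments.
Unset Strict Implicit.
Unset Printing Implicit Defensive.

Import Order.TTheory GRing.Theory Num.Theory.
Import numFieldNormedType.Exports.

Local Open Scope classical_set_scope.
Local Open Scope ring_scope.
Local Open Scope complex_scope.

(* As a numFieldType, [R[i]] carries the topology and the structure of normed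
   module over itself that MathComp-Analysis attaches to every numFieldType, so
   [differentiable] and ['D_v] below are complex notions. *)
Definition Cx (R : realType) : numFieldType := R[i].

Section Notions.
Variable R : realType.
Local Notation C := (Cx R).

Definition disc (r : R) : set C := [set z | `|z| < r%:C].

Definition bidisc (r : R) : set (C * C) := disc r `*` disc r.

(* Used only for open [U]; [differentiable] is Frechet differentiability over
   the complex field. *)
Definition holomorphic_on (V : normedModType C) (U : set V) (f : V -> C) :=
  forall p, U p -> differentiable f p.

(* The modulus is a real element of [R[i]], whence the real part; the supremum
   is [+oo] when [f] is unbounded on [A]. *)
Definition supnorm (T : Type) (A : set T) (f : T -> C) : \bar R :=
  ereal_sup [set (complex.Re `|f x|)%:E | x in A].

Definition analytic_variety (D Theta : set (C * C)) :=
  Theta `<=` D /\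
  forall p, D p -> exists U : set (C * C),
    [/\ open U, U p, U `<=` D &
        exists (n : nat) (F : 'I_n -> C * C -> C),
          (forall i, holomorphic_on U (F i)) /\
          U `&` Theta = [set q | U q /\ forall i, F i q = 0]].

(* Functions of [(t, z)] live on [C * C], those of [(t, z, w)] on
   [(C * C) * C]. *)
Definition dt (F : C * C -> C) : C * C -> C := 'D_((1, 0) : C * C) F.
Definition dz (F : C * C -> C) : C * C -> C := 'D_((0, 1) : C * C) F.
Definition dt3 (F : C * C * C -> C) : C * C * C -> C :=
  'D_((1, 0, 0) : C * C * C) F.
Definition dz3 (F : C * C * C -> C) : C * C * C -> C :=
  'D_((0, 1, 0) : C * C * C) F.
Definition dw3 (F : C * C * C -> C) : C * C * C -> C :=
  'D_((0, 0, 1) : C * C * C) F.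

(* When [(0, z)] belongs to [Theta] the value of [X] there is meaningless, so
   the initial condition is only required off [Theta]. *)
Definition solves_X (R' : R) (Theta : set (C * C)) (d : nat)
    (a : C * C -> C) (a_ : nat -> C * C -> C) (f : C -> C) (X : C * C -> C) :=
  [/\ holomorphic_on (bidisc R' `\` Theta) X,
      forall p, (bidisc R' `\` Theta) p ->
        dt X p = a p * dz X p + \sum_(i < d.+1) a_ i p * X p ^+ i &
      forall z, (bidisc R' `\` Theta) (0, z) -> X (0, z) = f z].

Definition cauchy_estimate (X : C * C -> C) (K : set (C * C)) (nu rho : R) :=
  forall h : nat,
    (supnorm K° (fun p : C * C => (iter h dz X p / (h`!%:R * nu%:C ^+ h))%R)
       <= (rho / 2)%:E)%E.

(* [nu] is a number that the Cauchy formula provides for [K], through some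
   larger compact set [K0] contained in [Omega]. *)
Definition cauchy_rate (Omega : set (C * C)) (X : C * C -> C)
    (K : set (C * C)) (nu : R) :=
  0 < nu /\
  exists (K0 : set (C * C)) (rho0 : R),
    [/\ compact K0, K0 `<=` Omega, K `<=` K0 /\ K <> K0, K0° !=set0 &
        [/\ 1 < rho0, (supnorm K0 X <= (rho0 / 2)%:E)%E &
            cauchy_estimate X K nu rho0]].

(* Degree at most [n], uniformly in [(t, z, w)]. *)
Definition polynomial_in_u0 (D : set (C * C)) (W : set C) (n : nat)
    (g : C * C * C * C -> C) :=
  forall t z w, D (t, z) -> W w ->
    exists2 q : {poly C}, (size q <= n.+1)%N & forall u, g (t, z, u, w) = q.[u].

Definition zetaR (b : R) : R := limn (series (riemannR b)).

End Notions.

(* Main.v *)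
(* X is controlled near every point of the bidisc, including the points of Theta.  Let F
   be a local defining function of Theta and P = F a_d.  Since the nonlinearity has degree
   d >= 2, the Cauchy estimates give |X| <= C / |P|^2, so X = H / G with H and G = P^4
   holomorphic.  Let D = d_t - a d_z.  As long as |X| < 8, the identity
   D (f(x, X(x))) = (V f)(x, X(x)) with V = D + (sum_p a_p w^p) d_w bounds all the D^n X;
   so X extends along the characteristics of D, and the ratio of the transported functions
   H and G stays within distance 1 of X.  This ratio depends on one variable only, and a
   one-variable quotient has a limit in the Riemann sphere.  It follows that near each
   point either |X| is at most 10 or |X| is at least 1, off the zeros of P.  The Schwarz
   lemma for X or 1 / X and compactness yield a uniform c > 0 such that |X(p)| <= rho / 2
   implies |X| <= rho on the ball B(p, c / rho), off an analytic set.

   The Taylor coefficients y_n of Y in w satisfy a recursion expressing y_(n+S) through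
   b_(m,k) and the y_(n-i+k) or their first derivatives, where k plus the degree of b_(m,k)
   in X plus the number of derivatives times two is at most S.  By induction, for
   0 < theta <= 1, |y_n| <= M (L / theta)^n (n + rho)^n on B(p, (1 - theta) c / rho); at
   p this gives |y_n| <= M e^rho (2 e L)^n n!, whence the estimate with sigma = 1 / zeta(b).
   Functions are only known off an analytic set here, so the Cauchy estimates are proved
   from a maximum principle that ignores zero sets. *)
Require Import Defs.
From HB Require Import structures.
From mathcomp Require Import all_boot all_order all_algebra finmap.
From mathcomp Require Import all_classical all_reals all_analysis.
From mathcomp Require Import complex.
From mathcomp Require Import ring lra zify.

Set Implicit Arguments.
Unset Strict Implicit.
Unset Printing Implicit Defensive.

Import Order.TTheory GRing.Theory Num.Theory.
Import numFieldNormedType.Exports.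

Local Open Scope classical_set_scope.
Local Open Scope ring_scope.
Local Open Scope complex_scope.

(** * The norm as a real number *)

Section Norm.
Variable R : realType.
Local Notation C := (Cx R).
Implicit Types V W : normedModType C.

(** The obstacle is indeterminacy: a quotient [H / G] in two variables may take all values near a
    common zero, as z / t does, and then no ball of radius c / rho would do. The equation excludes
    this: moderate values of [X] travel along characteristics with an error at most 1, so they can
    be read off on one slice t = t1, where a quotient has no indeterminacy. The radius c / rho comes
    from the case |X| >= 1: there 1 / X has bounded slope, and 1 / |X| must not drop from 2 / rho
    below 1 / rho.

    This radius fixes the count of powers in the recursion. A first derivative on a ball of radius c
    / rho costs a factor rho, and shrinking the ball at order n costs about n; both are at most n +
    S + rho, so a derivative counts for two and the majorant is a power of n + rho. The step (n +
    rho)^n <= n! e^(n + rho) is the source of the exponential in rho.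

    Singular factors are removed by one device: multiplied by the square of a vanishing function, a
    bounded function becomes differentiable, and n-th roots in the maximum principle make the square
    disappear. *)

Definition nrm V (x : V) : R := complex.Re `|x|.

(** The norm of a module over [R[i]] is an element of [R[i]], a partially ordered field. Through
    this rewriting all estimates take place in [R], where linear arithmetic decides. *)
Lemma nrmE V (x : V) : `|x| = (nrm x)%:C.
Proof. by rewrite /nrm (RRe_real (normr_real x)). Qed.

Lemma nrm_ge0 V (x : V) : 0 <= nrm x.
Proof. by rewrite -lecR -nrmE normr_ge0. Qed.

Lemma nrm0 V : nrm (0 : V) = 0.
Proof. by rewrite /nrm normr0. Qed.

Lemma nrm0_eq0 V (x : V) : nrm x = 0 -> x = 0.
Proof. by move=> h; apply/eqP; rewrite -normr_eq0 nrmE h. Qed.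

Lemma nrm_gt0 V (x : V) : x != 0 -> 0 < nrm x.
Proof.
move=> x0; rewrite lt_neqAle nrm_ge0 andbT; apply: contraNneq x0 => h.
exact/eqP/nrm0_eq0.
Qed.

Lemma nrmN V (x : V) : nrm (- x) = nrm x.
Proof. by rewrite /nrm normrN. Qed.

Lemma nrmB V (x y : V) : nrm (x - y) = nrm (y - x).
Proof. by rewrite /nrm distrC. Qed.

Lemma nrmD V (x y : V) : nrm (x + y) <= nrm x + nrm y.
Proof. by have := ler_normD x y; rewrite !nrmE -rmorphD lecR. Qed.

Lemma nrm_triB V (x y z : V) : nrm (x - z) <= nrm (x - y) + nrm (y - z).
Proof. by have := nrmD (x - y) (y - z); rewrite addrA subrK. Qed.

Lemma nrm_sub V (x y : V) : nrm x - nrm y <= nrm (x - y).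
Proof. by have := nrmD (x - y) y; rewrite subrK; lra. Qed.

Lemma nrmZ V (a : C) (x : V) : nrm (a *: x) = nrm a * nrm x.
Proof. by have := normrZ a x; rewrite !nrmE -rmorphM => /complexI. Qed.

Lemma nrmM (a b : C) : nrm (a * b) = nrm a * nrm b.
Proof. by apply: complexI; rewrite rmorphM -!nrmE normrM. Qed.

Lemma nrm1 : nrm (1 : C) = 1.
Proof. by rewrite /nrm normr1. Qed.

Lemma nrmX (a : C) n : nrm (a ^+ n) = nrm a ^+ n.
Proof. by apply: complexI; rewrite rmorphXn -!nrmE normrX. Qed.

Lemma nrmV (a : C) : nrm a^-1 = (nrm a)^-1.
Proof. by apply: complexI; rewrite fmorphV -!nrmE normfV. Qed.

Lemma nrm_real (x : R) : nrm (x%:C : C) = `|x|.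
Proof. by apply: complexI; rewrite -nrmE normc_def /= expr0n addr0 sqrtr_sqr. Qed.

Lemma nrm_nat n : nrm (n%:R : C) = n%:R.
Proof. by rewrite /nrm normr_nat -(rmorph_nat (real_complex R)). Qed.

Lemma nrm_pair V W (x : V * W) : nrm x = Num.max (nrm x.1) (nrm x.2).
Proof.
have : `|x| = Num.max `|x.1| `|x.2| by [].
rewrite !nrmE /Num.max ltcR => h; apply: complexI; rewrite h.
by rewrite /Num.max; case: ifP.
Qed.

Lemma nrm_pairP V W (x : V * W) (r : R) :
  nrm x < r <-> nrm x.1 < r /\ nrm x.2 < r.
Proof. by rewrite nrm_pair gt_max; split=> [/andP //|[-> ->]]. Qed.

Lemma nrm_pairle V W (x : V * W) (r : R) :
  nrm x <= r <-> nrm x.1 <= r /\ nrm x.2 <= r.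
Proof. by rewrite nrm_pair ge_max; split=> [/andP //|[-> ->]]. Qed.

Lemma nrm_sum I (r : seq I) (P : pred I) V (F : I -> V) :
  nrm (\sum_(i <- r | P i) F i) <= \sum_(i <- r | P i) nrm (F i).
Proof.
elim/big_rec2: _ => [|i y x _ h]; first by rewrite nrm0.
by apply: (le_trans (nrmD _ _)); rewrite lerD2l.
Qed.

Lemma nbhs_nrm V (p : V) (A : set V) :
  nbhs p A <-> exists2 e : R, 0 < e & forall q, nrm (q - p) < e -> A q.
Proof.
split.
  move=> /nbhs_ballP[e /= e0 h].
  have er : e \is Num.real by apply: ger0_real; exact: ltW.
  exists (complex.Re e) => [|q hq]; first by rewrite -ltcR (RRe_real er).
  apply: h; rewrite -ball_normE /= distrC nrmE -(RRe_real er) ltcR //.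
case=> e e0 h; apply/nbhs_ballP; exists e%:C => /=; first by rewrite ltcR.
by move=> q; rewrite -ball_normE /= distrC nrmE ltcR => /h.
Qed.

Lemma open_nrm V (U : set V) :
  open U <-> forall p, U p -> exists2 e : R, 0 < e & forall q, nrm (q - p) < e -> U q.
Proof.
rewrite openE; split=> h p Up; first by apply/nbhs_nrm; exact: h.
by apply/nbhs_nrm; exact: h.
Qed.

Lemma disc_nrm (r : R) (z : C) : disc r z <-> nrm z < r.
Proof. by rewrite /disc /= nrmE ltcR. Qed.

Lemma cvg_nrm T (F : set_system T) {FF : Filter F} V (f : T -> V) (l : V) :
  f @ F --> l <-> forall e : R, 0 < e -> \forall x \near F, nrm (f x - l) < e.
Proof.
split=> [h e e0|h A /nbhs_nrm[e e0 hA]].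
  by apply: (h [set y | nrm (y - l) < e]); apply/nbhs_nrm; exists e.
by apply: filterS (h e e0) => x; exact: hA.
Qed.

Lemma cont_nrm V W (f : V -> W) (p : V) : {for p, continuous f} <->
  forall e : R, 0 < e -> exists2 d : R, 0 < d &
    forall q, nrm (q - p) < d -> nrm (f q - f p) < e.
Proof.
rewrite /prop_for /continuous_at; split=> [/cvg_nrm h e e0|h].
  by have /nbhs_nrm := h e e0.
by apply/cvg_nrm => e e0; apply/nbhs_nrm; exact: h.
Qed.

Lemma diff_nrm V W (f : V -> W) p : differentiable f p ->
  forall e : R, 0 < e -> exists2 d : R, 0 < d &
    forall v, nrm v < d -> nrm (f (p + v) - f p - 'd f p v) <= e * nrm v.
Proof.
move=> /diff_locallyxP[_ df] e e0.
have /= := df.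
set o := (X in forall h, _ = _ + X h) => dfo.
have : 0 < e%:C :> C by rewrite ltcR.
move=> /(littleoP [littleo of o]) /nbhs_nrm[d d0 hd].
exists d => // v vd.
have := hd v; rewrite subr0 => /(_ vd) /=.
rewrite nrmE (_ : `|v| = (nrm v)%:C) ?nrmE // -rmorphM lecR.
have -> : o v = f (p + v) - f p - 'd f p v; last by [].
by rewrite [p + v]addrC dfo -addrA -opprD [f p + _ + o v]addrC addrK.
Qed.

End Norm.

Lemma lt_min2 (R : realType) (x y z : R) : x < Num.min y z -> x < y /\ x < z.
Proof. by rewrite lt_min => /andP. Qed.

#[global] Opaque nrm.

(* [lra] inspects every hypothesis and compares atoms up to conversion, which is
   very slow on norms of pairs: keep only the inequalities and abstract the norms. *)
Ltac gen_nrm := repeat match goal with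
  | H : ?T |- _ => lazymatch type of T with Prop =>
      lazymatch T with
      | is_true (@Order.le _ _ _ _) => fail
      | is_true (@Order.lt _ _ _ _) => fail
      | @eq ?S _ _ => lazymatch goal with Q : realType |- _ =>
          tryif unify S (Real.sort Q) then fail else clear H end
      | _ => clear H
      end end
  end; repeat match goal with
  | |- context [@nrm ?R ?V ?x] => let y := fresh "n_" in
      set (y := @nrm R V x) in *; clearbody y
  | H : context [@nrm ?R ?V ?x] |- _ => let y := fresh "n_" in
      set (y := @nrm R V x) in *; clearbody y
  end.
Ltac xlra := intros; gen_nrm; lra.

Section Basics.
Variable R : realType.
Local Notation C := (Cx R).
Implicit Types V W : normedModType C.

(** Differentials are obtained by exhibiting them. The bound by [K] provides the continuity of the
    candidate, which is part of differentiability on a general normed module. *)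
Lemma diffI V W (f : V -> W) (p : V) (L : V -> W) (K : R) :
  linear L -> (forall v, nrm (L v) <= K * nrm v) ->
  (forall e : R, 0 < e -> exists2 d : R, 0 < d &
    forall v, nrm v < d -> nrm (f (p + v) - f p - L v) <= e * nrm v) ->
  differentiable f p /\ forall v, 'd f p v = L v.
Proof.
move=> linL KL fL.
pose L' : {linear V -> W} := HB.pack L (GRing.isLinear.Build C V W *:%R L linL).
have Lc : continuous L'.
  move=> x; apply/cont_nrm => e e0.
  have K0 : 0 < `|K| + 1 by have := normr_ge0 K; lra.
  exists (e / (`|K| + 1)); first exact: divr_gt0.
  move=> q hq; rewrite -linearB.
  apply: (le_lt_trans (KL _)).
  apply: (@le_lt_trans _ _ ((`|K| + 1) * nrm (q - x))).
    by apply: ler_wpM2r; [exact: nrm_ge0|have := ler_norm K; lra].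
  by rewrite mulrC -ltr_pdivlMr.
have fo : f \o shift p = cst (f p) + L' +o_ 0 id.
  apply/eqaddoP => e e0.
  have er : e \is Num.real by apply: ger0_real; exact: ltW.
  have e0' : 0 < complex.Re e by rewrite -ltcR (RRe_real er).
  have [d d0 hd] := fL _ e0'.
  apply/nbhs_nrm; exists d => // v; rewrite subr0 => vd.
  rewrite -(RRe_real er) nrmE (_ : `|id v| = (nrm v)%:C) ?nrmE //.
  rewrite -rmorphM lecR; apply: le_trans (hd v vd).
  by rewrite -[X in nrm X]/(f (v + p) - (f p + L v)) [v + p]addrC opprD addrA.
have dL := diff_unique Lc fo.
split; last by move=> v; rewrite dL.
apply/diff_locallyP; split; first by rewrite dL.
by rewrite dL; exact: fo.
Qed.

Lemma diff_bound V W (f : V -> W) p : differentiable f p ->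
  exists2 K : R, 0 < K & forall v, nrm ('d f p v) <= K * nrm v.
Proof.
move=> df.
have /linear_lipschitz[k k0 hk] := diff_continuous df.
have kr : k \is Num.real by apply: ger0_real; exact: ltW.
exists (complex.Re k); first by rewrite -ltcR (RRe_real kr).
by move=> v; have := hk v; rewrite !nrmE -{1}(RRe_real kr) -rmorphM lecR.
Qed.

Lemma diff_cont V W (f : V -> W) p : differentiable f p ->
  forall e : R, 0 < e -> exists2 d : R, 0 < d &
    forall q, nrm (q - p) < d -> nrm (f q - f p) < e.
Proof. by move=> /differentiable_continuous /cont_nrm. Qed.

Lemma diff_lip V W (f : V -> W) p : differentiable f p ->
  exists K d : R, [/\ 0 < K, 0 < d &
    forall v, nrm v < d -> nrm (f (p + v) - f p) <= K * nrm v].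
Proof.
move=> df; have [K K0 hK] := diff_bound df.
have [d d0 hd] := diff_nrm df (@ltr01 R).
exists (K + 1), d; split=> [||v vd]; [lra|by []|].
have := nrm_triB (f (p + v) - f p) ('d f p v) 0; rewrite !subr0.
have := hd v vd; have := hK v; lra.
Qed.

Lemma diff_near V W (f g : V -> W) p (d : R) : 0 < d ->
  (forall q, nrm (q - p) < d -> f q = g q) ->
  differentiable f p -> differentiable g p /\ forall v, 'd g p v = 'd f p v.
Proof.
move=> d0 fg df; have [K K0 hK] := diff_bound df.
apply: (diffI (K := K)) => //; first exact: linearP.
move=> e e0; have [d1 d10 h] := diff_nrm df e0.
exists (Num.min d d1); first by rewrite lt_min d0.
move=> v /lt_min2[vd vd1].
by rewrite -!fg ?h // ?subrr ?nrm0 // addrC addKr.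
Qed.

(** This is the removable singularity theorem of the development: a quadratic bound makes the
    differential zero at [p], whatever [f] does at other zeros of [k]. A bounded function with
    singularities among the zeros of [k] thus becomes holomorphic after multiplication by
    [k ^+ 2]. *)
Lemma diff_zero V (f : V -> C) p (k : V -> C) (M d : R) : 0 < d ->
  (forall q, nrm (q - p) < d -> nrm (f q) <= M * nrm (k q) ^+ 2) ->
  differentiable k p -> k p = 0 -> differentiable f p.
Proof.
move=> d0 fk dk kp; have fp : f p = 0.
  apply: nrm0_eq0; apply/eqP; rewrite eq_le nrm_ge0 andbT.
  have := fk p; rewrite subrr nrm0 => /(_ d0); rewrite kp nrm0.
  by rewrite expr0n mulr0.
have [K [d1 [K0 d10 hk]]] := diff_lip dk.
suff [] : differentiable f p /\ forall v, 'd f p v = (cst 0 : V -> C) v by [].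
apply: (diffI (K := 0)) => [a u v|v|e e0].
- by rewrite /= scaler0 addr0.
- by rewrite nrm0 mul0r.
pose M' := `|M| + 1; have M0 : 0 < M' by have := normr_ge0 M; rewrite /M'; lra.
have MM : M <= M' by have := ler_norm M; rewrite /M'; lra.
have X0 : 0 < M' * K ^+ 2 by rewrite mulr_gt0 // exprn_gt0.
exists (Num.min (Num.min d d1) (e / (M' * K ^+ 2))).
  by rewrite !lt_min d0 d10 divr_gt0.
move=> v /lt_min2[/lt_min2[vd vd1] ve].
rewrite fp /= !subr0.
have h := fk (p + v); have : nrm (p + v - p) < d by rewrite [p + v]addrC addrK.
move=> /h {}h; apply: (le_trans h).
have := hk v vd1; rewrite kp subr0 => kv.
have v0 := nrm_ge0 v; have k0 := nrm_ge0 (k (p + v)).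
apply: (@le_trans _ _ (M' * nrm (k (p + v)) ^+ 2)).
  by rewrite ler_wpM2r ?sqr_ge0.
apply: (@le_trans _ _ (M' * (K * nrm v) ^+ 2)).
  rewrite ler_wpM2l ?(ltW M0) //.
  by rewrite ler_pXn2r // nnegrE // mulr_ge0 // ltW.
rewrite exprMn mulrA expr2 mulrA ler_wpM2r //.
by rewrite mulrC -ler_pdivlMr // ltW.
Qed.

Lemma diff_line V (p v : V) (l : C) :
  differentiable (fun l : C => p + l *: v) l.
Proof.
apply: (@differentiableD _ _ _ (cst p)); first exact: differentiable_cst.
by apply: (@differentiableZl _ _ _ id v l); exact: ex_diff.
Qed.

Lemma geomP (x e : R) : 0 <= x < 1 -> 0 < e -> exists n, forall m, (n <= m)%N -> x ^+ m < e.
Proof.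
move=> /andP[x0 x1] e0.
have : (fun n => x ^+ n) @ \oo --> (0 : R) by apply: cvg_expr; rewrite ger0_norm.
move=> /cvgrPdist_lt /(_ _ e0)[n _ h]; exists n => m nm.
by have := h m nm; rewrite sub0r normrN ger0_norm ?exprn_ge0.
Qed.

Lemma ReB (x y : C) : complex.Re (x - y) = complex.Re x - complex.Re y.
Proof. by case: x y => ? ? []. Qed.

Lemma ImB (x y : C) : complex.Im (x - y) = complex.Im x - complex.Im y.
Proof. by case: x y => ? ? []. Qed.

Lemma nrm_sqrt (x : C) :
  nrm x = Num.sqrt (complex.Re x ^+ 2 + complex.Im x ^+ 2).
Proof. by apply: complexI; rewrite -nrmE normc_def. Qed.

Lemma Re_le_nrm (x : C) : `|complex.Re x| <= nrm x.
Proof. by rewrite nrm_sqrt -sqrtr_sqr ler_wsqrtr // lerDl sqr_ge0. Qed.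

Lemma Im_le_nrm (x : C) : `|complex.Im x| <= nrm x.
Proof. by rewrite nrm_sqrt -sqrtr_sqr ler_wsqrtr // lerDr sqr_ge0. Qed.

Lemma nrm_le_ReIm (x : C) : nrm x <= `|complex.Re x| + `|complex.Im x|.
Proof.
case: x => x y; rewrite nrm_sqrt /= -(ler_pXn2r (n := 2)) ?nnegrE ?sqrtr_ge0 ?addr_ge0 //.
rewrite sqr_sqrtr ?addr_ge0 ?sqr_ge0 // sqrrD !real_normK ?num_real //.
by rewrite lerD2r lerDl mulrn_wge0 // mulr_ge0.
Qed.

Lemma complete_seq (u : nat -> C) (a : nat -> R) :
  (forall e, 0 < e -> exists N, forall n, (N <= n)%N -> a n <= e) ->
  (forall m n, nrm (u m - u n) <= a m + a n) ->
  exists l : C, forall n, nrm (u n - l) <= a n.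
Proof.
move=> a0 ua.
have key (g : C -> R) : (forall x y, `|g x - g y| <= nrm (x - y)) ->
    exists l : R, (fun n => g (u n)) @ \oo --> l.
  move=> hg; apply/cvg_ex/cauchy_cvgP/cauchyP => e e0.
  have [N hN] := a0 (e / 4) ltac:(lra).
  exists (g (u N)); exists N => // n /= Nn.
  apply: (le_lt_trans (hg _ _)); apply: (le_lt_trans (ua _ _)).
  have := hN _ Nn; have := hN N (leqnn N); lra.
have [x hx] : exists l : R, (fun n => complex.Re (u n)) @ \oo --> l.
  by apply: key => z z'; rewrite -ReB Re_le_nrm.
have [y hy] : exists l : R, (fun n => complex.Im (u n)) @ \oo --> l.
  by apply: key => z z'; rewrite -ImB Im_le_nrm.
exists (Complex x y) => n; apply/ler_addgt0Pr => e e0.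
have [N1 _ h1] := proj1 (cvgrPdist_lt _ _) hx (e / 4) ltac:(lra).
have [N2 _ h2] := proj1 (cvgrPdist_lt _ _) hy (e / 4) ltac:(lra).
have [N3 h3] := a0 (e / 4) ltac:(lra).
pose m := maxn N1 (maxn N2 N3).
have m1 : (N1 <= m)%N by rewrite leq_maxl.
have m2 : (N2 <= m)%N by rewrite /m leq_max leq_max leqnn orbT.
have m3 : (N3 <= m)%N by rewrite /m leq_max leq_max leqnn !orbT.
have := nrm_triB (u n) (u m) (Complex x y).
have := nrm_le_ReIm (u m - Complex x y); rewrite ReB ImB /=.
have := h1 m m1; rewrite /= distrC => ?; have := h2 m m2; rewrite /= distrC => ?.
have := ua n m; have := h3 m m3; lra.
Qed.

(** Taking n-th roots sends the constants [B] and [S] to 1. They will come from an auxiliary factor,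
    while [A] and [D] are the quantities to compare. *)
Lemma pow_le_limit (A B D S : R) : 0 <= A -> 0 < D -> 0 < B ->
  (forall n, A ^+ n * B <= D ^+ n * S) -> A <= D.
Proof.
move=> A0 D0 B0 h; rewrite leNgt; apply/negP => DA.
have xlt : 0 <= D / A < 1.
  by rewrite divr_ge0 ?(ltW D0) //= ltr_pdivrMr ?mul1r // (lt_trans D0).
have Ap : 0 < A by exact: lt_trans DA.
pose S' := `|S| + 1; have S0 : 0 < S' by have := normr_ge0 S; rewrite /S'; lra.
have [n hn] := geomP xlt (divr_gt0 B0 S0).
have := h n; have := hn n (leqnn n); rewrite expr_div_n ltr_pdivrMr ?exprn_gt0 //.
rewrite mulrAC ltr_pdivlMr // => h1 h2.
have : D ^+ n * S <= D ^+ n * S'.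
  by rewrite ler_wpM2l ?exprn_ge0 ?(ltW D0) // /S'; have := ler_norm S; lra.
by move=> h3; have := lt_le_trans h1 (le_trans _ (le_trans h2 h3)); rewrite [B * _]mulrC lexx ltxx => /(_ isT).
Qed.

End Basics.

(** * The maximum principle *)

Section Exponential.
Variable R : realType.
Local Notation C := (Cx R).

(** It maps vertical segments of length 2 pi onto circles, which turns the mean over a circle into a
    side of a rectangle. Periodicity, modulus and holomorphy are all that is needed of it. *)
Definition cexp (z : C) : C :=
  Complex (expR (complex.Re z) * cos (complex.Im z))
          (expR (complex.Re z) * sin (complex.Im z)).

Lemma cexpD z w : cexp (z + w) = cexp z * cexp w.
Proof.
case: z w => a b [a' b']; rewrite /cexp /= expRD cosD sinD.
by apply/eqP; rewrite eq_complex /=; apply/andP; split; apply/eqP; ring.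
Qed.

Lemma nrm_cexp z : nrm (cexp z) = expR (complex.Re z).
Proof.
rewrite nrm_sqrt /= !exprMn -mulrDr cos2Dsin2 mulr1 sqrtr_sqr.
by rewrite ger0_norm // expR_ge0.
Qed.

Lemma cexp_period z : cexp (z + Complex 0 (pi *+ 2)) = cexp z.
Proof. by case: z => a b; rewrite /cexp /= addr0 cosD2pi sinD2pi. Qed.

Lemma real_diff (g : R -> R) (l : R) : is_derive (0 : R) 1 g l ->
  forall e : R, 0 < e -> exists2 d : R, 0 < d &
    forall x, `|x| < d -> `|g x - g 0 - l * x| <= e * `|x|.
Proof.
move=> [dg dl] e e0; move: dg; rewrite /derivable => dg.
have : (fun h => h^-1 *: (g (h *: 1 + 0) - g 0)) @ 0^' --> l.
  by rewrite -dl; exact: dg.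
move=> /cvgrPdist_le /(_ _ e0) /nbhs_ballP[d /= d0 hd].
exists d => // x xd; have [->|x0] := eqVneq x 0.
  by rewrite subrr mulr0 subr0 normr0 mulr0.
have := hd x; rewrite -ball_normE /= sub0r normrN => /(_ xd x0) /=.
rewrite addr0 [x *: 1]mulr1 => h.
have -> : g x - g 0 - l * x = - (x * (l - x^-1 * (g x - g 0))).
  by rewrite mulrBr mulrA divff // mul1r; ring.
by rewrite normrN normrM mulrC ler_wpM2r.
Qed.

Lemma cexp_diff0 (e : R) : 0 < e -> exists2 d : R, 0 < d &
  forall v : C, nrm v < d -> nrm (cexp v - 1 - v) <= e * nrm v.
Proof.
move=> e0; pose e1 := Num.min (e / 8) 1.
have e10 : 0 < e1 by rewrite lt_min; apply/andP; split; lra.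
have e1e : e1 <= e / 8 by rewrite ge_min lexx.
have e11 : e1 <= 1 by rewrite ge_min lexx orbT.
have dE : is_derive (0 : R) 1 (@expR R) 1 by rewrite -[X in is_derive _ _ _ X]expR0; exact: is_derive_expR.
have dC : is_derive (0 : R) 1 (@cos R) 0.
  by have := is_derive_cos (0 : R); rewrite sin0 oppr0.
have dS : is_derive (0 : R) 1 (@sin R) 1.
  by have := is_derive_sin (0 : R); rewrite cos0.
have [dx dx0 hx] := real_diff dE e10.
have [dy dy0 hy] := real_diff dC e10.
have [dz dz0 hz] := real_diff dS e10.
exists (Num.min (Num.min dx (e1 / 2)) (Num.min dy dz)).
  by rewrite !lt_min dx0 dy0 dz0 /= andbT; lra.
move=> v /lt_min2[/lt_min2[vx ve] /lt_min2[vy vz]].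
have rv := Re_le_nrm v; have iv := Im_le_nrm v.
apply: (le_trans (nrm_le_ReIm _)).
case: v vx ve vy vz rv iv => x y /=; set m := nrm _ => vx ve vy vz rv iv.
have := hx x (le_lt_trans rv vx); have := hy y (le_lt_trans iv vy).
have := hz y (le_lt_trans iv vz); rewrite expR0 cos0 sin0 !mul1r mul0r !subr0.
have x0 := normr_ge0 x; have y0 := normr_ge0 y.
set E := expR x; set c := cos y; set s := sin y => bz bb bx.
have E1 : `|E - 1| <= 1.
  have -> : E - 1 = (E - 1 - x) + x by ring.
  by apply: (le_trans (ler_normD _ _)); nra.
have E1' : `|E - 1| <= 2 * m.
  have -> : E - 1 = (E - 1 - x) + x by ring.
  by apply: (le_trans (ler_normD _ _)); nra.
have E2 : `|E| <= 2.
  have -> : E = (E - 1) + 1 by ring.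
  by apply: (le_trans (ler_normD _ _)); rewrite normr1; lra.
have -> : E * c - 1 - x = (E - 1 - x) + E * (c - 1) by ring.
have -> : E * s - y = E * (s - y) + (E - 1) * y by ring.
have := ler_normD (E - 1 - x) (E * (c - 1)).
have := ler_normD (E * (s - y)) ((E - 1) * y).
rewrite !normrM => h1 h2.
have g1 : `|E| * `|c - 1| <= 2 * (e1 * `|y|) by apply: ler_pM.
have g2 : `|E| * `|s - y| <= 2 * (e1 * `|y|) by apply: ler_pM.
have g3 : `|E - 1| * `|y| <= 2 * m * m by apply: ler_pM.
nra.
Qed.

Lemma cexp_diff z : differentiable cexp z.
Proof.
suff [] : differentiable cexp z /\ forall v, 'd cexp z v = v * cexp z by [].
apply: (diffI (K := nrm (cexp z))) => [a u v|v|e e0].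
- by rewrite mulrDl -scalerAl.
- by rewrite nrmM mulrC.
have n0 : 0 < nrm (cexp z) by rewrite nrm_cexp expR_gt0.
have [d d0 hd] := cexp_diff0 (divr_gt0 e0 n0).
exists d => // v vd; rewrite cexpD.
have -> : cexp z * cexp v - cexp z - v * cexp z = cexp z * (cexp v - 1 - v) by ring.
by rewrite nrmM mulrC -ler_pdivlMr // mulrAC; exact: hd.
Qed.

End Exponential.

(** * Goursat's lemma for trapezoid sums, and the maximum principle at a centre *)

Section Goursat.
Variable R : realType.
Local Notation C := (Cx R).

Lemma realC_half (s : R) : (s / 2)%:C = s%:C / 2 :> C.
Proof.
have c2 : 2 = 2%:C :> C by rewrite -[2 in RHS]/(1 + 1) rmorphD rmorph1.
by rewrite c2 -fmorphV -rmorphM.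
Qed.

Section Sums.
Variable h : C -> C.

(** The trapezoid rule with 2^N pieces replaces the integral from [z] to [z + v]. The dyadic
    subdivision makes contour sums split exactly, without any limit, under the bisection of
    Goursat's proof. *)
Fixpoint trapz N (z v : C) : C :=
  if N is N'.+1 then trapz N' z (v / 2) + trapz N' (z + v / 2) (v / 2)
  else v * (h z + h (z + v)) / 2.

Definition contour N (z a b : C) : C :=
  trapz N z a + trapz N (z + a) b - trapz N (z + b) a - trapz N z b.

(** The trapezoid rule is exact on affine functions, for which it returns the value at the midpoint
    times [v]. So only the distance [e] of [h] to the affine function contributes. *)
Lemma trapz_lin (al be c : C) (e : R) N (z v : C) :
  (forall s : R, 0 <= s <= 1 ->
    nrm (h (z + s%:C * v) - (al + be * (z + s%:C * v - c))) <= e) ->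
  nrm (trapz N z v - v * (al + be * (z + v / 2 - c))) <= nrm v * e.
Proof.
elim: N z v => [|N IH] z v hs.
  rewrite /=.
  have -> : v * (h z + h (z + v)) / 2 - v * (al + be * (z + v / 2 - c)) =
    v / 2 * ((h (z + 0%:C * v) - (al + be * (z + 0%:C * v - c))) +
             (h (z + 1%:C * v) - (al + be * (z + 1%:C * v - c)))).
    by rewrite rmorph0 rmorph1 mul0r mul1r addr0; field.
  rewrite nrmM nrmM nrmV nrm_nat -mulrA ler_wpM2l ?nrm_ge0 //.
  apply: (@le_trans _ _ (2^-1 * (e + e))); last by lra.
  rewrite ler_wpM2l ?invr_ge0 //; apply: (le_trans (nrmD _ _)).
  by apply: lerD; apply: hs; rewrite ?lexx ?ler01.
rewrite /=.
have half : nrm (v / 2) = nrm v / 2 by rewrite nrmM nrmV nrm_nat.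
have h1 := IH z (v / 2).
have h2 := IH (z + v / 2) (v / 2).
have {}h1 : nrm (trapz N z (v / 2) - v / 2 * (al + be * (z + v / 2 / 2 - c))) <=
    nrm v / 2 * e.
  rewrite -half; apply: h1 => s /andP[s0 s1].
  have -> : z + s%:C * (v / 2) = z + (s / 2)%:C * v.
    by rewrite realC_half; congr (_ + _); ring.
  by apply: hs; lra.
have {}h2 : nrm (trapz N (z + v / 2) (v / 2) -
    v / 2 * (al + be * (z + v / 2 + v / 2 / 2 - c))) <= nrm v / 2 * e.
  rewrite -half; apply: h2 => s /andP[s0 s1].
  have -> : z + v / 2 + s%:C * (v / 2) = z + ((1 + s) / 2)%:C * v.
    by rewrite realC_half rmorphD rmorph1; field.
  by apply: hs; lra.
have -> : v * (al + be * (z + v / 2 - c)) =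
  v / 2 * (al + be * (z + v / 2 / 2 - c)) +
  v / 2 * (al + be * (z + v / 2 + v / 2 / 2 - c)) by field.
rewrite opprD addrACA; apply: (le_trans (nrmD _ _)).
lra.
Qed.

(** The affine parts of the four sides cancel, which leaves the perimeter, at most [2 * D], times
    the error [e]. *)
Lemma contour_lin (al be c : C) (e D : R) N (z a b : C) :
  0 <= e -> nrm a + nrm b <= D ->
  (forall s t : R, 0 <= s <= 1 -> 0 <= t <= 1 ->
    nrm (h (z + s%:C * a + t%:C * b) -
         (al + be * (z + s%:C * a + t%:C * b - c))) <= e) ->
  nrm (contour N z a b) <= 2 * D * e.
Proof.
move=> e0 aD hs; rewrite /contour.
have h1 := @trapz_lin al be c e N z a.
have h2 := @trapz_lin al be c e N (z + a) b.
have h3 := @trapz_lin al be c e N (z + b) a.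
have h4 := @trapz_lin al be c e N z b.
have u0 : 0 <= (0 : R) <= 1 by rewrite lexx ler01.
have u1 : 0 <= (1 : R) <= 1 by rewrite lexx ler01.
have {}h1 := h1 ltac:(move=> s s1; have := hs s 0 s1 u0; rewrite rmorph0 mul0r addr0 //).
have {}h2 := h2 ltac:(move=> s s1; have := hs 1 s u1 s1; rewrite rmorph1 mul1r //).
have {}h3 := h3 ltac:(move=> s s1; have := hs s 1 s1 u1; rewrite rmorph1 mul1r addrAC //).
have {}h4 := h4 ltac:(move=> s s1; have := hs 0 s u0 s1; rewrite rmorph0 mul0r addr0 //).
set A1 := trapz N z a in h1 *; set A2 := trapz N (z + a) b in h2 *.
set A3 := trapz N (z + b) a in h3 *; set A4 := trapz N z b in h4 *.
set L1 := (X in nrm (_ - X)) in h1; set L2 := (X in nrm (_ - X)) in h2.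
set L3 := (X in nrm (_ - X)) in h3; set L4 := (X in nrm (_ - X)) in h4.
have -> : A1 + A2 - A3 - A4 = (A1 - L1) + (A2 - L2) + - (A3 - L3) + - (A4 - L4).
  by rewrite /L1 /L2 /L3 /L4; field.
have := nrmD (A1 - L1 + (A2 - L2) + - (A3 - L3)) (- (A4 - L4)).
have := nrmD (A1 - L1 + (A2 - L2)) (- (A3 - L3)).
have := nrmD (A1 - L1) (A2 - L2).
rewrite [nrm (- (A3 - L3))]nrmN [nrm (- (A4 - L4))]nrmN.
have := nrm_ge0 a; have := nrm_ge0 b; nra.
Qed.

(** The inner edges of the four quarters are run through twice, in opposite directions, and
    cancel. *)
Lemma contour_split N z a b : contour N.+1 z a b =
  contour N z (a / 2) (b / 2) + contour N (z + a / 2) (a / 2) (b / 2) +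
  contour N (z + b / 2) (a / 2) (b / 2) +
  contour N (z + a / 2 + b / 2) (a / 2) (b / 2).
Proof.
rewrite /contour /=.
have e1 : z + a / 2 + a / 2 = z + a by field.
have e2 : z + b / 2 + b / 2 = z + b by field.
have e3 : z + a / 2 + b / 2 + a / 2 = z + a + b / 2 by field.
have e4 : z + a / 2 + b / 2 + b / 2 = z + b + a / 2 by field.
have e5 : z + b / 2 + a / 2 = z + a / 2 + b / 2 by field.
rewrite e1 e2 e3 e4 e5; ring.
Qed.

Lemma dyadic_lim (s : nat -> R) :
  (forall k, s k <= s k.+1 <= s k + 2^-1 ^+ k.+1) ->
  exists l, forall k, s k <= l <= s k + 2^-1 ^+ k.
Proof.
move=> hs.
have mono k j : s k <= s (k + j)%N <= s k + 2^-1 ^+ k - 2^-1 ^+ (k + j).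
  elim: j => [|j /andP[IH1 IH2]]; first by rewrite addn0 addrK !lexx.
  have /andP[a1 a2] := hs (k + j)%N; rewrite addnS.
  rewrite (le_trans IH1 a1) /=; apply: (le_trans a2).
  have : 2^-1 ^+ (k + j) = 2 * 2^-1 ^+ (k + j).+1 :> R by rewrite exprS mulrA divff ?mul1r.
  by move: IH2; lra.
have pw k : 0 <= 2^-1 ^+ k :> R by rewrite exprn_ge0 // invr_ge0.
have ubd k m : s m <= s k + 2^-1 ^+ k.
  have /andP[a1 a2] := mono k (maxn k m - k)%N.
  have /andP[b1 b2] := mono m (maxn k m - m)%N.
  rewrite subnKC ?leq_maxl // in a2; rewrite subnKC ?leq_maxr // in b1.
  by have := pw (maxn k m); lra.
have hsup : has_sup (range s).
  by split; [exists (s 0%N), 0%N|exists (s 0%N + 2^-1 ^+ 0) => _ [m _ <-]].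
exists (sup (range s)) => k; apply/andP; split.
  by apply: ub_le_sup; [case: hsup|exists k].
by apply: ge_sup; [case: hsup|move=> _ [m _ <-]].
Qed.

(** If the sums do not become small, bisection yields nested parallelograms on which they stay above
    [eta] times 4^-k. At the common point the first-order expansion of [h] and [contour_lin] give a
    smaller bound. *)
Lemma goursat (z a b : C) :
  (forall s t : R, 0 <= s <= 1 -> 0 <= t <= 1 ->
    differentiable h (z + s%:C * a + t%:C * b)) ->
  forall e : R, 0 < e ->
    exists N0, forall N, (N0 <= N)%N -> nrm (contour N z a b) <= e.
Proof.
move=> dh eta eta0; apply: contrapT => hbad.
pose P k := (2^-1 ^+ k : R).
have P0 k : 0 < P k by rewrite exprn_gt0 // invr_gt0.
pose pt (s t : R) : C := z + s%:C * a + t%:C * b.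
(* Arbitrarily large [N] is required because each bisection lowers [N] by one, and because four
   eventual bounds on the quarters can then be combined into one on the whole. *)
pose Bad k (st : R * R) := forall N0, exists2 N, (N0 <= N)%N &
  eta * P k * P k < nrm (contour N (pt st.1 st.2) ((P k)%:C * a) ((P k)%:C * b)).
have PS k : P k = 2 * P k.+1 by rewrite /P exprS mulrA divff ?mul1r.
have half k (x : C) : (P k)%:C * x / 2 = (P k.+1)%:C * x.
  have -> : (P k)%:C = 2 * (P k.+1)%:C :> C.
    by rewrite PS rmorphM; congr (_ * _); rewrite -[2 in LHS]/(1 + 1) rmorphD rmorph1.
  by field.
have step k st : exists st' : R * R, Bad k st ->
    [/\ Bad k.+1 st', st.1 <= st'.1 <= st.1 + P k.+1 & st.2 <= st'.2 <= st.2 + P k.+1].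
  case: (pselect (Bad k st)) => [B|nB]; last by exists st.
  have pk := ltW (P0 k.+1).
  apply: contrapT => hno.
  have nb (st' : R * R) : st.1 <= st'.1 <= st.1 + P k.+1 -> st.2 <= st'.2 <= st.2 + P k.+1 ->
      exists N0, forall N, (N0 <= N)%N ->
      nrm (contour N (pt st'.1 st'.2) ((P k.+1)%:C * a) ((P k.+1)%:C * b)) <= eta * P k.+1 * P k.+1.
    move=> h1 h2; apply: contrapT => hh; apply: hno; exists st' => _; split => // N0.
    apply: contrapT => h3; apply: hh; exists N0 => N hN.
    by rewrite leNgt; apply/negP => h4; apply: h3; exists N.
  have [N1 H1] := nb st ltac:(lra) ltac:(lra).
  have [N2 H2] := nb (st.1 + P k.+1, st.2) ltac:(rewrite /=; lra) ltac:(rewrite /=; lra).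
  have [N3 H3] := nb (st.1, st.2 + P k.+1) ltac:(rewrite /=; lra) ltac:(rewrite /=; lra).
  have [N4 H4] := nb (st.1 + P k.+1, st.2 + P k.+1) ltac:(rewrite /=; lra) ltac:(rewrite /=; lra).
  have [[|N]] := B (maxn N1 (maxn N2 (maxn N3 N4))).+1; first by [].
  rewrite ltnS !geq_max => /and4P[l1 l2 l3 l4].
  rewrite contour_split !half.
  have {}H1 := H1 N l1; have {}H2 := H2 N l2; have {}H3 := H3 N l3; have {}H4 := H4 N l4.
  rewrite (_ : pt _ _ = pt st.1 st.2 + (P k.+1)%:C * a) in H2; last first.
    by rewrite /pt /= rmorphD; ring.
  rewrite (_ : pt _ _ = pt st.1 st.2 + (P k.+1)%:C * b) in H3; last first.
    by rewrite /pt /= rmorphD; ring.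
  rewrite (_ : pt _ _ = pt st.1 st.2 + (P k.+1)%:C * a + (P k.+1)%:C * b) in H4; last first.
    by rewrite /pt /= !rmorphD; ring.
  move: H1 H2 H3 H4.
  set c1 := contour _ _ _ _; set c2 := contour _ _ _ _.
  set c3 := contour _ _ _ _; set c4 := contour _ _ _ _ => H1 H2 H3 H4.
  have := nrmD (c1 + c2 + c3) c4; have := nrmD (c1 + c2) c3; have := nrmD c1 c2.
  have : eta * P k * P k = 4 * (eta * P k.+1 * P k.+1) by rewrite (PS k); ring.
  lra.
have /choice[F hF] : forall kst : nat * (R * R), exists st' : R * R, Bad kst.1 kst.2 ->
    [/\ Bad kst.1.+1 st', kst.2.1 <= st'.1 <= kst.2.1 + P kst.1.+1 &
        kst.2.2 <= st'.2 <= kst.2.2 + P kst.1.+1].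
  by move=> [k st]; exact: step.
pose u := fix u k := if k is k'.+1 then F (k', u k') else (0, 0) : R * R.
have uB k : Bad k (u k).
  elim: k => [|k IH]; last by have [] := hF (k, u k) IH.
  move=> N0; apply: contrapT => hN; apply: hbad; exists N0 => N hN0.
  rewrite leNgt; apply/negP => hc; apply: hN; exists N => //.
  by rewrite /P expr0 !mulr1 /pt /= rmorph0 !mul0r !addr0 rmorph1 !mul1r.
have u1 k : (u k).1 <= (u k.+1).1 <= (u k).1 + 2^-1 ^+ k.+1.
  by have [] := hF (k, u k) (uB k).
have u2 k : (u k).2 <= (u k.+1).2 <= (u k).2 + 2^-1 ^+ k.+1.
  by have [] := hF (k, u k) (uB k).
have [s hs] := dyadic_lim (s := fun k => (u k).1) u1.
have [t ht] := dyadic_lim (s := fun k => (u k).2) u2.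
have s01 : 0 <= s <= 1 by have := hs 0%N; rewrite /= expr0 add0r.
have t01 : 0 <= t <= 1 by have := ht 0%N; rewrite /= expr0 add0r.
pose c := pt s t; have dc : differentiable h c := dh s t s01 t01.
pose D := nrm a + nrm b + 1.
have D1 : 1 <= D by rewrite /D; have := nrm_ge0 a; have := nrm_ge0 b; lra.
(* With error [eta / (2 * D ^+ 2) * (P k * D)] and diameter [P k * D], the bound of [contour_lin] is
   exactly [eta * P k * P k]. *)
have e10 : 0 < eta / (2 * D ^+ 2) by rewrite divr_gt0 // mulr_gt0 // exprn_gt0; lra.
have [d d0 hd] := diff_nrm dc e10.
have [k hk] := @geomP R 2^-1 (d / D) ltac:(lra) ltac:(rewrite divr_gt0 //; lra).
have {hk} Pk : P k * D < d.
  by have := hk k (leqnn k); rewrite -/(P k) ltr_pdivlMr //; lra.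
have [N _] := uB k 0%N.
apply/negP; rewrite -leNgt.
have Pk0 := P0 k.
apply: (le_trans (@contour_lin (h c) ('d h c 1) c (eta / (2 * D ^+ 2) * (P k * D)) (P k * D) _ _ _ _ _ _ _)).
- by rewrite mulr_ge0 ?(ltW e10) // mulr_ge0 ?(ltW Pk0) //; lra.
- rewrite !nrmM nrm_real ger0_norm ?(ltW Pk0) // -mulrDr ler_wpM2l ?(ltW Pk0) //.
  by rewrite /D; lra.
- move=> s' t' s'01 t'01; set zeta := _ + _ + _.
  have zc : zeta = c + ((((u k).1 + s' * P k - s))%:C * a + (((u k).2 + t' * P k - t))%:C * b).
    by rewrite /zeta /c /pt !(rmorphB, rmorphD, rmorphM); ring.
  have /andP[hs1 hs2] := hs k; have /andP[ht1 ht2] := ht k.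
  have m1 : nrm (zeta - c) <= P k * D.
    rewrite zc addrC addKr; apply: (le_trans (nrmD _ _)); rewrite !nrmM !nrm_real.
    rewrite /D !mulrDr mulr1.
    apply: (@le_trans _ _ (P k * nrm a + P k * nrm b)); last by lra.
    apply: lerD; apply: ler_wpM2r; rewrite ?nrm_ge0 // ler_norml.
      rewrite /P in Pk0 *; move: hs1 hs2; set p := 2^-1 ^+ k in Pk0 * => *; apply/andP; split; nra.
    rewrite /P in Pk0 *; move: ht1 ht2; set p := 2^-1 ^+ k in Pk0 * => *; apply/andP; split; nra.
  have := hd (zeta - c) (le_lt_trans m1 Pk).
  have -> : c + (zeta - c) = zeta by ring.
  have -> : 'd h c (zeta - c) = 'd h c 1 * (zeta - c).
    by rewrite -[in LHS](mulr1 (zeta - c)) -[X in 'd h c X]/((zeta - c) *: (1 : C)) linearZ mulrC.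
  have -> : h zeta - (h c + 'd h c 1 * (zeta - c)) =
    h zeta - h c - 'd h c 1 * (zeta - c) by ring.
  move=> hh; apply: (le_trans hh).
  by rewrite ler_wpM2l // ltW.
rewrite le_eqVlt; apply/orP; left; apply/eqP.
by field; lra.
Qed.

End Sums.

(* Goursat for [f (c + exp z)] on a rectangle of height 2 pi: its horizontal sides cancel by
   periodicity, and its vertical sides are the circle of radius [r] and a small one. *)
Lemma max_modulus_center (f : C -> C) (c : C) (r K : R) : 0 < r ->
  (forall l, 0 < nrm (l - c) <= r -> differentiable f l) ->
  (forall e : R, 0 < e -> exists2 d : R, 0 < d &
     forall q, nrm (q - c) < d -> nrm (f q - f c) < e) ->
  (forall l, nrm (l - c) = r -> nrm (f l) <= K) ->
  nrm (f c) <= K.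
Proof.
move=> r0 df fc fK; apply/ler_addgt0Pr => e e0.
pose h z := f (c + cexp z).
have [d d0 hd] := fc (e / 2) ltac:(lra).
(* The inner circle has radius [expR s1], small enough that [f] is within [e / 2] of [f c] on it and
   not larger than the outer radius. *)
pose s1 := Num.min (ln r) (ln (d / 2)).
have s1r : s1 <= ln r by rewrite ge_min lexx.
have s1d : expR s1 < d.
  apply: (@le_lt_trans _ _ (d / 2)); last by lra.
  by rewrite -[leRHS]lnK ?posrE ?ler_expR ?ge_min ?lexx ?orbT //; lra.
have lnr : expR (ln r) = r by rewrite lnK // posrE.
pose b : C := Complex 0 (pi *+ 2).
pose a : C := (ln r - s1)%:C.
have p0 : 0 < pi :> R := pi_gt0 R.
have nb : nrm b = pi *+ 2.
  rewrite nrm_sqrt /= expr0n add0r sqrtr_sqr ger0_norm // mulrn_wge0 //; exact: ltW.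
have hper z : h (z + b) = h z by rewrite /h cexp_period.
have tper N z v : trapz h N (z + b) v = trapz h N z v.
  elim: N z v => [|N IH] z v /=; first by rewrite addrAC !hper.
  by rewrite [z + b + _]addrAC !IH.
have [N hN] : exists N0, forall N, (N0 <= N)%N -> nrm (contour h N s1%:C a b) <= e / 2.
  apply: goursat; last by lra.
  move=> s t s01 t01; apply: (@differentiable_comp _ _ _ _ (fun z => c + cexp z) f).
    apply: (@differentiableD _ _ _ (cst c)); first exact: differentiable_cst.
    exact: cexp_diff.
  apply: df; rewrite addrC addKr nrm_cexp expR_gt0 /= -[leRHS]lnr ler_expR.
  by move: s01 => /andP[s0 s1']; nra.
have {hN} := hN N (leqnn N); rewrite /contour tper.
have -> : trapz h N s1%:C a + trapz h N (s1%:C + a) b - trapz h N s1%:C a - trapz h N s1%:C b =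
  trapz h N (s1%:C + a) b - trapz h N s1%:C b by ring.
move=> hN.
have k1 := @trapz_lin h 0 0 0 K N (s1%:C + a) b.
have {}k1 : nrm (trapz h N (s1%:C + a) b) <= nrm b * K.
  have := k1 _; rewrite mul0r addr0 mulr0 subr0; apply=> s s01.
  rewrite mul0r addr0 subr0; apply: fK; rewrite addrC addKr nrm_cexp.
  by rewrite (_ : complex.Re _ = ln r) //=; ring.
have k2 := @trapz_lin h (f c) 0 0 (e / 2) N s1%:C b.
have {}k2 : nrm (trapz h N s1%:C b - b * f c) <= nrm b * (e / 2).
  have := k2 _; rewrite mul0r addr0; apply=> s s01; rewrite mul0r addr0.
  apply/ltW/hd; rewrite addrC addKr nrm_cexp.
  by rewrite (_ : complex.Re _ = s1) //=; ring.
set T1 := trapz h N (s1%:C + a) b in hN k1; set T2 := trapz h N s1%:C b in hN k2.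
have k3 : nrm (b * f c) <= nrm T1 + nrm (T1 - T2) + nrm (T2 - b * f c).
  rewrite [X in nrm X <= _](_ : b * f c = T1 + - (T1 - T2) + - (T2 - b * f c)); last by ring.
  apply: (le_trans (nrmD _ _)); rewrite nrmN lerD2r.
  by apply: (le_trans (nrmD _ _)); rewrite nrmN.
rewrite nrmM in k3.
(* The error [e / 2] of the contour sum has no factor [nrm b]; it is absorbed because the length 2
   pi of [b] is at least 1. *)
have b1 : 1 <= nrm b.
  by rewrite nb; have := pi_ge2 R; rewrite mulr2n; lra.
rewrite -(ler_pM2l (x := nrm b)); last by lra.
nra.
Qed.

End Goursat.

(** * Schwarz lemma and Cauchy estimates *)

Section Compactness.
Variable R : realType.
Local Notation C := (Cx R).
Implicit Types V W : normedModType C.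

(** One natural number encodes either a bound or an inverse radius, so this serves both for
    boundedness on compact sets and for uniform radii. *)
Lemma compact_unif (T : topologicalType) (A : set T) (Q : T -> nat -> Prop) :
  compact A -> (forall x m n, (m <= n)%N -> Q x m -> Q x n) ->
  (forall x, A x -> exists n, \forall y \near x, Q y n) ->
  exists n, forall x, A x -> Q x n.
Proof.
move=> /compact_near_coveringP cA mono loc.
have : \forall i \near \oo, A `<=` Q ^~ i.
  apply: (cA nat \oo (fun n x => Q x n)) => x /loc[n hn].
  exists ([set y | Q y n], [set i | (n <= i)%N]) => /=.
    by split=> //; exists n.
  by move=> [y i] /= [Qy ni]; exact: mono ni Qy.
by move=> [n _ hn]; exists n => x Ax; exact: (hn n (leqnn n)).
Qed.

Lemma compact_cdisc (c : C) (r : R) : compact [set z : C | nrm (z - c) <= r].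
Proof.
pose f (x : R * R) : C := c + Complex x.1 x.2.
have fc : continuous f.
  move=> [x y]; apply/cvg_nrm => e e0.
  exists ([set z | `|z - x| < e / 2], [set z | `|z - y| < e / 2]) => /=.
    split; apply/nbhs_ballP; exists (e / 2) => /=; try lra;
      by move=> z; rewrite -ball_normE /= distrC.
  move=> [x' y'] /= [hx hy].
  have -> : f (x', y') - f (x, y) = Complex (x' - x) (y' - y).
    rewrite /f /= opprD addrACA subrr add0r //.
  by apply: (le_lt_trans (nrm_le_ReIm _)) => /=; lra.
apply: (@subclosed_compact _ _ (f @` (`[- r, r] `*` `[- r, r]))).
- rewrite -openC; apply/open_nrm => p /= /negP; rewrite -ltNge => hp.
  exists (nrm (p - c) - r); first by lra.
  move=> q hq; apply/negP; rewrite -ltNge.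
  by have := nrm_triB p q c; rewrite (nrmB p q); lra.
- apply: continuous_compact; first exact: continuous_subspaceT.
  by apply: compact_setX; exact: segment_compact.
- move=> z /= hz; have := Re_le_nrm (z - c); have := Im_le_nrm (z - c).
  exists (complex.Re (z - c), complex.Im (z - c)).
    by rewrite /= !in_itv /=; split; apply/andP; split; have := le_trans _ hz;
      move: H H0; rewrite ?ler_norml; lra.
  by rewrite /f /= (_ : Complex _ _ = z - c) ?subrKC //; case: (z - c).
Qed.

Lemma bounded_cdisc (g : C -> C) (c : C) (r : R) :
  (forall l, nrm (l - c) <= r -> differentiable g l) ->
  exists2 S : R, 0 < S & forall l, nrm (l - c) <= r -> nrm (g l) <= S.
Proof.
move=> dg.
have [n hn] : exists n, forall x, [set z : C | nrm (z - c) <= r] x -> nrm (g x) <= n%:R.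
  apply: compact_unif; first exact: compact_cdisc.
    by move=> x m n mn h; apply: (le_trans h); rewrite ler_nat.
  move=> x xr; exists (Num.truncn (nrm (g x) + 1)).+1.
  have [d d0 hd] := diff_cont (dg x xr) (@ltr01 R).
  apply/nbhs_nrm; exists d => // q qd.
  have := hd q qd; have := nrm_sub (g q) (g x).
  have := truncnS_gt (nrm (g x) + 1); lra.
exists (n%:R + 1) => [|l lr]; first by have := ler0n R n; lra.
by have := hn l lr; lra.
Qed.

End Compactness.

Section DiffRules.
Variable R : realType.
Local Notation C := (Cx R).
Variable V : normedModType C.
Implicit Types (f g : V -> C) (p : V).

Lemma dcst_ (a : C) p : differentiable (fun _ : V => a) p.
Proof. exact: differentiable_cst. Qed.

Lemma did_ p : differentiable (fun x : V => x) p.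
Proof. by have : differentiable id p by exact: ex_diff. Qed.

Lemma dD_ f g p : differentiable f p -> differentiable g p ->
  differentiable (fun x => f x + g x) p.
Proof. exact: differentiableD. Qed.

Lemma dB_ f g p : differentiable f p -> differentiable g p ->
  differentiable (fun x => f x - g x) p.
Proof. exact: differentiableB. Qed.

Lemma dM_ f g p : differentiable f p -> differentiable g p ->
  differentiable (fun x => f x * g x) p.
Proof. exact: differentiableM. Qed.

Lemma dX_ f n p : differentiable f p -> differentiable (fun x => f x ^+ n) p.
Proof.
move=> df; elim: n => [|n IH].
  by rewrite (_ : (fun _ => _) = fun=> 1) ?funeqE //; exact: dcst_.
rewrite (_ : (fun _ => _) = fun x => f x * f x ^+ n); first exact: dM_.
by apply/funext => x; rewrite exprS.
Qed.

Lemma dV_ f p : f p != 0 -> differentiable f p ->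
  differentiable (fun x => (f x)^-1) p.
Proof. by move=> f0 df; exact: differentiableV. Qed.

Lemma ddiv_ f g p : g p != 0 -> differentiable f p -> differentiable g p ->
  differentiable (fun x => f x / g x) p.
Proof. by move=> g0 df dg; apply: dM_ => //; exact: dV_. Qed.

Lemma dsum_ I (r : seq I) (P : pred I) (F : I -> V -> C) p :
  (forall i, P i -> differentiable (F i) p) ->
  differentiable (fun x => \sum_(i <- r | P i) F i x) p.
Proof.
move=> dF; elim: r => [|i r IH].
  rewrite (_ : (fun _ => _) = fun=> 0); first exact: dcst_.
  by apply/funext => x; rewrite big_nil.
rewrite (_ : (fun _ => _) = fun x => (if P i then F i x else 0) + \sum_(i <- r | P i) F i x).
  apply: (dD_ (f := fun x => if P i then F i x else 0)) => //.
  by case: (P i) (dF i) => [h|_]; [exact: h|exact: dcst_].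
by apply/funext => x; rewrite big_cons; case: ifP => // _; rewrite add0r.
Qed.

Lemma dcomp_ (W : normedModType C) (f : V -> W) (g : W -> C) p :
  differentiable f p -> differentiable g (f p) ->
  differentiable (fun x => g (f x)) p.
Proof. exact: differentiable_comp. Qed.

End DiffRules.

Section Schwarz.
Variable R : realType.
Local Notation C := (Cx R).
Implicit Types V : normedModType C.

(** The slope [psi] is at most [2 * M / nrm l]. On the circle of radius [r / 2] about 1 one has
    [nrm l >= 3 / 8 * r], since [r >= 8], so there [psi] is at most 16 M / (3 r). The maximum
    principle is applied to [psi ^+ n * gl ^+ 2], which is holomorphic across the zeros of [gl], and
    [pow_le_limit] removes the square. *)
Lemma schwarz_lip1 (f g : C -> C) (r M : R) : 8 <= r -> 0 < M ->
  (forall l, nrm l < r -> differentiable g l) ->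
  (forall l, nrm l < r -> g l != 0 -> differentiable f l) ->
  (forall l, nrm l < r -> g l != 0 -> nrm (f l) <= M) ->
  g 0 != 0 -> g 1 != 0 -> nrm (f 1 - f 0) <= 6 * M / r.
Proof.
move=> r8 M0 dg df fM g0 g1.
pose psi l := (f l - f 0) / l.
(* The factor [l] adds 0, where the slope is a division by zero, to the points at which [k n] is set
   to 0. *)
pose gl l := g l * l.
pose k n l := if gl l == 0 then 0 else psi l ^+ n * gl l ^+ 2.
have r0 : 0 < r by lra.
have z0 : nrm (0 : C) < r by rewrite nrm0.
have f0M := fM 0 z0 g0.
have psiM l : nrm l < r -> g l != 0 -> l != 0 -> nrm (psi l) <= 2 * M / nrm l.
  move=> lr gl0 l0; rewrite nrmM nrmV ler_wpM2r ?invr_ge0 ?nrm_ge0 //.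
  by apply: (le_trans (nrmD _ _)); rewrite nrmN; have := fM l lr gl0; lra.
have dgl l : nrm l < r -> differentiable gl l.
  by move=> lr; apply: dM_; [exact: dg|exact: did_].
have dk n l : nrm l < r -> differentiable (k n) l.
  move=> lr; have [gl0|gl0] := eqVneq (gl l) 0.
    have [B [d [B0 d0 hB]]] : exists B d : R, [/\ 0 < B, 0 < d & forall q,
        nrm (q - l) < d -> gl q != 0 -> nrm (psi q) <= B].
      (* To use [diff_zero], [psi] must be bounded near each zero of [gl]: near 0 because [f] is
         differentiable there, elsewhere because [l] stays away from 0. *)
      have [l0|l0] := eqVneq l 0.
        have [K [d [K0 d0 hK]]] := diff_lip (df 0 z0 g0).
        exists K, d; split=> // q; rewrite l0 subr0 => qd.
        rewrite /gl mulf_eq0 negb_or => /andP[_ q0].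
        rewrite nrmM nrmV ler_pdivrMr ?nrm_gt0 //.
        by have := hK q qd; rewrite add0r.
      have n0 := nrm_gt0 l0.
      exists (4 * M / nrm l), (Num.min (nrm l / 2) (r - nrm l)).
      split; [by rewrite divr_gt0 //; lra|by rewrite lt_min; apply/andP; split; lra|].
      move=> q /lt_min2[q1 q2].
      rewrite /gl mulf_eq0 negb_or => /andP[gq q0].
      have t1 := nrm_sub l q; rewrite nrmB in t1.
      have t2 := nrm_sub q l.
      apply: (le_trans (psiM q _ gq q0)); first by lra.
      rewrite ler_pdivrMr ?nrm_gt0 // mulrAC ler_pdivlMr //.
      by nra.
    apply: (@diff_zero _ _ _ _ gl (B ^+ n) d) => //; last exact: dgl.
    move=> q qd; rewrite /k; case: ifPn => [_|gq].
      by rewrite nrm0 mulr_ge0 ?exprn_ge0 ?nrm_ge0 // ltW.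
    rewrite nrmM !nrmX ler_wpM2r ?exprn_ge0 ?nrm_ge0 //.
    by rewrite lerXn2r ?nnegrE ?nrm_ge0 ?(ltW B0) //; exact: hB.
  have [d d0 hd] := diff_cont (dgl l lr) (nrm_gt0 gl0).
  suff [] : differentiable (k n) l /\
     forall v, 'd (k n) l v = 'd (fun l => psi l ^+ n * gl l ^+ 2) l v by [].
  apply: (diff_near d0) => [q qd|].
    rewrite /k ifN //; apply: contraTneq (hd q qd) => ->.
    by rewrite sub0r nrmN ltxx.
  move: gl0; rewrite /gl mulf_eq0 negb_or => /andP[gl0 l0].
  apply: dM_; apply: dX_; last exact: dgl.
  have df0 : differentiable (fun l => f l - f 0) l by apply: dB_; [exact: df|exact: dcst_].
  exact: (ddiv_ (g := fun l => l) l0 df0 (did_ l)).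
have rr : 0 < r / 2 by lra.
have cl (l : C) : nrm (l - 1) <= r / 2 -> nrm l < r.
  by have := nrm_sub l 1; rewrite nrm1; lra.
have [S S0 hS] : exists2 S : R, 0 < S & forall l : C, nrm (l - 1) <= r / 2 -> nrm (gl l) <= S.
  by apply: bounded_cdisc => l /cl; exact: dgl.
have psi1 : psi 1 = f 1 - f 0 by rewrite /psi divr1.
rewrite -psi1.
apply: (@pow_le_limit _ _ (nrm (gl 1) ^+ 2) _ (S ^+ 2)).
- exact: nrm_ge0.
- by rewrite divr_gt0 //; lra.
- by rewrite exprn_gt0 // /gl mulr1 nrm_gt0.
move=> n; have -> : nrm (psi 1) ^+ n * nrm (gl 1) ^+ 2 = nrm (k n 1).
  by rewrite /k /gl mulr1 (negbTE g1) nrmM !nrmX.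
apply: (max_modulus_center rr).
- by move=> l /andP[_ /cl]; exact: dk.
- by move=> e e0; apply: (diff_cont (dk n 1 _)) => //; rewrite nrm1; lra.
move=> l lr; have lr' : nrm (l - 1) <= r / 2 by rewrite lr.
have lr1 := cl l lr'; rewrite /k; case: ifPn => [_|gl0].
  by rewrite nrm0 mulr_ge0 // exprn_ge0 // ltW // divr_gt0 //; lra.
rewrite nrmM !nrmX; apply: ler_pM; rewrite ?exprn_ge0 ?nrm_ge0 //; last first.
  by rewrite lerXn2r ?nnegrE ?nrm_ge0 ?(ltW S0) //; exact: hS.
have gl0' := gl0; move: gl0'; rewrite /gl mulf_eq0 negb_or => /andP[g_l l0].
have l1 : 3 / 8 * r <= nrm l.
  by have := nrm_sub (l - 1) (- 1); rewrite nrmN nrm1 opprK subrK; have := nrmD l (-1); rewrite nrmN nrm1; lra.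
rewrite lerXn2r ?nnegrE ?nrm_ge0 ?divr_ge0 //; try lra.
apply: (le_trans (psiM l lr1 g_l l0)).
by rewrite ler_pdivrMr ?nrm_gt0 // mulrAC ler_pdivlMr //; nra.
Qed.

Variable V : normedModType C.
Implicit Types (F G : V -> C) (p q : V).

(** On the complex line through [p] and [q], parametrized so that they sit at 0 and 1, the available
    radius is [r / nrm (q - p) >= 8]. *)
Lemma schwarz_lip F G p q (r M : R) : 0 < r -> 0 < M ->
  (forall x, nrm (x - p) < r -> differentiable G x) ->
  (forall x, nrm (x - p) < r -> G x != 0 -> differentiable F x) ->
  (forall x, nrm (x - p) < r -> G x != 0 -> nrm (F x) <= M) ->
  G p != 0 -> G q != 0 -> nrm (q - p) <= r / 8 ->
  nrm (F q - F p) <= 6 * M / r * nrm (q - p).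
Proof.
move=> r0 M0 dG dF FM Gp Gq qp.
have [->|qnp] := eqVneq q p; first by rewrite !subrr !nrm0 mulr0.
have n0 : 0 < nrm (q - p) by rewrite nrm_gt0 // subr_eq0.
pose ln (l : C) := p + l *: (q - p).
have lnr l : nrm l < r / nrm (q - p) -> nrm (ln l - p) < r.
  by rewrite /ln addrAC subrr add0r nrmZ -ltr_pdivlMr.
have ln0 : ln 0 = p by rewrite /ln scale0r addr0.
have ln1 : ln 1 = q by rewrite /ln scale1r subrKC.
rewrite -{1}ln0 -{1}ln1.
apply: (@le_trans _ _ (6 * M / (r / nrm (q - p)))); last first.
  by rewrite invf_div mulrA mulrAC.
apply: (@schwarz_lip1 (F \o ln) (G \o ln)) => //=.
- by rewrite ler_pdivlMr // mulrC -ler_pdivlMr.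
- by move=> l /lnr lr; apply: dcomp_; [exact: diff_line|exact: dG].
- by move=> l /lnr lr Gl; apply: dcomp_; [exact: diff_line|exact: dF].
- by move=> l /lnr lr Gl; exact: FM.
- by rewrite ln0.
- by rewrite ln1.
Qed.

End Schwarz.

Section SchwarzOff.
Variable R : realType.
Local Notation C := (Cx R).
Variable V : normedModType C.
Implicit Types (F G : V -> C) (p q v : V).

Lemma schwarz_off F G p q (r M : R) : 0 < r ->
  (forall x, nrm (x - p) < r -> differentiable G x) ->
  (forall x, nrm (x - p) < r -> G x != 0 -> differentiable F x) ->
  (forall x, nrm (x - p) < r -> G x != 0 -> nrm (F x) <= M) ->
  G p != 0 -> G q != 0 -> nrm (q - p) <= r / 8 ->
  nrm (F q - F p) <= 6 * M / r * nrm (q - p).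
Proof.
move=> r0 dG dF FM Gp Gq qp.
have M0 : 0 <= M.
  by apply: le_trans (nrm_ge0 (F p)) _; apply: FM => //; rewrite subrr nrm0.
apply/ler_addgt0Pr => e e0; have n0 := nrm_ge0 (q - p).
pose e1 := e * r / (6 * (nrm (q - p) + 1)).
have e10 : 0 < e1 by rewrite divr_gt0 ?mulr_gt0 //; lra.
apply: (le_trans (@schwarz_lip _ _ F G p q r (M + e1) r0 _ dG dF _ Gp Gq qp)).
- by lra.
- by move=> x xr Gx; have := FM x xr Gx; lra.
have -> : 6 * (M + e1) / r * nrm (q - p) =
   6 * M / r * nrm (q - p) + e * (nrm (q - p) / (nrm (q - p) + 1)).
  by rewrite /e1; field; rewrite !gt_eqF //; lra.
rewrite lerD2l ler_piMr ?(ltW e0) // ler_pdivrMr; lra.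
Qed.

(** The derivative is a limit of increments from [p] to points where [G] is still nonzero, and
    [schwarz_off] bounds these. This Cauchy estimate asks nothing of [F] on the zeros of [G]; its
    price is the constant 6 in place of 1. *)
Lemma cauchy_off F G p v (r M : R) : 0 < r ->
  (forall x, nrm (x - p) < r -> differentiable G x) ->
  (forall x, nrm (x - p) < r -> G x != 0 -> differentiable F x) ->
  (forall x, nrm (x - p) < r -> G x != 0 -> nrm (F x) <= M) ->
  G p != 0 -> nrm ('D_v F p) <= 6 * M / r * nrm v.
Proof.
move=> r0 dG dF FM Gp.
have pr : nrm (p - p) < r by rewrite subrr nrm0.
have dFp := dF p pr Gp; rewrite (deriveE _ dFp).
have [->|v0] := eqVneq v 0; first by rewrite linear0 !nrm0 mulr0.
have vn : 0 < nrm v := nrm_gt0 v0.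
apply/ler_addgt0Pr => e e0.
have [d1 d10 h1] := diff_nrm dFp (divr_gt0 e0 vn).
have [d2 d20 h2] := diff_cont (dG p pr) (nrm_gt0 Gp).
pose t := Num.min (Num.min d1 d2) (r / 8) / (2 * nrm v).
have t0 : 0 < t by rewrite divr_gt0 ?mulr_gt0 // !lt_min d10 d20 divr_gt0.
have tv : nrm (t%:C *: v) < Num.min (Num.min d1 d2) (r / 8).
  rewrite nrmZ nrm_real ger0_norm ?(ltW t0) // /t.
  rewrite invfM mulrA divfK ?gt_eqF // ltr_pdivrMr // ltr_pMr ?ltr1n //.
  by rewrite !lt_min d10 d20 divr_gt0.
move: tv => /lt_min2[/lt_min2[tv1 tv2] tv3].
have Gq : G (p + t%:C *: v) != 0.
  apply/eqP => G0; have := h2 (p + t%:C *: v); rewrite G0 sub0r nrmN addrAC subrr add0r.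
  by move=> /(_ tv2); rewrite ltxx.
have := @schwarz_off F G p (p + t%:C *: v) r M r0 dG dF FM Gp Gq.
rewrite [p + _ - p]addrAC subrr add0r => /(_ (ltW tv3)).
have := h1 _ tv1; rewrite linearZ /=.
set X := F _ - F p => a1 a2.
have : nrm (t%:C *: 'd F p v) <= nrm X + nrm (X - t%:C *: 'd F p v).
  by have := nrm_sub (t%:C *: 'd F p v) X; rewrite nrmB; lra.
move: a1 a2; rewrite !nrmZ !nrm_real ger0_norm ?(ltW t0) // => a1 a2 a3.
rewrite -(ler_pM2l t0); apply: (le_trans a3).
have : e / nrm v * (t * nrm v) = t * e by field; rewrite gt_eqF.
by rewrite mulrDr; move: a1 a2; lra.
Qed.

End SchwarzOff.

Section Cauchy.
Variable R : realType.
Local Notation C := (Cx R).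
Variable V : normedModType C.
Implicit Types (F G : V -> C) (p q v : V).

Lemma schwarz_ball F p q (r M : R) : 0 < r ->
  (forall x, nrm (x - p) < r -> differentiable F x) ->
  (forall x, nrm (x - p) < r -> nrm (F x) <= M) ->
  nrm (q - p) <= r / 8 -> nrm (F q - F p) <= 6 * M / r * nrm (q - p).
Proof.
move=> r0 dF FM qp; apply: (schwarz_off (G := fun=> 1)) => //.
- by move=> x xr _; exact: dF.
- by move=> x xr _; exact: FM.
Qed.

Lemma cauchy_est F p v (r M : R) : 0 < r ->
  (forall x, nrm (x - p) < r -> differentiable F x) ->
  (forall x, nrm (x - p) < r -> nrm (F x) <= M) ->
  nrm ('D_v F p) <= 6 * M / r * nrm v.
Proof.
move=> r0 dF FM; apply: (cauchy_off (G := fun=> 1)) => //.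
- by move=> x xr _; exact: dF.
- by move=> x xr _; exact: FM.
Qed.

(** The slope [ps] along the line is itself bounded, by [6 * M / rho] for [nrm l <= rho / 8], so
    Schwarz applies to it. It is compared at 1 and near 0, where it tends to the derivative. A disc
    of radius [rho / 16] and a distance at most 2 produce 6 * 6 * 16 * 2, written
    [6 * 6 * 8 * 4]. *)
Lemma second_order F p v (r M : R) : 0 < r ->
  (forall x, nrm (x - p) < r -> differentiable F x) ->
  (forall x, nrm (x - p) < r -> nrm (F x) <= M) ->
  8 * 8 * 8 * nrm v <= r ->
  nrm (F (p + v) - F p - 'D_v F p) <= (6 * 6 * 8 * 4) * M / r ^+ 2 * nrm v ^+ 2.
Proof.
move=> r0 dF FM vr.
have pr : nrm (p - p) < r by rewrite subrr nrm0.
have dFp := dF p pr; rewrite (deriveE _ dFp).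
have [->|v0] := eqVneq v 0.
  by rewrite linear0 addr0 subr0 subrr !nrm0 expr0n mulr0.
have vn : 0 < nrm v := nrm_gt0 v0.
pose ps (l : C) := (F (p + l *: v) - F p) / l.
pose rho := r / nrm v.
have rho0 : 8 * 8 * 8 <= rho by rewrite /rho ler_pdivlMr.
have inb (l : C) : nrm l <= rho / 8 -> nrm (p + l *: v - p) <= r / 8.
  rewrite addrAC subrr add0r nrmZ => h.
  have -> : r / 8 = rho / 8 * nrm v by rewrite /rho; field; rewrite gt_eqF.
  by rewrite ler_wpM2r // ltW.
have psM (l : C) : nrm l <= rho / 8 -> l != 0 -> nrm (ps l) <= 6 * M / rho.
  move=> lr l0; have := @schwarz_ball F p (p + l *: v) r M r0 dF FM (inb l lr).
  rewrite addrAC subrr add0r nrmZ nrmM nrmV => h.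
  rewrite ler_pdivrMr ?nrm_gt0 //; apply: (le_trans h).
  by rewrite /rho le_eqVlt; apply/orP; left; apply/eqP; field; rewrite !gt_eqF.
have rho16 : 0 < rho / 16 by lra.
have key (l : C) : l != 0 -> nrm l <= 1 ->
    nrm (ps l - ps 1) <= (6 * 6 * 8 * 4) * M / r ^+ 2 * nrm v ^+ 2.
  move=> l0 l1.
  have x8 (x : C) : nrm (x - 1) < rho / 16 -> nrm x <= rho / 8.
    by have := nrm_sub x 1; rewrite nrm1; lra.
  have l1' : nrm (l - 1) <= 2 by have := nrmD l (-1); rewrite nrmN nrm1; lra.
  have M0 : 0 <= M by apply: le_trans (FM p pr); exact: nrm_ge0.
  have K0 : 0 <= 6 * (6 * M / rho) / (rho / 16).
    by rewrite !(divr_ge0, mulr_ge0) //; lra.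
  apply: (@le_trans _ _ (6 * (6 * M / rho) / (rho / 16) * 2)).
    apply: (@le_trans _ _ (6 * (6 * M / rho) / (rho / 16) * nrm (l - 1))); last first.
      by rewrite ler_wpM2l.
    apply: (@schwarz_off R _ ps (fun x : C => x)) => //.
    - move=> x /x8 xr x0; apply: ddiv_; [exact: x0| |exact: did_].
      apply: dB_; last exact: dcst_.
      apply: dcomp_; first exact: diff_line.
      by apply: dF; have := inb x xr; lra.
    - by move=> x /x8 xr x0; exact: psM.
    - by lra.
  by rewrite /rho le_eqVlt; apply/orP; left; apply/eqP; field; rewrite !gt_eqF.
have F1 : ps 1 = F (p + v) - F p by rewrite /ps scale1r divr1.
rewrite -F1; apply/ler_addgt0Pr => e e0.
have [d1 d10 h1] := diff_nrm dFp (divr_gt0 e0 vn).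
pose t := Num.min (d1 / (2 * nrm v)) 1.
have t0 : 0 < t by rewrite lt_min ltr01 divr_gt0 ?mulr_gt0.
have tn : nrm (t%:C : C) = t by rewrite nrm_real ger0_norm // ltW.
have t1 : nrm (t%:C : C) <= 1 by rewrite tn ge_min lexx orbT.
have tC0 : t%:C != 0 :> C by apply/eqP => h; move: tn; rewrite h nrm0 => /esym; lra.
have {}key := key _ tC0 t1.
have tv : nrm (t%:C *: v) < d1.
  rewrite nrmZ tn; have : t <= d1 / (2 * nrm v) by rewrite ge_min lexx.
  rewrite ler_pdivlMr ?mulr_gt0 // => h.
  by have := mulr_gt0 t0 vn; lra.
have := h1 _ tv; rewrite linearZ /= => h2.
have : nrm (ps t%:C - 'd F p v) <= e.
  have -> : ps t%:C - 'd F p v = (F (p + t%:C *: v) - F p - t%:C *: 'd F p v) / t%:C.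
    have sE (a b : C) : a *: b = b * a by exact: mulrC.
    by rewrite /ps [RHS]mulrBl (sE _ ('d F p v)) mulfK.
  rewrite nrmM nrmV tn ler_pdivrMr //; apply: (le_trans h2).
  by rewrite nrmZ tn mulrCA divfK ?gt_eqF // mulrC.
have := nrm_triB (ps 1) (ps t%:C) ('d F p v).
by have := nrmB (ps 1) (ps t%:C); lra.
Qed.

(** By the Cauchy estimate the derivatives of [F_ n] form a Cauchy sequence. The second-order
    remainder is bounded uniformly in [n], so it survives in the limit and shows that the limit of
    the derivatives is the differential of [F]. The rate is recorded because it is needed for series
    and mixed partials. *)
Lemma weierstrass (F_ : nat -> V -> C) F p (r M : R) (e_ : nat -> R) : 0 < r ->
  (forall n x, nrm (x - p) < r -> differentiable (F_ n) x) ->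
  (forall n x, nrm (x - p) < r -> nrm (F_ n x) <= M) ->
  (forall n x, nrm (x - p) < r -> nrm (F_ n x - F x) <= e_ n) ->
  (forall e, 0 < e -> exists N, forall n, (N <= n)%N -> e_ n <= e) ->
  differentiable F p /\
  forall n v, nrm ('D_v (F_ n) p - 'D_v F p) <= 6 * e_ n / r * nrm v.
Proof.
move=> r0 dF FM Fe e0.
have pr : nrm (p - p) < r by rewrite subrr nrm0.
have en n : 0 <= e_ n by apply: le_trans (Fe n p pr); exact: nrm_ge0.
have M0 : 0 <= M by apply: le_trans (FM 0%N p pr); exact: nrm_ge0.
have e0' v e : 0 < e -> exists N, forall n, (N <= n)%N -> 6 * e_ n / r * nrm v <= e.
  move=> ep; have vn := nrm_ge0 v.
  have [|N hN] := e0 (e * r / (6 * (nrm v + 1))).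
    by rewrite divr_gt0 ?mulr_gt0 //; lra.
  exists N => n Nn; apply: (@le_trans _ _ (e * (nrm v / (nrm v + 1)))); last first.
    by rewrite ler_piMr ?(ltW ep) // ler_pdivrMr; lra.
  have -> : e * (nrm v / (nrm v + 1)) = 6 * (e * r / (6 * (nrm v + 1))) / r * nrm v.
    by field; rewrite !gt_eqF //; lra.
  by rewrite !ler_wpM2r ?invr_ge0 ?(ltW r0) // ler_wpM2l //; exact: hN.
have Dlim v : exists l : C, forall n, nrm ('D_v (F_ n) p - l) <= 6 * e_ n / r * nrm v.
  apply: complete_seq; first exact: e0'.
  move=> m n.
  have dmn : forall x, nrm (x - p) < r -> differentiable (fun x => F_ m x - F_ n x) x.
    by move=> x xr; apply: dB_; exact: dF.
  have := @cauchy_est (fun x => F_ m x - F_ n x) p v r (e_ m + e_ n) r0 dmn.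
  have -> : 'D_v (fun x => F_ m x - F_ n x) p = 'D_v (F_ m) p - 'D_v (F_ n) p.
    by rewrite (@deriveB _ _ _ (F_ m) (F_ n)) //; apply: diff_derivable; exact: dF.
  move=> h; rewrite -mulrDl -mulrDl -mulrDr; apply: h => x xr.
  have := nrm_triB (F_ m x) (F x) (F_ n x); rewrite (nrmB (F x)).
  by have := Fe m x xr; have := Fe n x xr; lra.
have [L hL] := choice Dlim.
have small (x : C) : (forall e, 0 < e -> nrm x <= e) -> x = 0.
  move=> h; apply: nrm0_eq0; apply/eqP; rewrite eq_le nrm_ge0 andbT.
  by apply/ler_addgt0Pr => e ep; rewrite add0r; exact: h.
have Dlin n : forall a u v, 'D_(a *: u + v) (F_ n) p = a * 'D_u (F_ n) p + 'D_v (F_ n) p.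
  by move=> a u v; rewrite !(deriveE _ (dF n p pr)) linearP.
have linL : linear L.
  move=> a u v; apply/eqP; rewrite -subr_eq0; apply/eqP/small => e ep.
  have ap : 0 < nrm a + 1 by have := nrm_ge0 a; lra.
  have [N1 h1] := e0' (a *: u + v) (e / 3) ltac:(lra).
  have [N2 h2] := e0' u (e / (3 * (nrm a + 1))) ltac:(rewrite divr_gt0 // mulr_gt0 //).
  have [N3 h3] := e0' v (e / 3) ltac:(lra).
  pose n := maxn N1 (maxn N2 N3).
  have {}h1 := h1 n ltac:(by rewrite leq_maxl).
  have {}h2 := h2 n ltac:(by rewrite /n leq_max leq_max leqnn orbT).
  have {}h3 := h3 n ltac:(by rewrite /n leq_max leq_max leqnn !orbT).
  have g1 := hL (a *: u + v) n; have g2 := hL u n; have g3 := hL v n.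
  rewrite Dlin in g1.
  set X := 'D_u _ _ in g1 g2; set Y := 'D_v _ _ in g1 g3.
  have -> : L (a *: u + v) - (a *: L u + L v) =
    - (a * X + Y - L (a *: u + v)) + a * (X - L u) + (Y - L v).
    by rewrite (_ : a *: L u = a * L u) //; ring.
  apply: (le_trans (nrmD _ _)); apply: (@le_trans _ _ (e / 3 + e / 3 + e / 3)); last by lra.
  apply: lerD; last by exact: le_trans g3 h3.
  apply: (le_trans (nrmD _ _)); apply: lerD.
    by rewrite nrmN; exact: le_trans g1 h1.
  rewrite nrmM; apply: (@le_trans _ _ (nrm a * (e / (3 * (nrm a + 1))))).
    by rewrite ler_wpM2l ?nrm_ge0 //; exact: le_trans g2 h2.
  rewrite mulrA ler_pdivrMr ?mulr_gt0 //.
  have -> : e / 3 * (3 * (nrm a + 1)) = e * (nrm a + 1) by field.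
  by rewrite mulrC ler_wpM2l ?(ltW ep) //; lra.
have [dFp dL] : differentiable F p /\ forall v, 'd F p v = L v.
  apply: (diffI (K := 6 * M / r + 6 * e_ 0%N / r)) => //.
    move=> v; have := hL v 0%N.
    have := cauchy_est v r0 (dF 0%N) (FM 0%N).
    rewrite mulrDl; have := nrm_sub (L v) ('D_v (F_ 0%N) p); rewrite nrmB; lra.
  move=> e ep; pose K := (6 * 6 * 8 * 4) * M / r ^+ 2 + 1.
  have K0 : 0 < K.
    have : 0 <= (6 * 6 * 8 * 4) * M / r ^+ 2 by rewrite divr_ge0 ?exprn_ge0 ?(ltW r0) // mulr_ge0.
    by rewrite /K; lra.
  exists (Num.min (r / (8 * 8 * 8)) (e / K)); first by rewrite lt_min !divr_gt0.
  move=> v /lt_min2[vr ve].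
  have vr' : 8 * 8 * 8 * nrm v <= r by move: vr; lra.
  have pv : nrm (p + v - p) < r by rewrite addrAC subrr add0r; have := nrm_ge0 v; lra.
  apply: (@le_trans _ _ ((6 * 6 * 8 * 4) * M / r ^+ 2 * nrm v ^+ 2)); last first.
    rewrite expr2 mulrA ler_wpM2r ?nrm_ge0 //.
    apply: (@le_trans _ _ (K * nrm v)); first by rewrite ler_wpM2r ?nrm_ge0 // /K; lra.
    by rewrite mulrC -ler_pdivlMr // ltW.
  apply/ler_addgt0Pr => d d0.
  have [N1 h1] := e0' v (d / 3) ltac:(lra); have [N2 h2] := e0 (d / 3) ltac:(lra).
  pose n := maxn N1 N2.
  have {}h1 := h1 n ltac:(by rewrite leq_maxl).
  have {}h2 := h2 n ltac:(by rewrite leq_maxr).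
  have g1 := hL v n; have g2 := Fe n p pr; have g3 := Fe n _ pv.
  have g4 := second_order r0 (dF n) (FM n) vr'.
  set A := F (p + v); set B := F p.
  have -> : A - B - L v = (F_ n (p + v) - F_ n p - 'D_v (F_ n) p) -
     (F_ n (p + v) - A) + (F_ n p - B) + ('D_v (F_ n) p - L v) by ring.
  have t1 := nrmD (F_ n (p + v) - F_ n p - 'D_v (F_ n) p - (F_ n (p + v) - A) + (F_ n p - B))
     ('D_v (F_ n) p - L v).
  have t2 := nrmD (F_ n (p + v) - F_ n p - 'D_v (F_ n) p - (F_ n (p + v) - A)) (F_ n p - B).
  have t3 := nrmD (F_ n (p + v) - F_ n p - 'D_v (F_ n) p) (- (F_ n (p + v) - A)).
  rewrite nrmN in t3; lra.
by split=> // n v; rewrite (deriveE _ dFp) dL; exact: hL.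
Qed.

(** The difference quotients with increments [h n] are holomorphic and, by [second_order], converge
    uniformly to the derivative at rate [K * h n]; [weierstrass] concludes. *)
Lemma diff_derive F p e (r : R) : 0 < r ->
  (forall x, nrm (x - p) < r -> differentiable F x) ->
  differentiable (fun x => 'D_e F x) p.
Proof.
move=> r0 dF.
have [->|en0] := eqVneq e 0.
  rewrite (_ : (fun _ => _) = fun=> 0); first exact: dcst_.
  by apply/funext => x; rewrite derive0.
have en : 0 < nrm e := nrm_gt0 en0.
have pr : nrm (p - p) < r by rewrite subrr nrm0.
have [d d0 hd] := diff_cont (dF p pr) (@ltr01 R).
pose s := Num.min d r / 2; pose M := nrm (F p) + 1.
have s0 : 0 < s by rewrite divr_gt0 // lt_min d0.
have sd : 2 * s <= d by rewrite /s mulrC divfK // ge_min lexx.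
have sr : 2 * s <= r by rewrite /s mulrC divfK // ge_min lexx orbT.
have dF2 x : nrm (x - p) < 2 * s -> differentiable F x by move=> h; apply: dF; lra.
have FM x : nrm (x - p) < 2 * s -> nrm (F x) <= M.
  move=> h; have := hd x (lt_le_trans h sd); have := nrm_sub (F x) (F p).
  by rewrite /M; lra.
have M0 : 0 <= M by rewrite /M; have := nrm_ge0 (F p); lra.
pose h n : R := s / (8 * 8 * 8 * nrm e) / n.+1%:R.
have h0 n : 0 < h n by rewrite /h; do 2! apply: divr_gt0 => //; apply: mulr_gt0.
have hC n : nrm ((h n)%:C : C) = h n by rewrite nrm_real ger0_norm // ltW.
have hCn n : (h n)%:C != 0 :> C.
  by apply/eqP => E; have := hC n; rewrite E nrm0 => /esym; have := h0 n; lra.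
have he n : 8 * 8 * 8 * nrm ((h n)%:C *: e) <= s.
  rewrite nrmZ hC /h.
  have -> : 8 * 8 * 8 * (s / (8 * 8 * 8 * nrm e) / n.+1%:R * nrm e) = s / n.+1%:R.
    by field; rewrite !gt_eqF.
  by rewrite ler_pdivrMr // ler_peMr ?ler1n // ltW.
pose F_ n x := (F (x + (h n)%:C *: e) - F x) / (h n)%:C.
pose K := (6 * 6 * 8 * 4) * M / s ^+ 2 * nrm e ^+ 2.
have K0 : 0 <= K by rewrite mulr_ge0 ?exprn_ge0 ?(ltW en) // divr_ge0 ?exprn_ge0 ?(ltW s0) // mulr_ge0.
have shift x n : nrm (x - p) < s -> nrm (x + (h n)%:C *: e - p) < 2 * s.
  move=> xs; have := nrmD (x - p) ((h n)%:C *: e); rewrite addrAC.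
  by have := he n; have := nrm_ge0 ((h n)%:C *: e); lra.
have sub x y : nrm (x - p) < s -> nrm (y - x) < s -> nrm (y - p) < 2 * s.
  by move=> xs yx; have := nrm_triB y x p; lra.
have Fe n x : nrm (x - p) < s -> nrm (F_ n x - 'D_e F x) <= K * h n.
  move=> xs.
  have := @second_order F x ((h n)%:C *: e) s M s0 (fun y ys => dF2 y (sub x y xs ys))
            (fun y ys => FM y (sub x y xs ys)) (he n).
  have dFx : differentiable F x by apply: dF2; lra.
  rewrite (deriveE _ dFx) linearZ -(deriveE _ dFx) /= => hh.
  have -> : F_ n x - 'D_e F x =
     (F (x + (h n)%:C *: e) - F x - (h n)%:C *: 'D_e F x) / (h n)%:C.
    have sE (a b : C) : a *: b = b * a by exact: mulrC.
    by rewrite /F_ [RHS]mulrBl (sE _ ('D_e F x)) mulfK.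
  rewrite nrmM nrmV hC ler_pdivrMr //; apply: (le_trans hh).
  by rewrite nrmZ hC /K exprMn le_eqVlt; apply/orP; left; apply/eqP; ring.
have h1 n : h n <= h 0%N.
  rewrite /h divr1 ler_pdivrMr // ler_peMr ?ler1n //.
  by apply: divr_ge0; [exact: ltW|apply: mulr_ge0 => //; exact: ltW].
apply: (proj1 (@weierstrass F_ _ p s (6 * M / s * nrm e + K * h 0%N) (fun n => K * h n) s0 _ _ Fe _)).
- move=> n x xs; apply: dM_; last exact: dcst_.
  apply: dB_; last by apply: dF2; lra.
  apply: (dcomp_ (f := fun x => x + (h n)%:C *: e)).
    by apply: (@differentiableD _ _ _ id (cst _)); [exact: did_|exact: differentiable_cst].
  by apply: dF2; exact: shift.
- move=> n x xs.
  have := Fe n x xs; have := nrm_sub (F_ n x) ('D_e F x).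
  have := @cauchy_est F x e s M s0 (fun y ys => dF2 y (sub x y xs ys))
            (fun y ys => FM y (sub x y xs ys)).
  have : K * h n <= K * h 0%N by rewrite ler_wpM2l.
  lra.
move=> eps eps0.
have A0 : 0 < K * (s / (8 * 8 * 8 * nrm e)) + 1.
  apply: ltr_pwDr => //; apply: mulr_ge0 => //.
  by apply: divr_ge0; [exact: ltW|apply: mulr_ge0 => //; exact: ltW].
exists (Num.truncn ((K * (s / (8 * 8 * 8 * nrm e)) + 1) / eps)).+1 => n hn.
rewrite /h mulrA ler_pdivrMr // [eps * _]mulrC -ler_pdivrMr //.
apply: (@le_trans _ _ ((K * (s / (8 * 8 * 8 * nrm e)) + 1) / eps)).
  by rewrite ler_wpM2r ?invr_ge0 ?(ltW eps0) //; lra.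
apply: (le_trans (ltW (truncnS_gt _))); rewrite ler_nat.
by apply: (leq_trans hn).
Qed.

Lemma hol_derive (U : set V) F e : open U -> holomorphic_on U F ->
  holomorphic_on U ('D_e F).
Proof.
move=> /open_nrm oU hF p /oU[r r0 hr].
have h := @diff_derive F p e r r0.
by apply: h => x xr; apply: hF; exact: hr.
Qed.

End Cauchy.

(** * Identity theorem and series *)

Section Identity.
Variable R : realType.
Local Notation C := (Cx R).

(** The quotient of [f] by the m-th power is holomorphic, and the maximum principle bounds it by its
    values on the circle of radius [r / 2] about [l], where the modulus is at least [3 / 8 * r]. As
    [nrm l < r / 8], this gives [nrm (f l) <= M * 3^-1 ^+ m] for every [m]. *)
Lemma flat_zero1 (f : C -> C) (r M : R) : 0 < r ->
  (forall l, nrm l < r -> differentiable f l) ->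
  (forall l, nrm l < r -> nrm (f l) <= M) ->
  (forall m, exists K d : R, 0 < d /\ forall l, nrm l < d -> nrm (f l) <= K * nrm l ^+ m) ->
  forall l, nrm l < r / 8 -> f l = 0.
Proof.
move=> r0 df fM flat l lr.
have [l0|l0] := eqVneq l 0.
  have [K [d [d0 h]]] := flat 1%N; apply: nrm0_eq0; apply/eqP.
  by rewrite eq_le nrm_ge0 andbT; have := h l; rewrite l0 nrm0 mulr0 => /(_ d0).
have ln := nrm_gt0 l0.
have M0 : 0 <= M by apply: le_trans (fM l _); [exact: nrm_ge0|lra].
have key m : nrm (f l) <= M * (3^-1) ^+ m.
  pose k x := if x == 0 then 0 else f x / x ^+ m.
  have dk x : nrm x < r -> differentiable k x.
    move=> xr; have [->|x0] := eqVneq x 0.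
      (* Two more orders of flatness give the quadratic bound that [diff_zero] requires at 0. *)
      have [K [d [d0 h]]] := flat (m + 2)%N.
      apply: (@diff_zero _ _ _ _ id K d d0) => // q; rewrite subr0 => qd.
      rewrite /k; case: eqVneq => [->|q0]; first by rewrite !nrm0 expr0n mulr0.
      rewrite nrmM nrmV nrmX ler_pdivrMr ?exprn_gt0 ?nrm_gt0 //.
      by rewrite -mulrA -exprD addnC; exact: h.
    suff [] : differentiable k x /\ forall v, 'd k x v = 'd (fun x => f x / x ^+ m) x v by [].
    apply: (@diff_near _ _ _ _ _ _ (nrm x)) => [|q qx|]; first exact: nrm_gt0.
      rewrite /k ifN //; apply: contraTneq qx => ->.
      by rewrite sub0r nrmN ltxx.
    apply: ddiv_; [by rewrite expf_neq0|exact: df|].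
    by apply: dX_; exact: did_.
  have fk : nrm (f l) = nrm (k l) * nrm l ^+ m.
    by rewrite /k (negbTE l0) nrmM nrmV nrmX divfK // expf_neq0 // gt_eqF.
  have cl (x : C) : nrm (x - l) <= r / 2 -> nrm x < r by have := nrm_sub x l; lra.
  have : nrm (k l) <= M / (3 / 8 * r) ^+ m.
    apply: (@max_modulus_center _ k l (r / 2)); first by lra.
    - by move=> x /andP[_ /cl]; exact: dk.
    - by move=> e e0; apply: (diff_cont (dk l _)) => //; lra.
    move=> x xl; have xr : nrm x < r by apply: cl; rewrite xl.
    have x3 : 3 / 8 * r <= nrm x.
      by have := nrmD x (- l); rewrite nrmN xl; lra.
    have x0 : x != 0 by apply: contraTneq x3 => ->; rewrite nrm0 -ltNge; lra.
    rewrite /k (negbTE x0) nrmM nrmV nrmX; apply: ler_pM; rewrite ?nrm_ge0 ?invr_ge0 ?exprn_ge0 ?nrm_ge0 //.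
      exact: fM.
    rewrite lef_pV2 ?posrE ?exprn_gt0 ?nrm_gt0 //; last by lra.
    by rewrite lerXn2r ?nnegrE ?nrm_ge0 //; lra.
  move=> h; rewrite fk; apply: (@le_trans _ _ (M / (3 / 8 * r) ^+ m * (r / 8) ^+ m)).
    apply: ler_pM; rewrite ?nrm_ge0 ?exprn_ge0 ?nrm_ge0 //.
    by rewrite lerXn2r ?nnegrE ?nrm_ge0 //; lra.
  rewrite -mulrA -exprVn -exprMn ler_wpM2l //.
  by rewrite le_eqVlt; apply/orP; left; apply/eqP; congr (_ ^+ _); field; lra.
apply: nrm0_eq0; apply/eqP; rewrite eq_le nrm_ge0 andbT; apply/ler_addgt0Pr => e e0.
have e1 : 0 < e / (M + 1) by rewrite divr_gt0 //; lra.
have [n hn] := @geomP R 3^-1 _ ltac:(lra) e1.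
apply: (le_trans (key n)); rewrite add0r.
have {}hn := hn n (leqnn n).
apply: (@le_trans _ _ ((M + 1) * (e / (M + 1)))).
  apply: ler_pM => //; [by lra|exact: ltW].
by rewrite mulrC divfK // gt_eqF //; lra.
Qed.

Variable V : normedModType C.
Implicit Types (F : V -> C) (p q x : V).

(** Two points of the ball of radius [r / 32] are less than [r / 16] apart, so the line from [q]
    towards [x] stays in the large ball up to parameter 15. [flat_zero1] then reaches the parameter
    1, which is below 15 / 8. *)
Lemma vanish_near F p q (r M d : R) : 0 < r ->
  (forall x, nrm (x - p) < r -> differentiable F x) ->
  (forall x, nrm (x - p) < r -> nrm (F x) <= M) ->
  0 < d -> nrm (q - p) < r / 32 -> (forall x, nrm (x - q) < d -> F x = 0) ->
  forall x, nrm (x - p) < r / 32 -> F x = 0.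
Proof.
move=> r0 dF FM d0 qp Fq x xp.
have inb (l : C) : nrm l < 15 -> nrm (q + l *: (x - q) - p) < r.
  move=> l15; rewrite addrAC; apply: (le_lt_trans (nrmD _ _)); rewrite nrmZ.
  have := nrm_triB x p q; rewrite (nrmB p q); have := nrm_ge0 (x - q); have := nrm_ge0 l.
  nra.
suff : F (q + (1 : C) *: (x - q)) = 0 by rewrite scale1r subrKC.
have h := @flat_zero1 (fun l : C => F (q + l *: (x - q))) 15 M.
apply: h; first by lra.
- by move=> l l15; apply: dcomp_; [exact: diff_line|apply/dF/inb].
- by move=> l l15; apply/FM/inb.
- move=> m; exists 0, (d / (nrm (x - q) + 1)).
  have n0 := nrm_ge0 (x - q).
  split; first by apply: divr_gt0 => //; lra.
  move=> l; rewrite ltr_pdivlMr; last by lra.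
  move=> hl; rewrite mul0r Fq ?nrm0 // addrAC subrr add0r nrmZ.
  by apply: le_lt_trans hl; rewrite ler_wpM2l ?nrm_ge0 //; lra.
- by rewrite nrm1; lra.
Qed.

Lemma nonzero_dense F p q (r M : R) : 0 < r ->
  (forall x, nrm (x - p) < r -> differentiable F x) ->
  (forall x, nrm (x - p) < r -> nrm (F x) <= M) ->
  nrm (q - p) < r / 32 -> F q != 0 ->
  forall x (e : R), 0 < e -> nrm (x - p) < r / 32 ->
    exists2 y, nrm (y - x) < e & F y != 0.
Proof.
move=> r0 dF FM qp Fq x e e0 xp; apply: contrapT => h.
move/eqP: Fq; apply; apply: (vanish_near r0 dF FM e0 xp) => // y yx.
by apply: contrapT => /eqP Fy; apply: h; exists y.
Qed.

(** This mean value inequality is obtained by cutting the segment into [n.+1] pieces: each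
    second-order remainder is of size [B] over the square of [n.+1], so their sum tends to 0. *)
Lemma increment_le F p v (r K : R) (l : C) : 0 < r ->
  (forall x, nrm (x - p) < r -> differentiable F x) ->
  (exists M, forall x, nrm (x - p) < r -> nrm (F x) <= M) ->
  nrm (l *: v) <= r / 2 ->
  (forall m : C, nrm m <= nrm l -> nrm ('D_v F (p + m *: v)) <= K) ->
  nrm (F (p + l *: v) - F p) <= K * nrm l.
Proof.
move=> r0 dF [M FM] lr FK.
have K0 : 0 <= K by apply: le_trans (FK 0 _); rewrite ?nrm0 ?nrm_ge0.
have M0 : 0 <= M by apply: le_trans (FM p _); rewrite ?subrr ?nrm0 ?nrm_ge0.
pose B := 6 * 6 * 8 * 4 * M / (r / 2) ^+ 2 * nrm (l *: v) ^+ 2.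
have B0 : 0 <= B.
  apply: mulr_ge0; last by rewrite exprn_ge0 ?nrm_ge0.
  by apply: divr_ge0; [apply: mulr_ge0|rewrite exprn_ge0 //; lra].
have key n : 8 * 8 * 8 * nrm (l *: v) <= (r / 2) * n.+1%:R ->
    nrm (F (p + l *: v) - F p) <= K * nrm l + B / n.+1%:R.
  move=> hn; have n0 : 0 < n.+1%:R :> R by [].
  pose c i : C := (i%:R / n.+1%:R)%:C.
  pose cn : R := n.+1%:R^-1.
  have cn0 : 0 <= cn by rewrite invr_ge0.
  pose h : V := (cn%:C : C) *: (l *: v).
  pose x i := p + c i *: (l *: v).
  have xS i : x i.+1 = x i + h.
    by rewrite /x /h -addrA -scalerDl -rmorphD /c -natr1 mulrDl mul1r.
  have hh : nrm h = nrm (l *: v) / n.+1%:R.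
    by rewrite /h nrmZ nrm_real ger0_norm // mulrC.
  have step i : (i <= n)%N -> nrm (F (x i.+1) - F (x i)) <= (K * nrm l + B / n.+1%:R) / n.+1%:R.
    move=> ni.
    have c1 : nrm (c i) <= 1.
      rewrite /c nrm_real ger0_norm ?divr_ge0 // ler_pdivrMr // mul1r ler_nat.
      exact: leqW.
    have xb : nrm (x i - p) <= r / 2.
      rewrite /x addrAC subrr add0r nrmZ; apply: le_trans lr.
      by rewrite ler_piMl ?nrm_ge0.
    have xr y : nrm (y - x i) < r / 2 -> nrm (y - p) < r.
      by have := nrm_triB y (x i) p; lra.
    have r2 : 0 < r / 2 by lra.
    have := @second_order _ _ F (x i) h (r / 2) M r2 (fun y hy => dF y (xr y hy))
       (fun y hy => FM y (xr y hy)).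
    rewrite hh mulrA ler_pdivrMr // => /(_ hn).
    have dFx : differentiable F (x i) by apply: dF; lra.
    have -> : 'D_h F (x i) = cn%:C * l * 'D_v F (x i).
      by rewrite !(deriveE _ dFx) /h scalerA linearZ.
    have {}FKi : nrm ('D_v F (x i)) <= K.
      rewrite /x scalerA; apply: FK; rewrite nrmM ler_piMl ?nrm_ge0 //.
    set A := _ * 'D_v F (x i) => h2.
    have hA : nrm A <= K * nrm l / n.+1%:R.
      rewrite /A !nrmM nrm_real ger0_norm // -mulrA mulrC -/cn ler_wpM2r //.
      by rewrite [K * _]mulrC ler_wpM2l ?nrm_ge0.
    rewrite xS.
    have := nrm_sub (F (x i + h) - F (x i)) A.
    have : (6 * 6 * 8 * 4) * M / (r / 2) ^+ 2 * (nrm (l *: v) / n.+1%:R) ^+ 2 = B / n.+1%:R / n.+1%:R.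
      by rewrite /B exprMn exprVn; field; rewrite !gt_eqF //; lra.
    move=> q1; rewrite lerBlDr => q2; apply: (le_trans q2).
    rewrite mulrDl addrC; apply: lerD; first exact: hA.
    by rewrite -q1.
  have tel m : (m <= n.+1)%N -> nrm (F (x m) - F (x 0%N)) <=
      m%:R * ((K * nrm l + B / n.+1%:R) / n.+1%:R).
    elim: m => [|m IH] mn; first by rewrite subrr nrm0 mul0r.
    apply: (le_trans (nrm_triB _ (F (x m)) _)).
    rewrite -[m.+1%:R]natr1 mulrDl mul1r addrC.
    by apply: lerD; [exact: IH (ltnW mn)|exact: step].
  have := tel n.+1 (leqnn _).
  rewrite /x /c mul0r rmorph0 scale0r addr0 divff ?gt_eqF // rmorph1 scale1r.
  by rewrite mulrC divfK // gt_eqF.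
apply/ler_addgt0Pr => e e0.
pose A := B / e + 8 * 8 * 8 * nrm (l *: v) / (r / 2).
pose n := Num.truncn A.
have An : A < n.+1%:R := truncnS_gt A.
have A1 : B / e <= A by rewrite /A lerDl; apply: divr_ge0; [apply: mulr_ge0 => //; exact: nrm_ge0|lra].
have A2 : 8 * 8 * 8 * nrm (l *: v) / (r / 2) <= A by rewrite /A lerDr divr_ge0 // ltW.
have n0 : 0 < n.+1%:R :> R by [].
apply: (le_trans (key n _)).
  by rewrite [r / 2 * _]mulrC -ler_pdivrMr; [apply: ltW; exact: le_lt_trans A2 An|lra].
rewrite lerD2l ler_pdivrMr // [e * _]mulrC -ler_pdivrMr //.
by apply: ltW; exact: le_lt_trans A1 An.
Qed.

Definition nderive (v : V) (n : nat) (F : V -> C) : V -> C :=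
  iter n (fun F => 'D_v F) F.

Lemma bounded_ball_near F p (r : R) : 0 < r ->
  (forall x, nrm (x - p) < r -> differentiable F x) ->
  exists s M : R, [/\ 0 < s, s <= r & forall x, nrm (x - p) < s -> nrm (F x) <= M].
Proof.
move=> r0 dF; have pr : nrm (p - p) < r by rewrite subrr nrm0.
have [d d0 hd] := diff_cont (dF p pr) (@ltr01 R).
exists (Num.min d r), (nrm (F p) + 1); split.
- by rewrite lt_min d0.
- by rewrite ge_min lexx orbT.
move=> x /lt_min2[/hd xd _].
by have := nrm_sub (F x) (F p); lra.
Qed.

Lemma ball_diff_derive F p v (r : R) :
  (forall x, nrm (x - p) < r -> differentiable F x) ->
  forall x, nrm (x - p) < r -> differentiable ('D_v F) x.
Proof.
move=> dF x xr; have e0 : 0 < r - nrm (x - p) by lra.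
apply: (@diff_derive _ _ F x v _ e0) => y yx; apply: dF.
by have := nrm_triB y x p; lra.
Qed.

(** By induction on [m]: the derivative is flat of order m along the line, and [increment_le] gains
    one order. *)
Lemma flat_derive F p v (r : R) m : 0 < r ->
  (forall x, nrm (x - p) < r -> differentiable F x) ->
  (forall j, (j < m)%N -> nderive v j F p = 0) ->
  exists K d : R, 0 < d /\ forall l : C, nrm l < d -> nrm (F (p + l *: v)) <= K * nrm l ^+ m.
Proof.
move=> r0; elim: m F => [|m IH] F dF Fj.
  have [s [M [s0 sr FM]]] := bounded_ball_near r0 dF.
  exists M, (s / (nrm v + 1)).
  have n0 := nrm_ge0 v.
  split; first by apply: divr_gt0 => //; lra.
  move=> l; rewrite ltr_pdivlMr; last by lra.
  move=> hl; rewrite expr0 mulr1; apply: FM; rewrite addrAC subrr add0r nrmZ.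
  by apply: le_lt_trans hl; rewrite ler_wpM2l ?nrm_ge0 //; lra.
have [K [d [d0 hK]]] := IH ('D_v F) (ball_diff_derive v dF)
   (fun j hj => eq_trans (congr1 (fun f => f p) (esym (iterSr j _ F))) (Fj j.+1 hj)).
have [s [M [s0 sr FM]]] := bounded_ball_near r0 dF.
exists `|K|, (Num.min d (s / (2 * (nrm v + 1)))).
have n0 := nrm_ge0 v.
split; first by rewrite lt_min d0 divr_gt0 //; lra.
move=> l /lt_min2[ld]; rewrite ltr_pdivlMr; last by lra.
move=> hl; have F0 := Fj 0%N isT.
have -> : F (p + l *: v) = F (p + l *: v) - F p.
  by rewrite (_ : F p = 0) ?subr0 //; exact: F0.
rewrite exprSr mulrA; apply: (@increment_le F p v s) => //.
- by move=> x xs; apply: dF; lra.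
- by exists M.
- rewrite nrmZ; have := nrm_ge0 l; nra.
move=> mm ml; apply: (le_trans (hK mm (le_lt_trans ml ld))).
apply: (@le_trans _ _ (`|K| * nrm mm ^+ m)).
  by rewrite ler_wpM2r ?exprn_ge0 ?nrm_ge0 // ler_norm.
by rewrite ler_wpM2l // lerXn2r ?nnegrE ?nrm_ge0.
Qed.

(** This form of the identity theorem is how two analytic functions are identified from now on:
    their difference has a vanishing jet along one line. *)
Lemma flat_line F p v (r M : R) : 0 < r ->
  (forall l : C, nrm l < r -> differentiable F (p + l *: v)) ->
  (forall l : C, nrm l < r -> nrm (F (p + l *: v)) <= M) ->
  (exists2 s : R, 0 < s & forall x, nrm (x - p) < s -> differentiable F x) ->
  (forall j, nderive v j F p = 0) ->
  forall l : C, nrm l < r / 8 -> F (p + l *: v) = 0.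
Proof.
move=> r0 dF FM [s s0 dFs] Fj.
apply: (@flat_zero1 (fun l => F (p + l *: v)) r M r0) => //.
  by move=> l lr; apply: dcomp_; [exact: diff_line|exact: dF].
by move=> m; apply: (flat_derive s0 dFs).
Qed.

End Identity.

(** * Derivations on an open set and the Leibniz rule *)

Section Leibniz.
Variable R : realType.
Local Notation C := (Cx R).
Variable V : normedModType C.
Implicit Types (F G : V -> C) (U : set V) (L : (V -> C) -> V -> C).

(** The same Leibniz rule is needed for the w-derivative, the t-derivative and the characteristic
    field. Functions being total, locality ([der_eq]) has to be stated: values outside [U] are
    irrelevant. *)
Record derivation U L : Prop := Derivation {
  der_hol : forall F, holomorphic_on U F -> holomorphic_on U (L F);
  der_eq : forall F G, (forall x, U x -> F x = G x) -> forall x, U x -> L F x = L G x;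
  deriv_add : forall F G, holomorphic_on U F -> holomorphic_on U G ->
    forall x, U x -> L (fun x => F x + G x) x = L F x + L G x;
  deriv_mul : forall F G, holomorphic_on U F -> holomorphic_on U G ->
    forall x, U x -> L (fun x => F x * G x) x = L F x * G x + F x * L G x }.

Variables (U : set V) (L : (V -> C) -> V -> C).
Hypothesis dL : derivation U L.

Lemma der_iter_hol n F : holomorphic_on U F -> holomorphic_on U (iter n L F).
Proof. by move=> hF; elim: n => //= n; exact: der_hol. Qed.

Lemma der_iter_eq n F G : (forall x, U x -> F x = G x) ->
  forall x, U x -> iter n L F x = iter n L G x.
Proof. by move=> FG; elim: n => //= n IH; exact: der_eq. Qed.

Lemma hol_add F G : holomorphic_on U F -> holomorphic_on U G ->
  holomorphic_on U (fun x => F x + G x).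
Proof. by move=> hF hG x Ux; apply: dD_; [exact: hF|exact: hG]. Qed.

Lemma hol_mul F G : holomorphic_on U F -> holomorphic_on U G ->
  holomorphic_on U (fun x => F x * G x).
Proof. by move=> hF hG x Ux; apply: dM_; [exact: hF|exact: hG]. Qed.

Lemma der_iter_add n F G : holomorphic_on U F -> holomorphic_on U G ->
  forall x, U x -> iter n L (fun x => F x + G x) x = iter n L F x + iter n L G x.
Proof.
move=> hF hG; elim: n => //= n IH x Ux.
by rewrite (der_eq dL IH) // (deriv_add dL) //; exact: der_iter_hol.
Qed.

Lemma der_leibniz n F G : holomorphic_on U F -> holomorphic_on U G ->
  forall x, U x -> iter n L (fun x => F x * G x) x =
    \sum_(j < n.+1) 'C(n, j)%:R * iter j L F x * iter (n - j) L G x.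
Proof.
elim: n F G => [|n IH] F G hF hG x Ux.
  by rewrite big_ord_recl big_ord0 /= addr0 bin0 mul1r.
rewrite iterSr (der_iter_eq _ (deriv_mul dL hF hG)) //.
have hLF := der_hol dL hF; have hLG := der_hol dL hG.
rewrite (der_iter_add n (hol_mul hLF hG) (hol_mul hF hLG)) // !IH //.
rewrite big_ord_recr /= [X in _ + X = _]big_ord_recl /= [RHS]big_ord_recl /=.
rewrite [X in _ = _ + X]big_ord_recr /=.
rewrite !subn0 !bin0 !mul1r -!iterSr !iterS -iterS !binn !mul1r !subnn.
have E : \sum_(i < n) 'C(n.+1, bump 0 i)%:R * iter (bump 0 i) L F x * iter (n.+1 - bump 0 i) L G x =
  \sum_(i < n) 'C(n, i)%:R * iter i L (L F) x * iter (n - i) L G x +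
  \sum_(i < n) 'C(n, bump 0 i)%:R * iter (bump 0 i) L F x * iter (n - bump 0 i) L (L G) x.
  rewrite -big_split /=; apply: eq_bigr => i _.
  rewrite /bump /= add1n binS natrD subSS -!iterSr.
  have -> : iter (n - i.+1).+1 L G x = iter (n - i) L G x by rewrite subnSK.
  by rewrite !mulrDl addrC.
rewrite E; ring.
Qed.

End Leibniz.

(** * Series dominated by a geometric series of ratio 1/2 *)

Section Sums.
Variable R : realType.
Local Notation C := (Cx R).

(** The sum is total, with default value 0 when the partial sums have no limit. *)
Definition csum (u : nat -> C) : C :=
  xget 0 [set l | forall e : R, 0 < e -> exists N, forall n, (N <= n)%N ->
    nrm (\sum_(i < n) u i - l) <= e].

Lemma half_pow_small (K e : R) : 0 < e -> exists N, forall n, (N <= n)%N ->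
  K * 2^-1 ^+ n <= e.
Proof.
move=> e0; have K0 : 0 < `|K| + 1 by have := normr_ge0 K; lra.
have [N hN] := @geomP R 2^-1 (e / (`|K| + 1)) ltac:(lra) (divr_gt0 e0 K0).
exists N => n /hN; rewrite ltr_pdivlMr // mulrC => h; apply: le_trans (ltW h).
by rewrite ler_wpM2r ?exprn_ge0 ?invr_ge0 //; have := ler_norm K; lra.
Qed.

Lemma geo_tail (u : nat -> C) (K : R) : (forall n, nrm (u n) <= K * 2^-1 ^+ n) ->
  forall n k, nrm (\sum_(i < n + k) u i - \sum_(i < n) u i) <=
    2 * K * 2^-1 ^+ n - 2 * K * 2^-1 ^+ (n + k).
Proof.
move=> uK n; elim=> [|k IH]; first by rewrite addn0 !subrr nrm0.
rewrite addnS big_ord_recr /=.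
have -> : 2 * K * 2^-1 ^+ (n + k).+1 = K * 2^-1 ^+ (n + k) by rewrite exprS; field.
have := uK (n + k)%N.
set A := \sum_(i < n + k) u i; set B := \sum_(i < n) u i in IH *.
have := nrmD (A - B) (u (n + k)%N); rewrite addrAC; lra.
Qed.

Lemma csumP (u : nat -> C) (K : R) : (forall n, nrm (u n) <= K * 2^-1 ^+ n) ->
  forall n, nrm (\sum_(i < n) u i - csum u) <= 2 * K * 2^-1 ^+ n.
Proof.
move=> uK; have K0 : 0 <= K.
  by have := uK 0%N; rewrite expr0 mulr1; apply: le_trans; exact: nrm_ge0.
have p0 n : 0 <= 2^-1 ^+ n :> R by rewrite exprn_ge0 ?invr_ge0.
have [l hl] : exists l : C, forall n, nrm (\sum_(i < n) u i - l) <= 2 * K * 2^-1 ^+ n.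
  apply: complete_seq; first by move=> e; exact: half_pow_small.
  have sym m n : (m <= n)%N -> nrm (\sum_(i < m) u i - \sum_(i < n) u i) <=
      2 * K * 2^-1 ^+ m + 2 * K * 2^-1 ^+ n.
    move=> mn; rewrite nrmB -(subnKC mn).
    have := geo_tail uK m (n - m).
    by have := mulr_ge0 K0 (p0 (m + (n - m))%N); lra.
  move=> m n; have [mn|/ltnW mn] := leqP m n; first exact: sym.
  by rewrite nrmB [2 * K * _ + _]addrC; exact: sym.
have Pl : forall e : R, 0 < e -> exists N, forall n, (N <= n)%N ->
    nrm (\sum_(i < n) u i - l) <= e.
  move=> e e0; have [N hN] := half_pow_small (2 * K) e0.
  by exists N => n /hN; exact: le_trans.
have Pc := @xgetI _ 0 [set l | forall e : R, 0 < e -> exists N, forall n, (N <= n)%N ->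
    nrm (\sum_(i < n) u i - l) <= e] l Pl.
suff -> : csum u = l by [].
apply/eqP; rewrite -subr_eq0; apply/eqP/nrm0_eq0/eqP; rewrite eq_le nrm_ge0 andbT.
apply/ler_addgt0Pr => e e0; rewrite add0r.
have [N1 h1] := Pc (e / 2) ltac:(lra); have [N2 h2] := Pl (e / 2) ltac:(lra).
have := nrm_triB (csum u) (\sum_(i < maxn N1 N2) u i) l.
have := h1 (maxn N1 N2) (leq_maxl _ _); have := h2 (maxn N1 N2) (leq_maxr _ _).
by have := nrmB (csum u) (\sum_(i < maxn N1 N2) u i); rewrite -/(csum u); lra.
Qed.

Lemma csum_unique (u : nat -> C) (K : R) (l : C) :
  (forall n, nrm (u n) <= K * 2^-1 ^+ n) ->
  (forall e : R, 0 < e -> exists N, forall n, (N <= n)%N ->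
    nrm (\sum_(i < n) u i - l) <= e) -> csum u = l.
Proof.
move=> uK ul; apply/eqP; rewrite -subr_eq0; apply/eqP/nrm0_eq0/eqP; rewrite eq_le nrm_ge0 andbT.
apply/ler_addgt0Pr => e e0; rewrite add0r.
have [N1 h1] := half_pow_small (2 * K) (e := e / 2) ltac:(lra).
have [N2 h2] := ul (e / 2) ltac:(lra).
have := nrm_triB (csum u) (\sum_(i < maxn N1 N2) u i) l.
have := h1 (maxn N1 N2) (leq_maxl _ _); have := h2 (maxn N1 N2) (leq_maxr _ _).
have := csumP uK (maxn N1 N2).
by have := nrmB (csum u) (\sum_(i < maxn N1 N2) u i); lra.
Qed.

Lemma csum_fin (u : nat -> C) (m : nat) : (forall n, (m <= n)%N -> u n = 0) ->
  csum u = \sum_(i < m) u i.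
Proof.
move=> u0; pose K := \sum_(i < m) nrm (u i) * 2 ^+ i.
apply: (@csum_unique _ K) => [n|e e0].
  have [mn|nm] := leqP m n.
    rewrite u0 // nrm0 mulr_ge0 ?exprn_ge0 ?invr_ge0 //.
    by apply: sumr_ge0 => i _; rewrite mulr_ge0 ?exprn_ge0 ?nrm_ge0.
  rewrite exprVn -ler_pdivrMr ?invr_gt0 ?exprn_gt0 // invrK.
  rewrite /K (bigD1 (Ordinal nm)) //= lerDl.
  by apply: sumr_ge0 => i _; rewrite mulr_ge0 ?exprn_ge0 ?nrm_ge0.
exists m => n mn; rewrite -(subnKC mn) big_split_ord /=.
rewrite [X in _ + X - _]big1 ?addr0 ?subrr ?nrm0 ?(ltW e0) // => i _.
by apply: u0; rewrite leq_addr.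
Qed.

Lemma csum_nrm (u : nat -> C) (K : R) : (forall n, nrm (u n) <= K * 2^-1 ^+ n) ->
  nrm (csum u) <= 2 * K.
Proof.
by move=> /csumP /(_ 0%N); rewrite big_ord0 sub0r nrmN expr0 mulr1.
Qed.

Lemma csumD (u v : nat -> C) (K K' : R) : (forall n, nrm (u n) <= K * 2^-1 ^+ n) ->
  (forall n, nrm (v n) <= K' * 2^-1 ^+ n) ->
  csum (fun n => u n + v n) = csum u + csum v.
Proof.
move=> uK vK; apply: (@csum_unique _ (K + K')) => [n|e e0].
  by rewrite mulrDl; apply: (le_trans (nrmD _ _)); exact: lerD.
have [N1 h1] := half_pow_small (2 * K) (e := e / 2) ltac:(lra).
have [N2 h2] := half_pow_small (2 * K') (e := e / 2) ltac:(lra).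
exists (maxn N1 N2) => n; rewrite geq_max => /andP[n1 n2].
rewrite big_split /= opprD addrACA; apply: (le_trans (nrmD _ _)).
have := h1 n n1; have := h2 n n2; have := csumP uK n; have := csumP vK n; lra.
Qed.

Lemma csumZ (u : nat -> C) (K : R) (c : C) : (forall n, nrm (u n) <= K * 2^-1 ^+ n) ->
  csum (fun n => c * u n) = c * csum u.
Proof.
move=> uK; have c0 := nrm_ge0 c.
apply: (@csum_unique _ (nrm c * K)) => [n|e e0].
  by rewrite nrmM -mulrA ler_wpM2l.
have [N hN] := half_pow_small (nrm c * (2 * K)) e0.
exists N => n /hN h; rewrite -mulr_sumr -mulrBr nrmM; apply: le_trans h.
by rewrite -mulrA ler_wpM2l //; exact: csumP.
Qed.

Lemma csum_head (u : nat -> C) (K : R) : (forall n, nrm (u n) <= K * 2^-1 ^+ n) ->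
  csum u = u 0%N + csum (fun n => u n.+1).
Proof.
move=> uK; apply: (csum_unique uK) => e e0.
have uS n : nrm (u n.+1) <= K / 2 * 2^-1 ^+ n.
  by apply: (le_trans (uK n.+1)); rewrite exprS mulrA.
have [N hN] := half_pow_small (2 * (K / 2)) e0.
exists N.+1 => -[//|n]; rewrite ltnS => /hN; apply: le_trans.
by rewrite big_ord_recl /= opprD addrACA subrr add0r; exact: csumP.
Qed.

Variable V : normedModType C.

(** This is [weierstrass] for partial sums. The bound on the derivatives of the terms is returned as
    well, so that the differentiated series can again be handled by the lemmas on [csum]. *)
Lemma csum_diff (T : nat -> V -> C) (p : V) (r K : R) : 0 < r ->
  (forall n x, nrm (x - p) < r -> differentiable (T n) x) ->
  (forall n x, nrm (x - p) < r -> nrm (T n x) <= K * 2^-1 ^+ n) ->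
  differentiable (fun x => csum (fun n => T n x)) p /\
  forall v, (forall n, nrm ('D_v (T n) p) <= 6 * K / r * nrm v * 2^-1 ^+ n) /\
    'D_v (fun x => csum (fun n => T n x)) p = csum (fun n => 'D_v (T n) p).
Proof.
move=> r0 dT TK.
have pr : nrm (p - p) < r by rewrite subrr nrm0.
have K0 : 0 <= K.
  by have := TK 0%N p pr; rewrite expr0 mulr1; apply: le_trans; exact: nrm_ge0.
have p0 n : (0 <= 2^-1 ^+ n :> R) && (2^-1 ^+ n <= 1 :> R).
  by rewrite exprn_ge0 ?invr_ge0 //= exprn_ile1 //; lra.
pose F n x := \sum_(i < n) T i x.
have dF n x : nrm (x - p) < r -> differentiable (F n) x.
  by move=> xr; apply: dsum_ => i _; exact: dT.
have Fe n x : nrm (x - p) < r -> nrm (F n x - csum (fun n => T n x)) <= 2 * K * 2^-1 ^+ n.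
  by move=> xr; apply: csumP => m; exact: TK.
have FM n x : nrm (x - p) < r -> nrm (F n x) <= 4 * K.
  move=> xr; have := Fe n x xr; have := csum_nrm (fun m => TK m x xr).
  have := nrm_sub (F n x) (csum (fun n => T n x)).
  by have /andP[a1 a2] := p0 n; nra.
have [dS DS] := weierstrass r0 dF FM Fe (fun e => half_pow_small (2 * K) (e := e)).
split=> // v.
have Tv n : nrm ('D_v (T n) p) <= 6 * K / r * nrm v * 2^-1 ^+ n.
  have h := @cauchy_est R V (T n) p v r (K * 2^-1 ^+ n) r0 (dT n) (TK n).
  apply: (le_trans h).
  by rewrite le_eqVlt; apply/orP; left; apply/eqP; field; rewrite gt_eqF.
split=> //; apply/esym/(csum_unique Tv) => e e0.
have [N hN] := half_pow_small (6 * (2 * K) / r * nrm v) e0.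
exists N => n /hN; apply: le_trans.
have -> : \sum_(i < n) 'D_v (T i) p = 'D_v (F n) p.
  rewrite (_ : F n = \sum_(i < n) T i).
    by rewrite derive_sum // => i; apply: diff_derivable; exact: dT.
  by apply/funext => x; rewrite fct_sumE.
apply: (le_trans (DS n v)).
by rewrite le_eqVlt; apply/orP; left; apply/eqP; field; rewrite gt_eqF.
Qed.

End Sums.

(** * Growth of solutions *)

Section NrmAdd.
Variable R : realType.
Variable V : normedModType (Cx R).

Lemma nrm_lt_add (x y : V) (e : R) : nrm (x - y) < e -> nrm x < nrm y + e.
Proof. by have := nrm_sub x y; lra. Qed.

Lemma nrm_le_add (x y : V) (e : R) : nrm (x - y) <= e -> nrm x <= nrm y + e.
Proof. by have := nrm_sub x y; lra. Qed.

Lemma nrm_sub_lt (x y z : V) (e e' : R) :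
  nrm (x - y) < e -> nrm (y - z) < e' -> nrm (x - z) < e + e'.
Proof. by have := nrm_triB x y z; lra. Qed.

Lemma nrm_sub_le (x y z : V) (e e' : R) :
  nrm (x - y) < e -> nrm (y - z) <= e' -> nrm (x - z) < e + e'.
Proof. by have := nrm_triB x y z; lra. Qed.

End NrmAdd.

Section Nagumo.
Variable R : realType.
Local Notation C := (Cx R).

Lemma pow_fact_bound n : n%:R ^+ n <= expR 1 ^+ n * n`!%:R :> R.
Proof.
elim: n => [|n IH]; first by rewrite !expr0 mul1r.
case: n IH => [|n] IH.
  by rewrite !expr1 (_ : 1`!%:R = 1) // mulr1; apply: le_trans (expR_ge1Dx 1); lra.
have n0 : 0 < n.+1%:R :> R by [].
have h : (n.+2%:R / n.+1%:R) ^+ n.+1 <= expR 1 :> R.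
  have -> : n.+2%:R / n.+1%:R = 1 + n.+1%:R^-1 :> R.
    by rewrite -natr1 mulrDl divff ?gt_eqF // mul1r.
  apply: (@le_trans _ _ (expR (n.+1%:R^-1) ^+ n.+1)).
    rewrite lerXn2r ?nnegrE ?expR_ge0 ?addr_ge0 ?invr_ge0 //; exact: expR_ge1Dx.
  by rewrite -expRM_natl mulfV ?gt_eqF.
rewrite exprS [expR 1 ^+ n.+2]exprS factS natrM.
have -> : n.+2%:R ^+ n.+1 = (n.+2%:R / n.+1%:R) ^+ n.+1 * n.+1%:R ^+ n.+1 :> R.
  by rewrite -exprMn divfK ?gt_eqF.
have -> : expR 1 * expR 1 ^+ n.+1 * (n.+2%:R * n.+1`!%:R) =
  n.+2%:R * (expR 1 * (expR 1 ^+ n.+1 * n.+1`!%:R)) :> R by ring.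
rewrite ler_wpM2l //; apply: ler_pM => //.
Qed.

Variable V : normedModType C.

(** Each application of the first-order operator costs [A / s] on a loss of radius [s]. Sharing [r]
    equally among the [n] applications gives (A n / r)^n, and n^n <= e^n n! turns this into
    factorial growth. [L] is abstract because this serves for one derivative, for [Dop] and for
    [Vop]. *)
Lemma nagumo (L : (V -> C) -> V -> C) (F : V -> C) (p : V) (r A M : R) n :
  0 < r -> 0 <= A ->
  (forall G s, s <= r -> (forall x, nrm (x - p) < s -> differentiable G x) ->
     forall x, nrm (x - p) < s -> differentiable (L G) x) ->
  (forall G x s B, 0 < s -> (forall y, nrm (y - x) < s -> nrm (y - p) < r) ->
     (forall y, nrm (y - x) < s -> differentiable G y) ->
     (forall y, nrm (y - x) < s -> nrm (G y) <= B) -> nrm (L G x) <= A * B / s) ->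
  (forall x, nrm (x - p) < r -> differentiable F x) ->
  (forall x, nrm (x - p) < r -> nrm (F x) <= M) ->
  nrm (iter n L F p) <= n`!%:R * (A * expR 1 / r) ^+ n * M.
Proof.
move=> r0 A0 Lhol Lest dF FM.
have M0 : 0 <= M by apply: le_trans (FM p _); rewrite ?subrr ?nrm0 ?nrm_ge0.
case: n => [|n]; first by rewrite /= fact0 expr0 !mul1r; apply: FM; rewrite subrr nrm0.
set N := n.+1; have N0 : 0 < N%:R :> R by [].
pose e := r / N%:R; have e0 : 0 < e by exact: divr_gt0.
have hol k x : nrm (x - p) < r -> differentiable (iter k L F) x.
  by elim: k x => [|k IH] x xr /=; [exact: dF|exact: (Lhol _ r)].
have key k : (k <= n)%N -> forall x, nrm (x - p) < r - k%:R * e ->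
    nrm (iter k L F x) <= (A / e) ^+ k * M.
  elim: k => [|k IH] kn x xr.
    by rewrite expr0 mul1r; apply: FM; move: xr; lra.
  have kl : k.+1%:R * e = k%:R * e + e by rewrite -natr1; ring.
  have ke : 0 <= k%:R * e by rewrite mulr_ge0 // ltW.
  have sub y : nrm (y - x) < e -> nrm (y - p) < r - k%:R * e.
    by move=> ye; have := nrm_triB y x p; lra.
  rewrite /= exprS.
  have -> : A / e * (A / e) ^+ k * M = A * ((A / e) ^+ k * M) / e by ring.
  apply: Lest => //.
  - by move=> y /sub; lra.
  - by move=> y /sub yp; apply: hol; lra.
  - by move=> y /sub; apply: IH; exact: ltnW.
have pe : r - n%:R * e = e.
  by rewrite /e /N -natr1; field; rewrite natr1 gt_eqF.
have h : nrm (iter N L F p) <= (A / e) ^+ N * M.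
  rewrite /= exprS.
  have -> : A / e * (A / e) ^+ n * M = A * ((A / e) ^+ n * M) / e by ring.
  have er : e <= r by rewrite /e ler_pdivrMr // ler_peMr ?ler1n // ltW.
  apply: Lest => //.
  - by move=> y ye; lra.
  - by move=> y ye; apply: hol; lra.
  - by move=> y ye; apply: key; rewrite // pe.
apply: (le_trans h); rewrite ler_wpM2r //.
have -> : (A / e) ^+ N = (A / r) ^+ N * N%:R ^+ N.
  by rewrite -exprMn; congr (_ ^+ _); rewrite /e; field; rewrite !gt_eqF.
have -> : N`!%:R * (A * expR 1 / r) ^+ N = (A / r) ^+ N * (expR 1 ^+ N * N`!%:R).
  by rewrite [in RHS]mulrA -exprMn mulrC; congr (_ ^+ _ * _); ring.
rewrite ler_wpM2l ?pow_fact_bound //.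
by apply: exprn_ge0; apply: divr_ge0 => //; exact: ltW.
Qed.

End Nagumo.

Section Growth.
Variable R : realType.
Local Notation C := (Cx R).
Local Notation V2 := (C * C)%type.

Lemma bounded_cball2 (F : V2 -> C) (p : V2) (r : R) :
  (forall x, nrm (x - p) <= r -> differentiable F x) ->
  exists2 S : R, 0 < S & forall x, nrm (x - p) <= r -> nrm (F x) <= S.
Proof.
move=> dF.
pose B := [set z : C | nrm (z - p.1) <= r] `*` [set z : C | nrm (z - p.2) <= r].
have BE x : B x <-> nrm (x - p) <= r by rewrite nrm_pairle.
have [n hn] : exists n, forall x, B x -> nrm (F x) <= n%:R.
  apply: compact_unif; first by apply: compact_setX; exact: compact_cdisc.
    by move=> x m n mn h; apply: (le_trans h); rewrite ler_nat.
  move=> x /BE xr; exists (Num.truncn (nrm (F x) + 1)).+1.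
  have [d d0 hd] := diff_cont (dF x xr) (@ltr01 R).
  apply/nbhs_nrm; exists d => // q qd.
  by apply: ltW; apply: lt_trans (truncnS_gt _); exact: nrm_lt_add (hd q qd).
exists (n%:R + 1) => [|l lr]; first by have := ler0n R n; lra.
by apply: (le_trans (hn l (proj2 (BE l) lr))); rewrite lerDl.
Qed.

Lemma nrm_e1 : nrm ((1, 0) : V2) = 1.
Proof. by rewrite nrm_pair /= nrm1 nrm0; apply/max_l; lra. Qed.

Lemma nrm_e2 : nrm ((0, 1) : V2) = 1.
Proof. by rewrite nrm_pair /= nrm1 nrm0; apply/max_r; lra. Qed.

Section Growth1.
Variables (d : nat) (a : V2 -> C) (a_ : nat -> V2 -> C) (X : V2 -> C).
Hypothesis d2 : (2 <= d)%N.

Definition pde_at (q : V2) :=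
  dt X q = a q * dz X q + \sum_(i < d.+1) a_ i q * X q ^+ i.

(** Were [X] at most [4 * nrm (X q)] on the ball, its first derivatives at [q] would be linear in
    [nrm (X q)] by Cauchy, while the equation equates them with a polynomial of degree [d >= 2]
    whose leading coefficient is at least [eta]. This fails once [nrm (X q)] is large. *)
Lemma growth_step q (s A eta : R) : 0 < s -> s <= 1 -> 1 <= A -> 0 < eta ->
  (forall x, nrm (x - q) < s -> differentiable X x) ->
  pde_at q -> nrm (a q) <= A -> (forall i, (i <= d)%N -> nrm (a_ i q) <= A) ->
  eta <= nrm (a_ d q) ->
  20 * 20 * d%:R * A < eta * s * nrm (X q) ->
  exists2 x, nrm (x - q) < s & 4 * nrm (X q) < nrm (X x).
Proof.
move=> s0 s1 A1 eta0 dX pq aA a_A ade big; apply: contrapT => no.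
have XM x : nrm (x - q) < s -> nrm (X x) <= 4 * nrm (X q).
  by move=> xs; rewrite leNgt; apply/negP => h; apply: no; exists x.
set m := nrm (X q) in big XM *.
have Xt : nrm (dt X q) <= 6 * (4 * m) / s.
  by have := cauchy_est ((1, 0) : V2) s0 dX XM; rewrite nrm_e1 mulr1.
have Xz : nrm (dz X q) <= 6 * (4 * m) / s.
  by have := cauchy_est ((0, 1) : V2) s0 dX XM; rewrite nrm_e2 mulr1.
have d2' : 2 <= d%:R :> R by rewrite ler_nat.
have etaA : eta <= A by apply: le_trans ade (a_A d (leqnn d)).
have m0 : 0 <= m := nrm_ge0 _.
have em : 20 * 20 * d%:R * A < eta * m.
  by apply: (lt_le_trans big); rewrite ler_wpM2r // ler_piMr // ltW.
have dA : 2 * A <= d%:R * A by rewrite ler_wpM2r //; xlra.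
have m1 : 1 <= m.
  rewrite leNgt; apply/negP => ml.
  have e1 : eta * m <= A * m by rewrite ler_wpM2r.
  have e2 : A * m <= A * 1 by rewrite ler_wpM2l //; xlra.
  xlra.
have hd : nrm (a_ d q * X q ^+ d) <=
    6 * (4 * m) / s + A * (6 * (4 * m) / s) + d%:R * (A * m ^+ d.-1).
  have -> : a_ d q * X q ^+ d = dt X q - a q * dz X q - \sum_(i < d) a_ i q * X q ^+ i.
    by rewrite pq big_ord_recr /=; ring.
  apply: (le_trans (nrmD _ _)); rewrite nrmN; apply: lerD.
    apply: (le_trans (nrmD _ _)); rewrite nrmN; apply: lerD; first exact: Xt.
    by rewrite nrmM; apply: ler_pM; rewrite ?nrm_ge0.
  apply: (le_trans (nrm_sum _ _ _)).
  apply: (@le_trans _ _ (\sum_(i < d) A * m ^+ d.-1)).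
    apply: ler_sum => i _; rewrite nrmM nrmX; apply: ler_pM; rewrite ?nrm_ge0 ?exprn_ge0 //.
      by apply: a_A; rewrite ltnW.
    by apply: ler_weXn2l => //; rewrite -ltnS prednK ?(ltn_ord i) // (leq_trans _ d2).
  by rewrite sumr_const card_ord mulr_natl.
move: hd; rewrite nrmM nrmX -/m.
have -> : m ^+ d = m * m ^+ d.-1 by rewrite -exprS prednK // (leq_trans _ d2).
have : m <= m ^+ d.-1.
  by rewrite -{1}[m]expr1; apply: ler_weXn2l => //; case: (d) d2 => [|[]].
set P := m ^+ d.-1 => mP hd.
have P0 : 0 <= P by xlra.
have h1 : eta * (m * P) <= nrm (a_ d q) * (m * P) by rewrite ler_wpM2r // mulr_ge0.
have emP := ler_wpM2r P0 (ltW em).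
have dAP : 0 <= d%:R * A * P by rewrite !mulr_ge0 //; xlra.
move: hd; set T := 6 * (4 * m) / s => hd.
have T0 : 0 <= T by rewrite divr_ge0 ?(ltW s0) //; xlra.
have TA : T <= A * T by rewrite ler_peMl.
have h3 : eta * (m * P) / 2 <= 2 * (A * T) by xlra.
have h4 : eta * (m * P) / 2 * s <= 2 * A * (6 * (4 * m)).
  have -> : 2 * A * (6 * (4 * m)) = 2 * (A * T) * s by rewrite /T; field; xlra.
  by rewrite ler_wpM2r // ltW.
have h5 : eta * s * m * m <= eta * s * m * P.
  by rewrite ler_wpM2l // !mulr_ge0 // ltW.
have b2 : 20 * 20 * d%:R * A * m < eta * s * m * m by rewrite ltr_pM2r //; xlra.
have dAm : 2 * A * m <= d%:R * A * m by rewrite ler_wpM2r.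
have Am : 0 < A * m by rewrite mulr_gt0 //; xlra.
xlra.
Qed.

(** If [X] is too large at [p], [growth_step] can be repeated with radii [del j], halved each time:
    the values grow by 4 while the condition of the step tightens only by 2. The points remain
    within [s / 2] of [p], where [X] is bounded by compactness. The extra factor 4 in the constant
    comes from the first radius [s / 4]. *)
Lemma growth p (s A eta : R) : 0 < s -> s <= 1 -> 1 <= A -> 0 < eta ->
  (forall x, nrm (x - p) < s -> [/\ differentiable X x, pde_at x, nrm (a x) <= A,
     forall i, (i <= d)%N -> nrm (a_ i x) <= A & eta <= nrm (a_ d x)]) ->
  nrm (X p) <= 20 * 20 * 4 * d%:R * A / (eta * s).
Proof.
move=> s0 s1 A1 eta0 hp; rewrite leNgt; apply/negP => big.
set K := 20 * 20 * 4 * d%:R * A / (eta * s) in big.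
pose del j := s * 2^-1 ^+ j.+2.
have del0 j : 0 < del j by rewrite mulr_gt0 // exprn_gt0.
pose ok j q := nrm (q - p) <= s / 2 - s * 2^-1 ^+ j.+1 /\ K * 4 ^+ j < nrm (X q).
have d2' : 2 <= d%:R :> R by rewrite ler_nat.
have es : 0 < eta * s by exact: mulr_gt0.
have K0 : 0 < K by rewrite /K divr_gt0 // !mulr_gt0 //; xlra.
have step jq : exists q', ok jq.1 jq.2 -> ok jq.1.+1 q'.
  case: jq => j q /=; case: (pselect (ok j q)) => [[qp qX]|no]; last by exists q.
  have dj : s * 2^-1 ^+ j.+1 = 2 * del j by rewrite /del [2^-1 ^+ j.+2]exprS; field.
  have dj0 := del0 j.
  have sub x : nrm (x - q) < del j -> nrm (x - p) < s.
    by move=> xq; apply: lt_le_trans (nrm_sub_le xq qp) _; xlra.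
  have dj1 : del j <= 1.
    apply: le_trans s1; rewrite /del ler_piMr ?(ltW s0) // exprn_ile1 //; xlra.
  have qs : nrm (q - p) < s by xlra.
  have [dXq pq aq a_q adq] := hp q qs.
  have [||x xq xX] := @growth_step q (del j) A eta dj0 dj1 A1 eta0 _ pq aq a_q adq.
  - by move=> x /sub /hp[].
  - apply: (@le_lt_trans _ _ (eta * del j * (K * 4 ^+ j))); last first.
      by rewrite ltr_pM2l // mulr_gt0.
    have -> : eta * del j * (K * 4 ^+ j) = 20 * 20 * d%:R * A * 2 ^+ j.
      have -> : 4 ^+ j = 2 ^+ j * 2 ^+ j :> R by rewrite -exprMn; congr (_ ^+ _); ring.
      have p2 : 2 ^+ j != 0 :> R by rewrite expf_neq0.
      by rewrite /K /del !exprS exprVn; field; rewrite p2 !gt_eqF.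
    by rewrite ler_peMr ?exprn_ege1 ?mulr_ge0 //; xlra.
  exists x => _; split.
    have dS : s * 2^-1 ^+ j.+2 = del j by [].
    by apply: ltW; apply: lt_le_trans (nrm_sub_le xq qp) _; rewrite dS; xlra.
  by rewrite exprS; xlra.
have [F hF] := choice step.
pose u := fix u j := if j is j'.+1 then F (j', u j') else p.
have uok j : ok j (u j).
  elim: j => [|j IH]; last exact: (hF (j, u j)).
  by split; rewrite ?expr0 ?mulr1 // expr1 subrr subrr nrm0.
have [S S0 hS] : exists2 S : R, 0 < S & forall x, nrm (x - p) <= s / 2 -> nrm (X x) <= S.
  apply: bounded_cball2 => x xs.
  have xs' : nrm (x - p) < s by apply: le_lt_trans xs _; xlra.
  by have [] := hp x xs'.
have [n hn] := half_pow_small S (e := K / 2) ltac:(xlra).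
have [up uX] := uok n.
have e2 : 0 <= s * 2^-1 ^+ n.+1 by rewrite mulr_ge0 ?exprn_ge0 // ltW.
have us : nrm (u n - p) <= s / 2 by apply: (le_trans up); rewrite lerBlDr lerDl.
have XS := hS (u n) us.
have := hn n (leqnn n); rewrite exprVn ler_pdivrMr ?exprn_gt0 //.
have : K * 2 ^+ n <= K * 4 ^+ n.
  by rewrite ler_wpM2l ?(ltW K0) // lerXn2r ?nnegrE //; xlra.
have P21 : 1 <= 2 ^+ n :> R by rewrite exprn_ege1 ?ler1n.
move=> PP SP; have KP := lt_le_trans uX XS.
have KK : K * 1 <= K * 2 ^+ n by rewrite ler_wpM2l // ltW.
by move: P21 PP SP KP KK; move: (2 ^+ n) (4 ^+ n) => P2 P4 P21 PP SP KP KK; xlra.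
Qed.

End Growth1.
End Growth.

(** * Power series in w *)

Section Projections.
Variable R : realType.
Local Notation C := (Cx R).
Variables V W : normedModType C.

Lemma nrm_fst_le (v : V * W) : nrm v.1 <= nrm v.
Proof. by have [] := proj1 (nrm_pairle v (nrm v)) (lexx _). Qed.

Lemma nrm_snd_le (v : V * W) : nrm v.2 <= nrm v.
Proof. by have [] := proj1 (nrm_pairle v (nrm v)) (lexx _). Qed.

Lemma diff_fst (f : V -> C) (q : V * W) : differentiable f q.1 ->
  differentiable (fun q : V * W => f q.1) q /\
  forall v, 'D_v (fun q : V * W => f q.1) q = 'D_(v.1) f q.1.
Proof.
move=> df; have [K K0 hK] := diff_bound df.
have [h1 h2] : differentiable (fun q : V * W => f q.1) q /\
    forall v, 'd (fun q : V * W => f q.1) q v = 'd f (q.1) v.1.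
  apply: (diffI (L := fun v => 'd f (q.1) v.1) (K := K)) => [a u v|v|e e0].
  - by rewrite /= linearP.
  - by apply: (le_trans (hK _)); rewrite ler_wpM2l ?nrm_fst_le // ltW.
  have [d d0 hd] := diff_nrm df e0.
  exists d => // v vd; apply: le_trans (hd v.1 (le_lt_trans (nrm_fst_le v) vd)) _.
  by rewrite ler_wpM2l ?nrm_fst_le // ltW.
by split=> // v; rewrite (deriveE _ h1) h2 (deriveE _ df).
Qed.

Lemma diff_snd (f : W -> C) (q : V * W) : differentiable f q.2 ->
  differentiable (fun q : V * W => f q.2) q /\
  forall v, 'D_v (fun q : V * W => f q.2) q = 'D_(v.2) f q.2.
Proof.
move=> df; have [K K0 hK] := diff_bound df.
have [h1 h2] : differentiable (fun q : V * W => f q.2) q /\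
    forall v, 'd (fun q : V * W => f q.2) q v = 'd f (q.2) v.2.
  apply: (diffI (L := fun v => 'd f (q.2) v.2) (K := K)) => [a u v|v|e e0].
  - by rewrite /= linearP.
  - by apply: (le_trans (hK _)); rewrite ler_wpM2l ?nrm_snd_le // ltW.
  have [d d0 hd] := diff_nrm df e0.
  exists d => // v vd; apply: le_trans (hd v.2 (le_lt_trans (nrm_snd_le v) vd)) _.
  by rewrite ler_wpM2l ?nrm_snd_le // ltW.
by split=> // v; rewrite (deriveE _ h1) h2 (deriveE _ df).
Qed.

Lemma derive_mul (f g : V -> C) p v : differentiable f p -> differentiable g p ->
  'D_v (fun x => f x * g x) p = 'D_v f p * g p + f p * 'D_v g p.
Proof.
move=> df dg; have h : 'D_v (f * g) p = f p *: 'D_v g p + g p *: 'D_v f p.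
  by apply: deriveM; exact: diff_derivable.
have -> : (fun x => f x * g x) = f * g by [].
rewrite h addrC; congr (_ + _); exact: mulrC.
Qed.

Lemma derive_add (f g : V -> C) p v : differentiable f p -> differentiable g p ->
  'D_v (fun x => f x + g x) p = 'D_v f p + 'D_v g p.
Proof. by move=> df dg; apply: deriveD; exact: diff_derivable. Qed.

Lemma derive_near (f g : V -> C) p v (r : R) : 0 < r ->
  (forall x, nrm (x - p) < r -> f x = g x) -> 'D_v f p = 'D_v g p.
Proof.
move=> r0 fg; apply: near_eq_derive; apply/nbhs_nrm; exists r => // x; exact: fg.
Qed.

Lemma derive_const (a : C) (p v : V) : 'D_v (fun=> a) p = 0.
Proof. exact: derive_cst. Qed.

End Projections.

Section PowerSeries.
Variable R : realType.
Local Notation C := (Cx R).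
Local Notation V2 := (C * C)%type.
Local Notation V3 := (C * C * C)%type.

(** The coefficient [c n] stands for the n-th w-derivative at w = 0, whence the factorial. *)
Definition pterm (c : nat -> V2 -> C) (n : nat) (q : V3) : C :=
  c n q.1 * (q.2 ^+ n / n`!%:R).

Definition pser (c : nat -> V2 -> C) (q : V3) : C := csum (fun n => pterm c n q).

(* Under this locally uniform growth of the coefficients, [pser c] is holomorphic on
   [U] times the disc [2 |w| < rho]. *)
Definition adm (U : set V2) (rho : R) (c : nat -> V2 -> C) :=
  forall p, U p -> exists r : R, [/\ 0 < r, forall x, nrm (x - p) < r -> U x,
    forall n x, nrm (x - p) < r -> differentiable (c n) x &
    forall s, 0 < s -> s < rho -> exists M : R, forall n x, nrm (x - p) < r ->
      nrm (c n x) * s ^+ n <= M * n`!%:R].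

(** The shift costs a factor [n.+1], which is absorbed by comparing with the larger radius [s']:
    (n+1) q^n <= 1 / (1 - q), because (n+1) q^n is at most 1 + q + ... + q^n. *)
Lemma adm_shift U rho c : adm U rho c -> adm U rho (fun n => c n.+1).
Proof.
move=> hc p Up; have [r [r0 rU dc cM]] := hc p Up.
exists r; split=> // [n x|s s0 sr]; first exact: dc.
pose s' := (s + rho) / 2; have ss' : s < s' by rewrite /s'; lra.
have s'0 : 0 < s' by lra.
have [M hM] := cM s' s'0 ltac:(rewrite /s'; lra).
pose q := s / s'; have q0 : 0 <= q by rewrite divr_ge0 // ltW.
have q1 : q < 1 by rewrite ltr_pdivrMr // mul1r.
have qn n : n.+1%:R * q ^+ n <= (1 - q)^-1.
  rewrite -[leRHS]mul1r ler_pdivlMr; last by lra.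
  apply: (@le_trans _ _ (1 - q ^+ n.+1)); last by rewrite lerBlDr lerDl exprn_ge0.
  elim: n => [|n IH]; first by rewrite expr0 expr1; lra.
  have p0 : 0 <= q ^+ n by rewrite exprn_ge0.
  have : n.+1%:R * q ^+ n * (1 - q) * q <= (1 - q ^+ n.+1) * q by rewrite ler_wpM2r.
  have Pq : q ^+ n * q * (1 - q) <= 1 * (1 - q).
    rewrite ler_wpM2r ?subr_ge0 ?(ltW q1) // -exprSr exprn_ile1 //; exact: ltW.
  move: Pq IH p0; rewrite -[n.+2%:R]natr1 !exprS; move: (q ^+ n) (n.+1%:R) => P N.
  by move=> *; lra.
exists (M / s' * (1 - q)^-1) => n x xr.
have M0 : 0 <= M.
  have := hM 0%N x xr; rewrite expr0 mulr1 fact0 mulr1; apply: le_trans.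
  exact: nrm_ge0.
have sE : s ^+ n = q ^+ n * s' ^+ n by rewrite -exprMn divfK // gt_eqF.
have := hM n.+1 x xr.
rewrite exprS => h1.
have h2 : nrm (c n.+1 x) * s' ^+ n <= M / s' * n.+1`!%:R.
  rewrite mulrAC ler_pdivlMr // -mulrA [s' ^+ n * _]mulrC; exact: h1.
rewrite sE [q ^+ n * _]mulrC mulrA.
apply: (@le_trans _ _ (M / s' * n.+1`!%:R * q ^+ n)).
  by rewrite ler_wpM2r // exprn_ge0.
rewrite factS natrM.
have -> : M / s' * (n.+1%:R * n`!%:R) * q ^+ n = M / s' * (n.+1%:R * q ^+ n) * n`!%:R by ring.
rewrite ler_wpM2r // ler_wpM2l //.
by rewrite divr_ge0 // ltW.
Qed.

Lemma adm_derive U rho c v : adm U rho c -> adm U rho (fun n => 'D_v (c n)).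
Proof.
move=> hc p Up; have [r [r0 rU dc cM]] := hc p Up.
have r2 : 0 < r / 2 by lra.
have sub x y : nrm (x - p) < r / 2 -> nrm (y - x) < r / 2 -> nrm (y - p) < r.
  by move=> xp yx; have := nrm_sub_lt yx xp; rewrite -splitr.
exists (r / 2); split=> //.
- by move=> x xr; apply: rU; apply: lt_trans xr _; lra.
- move=> n x xr; apply: (@diff_derive _ _ (c n) x v _ r2) => y yx.
  by apply: dc; exact: sub yx.
move=> s s0 sr; have [M hM] := cM s s0 sr.
exists (6 * M / (r / 2) * nrm v) => n x xr.
have sn : 0 < s ^+ n by rewrite exprn_gt0.
have := @cauchy_est _ _ (c n) x v (r / 2) (M * n`!%:R / s ^+ n) r2
  (fun y yx => dc n y (sub x y xr yx)).
have hb y : nrm (y - x) < r / 2 -> nrm (c n y) <= M * n`!%:R / s ^+ n.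
  by move=> yx; rewrite ler_pdivlMr //; apply: hM; exact: sub yx.
move=> /(_ hb) h; rewrite -ler_pdivlMr //; apply: (le_trans h).
have -> // : forall a b c d : R, 6 * (M * a * b) * c * d = 6 * M * c * d * a * b.
by move=> a b c' d; ring.
Qed.

(** Asking for [2 * s < rho] rather than [s < rho] makes the terms decrease at ratio 1/2, the only
    ratio that [csum] deals with. *)
Lemma pterm_geo U rho c p (s : R) : adm U rho c -> U p -> 0 < s -> 2 * s < rho ->
  exists r K : R, [/\ 0 < r, forall x, nrm (x - p) < r -> U x,
    forall n x, nrm (x - p) < r -> differentiable (c n) x &
    forall n (q : V3), nrm (q.1 - p) < r -> nrm q.2 <= s ->
      nrm (pterm c n q) <= K * 2^-1 ^+ n].
Proof.
move=> hc Up s0 sr; have [r [r0 rU dc cM]] := hc p Up.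
have [M hM] := cM (2 * s) ltac:(lra) sr.
exists r, M; split=> // n q qp qs.
rewrite /pterm nrmM nrmM nrmX nrmV nrm_nat.
have n0 : 0 < n`!%:R :> R by rewrite ltr0n fact_gt0.
have h := hM n q.1 qp.
rewrite mulrA ler_pdivrMr //.
apply: (@le_trans _ _ (nrm (c n q.1) * s ^+ n)).
  rewrite ler_wpM2l ?nrm_ge0 // lerXn2r ?nnegrE ?nrm_ge0 //; exact: ltW.
have -> : s ^+ n = (2 * s) ^+ n * 2^-1 ^+ n.
  by rewrite -exprMn; congr (_ ^+ _); field.
rewrite mulrA [leRHS]mulrAC ler_wpM2r // exprn_ge0 //; lra.
Qed.

Lemma derive_pow_fact n (w : C) :
  'D_1 (fun w : C => w ^+ n.+1 / n.+1`!%:R) w = w ^+ n / n`!%:R.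
Proof.
rewrite derive_mul; last exact: dcst_; last by apply: dX_; exact: did_.
rewrite derive_const.
rewrite mulr0 addr0 (_ : 'D_1 _ w = n.+1%:R * w ^+ n); last first.
  by rewrite exp_derive /= [_ *: 1]mulr1.
rewrite factS natrM; field.
by rewrite nat1r !pnatr_eq0 -lt0n fact_gt0.
Qed.

Lemma pser_diff U rho c (q : V3) : adm U rho c -> U q.1 -> 2 * nrm q.2 < rho ->
  [/\ differentiable (pser c) q,
   dw3 (pser c) q = pser (fun n => c n.+1) q &
   forall v : V2, 'D_((v, 0) : V3) (pser c) q = pser (fun n => 'D_v (c n)) q].
Proof.
move=> hc Uq qr.
pose s := (nrm q.2 + rho / 2) / 2.
have s0 : 0 < s by rewrite /s; have := nrm_ge0 q.2; lra.
have sr : 2 * s < rho by rewrite /s; lra.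
have qs : nrm q.2 < s by rewrite /s; lra.
have [r [K [r0 rU dc cK]]] := pterm_geo hc Uq s0 sr.
pose r' := Num.min r (s - nrm q.2).
have r'0 : 0 < r' by rewrite lt_min r0 subr_gt0.
have inb (x : V3) : nrm (x - q) < r' -> nrm (x.1 - q.1) < r /\ nrm x.2 <= s.
  move=> /nrm_pairP[]; rewrite /r' !lt_min => /andP[h1 _] /andP[_ h2].
  split=> //; apply: ltW; have := nrm_lt_add h2; rewrite addrC subrK //.
have dT n (x : V3) : nrm (x - q) < r' -> differentiable (pterm c n) x.
  move=> /inb[xr _]; apply: dM_; first by have [] := diff_fst (q := x) (dc n _ xr).
  have dw : differentiable (fun w : C => w ^+ n / n`!%:R) x.2.
    by apply: dM_; [apply: dX_; exact: did_|exact: dcst_].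
  by have [] := diff_snd (q := x) dw.
have TK n (x : V3) : nrm (x - q) < r' -> nrm (pterm c n x) <= K * 2^-1 ^+ n.
  by move=> /inb[xr xs]; exact: cK.
have [dS DS] := csum_diff r'0 dT TK.
have qq : nrm (q.1 - q.1) < r by rewrite subrr nrm0.
have Tq n v : 'D_v (pterm c n) q =
   'D_(v.1) (c n) q.1 * (q.2 ^+ n / n`!%:R) + c n q.1 * 'D_(v.2) (fun w : C => w ^+ n / n`!%:R) q.2.
  have dw : differentiable (fun w : C => w ^+ n / n`!%:R) q.2.
    by apply: dM_; [apply: dX_; exact: did_|exact: dcst_].
  have [d1 e1] := diff_fst (q := q) (dc n _ qq).
  have [d2 e2] := diff_snd (q := q) dw.
  by rewrite -e1 -e2 -derive_mul.
split=> //.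
- have [b e] := DS ((0, 0, 1) : V3).
  rewrite /dw3 e (csum_head b) Tq /= !derive0 mul0r add0r.
  have -> : 'D_1 (fun w : C => w ^+ 0 / 0`!%:R) q.2 = 0.
    rewrite (_ : (fun _ => _) = fun=> 1); first exact: derive_const.
    by apply/funext => w; rewrite expr0 fact0 divr1.
  rewrite mulr0 add0r; congr csum; apply/funext => n.
  by rewrite Tq /= derive0 mul0r add0r derive_pow_fact.
move=> v; have [b e] := DS ((v, 0) : V3).
rewrite e; congr csum; apply/funext => n.
by rewrite Tq /= derive0 mulr0 addr0.
Qed.

Lemma pser0 c (p : V2) : pser c (p, 0) = c 0%N p.
Proof.
rewrite /pser (@csum_fin _ _ 1).
  by rewrite big_ord_recl big_ord0 addr0 /pterm /= expr0 fact0 divr1 mulr1.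
by case=> // n _; rewrite /pterm /= expr0n mul0r mulr0.
Qed.

Lemma pser_iter U rho c n (q : V3) : adm U rho c -> U q.1 -> 2 * nrm q.2 < rho ->
  iter n (@dw3 R) (pser c) q = pser (fun m => c (n + m)%N) q.
Proof.
have open_near (q' : V3) : adm U rho c -> U q'.1 -> 2 * nrm q'.2 < rho ->
    exists2 r : R, 0 < r & forall x, nrm (x - q') < r -> U x.1 /\ 2 * nrm x.2 < rho.
  move=> hc Uq qr; have [r [r0 rU _ _]] := hc _ Uq.
  exists (Num.min r ((rho - 2 * nrm q'.2) / 2)).
    by rewrite lt_min r0 /=; lra.
  move=> x /nrm_pairP[] /lt_min2[h1 _] /lt_min2[_ h2].
  split; first exact: rU.
  by have := nrm_lt_add (h2 : nrm (x.2 - q'.2) < _); xlra.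
elim: n q => [|n IH] q hc Uq qr.
  by rewrite /=; congr pser; apply/funext => m; rewrite add0n.
have [r r0 hr] := open_near q hc Uq qr.
rewrite iterS /dw3 (derive_near (g := pser (fun m => c (n + m)%N)) _ r0); last first.
  by move=> x /hr[Ux xr]; exact: IH.
have hn : adm U rho (fun m => c (n + m)%N).
  elim: n {IH} => [|n IHn]; first exact: hc.
  by have := adm_shift IHn; congr adm; apply/funext => m; rewrite addSnnS.
have [_ h _] := pser_diff hn Uq qr.
by rewrite -/(dw3 _ q) h; congr pser; apply/funext => m; rewrite addSnnS.
Qed.

Lemma pser_add U rho c c' (q : V3) : adm U rho c -> adm U rho c' -> U q.1 ->
  2 * nrm q.2 < rho -> pser (fun n x => c n x + c' n x) q = pser c q + pser c' q.
Proof.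
move=> hc hc' Uq qr.
pose s := (nrm q.2 + rho / 2) / 2.
have s0 : 0 < s by rewrite /s; have := nrm_ge0 q.2; lra.
have sr : 2 * s < rho by rewrite /s; lra.
have qs : nrm q.2 <= s by rewrite /s; lra.
have [r [K [r0 _ _ cK]]] := pterm_geo hc Uq s0 sr.
have [r' [K' [r'0 _ _ cK']]] := pterm_geo hc' Uq s0 sr.
rewrite /pser -(@csumD _ _ _ K K') => [|n|n].
- by congr csum; apply/funext => n; rewrite /pterm mulrDl.
- by apply: cK => //; rewrite subrr nrm0.
- by apply: cK' => //; rewrite subrr nrm0.
Qed.

Lemma pser_scale U rho c (k : V2 -> C) (q : V3) : adm U rho c -> U q.1 ->
  2 * nrm q.2 < rho -> pser (fun n x => k x * c n x) q = k q.1 * pser c q.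
Proof.
move=> hc Uq qr.
pose s := (nrm q.2 + rho / 2) / 2.
have s0 : 0 < s by rewrite /s; have := nrm_ge0 q.2; lra.
have sr : 2 * s < rho by rewrite /s; lra.
have qs : nrm q.2 <= s by rewrite /s; lra.
have [r [K [r0 _ _ cK]]] := pterm_geo hc Uq s0 sr.
rewrite /pser -(@csumZ _ _ K) => [|n].
- by congr csum; apply/funext => n; rewrite /pterm -!mulrA.
- by apply: cK => //; rewrite subrr nrm0.
Qed.

Lemma pser_bound U rho c (p : V2) (M s : R) (w : C) : adm U rho c -> U p ->
  0 < s -> (forall n, nrm (c n p) * s ^+ n <= M * n`!%:R) -> 2 * nrm w <= s ->
  nrm (pser c (p, w)) <= 2 * M.
Proof.
move=> hc Up s0 cM ws; apply: csum_nrm => n.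
rewrite /pterm /= nrmM nrmM nrmX nrmV nrm_nat.
have n0 : 0 < n`!%:R :> R by rewrite ltr0n fact_gt0.
rewrite mulrA ler_pdivrMr //.
apply: (@le_trans _ _ (nrm (c n p) * (s / 2) ^+ n)).
  rewrite ler_wpM2l ?nrm_ge0 // lerXn2r ?nnegrE ?nrm_ge0 //; lra.
rewrite exprMn mulrA [leRHS]mulrAC ler_wpM2r // exprn_ge0 //; lra.
Qed.

Lemma derivation_D (V : normedModType C) (U : set V) (v : V) : open U ->
  derivation U (fun F : V -> C => 'D_v F).
Proof.
move=> oU; split.
- by move=> F hF; exact: hol_derive.
- move=> F G FG x Ux; have [r r0 hr] := proj1 (open_nrm U) oU x Ux.
  by apply: (derive_near v r0) => y yx; apply: FG; exact: hr.
- by move=> F G hF hG x Ux; apply: derive_add; [exact: hF|exact: hG].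
- by move=> F G hF hG x Ux; apply: derive_mul; [exact: hF|exact: hG].
Qed.

End PowerSeries.

(** * Lie series along the characteristics *)

Section Arith.
Variable R : realType.
Implicit Types x y z e f L M s : R.

Lemma lt_half x e : 0 < e -> x < e / 2 -> x < e. Proof. lra. Qed.

Lemma geo_rearrange f L M s n : f * L ^+ n * M * s ^+ n = M * f * (s * L) ^+ n.
Proof. by rewrite exprMn; ring. Qed.

Lemma lin_bound x y z A B : x <= B -> 0 <= z -> 0 <= y -> y <= A -> z <= B ->
  x + y * z <= B + A * B.
Proof. by move=> xB z0 y0 yA zB; apply: lerD => //; apply: ler_pM. Qed.

Lemma small_prod L y : 8 * 8 * L * y < 1 -> L * y <= 8^-1 * 8^-1.
Proof. by rewrite -[8 * 8 * _ * _]mulrA; move: (L * y) => t; lra. Qed.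

Lemma geo_le1 M f s L n : 0 <= M -> 0 <= f -> 0 < L -> 0 < s -> s < L^-1 ->
  M * f * (s * L) ^+ n <= M * f.
Proof.
move=> M0 f0 L0 s0 sL; have ss : 0 <= s * L by apply: mulr_ge0; exact: ltW.
rewrite ler_piMr ?mulr_ge0 // exprn_ile1 //.
by rewrite -ler_pdivlMr // mul1r ltW.
Qed.

Lemma tail_le M x y n : 0 <= M -> 0 <= x -> x <= y -> M * x ^+ n <= M * y ^+ n.
Proof. by move=> M0 x0 xy; apply: ler_wpM2l => //; apply: lerXn2r; rewrite ?nnegrE ?(le_trans x0). Qed.

Lemma half_room x y z : x < y + (z - 2 * y) / 2 -> 2 * x < z. Proof. lra. Qed.

Lemma nine_room x y e : x < y + e / 2 -> y <= 8 -> e <= 1 -> x <= 9. Proof. lra. Qed.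

Lemma flow_room L y : 8 * 8 * L * y < 1 -> 4 * 9 * (L * y) <= 1.
Proof. by move=> /small_prod; move: (L * y) => t; lra. Qed.

Lemma pow_half_le M f n : 0 <= M -> 0 <= f -> M * f * 2^-1 ^+ n <= M * f.
Proof.
move=> M0 f0; rewrite ler_piMr ?mulr_ge0 // exprn_ile1 ?invr_ge0 //.
by rewrite invf_le1 // ler1n.
Qed.

Lemma flow_radius L y : 0 < L -> 0 <= y -> 8 * 8 * L * y < 1 -> y < L^-1 / 4 / 8.
Proof.
move=> L0 y0 h; have L8 : 0 < 4 * 8 * L by rewrite !mulr_gt0.
have -> : L^-1 / 4 / 8 = 1 / (4 * 8 * L) by field; rewrite gt_eqF.
rewrite ltr_pdivlMr //; have : 0 <= y * (4 * 8 * L) by rewrite mulr_ge0 // ltW.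
have -> : y * (4 * 8 * L) = (8 * 8 * L * y) / 2 by field.
by move: h; move: (8 * 8 * L * y) => t; lra.
Qed.

Lemma ler_mul2 x : 0 <= x -> x <= 2 * x. Proof. lra. Qed.

Local Notation C := (Cx R).

Lemma vf_add (u u' b v v' : C) : u + u' - b * (v + v') = u - b * v + (u' - b * v').
Proof. ring. Qed.

Lemma vf_mul (u u' b v v' f g : C) :
  u * g + f * u' - b * (v * g + f * v') = (u - b * v) * g + f * (u' - b * v').
Proof. ring. Qed.

Lemma vf_chain (u v w xt xz b p : C) : xt = b * xz + p ->
  u + xt * w - b * (v + xz * w) = u - b * v + p * w.
Proof. by move=> ->; ring. Qed.

End Arith.

Section GraphChain.
Variable R : realType.
Local Notation C := (Cx R).
Variable V : normedModType C.

Lemma derive_graph (Phi : V * C -> C) (g : V -> C) (x v : V) :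
  differentiable Phi (x, g x) -> differentiable g x ->
  differentiable (fun y => Phi (y, g y)) x /\
  'D_v (fun y => Phi (y, g y)) x =
    'D_((v, 0) : V * C) Phi (x, g x) + 'D_v g x * 'D_((0, 1) : V * C) Phi (x, g x).
Proof.
move=> dP dg.
have dpair : differentiable (fun y : V => (y, g y)) x.
  by apply: (@differentiable_pair _ _ _ _ id g) => //; exact: did_.
have dc : differentiable (Phi \o (fun y => (y, g y))) x by exact: differentiable_comp.
split; first exact: dc.
rewrite (deriveE _ (dc : differentiable (fun y => Phi (y, g y)) x)).
rewrite [LHS](_ : _ = 'd (Phi \o (fun y => (y, g y))) x v) // diff_comp //=.
rewrite (@diff_pair _ _ _ _ id g) //=.
rewrite (_ : 'd id x v = v); last by rewrite diff_val.
rewrite !(deriveE _ dP) (deriveE _ dg) -[_ * _]/(_ *: _) -linearZ -linearD.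
congr ('d Phi _ _); congr (_, _); rewrite /= ?scaler0 ?addr0 // add0r.
exact: (esym (mulr1 _)).
Qed.

Lemma derive_chain (g : C -> C) (f : V -> C) (x v : V) :
  differentiable f x -> differentiable g (f x) ->
  'D_v (fun y => g (f y)) x = 'D_1 g (f x) * 'D_v f x.
Proof.
move=> df dg.
have dc : differentiable (g \o f) x by exact: differentiable_comp.
rewrite (deriveE _ (dc : differentiable (fun y => g (f y)) x)).
rewrite [LHS](_ : _ = 'd (g \o f) x v) // diff_comp //=.
rewrite (deriveE _ df) (deriveE _ dg) mulrC -[RHS]/(_ *: _) -linearZ.
by congr ('d g _ _); exact: (esym (mulr1 _)).
Qed.

End GraphChain.

(** * The characteristic field, its lift to the graph of X, and the transport of X = H / G *)

Section Flow.
Variable R : realType.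
Local Notation C := (Cx R).
Local Notation V2 := (C * C)%type.
Local Notation V3 := (C * C * C)%type.

Variables (d : nat) (a : V2 -> C) (a_ : nat -> V2 -> C).
Variables (p0 : V2) (e A : R).
Hypotheses (e0 : 0 < e) (e1 : e <= 1) (A1 : 1 <= A).
Hypothesis ha : forall x, nrm (x - p0) < e -> differentiable a x /\ nrm (a x) <= A.
Hypothesis ha_ : forall i x, (i <= d)%N -> nrm (x - p0) < e ->
  differentiable (a_ i) x /\ nrm (a_ i x) <= A.

Local Ltac elra := have := e0; have := e1; have := A1; xlra.

(** The field whose integral curves are the characteristics; on a solution the equation reads
    [Dop X x = Pol (x, X x)]. *)
Definition Dop (F : V2 -> C) : V2 -> C := fun x => dt F x - a x * dz F x.

Definition Pol (q : V3) : C := \sum_(i < d.+1) a_ i q.1 * q.2 ^+ i.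

(* The lift of [Dop] to the (t, z, w)-space which is tangent to the graph [w = X] of a
   solution: [Dop (fun x => F (x, X x)) x = Vop F (x, X x)]. *)
Definition Vop (F : V3 -> C) : V3 -> C :=
  fun q => dt3 F q - a q.1 * dz3 F q + Pol q * dw3 F q.

Definition ball2 (r : R) : set V2 := [set x | nrm (x - p0) < r].

Lemma open_ball2 r : open (ball2 r).
Proof.
apply/open_nrm => p pr; exists (r - nrm (p - p0)); first by rewrite subr_gt0.
move=> q qp; rewrite /ball2 /=; have := nrm_sub_le qp (lexx (nrm (p - p0))).
by rewrite subrK.
Qed.

Lemma Dop_derivation (U : set V2) : open U -> U `<=` ball2 e -> derivation U Dop.
Proof.
move=> oU sU.
have dt_ := derivation_D ((1, 0) : V2) oU.
have dz_ := derivation_D ((0, 1) : V2) oU.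
split.
- move=> F hF x Ux; apply: dB_; first exact: (der_hol dt_ hF).
  apply: dM_; last exact: (der_hol dz_ hF).
  by have [] := ha (sU x Ux).
- move=> F G FG x Ux; rewrite /Dop /dt /dz (der_eq dt_ FG Ux) (der_eq dz_ FG Ux).
  by [].
- move=> F G hF hG x Ux; rewrite /Dop /dt /dz (deriv_add dt_ hF hG Ux) (deriv_add dz_ hF hG Ux).
  exact: vf_add.
- move=> F G hF hG x Ux; rewrite /Dop /dt /dz (deriv_mul dt_ hF hG Ux) (deriv_mul dz_ hF hG Ux).
  exact: vf_mul.
Qed.

(** A common growth rate for the iterates of [Dop] and [Vop]: 6 is the Cauchy constant, the sum
    bounds the coefficients of [Vop] where [nrm w <= 9], [expR 1] comes from [nagumo] and [e / 2] is
    the radius used there. *)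
Definition Lam : R := 6 * (1 + A + A * d.+1%:R * 9 ^+ d) * expR 1 / (e / 2).

Lemma LamA : 1 + A <= 1 + A + A * d.+1%:R * 9 ^+ d.
Proof. by rewrite lerDl !mulr_ge0 ?exprn_ge0 //; elra. Qed.

Lemma Lam_gt : 8 <= e * Lam.
Proof.
have h1 : 1 <= expR 1 :> R by apply: le_trans (expR_ge1Dx 1); lra.
have h2 := LamA.
have -> : e * Lam = 12 * ((1 + A + A * d.+1%:R * 9 ^+ d) * expR 1).
  by rewrite /Lam; field; rewrite gt_eqF ?e0.
move: h2; move: (1 + A + A * d.+1%:R * 9 ^+ d) (expR 1) h1 => B E h1 h2.
have : 2 * 1 <= B * E by apply: ler_pM; elra.
elra.
Qed.

Lemma Lam0 : 0 < Lam.
Proof. by have := Lam_gt; rewrite -(pmulr_rgt0 _ e0); xlra. Qed.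

Lemma half_sub x y : nrm (x - p0) < e / 2 -> nrm (y - x) < e / 2 -> nrm (y - p0) < e.
Proof. by move=> xp yx; have := nrm_sub_lt yx xp; rewrite -splitr. Qed.

Lemma Dop_bound F n x (M : R) : (forall y, nrm (y - p0) < e -> differentiable F y) ->
  (forall y, nrm (y - p0) < e -> nrm (F y) <= M) -> nrm (x - p0) < e / 2 ->
  nrm (iter n Dop F x) <= n`!%:R * Lam ^+ n * M.
Proof.
move=> dF FM xp.
have e2 : 0 < e / 2 by elra.
have A6 : 0 <= 6 * (1 + A) by elra.
have M0 : 0 <= M by apply: le_trans (FM p0 _); rewrite ?subrr ?nrm0 ?nrm_ge0.
have h : nrm (iter n Dop F x) <= n`!%:R * (6 * (1 + A) * expR 1 / (e / 2)) ^+ n * M.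
  apply: (@nagumo _ _ Dop F x (e / 2) (6 * (1 + A)) M n e2 A6).
  - move=> G s se dG.
    have oB : open [set y : V2 | nrm (y - x) < s].
      apply/open_nrm => p pr; exists (s - nrm (p - x)); first by rewrite subr_gt0.
      by move=> q qp /=; have := nrm_sub_le qp (lexx (nrm (p - x))); rewrite subrK.
    have sB : [set y : V2 | nrm (y - x) < s] `<=` ball2 e.
      by move=> y ys; apply: (half_sub xp); apply: lt_le_trans ys se.
    exact: (der_hol (Dop_derivation oB sB)).
  - move=> G y s B s0 ys dG GB.
    have yx : nrm (y - x) < e / 2 by apply: ys; rewrite subrr nrm0.
    have [_ aA] := ha (half_sub xp yx).
    have h1 : nrm (dt G y) <= 6 * B / s.
      by have := cauchy_est ((1, 0) : V2) s0 dG GB; rewrite nrm_e1 mulr1.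
    have h2 : nrm (dz G y) <= 6 * B / s.
      by have := cauchy_est ((0, 1) : V2) s0 dG GB; rewrite nrm_e2 mulr1.
    apply: (le_trans (nrmD _ _)); rewrite nrmN nrmM.
    have -> : 6 * (1 + A) * B / s = 6 * B / s + A * (6 * B / s) by ring.
    by apply: lin_bound => //; exact: nrm_ge0.
  - by move=> y yx; apply: dF; exact: half_sub xp yx.
  - by move=> y yx; apply: FM; exact: half_sub xp yx.
apply: (le_trans h); rewrite ler_wpM2r // ler_wpM2l //.
have E0 : 0 <= expR 1 / (e / 2) :> R by rewrite divr_ge0 ?expR_ge0 // ltW.
rewrite lerXn2r ?nnegrE //.
- by rewrite -mulrA mulr_ge0.
- exact: ltW Lam0.
rewrite /Lam -!mulrA; apply: ler_wpM2l => //.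
apply: ler_wpM2r => //; rewrite mulrA; exact: LamA.
Qed.

Lemma nrm_v3 : [/\ nrm ((1, 0, 0) : V3) = 1, nrm ((0, 1, 0) : V3) = 1 &
  nrm ((0, 0, 1) : V3) = 1].
Proof.
by split; rewrite !nrm_pair /= nrm1 !nrm0 /Num.max ?ltxx ?ltr01 ?ltr10 //.
Qed.

Lemma Pol_bound (q : V3) : nrm (q.1 - p0) < e -> nrm q.2 <= 9 ->
  nrm (Pol q) <= A * d.+1%:R * 9 ^+ d.
Proof.
move=> q1 q2; apply: (le_trans (nrm_sum _ _ _)).
apply: (@le_trans _ _ (\sum_(i < d.+1) A * 9 ^+ d)); last first.
  by rewrite sumr_const card_ord -[leLHS]mulr_natr mulrAC lexx.
apply: ler_sum => i _; rewrite nrmM nrmX; apply: ler_pM; rewrite ?nrm_ge0 ?exprn_ge0 ?nrm_ge0 //.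
  by have [] := ha_ (ltn_ord i : (i <= d)%N) q1.
apply: (@le_trans _ _ (9 ^+ i)); first by rewrite lerXn2r ?nnegrE ?nrm_ge0.
by apply: ler_weXn2l; [rewrite ler1n|rewrite -ltnS].
Qed.

Lemma Vop_diff (F : V3 -> C) (q : V3) (s : R) : 0 < s -> nrm (q.1 - p0) < e ->
  (forall y, nrm (y - q) < s -> differentiable F y) -> differentiable (Vop F) q.
Proof.
move=> s0 qe dF; have [da _] := ha qe.
have [dq _] := diff_fst (q := q) da.
have dD v : differentiable ('D_v F) q by apply: (@diff_derive _ _ F q v s).
apply: dD_; first apply: dB_; first exact: dD.
  by apply: dM_; [exact: dq|exact: dD].
apply: dM_; last exact: dD.
apply: dsum_ => i _; have [di _] := ha_ (ltn_ord i : (i <= d)%N) qe.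
apply: dM_; first by have [] := diff_fst (q := q) di.
have dw : differentiable (fun w : C => w ^+ i) q.2 by apply: dX_; exact: did_.
by have [] := diff_snd (q := q) dw.
Qed.

Lemma Vop_bound n (x : V2) (w : C) : nrm (x - p0) < e / 2 -> nrm w <= 8 ->
  nrm (iter n Vop snd (x, w)) <= n`!%:R * Lam ^+ n * 9.
Proof.
move=> xp w8.
have e2 : 0 < e / 2 by elra.
have AP : 0 <= 6 * (1 + A + A * d.+1%:R * 9 ^+ d) by have := LamA; elra.
have inb (y : V3) : nrm (y - (x, w)) < e / 2 -> nrm (y.1 - p0) < e /\ nrm y.2 <= 9.
  move=> /nrm_pairP[h1 h2]; split; first exact: half_sub xp h1.
  have h9 := nrm_lt_add (h2 : nrm (y.2 - w) < _); exact: nine_room h9 w8 e1.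
rewrite /Lam; apply: (@nagumo _ _ Vop snd (x, w) (e / 2) (6 * (1 + A + A * d.+1%:R * 9 ^+ d)) 9 n e2 AP).
- move=> G s se dG y ys; have ys0 : 0 < s - nrm (y - (x, w)) by rewrite subr_gt0.
  apply: (@Vop_diff G y _ ys0).
    by have [] := inb y (lt_le_trans ys se).
  move=> z zy; apply: dG; have := nrm_sub_le zy (lexx (nrm (y - (x, w)))).
  by rewrite subrK.
- move=> G y s B s0 ys dG GB.
  have [y1 y2] := inb y (ys y ltac:(by rewrite subrr nrm0)).
  have [_ aA] := ha y1.
  have [n1 n2 n3] := nrm_v3.
  have h1 : nrm (dt3 G y) <= 6 * B / s.
    by have := cauchy_est ((1, 0, 0) : V3) s0 dG GB; rewrite n1 mulr1.
  have h2 : nrm (dz3 G y) <= 6 * B / s.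
    by have := cauchy_est ((0, 1, 0) : V3) s0 dG GB; rewrite n2 mulr1.
  have h3 : nrm (dw3 G y) <= 6 * B / s.
    by have := cauchy_est ((0, 0, 1) : V3) s0 dG GB; rewrite n3 mulr1.
  have -> : 6 * (1 + A + A * d.+1%:R * 9 ^+ d) * B / s =
    6 * B / s + A * (6 * B / s) + A * d.+1%:R * 9 ^+ d * (6 * B / s) by ring.
  apply: (le_trans (nrmD _ _)); apply: lerD.
    apply: (le_trans (nrmD _ _)); rewrite nrmN nrmM.
    by apply: lin_bound => //; exact: nrm_ge0.
  by rewrite nrmM; apply: ler_pM; rewrite ?nrm_ge0 //; exact: Pol_bound.
- move=> y _.
  by have [] := diff_snd (q := y) (did_ (V := C) y.2).
- by move=> y /inb[].
Qed.

Section Solution.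
Variable X : V2 -> C.

Definition pde_at' (x : V2) := pde_at d a a_ X x.

(** The chain rule along the graph, with the equation for [X], turns [Dop] into [Vop]. The iterates
    of [Dop] on [X] are thereby bounded in terms of the coefficients alone, no matter how close the
    point is to a singularity of [X]. *)
Lemma Vop_iter (O : set V2) : open O -> O `<=` ball2 (e / 2) ->
  (forall x, O x -> differentiable X x /\ pde_at' x) ->
  (forall x, O x -> nrm (X x) < 8) ->
  forall n x, O x -> iter n Dop X x = iter n Vop snd (x, X x).
Proof.
move=> oO sO hX X8; elim=> [//|n IH] x Ox.
have [r r0 hr] := proj1 (open_nrm O) oO x Ox.
have xe : nrm (x - p0) < e / 2 := sO x Ox.
have e2 : 0 < e / 2 by elra.
have [dX px] := hX x Ox.
have hd : forall m y, nrm (y - (x, X x)) < e / 2 -> differentiable (iter m Vop snd) y.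
  elim=> [|m IHm] y ys.
    by have [] := diff_snd (q := y) (did_ (V := C) y.2).
  have ys0 : 0 < e / 2 - nrm (y - (x, X x)) by rewrite subr_gt0.
  apply: (Vop_diff ys0).
    by move: ys => /nrm_pairP[h1 _]; exact: half_sub xe h1.
  move=> z zy; apply: IHm; have := nrm_sub_le zy (lexx (nrm (y - (x, X x)))).
  by rewrite subrK.
have dn : differentiable (iter n Vop snd) (x, X x) by apply: hd; rewrite subrr nrm0.
have near F : (forall y, O y -> F y = iter n Vop snd (y, X y)) -> forall v,
   'D_v F x = 'D_v (fun y => iter n Vop snd (y, X y)) x.
  by move=> hF v; apply: (derive_near v r0) => y /hr; exact: hF.
rewrite !iterS {1}/Dop /dt /dz !(near _ IH).
have [_ g1] := derive_graph ((1, 0) : V2) dn dX.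
have [_ g2] := derive_graph ((0, 1) : V2) dn dX.
rewrite g1 g2; exact: vf_chain px.
Qed.

Lemma adm_Dop F (M : R) : (forall y, nrm (y - p0) < e -> differentiable F y) ->
  (forall y, nrm (y - p0) < e -> nrm (F y) <= M) ->
  adm (ball2 (e / 2)) Lam^-1 (fun n => iter n Dop F).
Proof.
move=> dF FM p pe; have r0 : 0 < e / 2 - nrm (p - p0) by rewrite subr_gt0.
have e2e : e / 2 <= e by elra.
have sub x : nrm (x - p) < e / 2 - nrm (p - p0) -> nrm (x - p0) < e / 2.
  by move=> xp; have := nrm_sub_le xp (lexx (nrm (p - p0))); rewrite subrK.
have hol : holomorphic_on (ball2 e) F by move=> x; exact: dF.
exists (e / 2 - nrm (p - p0)); split=> //.
- have sB : ball2 e `<=` ball2 e by [].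
  move=> n x xp; have xe : ball2 e x := lt_le_trans (sub x xp) e2e.
  exact: (der_iter_hol (Dop_derivation (open_ball2 (r := e)) sB) n hol).
move=> s s0 sL; exists M => n x xp.
have h := Dop_bound n dF FM (sub x xp).
have M0 : 0 <= M by apply: le_trans (FM p0 _); rewrite ?subrr ?nrm0 ?nrm_ge0.
apply: (@le_trans _ _ (n`!%:R * Lam ^+ n * M * s ^+ n)).
  by rewrite ler_wpM2r // exprn_ge0 // ltW.
by rewrite geo_rearrange; apply: geo_le1 => //; exact: Lam0.
Qed.

Variables (H G : V2 -> C) (B : R).
Hypothesis hG : forall x, nrm (x - p0) < e -> differentiable G x /\ nrm (G x) <= B.
Hypothesis hH : forall x, nrm (x - p0) < e -> differentiable H x /\ nrm (H x) <= B.
Hypothesis hX : forall x, nrm (x - p0) < e -> G x != 0 ->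
  [/\ differentiable X x, pde_at' x & H x = X x * G x].

Definition UX : set V2 := [set x | [/\ nrm (x - p0) < e / 2, G x != 0 & nrm (X x) < 8]].

Lemma open_UX : open UX.
Proof.
apply/open_nrm => x [xe Gx X8].
have xe' : nrm (x - p0) < e := lt_half e0 xe.
have [dG _] := hG xe'; have [dX _ _] := hX xe' Gx.
have [r1 r10 h1] := diff_cont dG (nrm_gt0 Gx).
have X8' : 0 < 8 - nrm (X x) by rewrite subr_gt0.
have [r2 r20 h2] := diff_cont dX X8'.
exists (Num.min (e / 2 - nrm (x - p0)) (Num.min r1 r2)).
  by rewrite !lt_min subr_gt0 xe r10.
move=> y /lt_min2[y0 /lt_min2[y1 y2]]; split.
- by have := nrm_sub_le y0 (lexx (nrm (x - p0))); rewrite subrK.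
- apply: contraTneq (h1 y y1) => ->; rewrite sub0r nrmN ltxx //.
- by have := nrm_lt_add (h2 y y2); rewrite addrC subrK.
Qed.

Lemma UX_e x : UX x -> nrm (x - p0) < e.
Proof. by case=> h _ _; exact: lt_half e0 h. Qed.

Lemma UX_iter n x : UX x -> iter n Dop X x = iter n Vop snd (x, X x).
Proof.
apply: Vop_iter; first exact: open_UX.
- by move=> y [].
- by move=> y Uy; have [_ Gy _] := Uy; have [] := hX (UX_e Uy) Gy.
- by move=> y [].
Qed.

Lemma UX_bound n x : UX x -> nrm (iter n Dop X x) <= n`!%:R * Lam ^+ n * 9.
Proof.
move=> Ux; rewrite UX_iter //; have [xe _ X8] := Ux.
by apply: Vop_bound => //; exact: ltW.
Qed.

Lemma UX_deriv : derivation UX Dop.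
Proof. by apply: Dop_derivation; [exact: open_UX|move=> x /UX_e]. Qed.

Lemma hol_XUX : holomorphic_on UX X.
Proof. by move=> x Ux; have [_ Gx _] := Ux; have [] := hX (UX_e Ux) Gx. Qed.

Lemma adm_X : adm UX Lam^-1 (fun n => iter n Dop X).
Proof.
move=> p Up; have [r r0 hr] := proj1 (open_nrm UX) open_UX p Up.
exists r; split=> //.
- by move=> n x /hr Ux; exact: (der_iter_hol UX_deriv n hol_XUX).
move=> s s0 sL; exists 9 => n x /hr Ux.
apply: (@le_trans _ _ (n`!%:R * Lam ^+ n * 9 * s ^+ n)).
  by rewrite ler_wpM2r ?exprn_ge0 ?(ltW s0) //; exact: UX_bound.
by rewrite geo_rearrange; apply: geo_le1 => //; exact: Lam0.
Qed.

Lemma adm_sub (U U' : set V2) rho c : open U' -> U' `<=` U -> adm U rho c -> adm U' rho c.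
Proof.
move=> oU sU hc p Up; have [r [r0 rU dc cM]] := hc p (sU p Up).
have [r' r'0 hr'] := proj1 (open_nrm U') oU p Up.
exists (Num.min r r'); split; first by rewrite lt_min r0.
- by move=> x /lt_min2[_ /hr'].
- by move=> n x /lt_min2[xr _]; exact: dc.
move=> s s0 sr; have [M hM] := cM s s0 sr.
by exists M => n x; move=> /lt_min2[xr _]; exact: hM.
Qed.

Lemma dGe y : nrm (y - p0) < e -> differentiable G y. Proof. by move=> /hG[]. Qed.
Lemma bGe y : nrm (y - p0) < e -> nrm (G y) <= B. Proof. by move=> /hG[]. Qed.
Lemma dHe y : nrm (y - p0) < e -> differentiable H y. Proof. by move=> /hH[]. Qed.
Lemma bHe y : nrm (y - p0) < e -> nrm (H y) <= B. Proof. by move=> /hH[]. Qed.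

(** Both sides have the same w-jet at w = 0, by [H = X * G] and the Leibniz rule, for [Dop] on the
    left and for the w-derivative on the right; [flat_line] does the rest. The time [l] allowed does
    not depend on the distance from [x] to the zeros of [G], so [X] is continued beyond the set
    where it was given. *)
Lemma flow_product x (l : C) : UX x -> 8 * 8 * Lam * nrm l < 1 ->
  pser (fun n => iter n Dop H) (x, l) =
  pser (fun n => iter n Dop X) (x, l) * pser (fun n => iter n Dop G) (x, l).
Proof.
move=> Ux lL; have [xe Gx X8] := Ux.
pose rho := Lam^-1; have rho0 : 0 < rho by rewrite invr_gt0 Lam0.
have sU : UX `<=` ball2 (e / 2) by move=> y [].
have aH : adm UX rho (fun n => iter n Dop H).
  by apply: (adm_sub open_UX sU); exact: adm_Dop dHe bHe.
have aG : adm UX rho (fun n => iter n Dop G).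
  by apply: (adm_sub open_UX sU); exact: adm_Dop dGe bGe.
have aX : adm UX rho (fun n => iter n Dop X) := adm_X.
set pH := pser _; set pX := pser _; set pG := pser _.
pose U3 : set V3 := [set q | UX q.1 /\ 2 * nrm q.2 < rho].
have oU3 : open U3.
  apply/open_nrm => q [Uq qr]; have [r r0 hr] := proj1 (open_nrm UX) open_UX _ Uq.
  exists (Num.min r ((rho - 2 * nrm q.2) / 2)).
    by rewrite lt_min r0 /= divr_gt0 // subr_gt0.
  move=> y /nrm_pairP[] /lt_min2[h1 _] /lt_min2[_ h2].
  split; first exact: hr.
  exact: half_room (nrm_lt_add (h2 : nrm (y.2 - q.2) < _)).
have hpH : holomorphic_on U3 pH by move=> q [Uq qr]; have [] := pser_diff aH Uq qr.
have hpX : holomorphic_on U3 pX by move=> q [Uq qr]; have [] := pser_diff aX Uq qr.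
have hpG : holomorphic_on U3 pG by move=> q [Uq qr]; have [] := pser_diff aG Uq qr.
have hpXG := hol_mul hpX hpG.
pose f q := pH q - pX q * pG q.
have hf : holomorphic_on U3 f by move=> q Uq; apply: dB_; [exact: hpH|exact: hpXG].
have dD := derivation_D ((0, 0, 1) : V3) oU3.
have x0 : U3 (x, 0) by split=> //=; rewrite nrm0 mulr0.
have Ux0 : UX ((x, 0) : V3).1 by [].
have fj j : nderive ((0, 0, 1) : V3) j f (x, 0) = 0.
  have E : iter j (@dw3 R) pH (x, 0) = nderive ((0, 0, 1) : V3) j f (x, 0) +
      iter j (@dw3 R) (fun q => pX q * pG q) (x, 0).
    rewrite /nderive -(der_iter_add dD j hf hpXG) //; apply: (der_iter_eq dD) => //.
    by move=> q _; rewrite /f subrK.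
  apply/eqP; rewrite -(subr_eq0) subr0 -[X in X == 0](addrK (iter j (@dw3 R) (fun q => pX q * pG q) (x, 0))).
  rewrite -E subr_eq0; apply/eqP.
  rewrite (pser_iter j aH Ux0) ?nrm0 ?mulr0 // pser0 addn0.
  rewrite (der_leibniz dD j hpX hpG) //.
  have hGU : holomorphic_on UX G by move=> y /UX_e; exact: dGe.
  have -> : iter j Dop H x = iter j Dop (fun y => X y * G y) x.
    apply: (der_iter_eq UX_deriv) => // y Uy; have [_ Gy _] := Uy.
    by have [] := hX (UX_e Uy) Gy.
  rewrite (der_leibniz UX_deriv j hol_XUX hGU) //; apply: eq_bigr => i _.
  rewrite (pser_iter i aX Ux0) ?nrm0 ?mulr0 // pser0 addn0.
  by rewrite (pser_iter (j - i) aG Ux0) ?nrm0 ?mulr0 // pser0 addn0.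
have line (m : C) : ((x, 0) : V3) + m *: ((0, 0, 1) : V3) = (x, m).
  congr (_, _); rewrite /= ?add0r; last exact: mulr1.
  by rewrite scaler0 addr0.
have rho4 : 0 < rho / 4 by xlra.
have inU (m : C) : nrm m < rho / 4 -> U3 (x, m) by move=> ml; split => //=; xlra.
have bnd c M (m : C) : adm UX rho c -> (forall n, nrm (c n x) <= n`!%:R * Lam ^+ n * M) ->
   0 <= M -> nrm m < rho / 4 -> nrm (pser c (x, m)) <= 2 * M.
  move=> ac cb M0 ml; apply: (@pser_bound _ UX rho c x M (rho / 2)) => //.
  - by xlra.
  - move=> n; apply: (@le_trans _ _ (n`!%:R * Lam ^+ n * M * (rho / 2) ^+ n)).
      by rewrite ler_wpM2r // exprn_ge0 //; xlra.
    rewrite geo_rearrange.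
    have -> : rho / 2 * Lam = 2^-1.
      by rewrite /rho mulrAC mulVf ?mul1r // gt_eqF // Lam0.
    exact: pow_half_le.
  - by xlra.
have B0 : 0 <= B by apply: le_trans (bGe (UX_e Ux)); exact: nrm_ge0.
suff : f (x, l) = 0 by move=> /eqP; rewrite subr_eq0 => /eqP.
rewrite -line; apply: (@flat_line _ _ f (x, 0) (0, 0, 1) (rho / 4) (2 * B + 2 * 9 * (2 * B)) rho4);
  [| | |exact: fj|].
- by move=> m ml; rewrite line; apply: hf; exact: inU.
- move=> m ml; rewrite line /f; apply: (le_trans (nrmD _ _)); rewrite nrmN nrmM.
  apply: lerD.
    by apply: bnd => // n; exact: Dop_bound dHe bHe xe.
  apply: ler_pM; rewrite ?nrm_ge0 //.
    by apply: bnd => // n; exact: UX_bound.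
  by apply: bnd => // n; exact: Dop_bound dGe bGe xe.
- have [r r0 hr] := proj1 (open_nrm U3) oU3 _ x0.
  exact: (ex_intro2 _ _ r r0 (fun y yr => hf y (hr y yr))).
exact: flow_radius Lam0 (nrm_ge0 l) lL.
Qed.

(** The term of order 0 is [F p], and the others are dominated by powers of [Lam * nrm l], which is
    at most 1/64. *)
Lemma pser_near F (M : R) (p : V2) (l : C) (U : set V2) : adm U Lam^-1 (fun n => iter n Dop F) ->
  U p -> (forall n, nrm (iter n Dop F p) <= n`!%:R * Lam ^+ n * M) -> 0 <= M ->
  8 * 8 * Lam * nrm l < 1 ->
  nrm (pser (fun n => iter n Dop F) (p, l) - F p) <= 4 * M * (Lam * nrm l).
Proof.
move=> aF Up FM M0 lL.
have L0 := Lam0; have l0 := nrm_ge0 l.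
have x0 : 0 <= Lam * nrm l by rewrite mulr_ge0 // ltW.
have x1 : Lam * nrm l <= 2^-1 by apply: (le_trans (small_prod lL)); xlra.
have tb n : nrm (pterm (fun n => iter n Dop F) n (p, l)) <= M * (Lam * nrm l) ^+ n.
  rewrite /pterm /= nrmM nrmM nrmX nrmV nrm_nat.
  have n0 : 0 < n`!%:R :> R by rewrite ltr0n fact_gt0.
  rewrite mulrA ler_pdivrMr //.
  apply: (@le_trans _ _ (n`!%:R * Lam ^+ n * M * nrm l ^+ n)).
    by rewrite ler_wpM2r ?exprn_ge0.
  by rewrite geo_rearrange [nrm l * Lam]mulrC -mulrA [n`!%:R * _]mulrC mulrA lexx.
have tb2 n : nrm (pterm (fun n => iter n Dop F) n (p, l)) <= M * 2^-1 ^+ n.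
  apply: (le_trans (tb n)); exact: tail_le.
rewrite /pser (csum_head tb2) {1}/pterm /= expr0 fact0 divr1 mulr1 addrC addKr.
have -> : 4 * M * (Lam * nrm l) = 2 * (2 * M * (Lam * nrm l)) by ring.
apply: csum_nrm => n; apply: (le_trans (tb n.+1)).
rewrite exprS mulrA.
apply: (@le_trans _ _ (M * (Lam * nrm l) * 2^-1 ^+ n)).
  by apply: tail_le => //; exact: mulr_ge0.
by rewrite -[2 * M * _]mulrA; apply: ler_wpM2r; [exact: exprn_ge0|exact/ler_mul2/mulr_ge0].
Qed.

(** The witness is [X] continued along the characteristic. Its displacement is at most 4 * 9 *
    (1/64), below 1. *)
Lemma flow_ratio x (l : C) : UX x -> 8 * 8 * Lam * nrm l < 1 ->
  exists2 xi : C, pser (fun n => iter n Dop H) (x, l) =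
    xi * pser (fun n => iter n Dop G) (x, l) & nrm (xi - X x) <= 1.
Proof.
move=> Ux lL; have ler09 : 0 <= 9 :> R by [].
exists (pser (fun n => iter n Dop X) (x, l)); first exact: flow_product.
have h := @pser_near X 9 x l UX adm_X Ux (fun n => UX_bound n Ux) ler09 lL.
apply: (le_trans h); exact: flow_room.
Qed.

End Solution.
End Flow.

(** * Symmetry of mixed partial derivatives *)

Section MixedPartials.
Variable R : realType.
Local Notation C := (Cx R).

Lemma quot_err (K s x : R) (d : R) : 0 <= x -> x <= K * d ^+ 2 -> 0 < d -> x / d <= K * d.
Proof. by move=> x0 xK d0; rewrite ler_pdivrMr // -mulrA -expr2. Qed.

(** A directional derivative sees only the values on one line, which allows passing between
    functions on different spaces. *)
Lemma derive_ext (V W : normedModType C) (f : V -> C) (g : W -> C) (p v : V) (q w : W) :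
  (forall h : C, f (h *: v + p) = g (h *: w + q)) -> 'D_v f p = 'D_w g q.
Proof.
move=> fg; have fp : f p = g q by have := fg 0; rewrite !scale0r !add0r.
have E : (fun h : C => h^-1 *: ((f \o shift p) (h *: v) - f p)) =
         (fun h : C => h^-1 *: ((g \o shift q) (h *: w) - g q)).
  by apply/funext => h; rewrite /= fp; congr (_ *: (_ - _)); exact: fg.
by rewrite /derive E.
Qed.

Lemma quot_rearr (k x y z : R) : 6 * (k * x) / y * z <= 6 * k / y * z * x.
Proof. by rewrite le_eqVlt; apply/orP; left; apply/eqP; ring. Qed.

Lemma quot_sub (u m x : C) : m != 0 -> u / m - x = (u - m * x) / m.
Proof. by move=> m0; field. Qed.

Lemma half_small (x t s : R) : 8 * 8 * 8 * x <= t -> 0 <= x -> t <= s / 2 -> 0 < s -> x < s / 2.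
Proof. lra. Qed.

(** The difference quotients [Q n] in direction [w] converge uniformly to the w-derivative, so by
    [weierstrass] their v-derivatives converge to the left side. These v-derivatives are also
    difference quotients of ['D_v F], which converge to the right side. *)
Lemma derive_comm (V : normedModType C) (F : V -> C) (p v w : V) (r : R) : 0 < r ->
  (forall x, nrm (x - p) < r -> differentiable F x) ->
  'D_v ('D_w F) p = 'D_w ('D_v F) p.
Proof.
move=> r0 dF.
have [s [M [s0 sr FM]]] := bounded_ball_near r0 dF.
have dDv := ball_diff_derive v dF.
have [s' [M' [s'0 s'r DM]]] := bounded_ball_near r0 dDv.
pose t := Num.min (s / 2) (s' / 2).
have t0 : 0 < t by rewrite lt_min !divr_gt0.
have ts : t <= s / 2 by rewrite ge_min lexx.
have ts' : t <= s' / 2 by rewrite ge_min lexx orbT.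
pose W := nrm w + 1; have W0 : 0 < W by rewrite ltr_wpDl ?nrm_ge0.
pose del n : R := t / (8 * 8 * 8 * W) * 2^-1 ^+ n.
have E0 : 0 < 8 * 8 * 8 * W by rewrite !mulr_gt0.
have del0 n : 0 < del n by rewrite /del !mulr_gt0 ?invr_gt0 // exprn_gt0 // invr_gt0.
pose l n : C := (del n)%:C.
have nl n : nrm (l n) = del n by rewrite nrm_real gtr0_norm.
have l0 n : l n != 0 by rewrite -[0]/(0%:C) (inj_eq (@complexI R)) gt_eqF.
have p2 n : (0 <= 2^-1 ^+ n :> R) && (2^-1 ^+ n <= 1 :> R).
  by rewrite exprn_ge0 ?exprn_ile1 ?invr_ge0 ?invf_le1 ?ler1n.
have small n : 8 * 8 * 8 * nrm (l n *: w) <= t.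
  rewrite nrmZ nl /del.
  have -> : 8 * 8 * 8 * (t / (8 * 8 * 8 * W) * 2^-1 ^+ n * nrm w) = t * (2^-1 ^+ n * (nrm w / W)).
    by field; rewrite gt_eqF.
  rewrite ler_piMr ?(ltW t0) // mulr_ile1 ?divr_ge0 ?nrm_ge0 ?(ltW W0) ?ler_pdivrMr ?mul1r ?lerDl //; by case/andP: (p2 n).
have small' n : nrm (l n *: w) < s / 2.
  have := small n; have := nrm_ge0 (l n *: w); move=> h1 h2; exact: half_small h2 h1 ts s0.
pose Q n x := (F (x + l n *: w) - F x) / l n.
have inS x n : nrm (x - p) < s / 2 -> nrm (x + l n *: w - p) < s.
  move=> xp; have -> : x + l n *: w - p = (x - p) + l n *: w by rewrite addrAC.
  apply: (le_lt_trans (nrmD _ _)); rewrite [ltRHS]splitr.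
  exact: ltrD.
have inS1 x : nrm (x - p) < s / 2 -> nrm (x - p) < s by move=> h; apply: lt_half.
have s20 : 0 < s / 2 by rewrite divr_gt0.
have dshift (x : V) n : differentiable (fun x : V => x + l n *: w) x.
  exact: (@differentiableD _ _ _ (fun y : V => y) (cst (l n *: w))).
have dQ n x : nrm (x - p) < s / 2 -> differentiable (Q n) x.
  move=> xp; apply: dM_; last exact: dcst_.
  apply: dB_; last by apply: dF; apply: lt_le_trans (inS1 x xp) sr.
  apply: (@dcomp_ _ V V (fun x => x + l n *: w) F) => //.
  by apply: dF; apply: lt_le_trans (inS x n xp) sr.
have qe n x : nrm (x - p) < s / 2 -> nrm (Q n x - 'D_w F x) <=
    (6 * 6 * 8 * 4) * M / (s / 2) ^+ 2 * nrm w ^+ 2 * del n.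
  move=> xp.
  have xs y : nrm (y - x) < s / 2 -> nrm (y - p) < s.
    by move=> yx; have := nrm_sub_lt yx xp; rewrite -splitr.
  have h := @second_order _ _ F x (l n *: w) (s / 2) M s20
    (fun y yx => dF y (lt_le_trans (xs y yx) sr)) (fun y yx => FM y (xs y yx))
    (le_trans (small n) ts).
  have dFx : differentiable F x by apply: dF; apply: lt_le_trans (inS1 x xp) sr.
  have Dl : 'D_(l n *: w) F x = l n * 'D_w F x.
    by rewrite !(deriveE _ dFx) linearZ.
  have -> : Q n x - 'D_w F x = (F (x + l n *: w) - F x - 'D_(l n *: w) F x) / l n.
    by rewrite Dl; exact: quot_sub.
  rewrite nrmM nrmV nl; apply: quot_err => //; first exact: nrm_ge0.
  by apply: (le_trans h); rewrite nrmZ nl [(del n * _) ^+ 2]exprMn [del n ^+ 2 * _]mulrC mulrA lexx.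
pose Ke := (6 * 6 * 8 * 4) * M / (s / 2) ^+ 2 * nrm w ^+ 2.
have M0 : 0 <= M by apply: le_trans (FM p _); rewrite ?subrr ?nrm0 ?nrm_ge0.
have Ke0 : 0 <= Ke by rewrite /Ke !mulr_ge0 ?invr_ge0 ?exprn_ge0 ?nrm_ge0 ?(ltW s20).
have delle n : del n <= del 0%N.
  rewrite /del expr0 mulr1; apply: ler_piMr; first by rewrite divr_ge0 // ltW.
  by case/andP: (p2 n).
have QM n x : nrm (x - p) < s / 2 -> nrm (Q n x) <= 6 * M / (s / 2) * nrm w + Ke * del 0%N.
  move=> xp; rewrite -(subrK ('D_w F x) (Q n x)) addrC; apply: (le_trans (nrmD _ _)).
  apply: lerD; last by apply: (le_trans (qe n x xp)); exact: ler_wpM2l.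
  apply: cauchy_est => // y yx; last by apply: FM; have := nrm_sub_lt yx xp; rewrite -splitr.
  by apply: dF; apply: lt_le_trans sr; have := nrm_sub_lt yx xp; rewrite -splitr.
have dsmall K (e' : R) : 0 < e' -> exists N, forall n, (N <= n)%N -> K * del n <= e'.
  move=> e0; have [N hN] := half_pow_small (K * (t / (8 * 8 * 8 * W))) e0.
  by exists N => n /hN; rewrite /del !mulrA.
have [_ WE] := weierstrass s20 dQ QM qe (dsmall Ke).
have Dp : forall n, 'D_v (Q n) p = ('D_v F (p + l n *: w) - 'D_v F p) / l n.
  move=> n; have pp : nrm (p - p) < s / 2 by rewrite subrr nrm0.
  have d1 : differentiable F (p + l n *: w) by apply: dF; apply: lt_le_trans (inS p n pp) sr.
  have d1' : differentiable (fun x => F (x + l n *: w)) p.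
    exact: (@dcomp_ _ V V (fun x => x + l n *: w) F).
  have d2 : differentiable F p by apply: dF; rewrite subrr nrm0.
  rewrite /Q derive_mul; [|exact: dB_|exact: dcst_].
  rewrite derive_const mulr0 addr0; congr (_ * _).
  have -> : 'D_v (fun x => F (x + l n *: w) - F x) p =
      'D_v (fun x => F (x + l n *: w)) p - 'D_v F p.
    exact: (deriveB (diff_derivable d1') (diff_derivable d2)).
  rewrite (derive_ext (g := F) (q := p + l n *: w) (w := v)) // => h.
  by rewrite addrA.
have E2 n : nrm ('D_v (Q n) p - 'D_w ('D_v F) p) <=
   (6 * 6 * 8 * 4) * M' / (s' / 2) ^+ 2 * nrm w ^+ 2 * del n.
  have s'20 : 0 < s' / 2 by rewrite divr_gt0.
  have lt_s x : nrm (x - p) < s' / 2 -> nrm (x - p) < s' by move=> h; apply: lt_half.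
  have h := @second_order _ _ ('D_v F) p (l n *: w) (s' / 2) M' s'20
    (fun y yx => dDv y (lt_le_trans (lt_s y yx) s'r)) (fun y yx => DM y (lt_s y yx))
    (le_trans (small n) ts').
  have dFx : differentiable ('D_v F) p by apply: dDv; rewrite subrr nrm0.
  have Dl : 'D_(l n *: w) ('D_v F) p = l n * 'D_w ('D_v F) p.
    by rewrite !(deriveE _ dFx) linearZ.
  rewrite Dp.
  have -> : ('D_v F (p + l n *: w) - 'D_v F p) / l n - 'D_w ('D_v F) p =
      ('D_v F (p + l n *: w) - 'D_v F p - 'D_(l n *: w) ('D_v F) p) / l n.
    by rewrite Dl; exact: quot_sub.
  rewrite nrmM nrmV nl; apply: quot_err => //; first exact: nrm_ge0.
  by apply: (le_trans h); rewrite nrmZ nl [(del n * _) ^+ 2]exprMn [del n ^+ 2 * _]mulrC mulrA lexx.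
apply/eqP; rewrite -subr_eq0; apply/negPn/negP => /nrm_gt0; set X := nrm _ => X0.
set K2 := _ * nrm w ^+ 2 in E2.
have [N hN] := dsmall (6 * Ke / (s / 2) * nrm v + K2) (X / 2) (divr_gt0 X0 (ltr0n _ 2)).
have := hN N (leqnn N); apply/negP; rewrite -ltNge.
apply: (@lt_le_trans _ _ X); first by rewrite ltr_pdivrMr // ltr_pMr // ltr1n.
apply: (le_trans (nrm_triB _ ('D_v (Q N) p) _)); rewrite mulrDl.
apply: lerD (E2 N); rewrite nrmB; apply: (le_trans (WE N v)).
exact: quot_rearr.
Qed.

End MixedPartials.

(** * Uniqueness for the homogeneous transport equation *)

Section Uniqueness.
Variable R : realType.
Local Notation C := (Cx R).
Local Notation V2 := (C * C)%type.

Lemma derive_line0 (V : normedModType C) (f : V -> C) (p v : V) (r : R) : 0 < r ->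
  (forall l : C, nrm l < r -> f (p + l *: v) = 0) -> 'D_v f p = 0.
Proof.
move=> r0 h; rewrite (derive_ext (g := fun l : C => f (p + l *: v)) (q := 0) (w := 1)).
  rewrite (derive_near (g := fun=> 0 : C) (1 : C) r0) ?derive_const // => x.
  by rewrite subr0; exact: h.
by move=> l; rewrite addr0 [p + _]addrC; congr (f (_ *: _ + _)); exact: (esym (mulr1 _)).
Qed.

Variables (a u : V2 -> C) (p0 : V2) (t1 : C) (r : R).
Hypothesis r0 : 0 < r.
Hypothesis da : forall x, nrm (x - p0) < r -> differentiable a x.
Hypothesis du : forall x, nrm (x - p0) < r -> differentiable u x.
Hypothesis Du : forall x, nrm (x - p0) < r -> Dop a u x = 0.
Hypothesis t1p : nrm (t1 - p0.1) < r.
Hypothesis u0 : forall z, nrm (z - p0.2) < r -> u (t1, z) = 0.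

Let B : set V2 := ball2 p0 r.
Let oB : open B := open_ball2 (p0 := p0) (r := r).
Let e1 : V2 := (1, 0).
Let e2 : V2 := (0, 1).

Lemma iter_dt_comm n x : B x ->
  iter n (@dt R) (dz u) x = dz (iter n (@dt R) u) x.
Proof.
have dD := derivation_D e1 oB.
have hu : holomorphic_on B u by move=> y; exact: du.
elim: n x => [//|n IH] x Bx; rewrite !iterS.
have [s s0 hs] := proj1 (open_nrm B) oB x Bx.
rewrite {1}/dt (derive_near e1 s0 (g := dz (iter n (@dt R) u))); last first.
  by move=> y /hs; exact: IH.
apply: (derive_comm e1 e2 s0) => y /hs By.
exact: (der_iter_hol dD n hu).
Qed.

(** On the slice t = [t1] every t-derivative vanishes, by induction: the Leibniz rule applied to
    [a * dz u] leaves z-derivatives of lower t-derivatives, which are already zero on the whole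
    slice. *)
Lemma iter_dt_flat n z : nrm (z - p0.2) < r -> iter n (@dt R) u (t1, z) = 0.
Proof.
have dD := derivation_D e1 oB.
have hu : holomorphic_on B u by move=> y; exact: du.
have ha : holomorphic_on B a by move=> y; exact: da.
have hz : holomorphic_on B (dz u) := hol_derive e2 oB hu.
move: n {-2}n (leqnn n) z; elim=> [|n IH] m.
  by rewrite leqn0 => /eqP-> z; exact: u0.
rewrite leq_eqVlt => /orP[/eqP->|mn] z zr; last exact: IH.
have Bz : B (t1, z) by apply/nrm_pairP.
rewrite iterSr (der_iter_eq dD n (G := fun x => a x * dz u x)) //; last first.
  by move=> x Bx; apply/eqP; rewrite -subr_eq0; apply/eqP; exact: Du.
rewrite (der_leibniz dD n ha hz) //; apply: big1 => i _.
rewrite [X in _ * X](_ : _ = 0) ?mulr0 //.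
rewrite (iter_dt_comm (n - i) Bz).
have s0 : 0 < r - nrm (z - p0.2) by rewrite subr_gt0.
apply: (derive_line0 s0) => l lr.
have -> : ((t1, z) : V2) + l *: ((0, 1) : V2) = (t1, z + l).
  by congr (_, _); rewrite /= ?scaler0 ?addr0 //; congr (_ + _); exact: mulr1.
apply: IH; first exact: leq_subr.
have lz : nrm (z + l - z) < r - nrm (z - p0.2) by rewrite addrAC subrr add0r.
by have := nrm_sub_le lz (lexx (nrm (z - p0.2))); rewrite subrK.
Qed.

(** Once the t-jet of [u] vanishes on the slice, the identity theorem on the t-line through
    [(t1, x.2)] reaches [x]. *)
Lemma transport_unique (M : R) x : (forall x, nrm (x - p0) < r -> nrm (u x) <= M) ->
  nrm (t1 - p0.1) < r / 2 -> nrm (x.2 - p0.2) < r / 2 -> nrm (x.1 - t1) < r / 2 / 8 ->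
  u x = 0.
Proof.
move=> uM t1p2 x2 x1.
have r20 : 0 < r / 2 by rewrite divr_gt0.
have E (l : C) : ((t1, x.2) : V2) + l *: e1 = (t1 + l, x.2).
  by congr (_, _); rewrite /= ?scaler0 ?addr0 //; congr (_ + _); exact: mulr1.
have inB (l : C) : nrm l < r / 2 -> nrm (((t1, x.2) : V2) + l *: e1 - p0) < r.
  move=> lr; rewrite E; apply/nrm_pairP; split => /=; last exact: lt_half.
  have lt : nrm (t1 + l - t1) < r / 2 by rewrite addrAC subrr add0r.
  by have := nrm_sub_lt lt t1p2; rewrite -splitr.
have := @flat_line _ _ u (t1, x.2) e1 (r / 2) M r20
  (fun l lr => du (inB l lr)) (fun l lr => uM _ (inB l lr)).
have B0 : B (t1, x.2) by apply/nrm_pairP; split; [exact: t1p|exact: lt_half].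
have [s s0 hs] := proj1 (open_nrm B) oB _ B0.
move/(_ (ex_intro2 _ _ s s0 (fun y ys => du (hs y ys)))).
move/(_ (fun j => iter_dt_flat j (lt_half r0 x2)) (x.1 - t1) x1).
by rewrite E addrC subrK -surjective_pairing.
Qed.

End Uniqueness.

Section StarArith.
Variable R : realType.
Implicit Types e L M x y f t s : R.

Lemma rad_gt0 L : 0 < L -> 0 < (8 * 8 * 8 * 4 * L)^-1.
Proof. by move=> L0; rewrite invr_gt0 !mulr_gt0. Qed.

Lemma rad_small L x : 0 < L -> x < (8 * 8 * 8 * 4 * L)^-1 + (8 * 8 * 8 * 4 * L)^-1 ->
  8 * 8 * 8 * L * x < 1.
Proof.
move=> L0; have P : 0 < 8 * 8 * 8 * L by rewrite !mulr_gt0.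
rewrite -(ltr_pM2l P) => h; apply: (lt_le_trans h).
have -> : 8 * 8 * 8 * L * ((8 * 8 * 8 * 4 * L)^-1 + (8 * 8 * 8 * 4 * L)^-1) = 2^-1.
  by field; rewrite gt_eqF.
by rewrite invf_le1 // ler1n.
Qed.

Lemma rad_e L e : 0 < L -> 8 <= e * L -> (8 * 8 * 8 * 4 * L)^-1 < e / 2.
Proof.
move=> L0 h; have P : 0 < 8 * 8 * 8 * 4 * L by rewrite !mulr_gt0.
rewrite -[_^-1]mul1r ltr_pdivrMr //.
have -> : e / 2 * (8 * 8 * 8 * 4 * L) = e * L * (8 * 8 * 8 * 2) by field.
by move: h; move: (e * L) => y; lra.
Qed.

Lemma weaken64 L x : 0 <= L * x -> 8 * 8 * 8 * L * x < 1 -> 8 * 8 * L * x < 1.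
Proof. by rewrite -[8 * 8 * 8 * L * x]mulrA -[8 * 8 * L * x]mulrA; move: (L * x) => t; lra. Qed.

Lemma weaken2 L x : 0 < L -> 0 <= x -> 8 * 8 * 8 * L * x < 1 -> 2 * x < L^-1.
Proof.
move=> L0 x0 h; rewrite -[L^-1]mul1r ltr_pdivlMr //.
have : 0 <= L * x by rewrite mulr_ge0 // ltW.
by move: h; rewrite -[8 * 8 * 8 * L * x]mulrA -[2 * x * L]mulrA [x * L]mulrC; move: (L * x) => t; lra.
Qed.

Lemma three_bound M x y f t : 0 <= M -> 0 <= t -> 8 * 8 * 8 * t < 1 -> x <= 4 * M * t -> f <= M -> y <= M ->
  x + f + y <= 3 * M.
Proof.
move=> M0 t0 t1 h1 h2 h3; have : M * (4 * t) <= M * 1 by apply: ler_wpM2l => //; lra.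
by rewrite mulrCA mulrA mulr1; move: (4 * M * t) h1 => z; lra.
Qed.

Lemma rad32 s x : 0 < s -> x < s / 8 / 4 -> x < s / 2. Proof. lra. Qed.

Lemma rad32D s x : x < s / 8 / 4 + s / 8 / 4 -> x < s / 2 / 8. Proof. lra. Qed.

End StarArith.

(** * Transport of functions to a slice t = t1 *)

Section Star.
Variable R : realType.
Local Notation C := (Cx R).
Local Notation V2 := (C * C)%type.
Local Notation V3 := (C * C * C)%type.
Variables (d : nat) (a : V2 -> C) (p0 : V2) (e A : R).
Hypotheses (e0 : 0 < e) (e1 : e <= 1) (A1 : 1 <= A).
Hypothesis ha : forall x, nrm (x - p0) < e -> differentiable a x /\ nrm (a x) <= A.

Lemma adm_scale (U : set V2) rho c (k : V2 -> C) : adm U rho c ->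
  (forall x, U x -> differentiable k x) -> adm U rho (fun n x => k x * c n x).
Proof.
move=> hc dk p Up; have [r [r0 rU dc cM]] := hc p Up.
have [r' r'0 hr'] := diff_cont (dk p Up) (ltr01 : 0 < 1 :> R).
exists (Num.min r r'); split; first by rewrite lt_min r0.
- by move=> x /lt_min2[/rU].
- move=> n x /lt_min2[xr _]; apply: dM_; last exact: dc.
  exact/dk/rU.
move=> s s0 sr; have [M hM] := cM s s0 sr.
exists ((nrm (k p) + 1) * M) => n x; move=> /lt_min2[xr xr'].
rewrite nrmM -[leLHS]mulrA -[leRHS]mulrA; apply: ler_pM; rewrite ?nrm_ge0 //.
- by rewrite mulr_ge0 ?nrm_ge0 // exprn_ge0 // ltW.
- by apply: ltW; exact: nrm_lt_add (hr' x xr').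
- exact: hM.
Qed.

Lemma star_room (l x y : R) : 8 * 8 * 8 * l * x < 1 -> y <= 4 * e * (l * x) -> y < e / 2.
Proof.
rewrite -[8 * 8 * 8 * _ * _]mulrA; move: (l * x) => t h2 h3.
have h4 : 8 * t < 1 by lra.
have : 0 < e * (1 - 8 * t) by rewrite mulr_gt0 // subr_gt0.
by move: h3; rewrite mulrBr mulr1 -[4 * e * t]mulrA [e * (8 * t)]mulrCA; move: (e * t) => x'; lra.
Qed.

Lemma sub_shift (x s y : C) : x + s - y = s - (y - x). Proof. ring. Qed.

Lemma star_alg (t w z b : C) : t = w + b * z -> t - w - b * z = 0.
Proof. by move=> ->; ring. Qed.

Lemma star_alg2 (w t b z : C) : w = t + - b * z -> t = w + b * z.
Proof. by move=> ->; ring. Qed.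

Lemma star_alg3 (t z t' z' b g : C) : t - b * z = 0 -> t' - b * z' = 0 ->
  t - g * t' - b * (z - g * z') = 0.
Proof.
move=> h1 h2; have -> : t - g * t' - b * (z - g * z') = t - b * z - g * (t' - b * z') by ring.
by rewrite h1 h2 mulr0 subr0.
Qed.

Let L := Lam d e A.

(* The Lie series [exp ((t1 - t) Dop)]: the function which is constant along the
   characteristics of [Dop] and equals [F] on the slice [t = t1]. *)
Definition star (t1 : C) (F : V2 -> C) : V2 -> C :=
  fun p => pser (fun n => iter n (Dop a) F) (p, t1 - p.1).

Lemma star_at t1 F z : star t1 F (t1, z) = F (t1, z).
Proof. by rewrite /star /= subrr pser0. Qed.

Section OneFunction.
Variables (F : V2 -> C) (M : R).
Hypothesis dF : forall y, nrm (y - p0) < e -> differentiable F y.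
Hypothesis FM : forall y, nrm (y - p0) < e -> nrm (F y) <= M.

Lemma star_near t1 p : nrm (p - p0) < e / 2 -> 8 * 8 * L * nrm (t1 - p.1) < 1 ->
  nrm (star t1 F p - F p) <= 4 * M * (L * nrm (t1 - p.1)).
Proof.
move=> pe lL; have ad := adm_Dop d e0 e1 A1 ha dF FM.
have M0 : 0 <= M by apply: le_trans (FM (y := p0) _); rewrite ?subrr ?nrm0 ?nrm_ge0.
exact: (pser_near e0 e1 A1 ad pe (fun n => Dop_bound d e0 e1 A1 ha n dF FM pe) M0 lL).
Qed.

(** The t-derivative acts on the coefficients and on the argument [t1 - p.1]. The second action
    shifts the series with a minus sign, and the shifted coefficients are [Dop] of the original
    ones, so everything cancels. *)
Lemma star_Dop t1 p : nrm (p - p0) < e / 2 -> 2 * nrm (t1 - p.1) < L^-1 ->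
  differentiable (star t1 F) p /\ Dop a (star t1 F) p = 0.
Proof.
move=> pe lL; have ad := adm_Dop d e0 e1 A1 ha dF FM.
set c := fun n => iter n (Dop a) F in ad.
pose g (x : V2) := t1 - x.1.
have [dP wP vP] := pser_diff (q := (p, g p)) ad pe lL.
have df1 := diff_fst (q := p) (did_ (V := C) p.1).
have dg : differentiable g p by apply: dB_; [exact: dcst_|exact: (proj1 df1)].
have Dg v : 'D_v g p = - v.1.
  have -> : 'D_v g p = 'D_v (fun=> t1) p - 'D_v (fun x : V2 => x.1) p.
    by apply: deriveB; apply: diff_derivable; [exact: dcst_|exact: (proj1 df1)].
  by rewrite derive_const sub0r (proj2 df1) derive_id.
have [ds D1] := derive_graph ((1, 0) : V2) (dP : differentiable (pser c) (p, g p)) dg.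
have [_ D2] := derive_graph ((0, 1) : V2) (dP : differentiable (pser c) (p, g p)) dg.
split; first exact: ds.
have E1 : dt (star t1 F) p = pser (fun n => 'D_((1, 0) : V2) (c n)) (p, g p) -
    pser (fun n => c n.+1) (p, g p).
  by rewrite [LHS]D1 Dg vP -/(dw3 (pser c) (p, g p)) wP mulN1r.
have E2 : dz (star t1 F) p = pser (fun n => 'D_((0, 1) : V2) (c n)) (p, g p).
  by rewrite [LHS]D2 Dg vP /= oppr0 mul0r addr0.
rewrite /Dop E1 E2; apply: star_alg.
have oB := open_ball2 (p0 := p0) (r := e / 2).
have adk : adm (ball2 p0 (e / 2)) L^-1 (fun n x => - a x * 'D_((0, 1) : V2) (c n) x).
  apply: (adm_scale (k := fun x => - a x)) => [|x xe]; first exact: adm_derive.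
  by apply: differentiableN; have [] := ha (lt_half e0 xe).
have := pser_add (q := (p, g p)) (adm_derive ((1, 0) : V2) ad) adk pe lL.
rewrite (pser_scale (q := (p, g p)) (fun x => - a x) (adm_derive ((0, 1) : V2) ad) pe lL).
have -> : (fun n x => 'D_((1, 0) : V2) (c n) x + - a x * 'D_((0, 1) : V2) (c n) x) =
    (fun n => c n.+1).
  by apply/funext => n; apply/funext => x; rewrite /c iterS /Dop mulNr.
exact: star_alg2.
Qed.

End OneFunction.

(* The second coordinate of the point where the characteristic through [p] meets the
   slice [t = t1]. *)
Definition pstar (t1 : C) (p : V2) : C := p0.2 + star t1 (fun x => x.2 - p0.2) p.

Lemma pstar_near t1 p : nrm (p - p0) < e / 2 -> 8 * 8 * L * nrm (t1 - p.1) < 1 ->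
  nrm (pstar t1 p - p.2) <= 4 * e * (L * nrm (t1 - p.1)).
Proof.
move=> pe lL.
have -> : pstar t1 p - p.2 = star t1 (fun x => x.2 - p0.2) p - (p.2 - p0.2).
  exact: sub_shift.
apply: star_near pe lL => y ye; last by apply: ltW; case: (proj1 (nrm_pairP _ _) ye).
apply: dB_; last exact: dcst_.
by have [] := diff_snd (q := y) (did_ (V := C) y.2).
Qed.

(** Two t-coordinates within [srad] of that of [p0] differ by less than [2 * srad], which makes the
    product with [8 * 8 * 8 * L] at most 1/2: the characteristics then stay inside the ball of
    radius [e]. *)
Definition srad : R := (8 * 8 * 8 * 4 * L)^-1.

Let L0 : 0 < L := Lam0 d e0 e1 A1.

Lemma srad_gt0 : 0 < srad. Proof. exact: rad_gt0 L0. Qed.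

Section Factor.
Variables (F : V2 -> C) (M : R) (t1 : C).
Hypothesis dF : forall y, nrm (y - p0) < e -> differentiable F y.
Hypothesis FM : forall y, nrm (y - p0) < e -> nrm (F y) <= M.
Hypothesis t1p : nrm (t1 - p0.1) < srad.

Let sre : srad < e / 2 := rad_e L0 (Lam_gt d e0 e1 A1).

Lemma t1_near p : nrm (p - p0) < srad ->
  [/\ nrm (p - p0) < e / 2, 8 * 8 * 8 * L * nrm (t1 - p.1) < 1,
   8 * 8 * L * nrm (t1 - p.1) < 1, 2 * nrm (t1 - p.1) < L^-1 &
   nrm ((t1, pstar t1 p) - p0) < e].
Proof.
move=> pr; have pe := lt_trans pr sre.
have [h1 h2] := proj1 (nrm_pairP _ _) pr.
have q1 : 8 * 8 * 8 * L * nrm (t1 - p.1) < 1.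
  apply: (rad_small L0); apply: (nrm_sub_lt t1p); rewrite nrmB; exact: h1.
have Lx0 : 0 <= L * nrm (t1 - p.1) by rewrite mulr_ge0 ?nrm_ge0 // ltW.
have q2 := weaken64 Lx0 q1.
split=> //; first exact: weaken2 L0 (nrm_ge0 _) q1.
apply/nrm_pairP; split => /=; first exact: lt_half e0 (lt_trans t1p sre).
have h3 := star_room q1 (pstar_near pe q2).
by have := nrm_sub_lt h3 (lt_trans h2 sre : nrm (p.2 - p0.2) < e / 2); rewrite -splitr.
Qed.

Lemma pstar_Dop p : nrm (p - p0) < srad ->
  differentiable (pstar t1) p /\ Dop a (pstar t1) p = 0.
Proof.
move=> pr; have [pe q1 q2 q3 q4] := t1_near pr.
have d2 y : differentiable (fun x : V2 => x.2 - p0.2) y.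
  apply: dB_; last exact: dcst_.
  by have [] := diff_snd (q := y) (did_ (V := C) y.2).
have b2 y : nrm (y - p0) < e -> nrm (y.2 - p0.2) <= e.
  by move=> ye; apply: ltW; case: (proj1 (nrm_pairP _ _) ye).
have [ds Ds] := star_Dop (fun y _ => d2 y) b2 pe q3.
have dc := dcst_ (p0.2 : C) p.
split; first exact: dD_.
have E v : 'D_v (pstar t1) p = 'D_v (star t1 (fun x => x.2 - p0.2)) p.
  by rewrite [LHS](derive_add v dc ds) derive_const add0r.
by move: Ds; rewrite /Dop /dt /dz !E.
Qed.

(** Both sides are annihilated by [Dop] and agree on the slice, so they coincide by
    [transport_unique]. This is the reduction to one variable: a transported function depends on [p]
    only through [pstar t1 p]. *)
Lemma star_factor p : nrm (p - p0) < srad / 8 / 4 -> nrm (t1 - p0.1) < srad / 8 / 4 ->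
  star t1 F p = F (t1, pstar t1 p).
Proof.
move=> ps ts.
pose u x := star t1 F x - F (t1, pstar t1 x).
suff : u p = 0 by move=> /eqP; rewrite subr_eq0 => /eqP.
have M0 : 0 <= M by apply: le_trans (FM (y := p0) _); rewrite ?subrr ?nrm0 ?nrm_ge0.
have dline x : nrm (x - p0) < srad -> differentiable (fun z : C => F (t1, z)) (pstar t1 x).
  move=> /t1_near[_ _ _ _ q4].
  apply: (@dcomp_ _ _ V2 (fun z : C => (t1, z)) F); last exact: dF q4.
  by apply: (@differentiable_pair _ _ _ _ (fun=> t1) id); [exact: dcst_|exact: did_].
have dcomp x : nrm (x - p0) < srad -> differentiable (fun x => F (t1, pstar t1 x)) x.
  move=> xr; apply: (@dcomp_ _ _ C (pstar t1) (fun z => F (t1, z))); last exact: dline.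
  by have [] := pstar_Dop xr.
have s0 := srad_gt0.
apply: (@transport_unique _ a u p0 t1 srad s0 _ _ _ _ _ (3 * M)).
- by move=> x xr; have [xe _ _ _ _] := t1_near xr; have [] := ha (lt_half e0 xe).
- move=> x xr; have [xe _ _ q3 _] := t1_near xr; apply: dB_; last exact: dcomp.
  by have [] := star_Dop dF FM xe q3.
- move=> x xr; have [xe _ _ q3 _] := t1_near xr.
  have [d1 D1] := star_Dop dF FM xe q3; have [d2 D2] := pstar_Dop xr.
  have dB v : 'D_v u x = 'D_v (star t1 F) x - 'D_v (fun x => F (t1, pstar t1 x)) x.
    by apply: deriveB; apply: diff_derivable => //; exact: dcomp.
  have c1 := derive_chain ((1, 0) : V2) d2 (dline x xr).
  have c2 := derive_chain ((0, 1) : V2) d2 (dline x xr).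
  rewrite /Dop /dt /dz (dB (1, 0)) (dB (0, 1)) c1 c2.
  exact: star_alg3 D1 D2.
- exact: t1p.
- move=> z zr; rewrite /u star_at.
  have -> : pstar t1 (t1, z) = z by rewrite /pstar star_at /= addrC subrK.
  by rewrite subrr.
- move=> x xr; have [xe q1 q2 _ q4] := t1_near xr.
  have h1 := star_near dF FM xe q2.
  apply: (le_trans (nrmD _ _)); rewrite nrmN -(subrK (F x) (star t1 F x)).
  have h0 : 0 <= L * nrm (t1 - x.1) by rewrite mulr_ge0 ?nrm_ge0 // ltW // Lam0.
  apply: (le_trans (lerD (nrmD _ _) (lexx _))).
  apply: (three_bound M0 h0 _ h1); [by rewrite mulrA| |exact: FM].
  exact: FM (lt_half e0 xe).
- exact: rad32 s0 ts.
- have [_ h] := proj1 (nrm_pairP _ _) ps.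
  exact: rad32 s0 h.
- have [h _] := proj1 (nrm_pairP _ _) ps; rewrite nrmB in ts.
  exact: rad32D (nrm_sub_lt (h : nrm (p.1 - p0.1) < _) ts).
Qed.

End Factor.
End Star.

(** * Quotients of holomorphic functions of one variable *)

Section Ratio.
Variable R : realType.
Local Notation C := (Cx R).

Lemma iter_derive_pow m j (c z : C) : (j <= m)%N ->
  nderive (1 : C) j (fun w : C => c * (w ^+ m / m`!%:R)) z = c * (z ^+ (m - j) / (m - j)`!%:R).
Proof.
elim: j z => [|j IH] z jm; first by rewrite subn0.
pose g (w : C) : C := w ^+ (m - j) / (m - j)`!%:R.
have dg : differentiable g z by apply: dM_; [apply: dX_; exact: did_|exact: dcst_].
rewrite /nderive iterS (derive_near (g := fun w => c * g w) (1 : C) (ltr01 : 0 < 1 :> R)).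
  rewrite derive_mul // derive_const mul0r add0r /g; congr (_ * _).
  by rewrite -(subnSK jm) derive_pow_fact.
by move=> x _; apply: IH; exact: ltnW.
Qed.

(** Subtracting the Taylor monomial of order [m] leaves a function whose derivatives up to order [m]
    vanish at 0, to which [flat_derive] applies. *)
Lemma asymptotic (f : C -> C) (r : R) m : 0 < r ->
  (forall z, nrm z < r -> differentiable f z) ->
  (forall j, (j < m)%N -> nderive (1 : C) j f 0 = 0) ->
  exists K d : R, [/\ 0 <= K, 0 < d & forall z, nrm z < d ->
    nrm (f z - nderive (1 : C) m f 0 * (z ^+ m / m`!%:R)) <= K * nrm z ^+ m.+1].
Proof.
move=> r0 df f0; set c := nderive _ m f 0.
pose q := fun w : C => w ^+ m / m`!%:R.
have dq z : differentiable q z by apply: dM_; [apply: dX_; exact: did_|exact: dcst_].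
pose U := [set z : C | nrm z < r].
have oU : open U.
  apply/open_nrm => p pr; exists (r - nrm p); first by rewrite subr_gt0.
  by move=> z zp; have := nrm_lt_add zp; rewrite addrC subrK.
have dD := derivation_D (1 : C) oU.
have U0 : U 0 by rewrite /U /= nrm0.
pose g z := f z - c * q z.
have dg z : nrm z < r -> differentiable g z.
  by move=> zr; apply: dB_; [exact: df|apply: dM_; [exact: dcst_|exact: dq]].
have hcq : holomorphic_on U (fun z => c * q z) by move=> z _; apply: dM_; [exact: dcst_|exact: dq].
have gj j : (j < m.+1)%N -> nderive (1 : C) j g 0 = 0.
  move=> jm.
  have E : nderive (1 : C) j f 0 = nderive (1 : C) j g 0 + nderive (1 : C) j (fun z => c * q z) 0.
    rewrite /nderive -(der_iter_add dD j _ hcq) //.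
    by apply: (der_iter_eq dD) => // z _; rewrite /g subrK.
  move: E; rewrite iter_derive_pow //; move: jm; rewrite ltnS leq_eqVlt.
  case/orP => [/eqP->|jm].
    by rewrite subnn expr0 fact0 divr1 mulr1 -/c -{1}[c]add0r => /addIr.
  by rewrite f0 // expr0n subn_eq0 leqNgt jm mul0r mulr0 addr0.
have := @flat_derive _ _ g 0 (1 : C) r m.+1 r0.
case=> [x||K [dl [d0 h]]]; [by rewrite subr0; exact: dg|exact: gj|].
exists `|K|, dl; split=> // z zd; have := h z zd.
have -> : 0 + z *: (1 : C) = z by rewrite add0r; exact: mulr1.
move/le_trans; apply; apply: ler_wpM2r; [by rewrite exprn_ge0 ?nrm_ge0|exact: ler_norm].
Qed.

Lemma le_small (x y K : R) :
  (forall e, 0 < e -> exists2 t, (0 <= t) && (t < e) & x <= y + K * t) -> x <= y.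
Proof.
move=> h; rewrite leNgt; apply/negP => xp.
have K0 : 0 < `|K| + 1 by rewrite ltr_wpDl.
have xy0 : 0 < x - y by rewrite subr_gt0.
have [t /andP[t0 tx] xt] := h ((x - y) / (`|K| + 1)) (divr_gt0 xy0 K0).
move: tx; rewrite ltr_pdivlMr // ltNge => /negP; apply.
rewrite lerBlDr; apply: (le_trans xt); rewrite addrC lerD2r mulrC; apply: ler_wpM2l => //.
by apply: (le_trans (ler_norm K)); rewrite lerDl.
Qed.

Lemma ratio_step (b g h c K K' t f : R) m : 0 < t ^+ m -> h <= 2 * g ->
  b * (t ^+ m / f) <= h + K * t ^+ m.+1 -> g <= c * t ^+ m + K' * t ^+ m.+1 ->
  b / f <= 2 * c + (K + 2 * K') * t.
Proof.
move=> t0 hg h1 h2; rewrite -(ler_pM2r t0).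
have -> : b / f * t ^+ m = b * (t ^+ m / f) by rewrite mulrAC -mulrA.
apply: (le_trans h1); move: h2; rewrite !exprS; move: (t ^+ m) => y.
rewrite mulrDl -!mulrA; lra.
Qed.

Lemma ratio_final (b c K K' t T f g : R) : 0 <= T -> 0 < f -> b <= 2 * c ->
  t * (3 * K + K' + 1) < c / f -> 0 <= t -> c * (T / f) <= g + K * (t * T) ->
  b * (T / f) + K' * (t * T) <= 3 * g.
Proof.
move=> T0 f0 bc tc t0 cg.
have Tf : 0 <= T / f by rewrite divr_ge0 // ltW.
have h1 : b * (T / f) <= 2 * c * (T / f) by rewrite ler_wpM2r.
have h2 : t * (3 * K + K' + 1) * T <= c / f * T by rewrite ler_wpM2r // ltW.
have tT : 0 <= t * T by rewrite mulr_ge0.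
move: h2; rewrite [c / f * T]mulrAC -[c * T / f]mulrA.
have -> : t * (3 * K + K' + 1) * T = 3 * (K * (t * T)) + K' * (t * T) + t * T by ring.
move: h1 cg tT; rewrite -mulrA; move: (c * (T / f)) (K * (t * T)) (K' * (t * T)) (t * T) (b * (T / f)).
by move=> v1 v2 v3 v4 v5; lra.
Qed.

Lemma pow_le1 (t : R) j k : (j <= k)%N -> 0 <= t -> t <= 1 -> t ^+ k <= t ^+ j.
Proof. by move=> jk t0 t1; apply: ler_wiXn2l. Qed.

(** This is the quantitative form of the fact that [h / g] has a limit at 0 in the Riemann sphere:
    if some values near 0 are at most 2, the limit is at most 2 and all values near 0 are at most
    3. *)
Lemma ratio1 (g h : C -> C) (r : R) : 0 < r ->
  (forall z, nrm z < r -> differentiable g z) ->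
  (forall z, nrm z < r -> differentiable h z) ->
  (exists j, nderive (1 : C) j g 0 != 0) ->
  (forall e, 0 < e -> exists z, [/\ nrm z < e, g z != 0 & nrm (h z) <= 2 * nrm (g z)]) ->
  exists2 e : R, 0 < e & forall z, nrm z < e -> nrm (h z) <= 3 * nrm (g z).
Proof.
move=> r0 dg dh gex seq; have [k gk gmin] := ex_minnP gex.
have gj j : (j < k)%N -> nderive (1 : C) j g 0 = 0.
  by move=> jk; apply/eqP; apply: contraTT jk => /gmin; rewrite leqNgt.
have [K1 [d1 [K10 d10 G]]] := asymptotic r0 dg gj.
set c := nderive _ k g 0 in G gk.
have c0 := nrm_gt0 gk.
have k0 : 0 < k`!%:R :> R by rewrite ltr0n fact_gt0.
have low x y (u v : C) : nrm (u - v) <= x -> nrm u <= y -> nrm v <= y + x.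
  by move=> h1 h2; rewrite -(subrK u v) addrC; apply: (le_trans (nrmD _ _)); rewrite nrmB lerD.
have npow (b z : C) n : nrm (b * (z ^+ n / n`!%:R)) = nrm b * (nrm z ^+ n / n`!%:R).
  by rewrite !nrmM nrmV nrmX nrm_nat.
have zpos z : (0 < k)%N -> g z != 0 -> nrm z < d1 -> 0 < nrm z.
  move=> kp gz zd; apply: nrm_gt0; apply: contraNneq gz => z0.
  have := G z zd; rewrite z0 nrm0 !expr0n /= (gtn_eqF kp) mul0r mulr0 subr0 mulr0 => h0.
  by apply/eqP/nrm0_eq0/eqP; rewrite eq_le h0 nrm_ge0.
have gup z : nrm z < d1 -> nrm (g z) <= (nrm c / k`!%:R) * nrm z ^+ k + K1 * nrm z ^+ k.+1.
  move=> zd; rewrite -(subrK (c * (z ^+ k / k`!%:R)) (g z)) addrC.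
  apply: (le_trans (nrmD _ _)); rewrite npow mulrA -mulrAC.
  by rewrite lerD2l; exact: G.
(* Leading terms are compared at the points supplied by [seq]. This is used with [c' = 0] at orders
   below that of [g], and with the leading coefficient of [g] at order [k]. *)
have hb m K2 d2 (b : C) c' K' : 0 < d2 ->
   (forall z, nrm z < d2 -> nrm (h z - b * (z ^+ m / m`!%:R)) <= K2 * nrm z ^+ m.+1) ->
   (forall z, nrm z < d1 -> nrm z < 1 -> nrm (g z) <= c' * nrm z ^+ m + K' * nrm z ^+ m.+1) ->
   (m <= k)%N -> nrm b / m`!%:R <= 2 * c'.
  move=> d20 H G' mk; apply: (@le_small _ _ (K2 + 2 * K')) => e ee.
  have [|z [ze gz hz]] := seq (Num.min (Num.min e 1) (Num.min d1 d2)).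
    by rewrite !lt_min ee ltr01 d10.
  move: ze => /lt_min2[/lt_min2[ze z1] /lt_min2[zd1 zd2]].
  exists (nrm z); first by rewrite nrm_ge0.
  apply: (ratio_step _ hz _ (G' z zd1 z1)); last by rewrite -npow; exact: low (H z zd2) (lexx _).
  case: m mk {H G'} => [_|m mk]; first by rewrite expr0.
  by apply: exprn_gt0; apply: zpos => //; exact: leq_ltn_trans mk.
(* A nonzero term of [h] of order below [k] would dominate [g] near 0, against [seq]. *)
have hj : forall j, (j < k)%N -> nderive (1 : C) j h 0 = 0.
  move=> j; have [n jn] := ubnP j; elim: n j jn => // n IH j; rewrite ltnS => jn jk.
  have [K2 [d2 [K20 d20 H]]] := asymptotic r0 dh (fun i ij => IH i (leq_trans ij jn) (ltn_trans ij jk)).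
  have := @hb j K2 d2 _ 0 (nrm c / k`!%:R + K1) d20 H; rewrite mulr0 => hb'.
  apply/nrm0_eq0/eqP; rewrite eq_le nrm_ge0 andbT.
  have j0 : 0 < j`!%:R :> R by rewrite ltr0n fact_gt0.
  rewrite -[leRHS](mul0r j`!%:R) -ler_pdivrMr //; apply: hb' => [z zd z1|]; last exact: ltnW.
  rewrite mul0r add0r; apply: (le_trans (gup z zd)); rewrite mulrDl; apply: lerD.
    apply: ler_wpM2l; first by rewrite divr_ge0 ?nrm_ge0 // ltW.
    exact: pow_le1 (nrm_ge0 z) (ltW z1).
  apply: ler_wpM2l => //; apply: pow_le1 (nrm_ge0 z) (ltW z1); exact: ltnW.
have [K2 [d2 [K20 d20 H]]] := asymptotic r0 dh hj.
set b := nderive _ k h 0 in H.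
have bc : nrm b <= 2 * nrm c.
  have := @hb k K2 d2 b (nrm c / k`!%:R) K1 d20 H (fun z zd _ => gup z zd) (leqnn k).
  by rewrite mulrA ler_pM2r // invr_gt0.
pose dl := Num.min (Num.min d1 d2) (nrm c / k`!%:R / (3 * K1 + K2 + 1)).
have P : 0 < 3 * K1 + K2 + 1 by move: K10 K20; lra.
exists dl; first by rewrite !lt_min d10 d20 !divr_gt0.
move=> z /lt_min2[/lt_min2[z1 z2]]; rewrite ltr_pdivlMr // => z3.
have g1 : nrm c * (nrm z ^+ k / k`!%:R) <= nrm (g z) + K1 * nrm z ^+ k.+1.
  by rewrite -npow; apply: low (G z z1) (lexx _).
have h1 : nrm (h z) <= nrm b * (nrm z ^+ k / k`!%:R) + K2 * nrm z ^+ k.+1.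
  rewrite -npow -(subrK (b * (z ^+ k / k`!%:R)) (h z)) addrC.
  by apply: (le_trans (nrmD _ _)); rewrite lerD2l; exact: H.
apply: (le_trans h1); move: g1; rewrite !exprS => g1.
exact: ratio_final (exprn_ge0 k (nrm_ge0 z)) k0 bc z3 (nrm_ge0 z) g1.
Qed.

End Ratio.

(** * The local dichotomy *)

Section DichotomyArith.
Variable R : realType.
Implicit Types e s x y z : R.

Lemma lt_div32 s x : 0 < s -> x < s / 32 -> x < s. Proof. lra. Qed.

Lemma z1_room e s L x y z t : 0 < e -> s < e / 2 -> 8 * 8 * 8 * L * t < 1 ->
  x < s / 32 -> y <= 4 * e * (L * t) -> z <= x + y -> z < e / 4 / 8.
Proof.
move=> e0 se h1 xs h2 h3; move: h1 h2; rewrite -[8 * 8 * 8 * L * t]mulrA.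
move: (L * t) => v h1 h2; have : 0 < e * (1 - 8 * 8 * 8 * v) by rewrite mulr_gt0 // subr_gt0.
have -> : e * (1 - 8 * 8 * 8 * v) = e - 8 * 8 * 2 * (4 * e * v) by ring.
move: h2; move: (4 * e * v) => w h2; lra.
Qed.

Lemma third_room e x y z : 0 < e -> x < e / 4 / 8 -> y < e / 4 -> z <= x + y -> z < e.
Proof. lra. Qed.

Lemma chi_room r x : 0 < r -> x < r / (8 * 8 * 2) -> 6 * 1 / (r / 2) * x < 1.
Proof.
move=> r0; rewrite ltr_pdivlMr // => h.
have -> : 6 * 1 / (r / 2) * x = 12 * x / r by field; rewrite gt_eqF.
by rewrite ltr_pdivrMr // mul1r; lra.
Qed.

Lemma chi_small r x : 0 < r -> x < r / (8 * 8 * 2) -> x <= r / 2 / 8.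
Proof. by move=> r0; rewrite ltr_pdivlMr // => h; lra. Qed.

Lemma lt_half32 s x : 0 < s -> x < s / 32 -> x < s / 2. Proof. lra. Qed.

Lemma div32_le s : 0 < s -> s / 32 <= s. Proof. lra. Qed.

Lemma div_half_lt s : 0 < s -> s / (8 * 8 * 8) < s /\ s / (8 * 8 * 4) < s / 2.
Proof. lra. Qed.

Lemma add_le2 x y : x <= y + 1 -> y < 1 -> x <= 2. Proof. lra. Qed.

Lemma add_le4 x y : x <= y + 1 -> y <= 3 -> x <= 4. Proof. lra. Qed.

Lemma gap_false x y : y < x + 1 -> x <= 4 -> 8 <= y -> False. Proof. lra. Qed.

Lemma above_open x : 10 < x -> exists2 k : R, 0 < k & forall y, y < x + k -> x < y + k -> 10 < y.
Proof. by move=> x10; exists (x - 10); [lra|move=> y _; lra]. Qed.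

Lemma below_open x : x < 1 -> exists2 k : R, 0 < k & forall y, y < x + k -> x < y + k -> y < 1.
Proof. by move=> x1; exists (1 - x); [lra|move=> y h _; move: h; lra]. Qed.

Lemma halves8 s : s / (8 * 8 * 8) + s / (8 * 8 * 8) = s / (8 * 8 * 4). Proof. by field. Qed.

Lemma halves4 s : s / (8 * 8 * 4) + s / (8 * 8 * 4) = s / (8 * 8 * 2). Proof. by field. Qed.

Lemma half_lt s : 0 < s -> s / 2 < s. Proof. lra. Qed.

Lemma lt1_le4 x : x < 1 -> x <= 4. Proof. lra. Qed.

Lemma gt10_le4 x : 10 < x -> (x <= 4) = false. Proof. by move=> h; apply/negbTE; rewrite -ltNge; lra. Qed.

End DichotomyArith.

Section Dichotomy.
Variable R : realType.
Local Notation C := (Cx R).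
Local Notation V2 := (C * C)%type.
Variables (d : nat) (a : V2 -> C) (a_ : nat -> V2 -> C).
Variables (p0 : V2) (e A : R).
Hypotheses (e0 : 0 < e) (e1 : e <= 1) (A1 : 1 <= A).
Hypothesis ha : forall x, nrm (x - p0) < e -> differentiable a x /\ nrm (a x) <= A.
Hypothesis ha_ : forall i x, (i <= d)%N -> nrm (x - p0) < e ->
  differentiable (a_ i) x /\ nrm (a_ i x) <= A.
Variables (X H G : V2 -> C) (B : R).
Hypothesis hG : forall x, nrm (x - p0) < e -> differentiable G x /\ nrm (G x) <= B.
Hypothesis hH : forall x, nrm (x - p0) < e -> differentiable H x /\ nrm (H x) <= B.
Hypothesis hX : forall x, nrm (x - p0) < e -> G x != 0 ->
  [/\ differentiable X x, pde_at d a a_ X x & H x = X x * G x].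

Let L := Lam d e A.
Let s := srad d e A.
Let s0 : 0 < s := srad_gt0 d e0 e1 A1.
Let L0 : 0 < L := Lam0 d e0 e1 A1.
Let se : s < e / 2 := rad_e L0 (Lam_gt d e0 e1 A1).
Let rho := s / 8 / 4.
Let rho0 : 0 < rho. Proof. by rewrite /rho !divr_gt0. Qed.
Let rhos : rho <= s. Proof. by rewrite /rho; move: s0; lra. Qed.
Let dG y : nrm (y - p0) < e -> differentiable G y. Proof. by move=> /hG[]. Qed.
Let bG y : nrm (y - p0) < e -> nrm (G y) <= B. Proof. by move=> /hG[]. Qed.
Let dH y : nrm (y - p0) < e -> differentiable H y. Proof. by move=> /hH[]. Qed.
Let bH y : nrm (y - p0) < e -> nrm (H y) <= B. Proof. by move=> /hH[]. Qed.

(** * The quotient H / G on one slice *)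

Section Slice.
Variable x1 : V2.
Hypothesis x1p : nrm (x1 - p0) < rho / 32.
Hypothesis Gx1 : G x1 != 0.
Let t1 : C := x1.1.

Let t1r : nrm (t1 - p0.1) < rho.
Proof. by apply: (lt_div32 rho0); have [] := proj1 (nrm_pairP _ _) x1p. Qed.

Let t1s : nrm (t1 - p0.1) < s.
Proof. exact: lt_le_trans t1r rhos. Qed.

Lemma star_slice_diff x : nrm (x - p0) < rho -> differentiable (star a t1 G) x.
Proof.
move=> xr; have xs := lt_le_trans xr rhos.
have [xe _ _ q3 _] := t1_near e0 e1 A1 ha t1s xs.
by have [] := star_Dop e0 e1 A1 ha dG bG xe q3.
Qed.

Lemma star_slice_bound x : nrm (x - p0) < rho -> nrm (star a t1 G x) <= B.
Proof.
move=> xr; have xs := lt_le_trans xr rhos.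
have [_ _ _ _ q4] := t1_near e0 e1 A1 ha t1s xs.
by rewrite (star_factor e0 e1 A1 ha dG bG t1s xr t1r); exact: bG.
Qed.

Lemma star_slice_dense x (r : R) : 0 < r -> nrm (x - p0) < rho / 32 ->
  exists2 y, nrm (y - x) < r & star a t1 G y != 0.
Proof.
move=> r0 xr; apply: (nonzero_dense rho0 star_slice_diff star_slice_bound x1p) => //.
by rewrite [x1]surjective_pairing star_at -surjective_pairing.
Qed.

(** The foot on the slice of the characteristic through [p0]. By continuity of [pstar], points near
    [p0] have their feet near [z1], which is therefore the base point for [ratio1]. *)
Let z1 : C := pstar a p0 t1 p0.

Let p00 : nrm (p0 - p0) < s. Proof. by rewrite subrr nrm0. Qed.

Let z1x1 : nrm (x1.2 - z1) < e / 4 / 8 /\ nrm (z1 - p0.2) < e / 4 / 8.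
Proof.
have [pe q1 q2 _ _] := t1_near e0 e1 A1 ha t1s p00.
have h := pstar_near e0 e1 A1 ha pe q2.
have [_ x2] := proj1 (nrm_pairP _ _) x1p.
have rs : rho / 32 <= s / 32 by rewrite ler_pM2r.
have x2s : nrm (x1.2 - p0.2) < s / 32 := lt_le_trans x2 rs.
split; apply: (z1_room e0 se q1 x2s h).
  by apply: (le_trans (nrm_triB _ p0.2 _)); rewrite [nrm (p0.2 - _)]nrmB.
by rewrite lerDr nrm_ge0.
Qed.

Let in_slice z : nrm z < e / 4 -> nrm ((t1, z1 + z) - p0) < e.
Proof.
move=> ze; apply/nrm_pairP; split => /=; first exact: lt_half e0 (lt_trans t1s se).
apply: (third_room e0 (proj2 z1x1) ze).
have -> : z1 + z - p0.2 = (z1 - p0.2) + z by rewrite addrAC.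
exact: nrmD.
Qed.

Let e40 : 0 < e / 4. Proof. by rewrite divr_gt0. Qed.

Let slice_diff (F : V2 -> C) : (forall y, nrm (y - p0) < e -> differentiable F y) ->
  forall z, nrm z < e / 4 -> differentiable (fun z => F (t1, z1 + z)) z.
Proof.
move=> dF z ze; apply: (@dcomp_ _ _ V2 (fun z : C => (t1, z1 + z)) F).
  apply: (@differentiable_pair _ _ _ _ (fun=> t1) (fun z => z1 + z)); first exact: dcst_.
  by apply: dD_; [exact: dcst_|exact: did_].
by apply: dF; exact: in_slice.
Qed.

(** [G] may vanish identically on the slice through [p0]. The slice is taken through a nearby [x1]
    with [G x1 != 0] instead, and is short enough for the identity theorem at [z1] to reach [x1]. *)
Lemma slice_not_flat : exists j, nderive (1 : C) j (fun z => G (t1, z1 + z)) 0 != 0.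
Proof.
apply: contrapT => nex; move/eqP: Gx1; apply.
have flat j : nderive (1 : C) j (fun z => G (t1, z1 + z)) 0 = 0.
  by apply: contrapT => /eqP h; apply: nex; exists j.
have E (l : C) : 0 + l *: (1 : C) = l by rewrite add0r; exact: mulr1.
have := @flat_line _ _ (fun z => G (t1, z1 + z)) 0 (1 : C) (e / 4) B e40.
have d1 (l : C) : nrm l < e / 4 -> differentiable (fun z => G (t1, z1 + z)) (0 + l *: (1 : C)).
  by rewrite E; exact: slice_diff.
have b1 (l : C) : nrm l < e / 4 -> nrm (G (t1, z1 + (0 + l *: (1 : C)))) <= B.
  by move=> le; rewrite E; apply: bG; exact: in_slice.
have n1 : exists2 r : R, 0 < r & forall x : C, nrm (x - 0) < r -> differentiable (fun z => G (t1, z1 + z)) x.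
  by exists (e / 4) => // x; rewrite subr0; exact: slice_diff.
move/(_ d1 b1 n1 flat (x1.2 - z1) (proj1 z1x1)).
by rewrite E addrC subrK -surjective_pairing.
Qed.

(** Points with [nrm (X x) < 1] have feet tending to [z1] at which the ratio of [H] to [G] is at
    most 2. By [ratio1] the ratio is at most 3 at all feet near [z1]. Going back along the
    characteristic costs at most 1, hence the bound 4. *)
Lemma slice_gap :
  (forall r : R, 0 < r -> exists x, [/\ nrm (x - p0) < r, G x != 0 & nrm (X x) < 1]) ->
  exists2 r : R, 0 < r & forall x, nrm (x - p0) < r -> G x != 0 -> star a t1 G x != 0 ->
    nrm (X x) < 8 -> nrm (X x) <= 4.
Proof.
move=> small.
have flow x : nrm (x - p0) < rho -> G x != 0 -> nrm (X x) < 8 ->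
   exists2 xi : C, H (t1, pstar a p0 t1 x) = xi * G (t1, pstar a p0 t1 x) & nrm (xi - X x) <= 1.
  move=> xr Gx X8; have xs := lt_le_trans xr rhos.
  have [xe _ q2 _ _] := t1_near e0 e1 A1 ha t1s xs.
  have Ux : UX p0 e X G x by split.
  have [xi E xiX] := flow_ratio e0 e1 A1 ha ha_ hG hH hX Ux q2.
  exists xi => //; rewrite -(star_factor e0 e1 A1 ha dH bH t1s xr t1r).
  by rewrite -(star_factor e0 e1 A1 ha dG bG t1s xr t1r).
have [dphi _] := pstar_Dop e0 e1 A1 ha t1s p00.
have [|k k0 hk] := @ratio1 _ (fun z => G (t1, z1 + z)) (fun z => H (t1, z1 + z)) (e / 4) e40
    (slice_diff dG) (slice_diff dH) slice_not_flat.
  move=> r r0.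
  have [k k0 hk] := diff_cont dphi r0.
  have m0 : 0 < Num.min (k / 2) (rho / 32) by rewrite lt_min !divr_gt0.
  have [x [xr Gx X1]] := small _ m0.
  move: xr => /lt_min2[xk xr].
  have xe : nrm (x - p0) < e.
    exact: lt_half e0 (lt_trans (lt_le_trans (lt_div32 rho0 xr) rhos) se).
  have [dX _ _] := hX xe Gx.
  have [k1 k10 hk1] := diff_cont (dG xe) (nrm_gt0 Gx).
  have X1' : 0 < 1 - nrm (X x) by rewrite subr_gt0.
  have [k2 k20 hk2] := diff_cont dX X1'.
  have rr : 0 < rho / 2 by rewrite divr_gt0.
  have k20' : 0 < k / 2 by rewrite divr_gt0.
  (* The point is moved slightly, keeping [nrm (X y) < 1], so that [G] does not vanish at its
     foot. *)
  have [|y] := @star_slice_dense x (Num.min (Num.min k1 k2) (Num.min (k / 2) (rho / 2))) _ xr.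
    by rewrite !lt_min k10 k20 k20' rr.
  move=> /lt_min2[/lt_min2[y1 y2] /lt_min2[yk yr]] Sy.
  have yr' : nrm (y - p0) < rho.
    have xr2 : nrm (x - p0) < rho / 2 by exact: lt_half32 rho0 xr.
    by have := nrm_sub_lt yr xr2; rewrite -splitr.
  have yk' : nrm (y - p0) < k by have := nrm_sub_lt yk xk; rewrite -splitr.
  have Gy : G y != 0.
    by apply: contraTneq (hk1 y y1) => ->; rewrite sub0r nrmN ltxx.
  have Xy : nrm (X y) < 1 by have := nrm_lt_add (hk2 y y2); rewrite addrC subrK.
  have Xy8 : nrm (X y) < 8 by apply: (lt_trans Xy); rewrite ltr1n.
  have [xi E xiX] := flow y yr' Gy Xy8.
  have zE : z1 + (pstar a p0 t1 y - z1) = pstar a p0 t1 y by rewrite addrC subrK.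
  have gn : G (t1, pstar a p0 t1 y) != 0.
    by rewrite -(star_factor e0 e1 A1 ha dG bG t1s yr' t1r).
  have hn : nrm (H (t1, pstar a p0 t1 y)) <= 2 * nrm (G (t1, pstar a p0 t1 y)).
    by rewrite E nrmM; apply: ler_wpM2r (nrm_ge0 _) _ _ _; exact: add_le2 (nrm_le_add xiX) Xy.
  have gE (F : V2 -> C) := congr1 (fun w => F (t1, w)) zE.
  have gn' : G (t1, z1 + (pstar a p0 t1 y - z1)) != 0 by rewrite (gE G).
  have hn' : nrm (H (t1, z1 + (pstar a p0 t1 y - z1))) <= 2 * nrm (G (t1, z1 + (pstar a p0 t1 y - z1))).
    by rewrite (gE G) (gE H).
  exact: (ex_intro _ _ (And3 (hk y yk') gn' hn')).
have [k' k'0 hk'] := diff_cont dphi k0.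
exists (Num.min k' rho); first by rewrite lt_min k'0.
move=> x /lt_min2[xk xr] Gx Sx X8.
have [xi E xiX] := flow x xr Gx X8.
have := hk (pstar a p0 t1 x - z1) (hk' x xk); rewrite addrC subrK E nrmM.
rewrite -(star_factor e0 e1 A1 ha dG bG t1s xr t1r) ler_pM2r ?nrm_gt0 // => xi3.
rewrite nrmB in xiX; exact: add_le4 (nrm_le_add xiX) xi3.
Qed.

End Slice.

(** If values above 10 and below 1 both accumulate at [p0], the gap between 4 and 8 makes the
    indicator [chi] of [nrm (X x) <= 4] locally constant off the zeros of [G * S]. Being bounded and
    holomorphic there, it is Lipschitz by [schwarz_off], and cannot jump from 1 to 0 between close
    points. This plays the part of connectedness of the complement of an analytic set. *)
Lemma dichotomy : (forall r : R, 0 < r -> exists2 x, nrm (x - p0) < r & G x != 0) ->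
  exists2 r : R, 0 < r &
    (forall x, nrm (x - p0) < r -> G x != 0 -> nrm (X x) <= 10) \/
    (forall x, nrm (x - p0) < r -> G x != 0 -> 1 <= nrm (X x)).
Proof.
move=> Gne; apply: contrapT => nex.
have big r : 0 < r -> exists x, [/\ nrm (x - p0) < r, G x != 0 & 10 < nrm (X x)].
  move=> r0; apply: contrapT => nx; apply: nex; exists r => //; left => x xr Gx.
  by rewrite leNgt; apply/negP => h; apply: nx; exists x.
have small r : 0 < r -> exists x, [/\ nrm (x - p0) < r, G x != 0 & nrm (X x) < 1].
  move=> r0; apply: contrapT => nx; apply: nex; exists r => //; right => x xr Gx.
  by rewrite leNgt; apply/negP => h; apply: nx; exists x.
have r320 : 0 < rho / 32 by rewrite divr_gt0.
have [x1 x1p Gx1] := Gne _ r320.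
have [r2' r2'0 gap] := slice_gap x1p Gx1 small.
pose r2 := Num.min r2' (rho / 32).
have r20 : 0 < r2 by rewrite lt_min r2'0.
have r2e : r2 <= e.
  apply: ltW; apply: (le_lt_trans _ (lt_half e0 se)); apply: (le_trans _ rhos).
  by rewrite /r2 ge_min; apply/orP; right; exact: div32_le.
pose S := star a x1.1 G.
pose O := [set x | [/\ nrm (x - p0) < r2, G x != 0 & S x != 0]].
have inr2 x : nrm (x - p0) < r2 -> [/\ nrm (x - p0) < r2', nrm (x - p0) < rho / 32 & nrm (x - p0) < e].
  move=> xr; split; last exact: lt_le_trans xr r2e.
    by move: xr => /lt_min2[].
  by move: xr => /lt_min2[].
have Odense x k : nrm (x - p0) < r2 -> G x != 0 -> 0 < k ->
    exists y, [/\ nrm (y - x) < k, G y != 0 & S y != 0].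
  move=> xr Gx k0; have [_ xrho xe] := inr2 x xr.
  have [k1 k10 hk1] := diff_cont (dG xe) (nrm_gt0 Gx).
  have [|y] := @star_slice_dense x1 x1p Gx1 x (Num.min k k1) _ xrho; first by rewrite lt_min k0.
  move=> /lt_min2[yk yk1] Sy; exists y; split=> //.
  by apply: contraTneq (hk1 y yk1) => ->; rewrite sub0r nrmN ltxx.
pose chi (x : V2) : C := if nrm (X x) <= 4 then 1 else 0.
have chi1 x : nrm (chi x) <= 1 by rewrite /chi; case: ifP; rewrite ?nrm1 ?nrm0.
have gapO x : O x -> (nrm (X x) <= 4) || (8 <= nrm (X x)).
  move=> [xr Gx Sx]; apply/orP; have [X8|X8] := ltP (nrm (X x)) 8; last by right.
  by left; have [xr' _ _] := inr2 x xr; exact: gap x xr' Gx Sx X8.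
have dS x : nrm (x - p0) < r2 -> differentiable S x.
  move=> /inr2[_ xr _]; apply: (star_slice_diff x1p); exact: lt_div32 rho0 xr.
have dchi x : O x -> differentiable chi x.
  move=> Ox; have [xr Gx Sx] := Ox; have [xr' xrho xe] := inr2 x xr.
  have [dX _ _] := hX xe Gx.
  have [k1 k10 hk1] := diff_cont dX (ltr01 : 0 < 1 :> R).
  have [k2 k20 hk2] := diff_cont (dG xe) (nrm_gt0 Gx).
  have [k3 k30 hk3] := diff_cont (dS x xr) (nrm_gt0 Sx).
  have k4 : 0 < r2 - nrm (x - p0) by rewrite subr_gt0.
  have [||h _] := @diff_near _ _ _ (fun=> chi x) chi x
     (Num.min (Num.min k1 k2) (Num.min k3 (r2 - nrm (x - p0)))) _ _ (dcst_ (chi x) x) => //.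
    by rewrite !lt_min k10 k20 k30 k4.
  move=> y /lt_min2[/lt_min2[y1 y2] /lt_min2[y3 y4]].
  have Oy : O y.
    split.
    - by have := nrm_sub_le y4 (lexx (nrm (x - p0))); rewrite subrK.
    - by apply: contraTneq (hk2 y y2) => ->; rewrite sub0r nrmN ltxx.
    - by apply: contraTneq (hk3 y y3) => ->; rewrite sub0r nrmN ltxx.
  have n1 := nrm_lt_add (hk1 y y1).
  have h1 := hk1 y y1; rewrite nrmB in h1; have n2 := nrm_lt_add h1.
  have := gapO y Oy; have := gapO x Ox; rewrite /chi.
  case: (leP (nrm (X x)) 4) => [X4 _|X4 /= X8].
    by case: (leP (nrm (X y)) 4) => [//|Y4 /= Y8]; case: (gap_false n1 X4 Y8).
  by case: (leP (nrm (X y)) 4) => [Y4 _|//]; case: (gap_false n2 Y4 X8).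
have d20 : 0 < r2 / (8 * 8 * 8) by rewrite divr_gt0 // !mulr_gt0.
(* An open condition on [nrm (X x)] survives a small move to a point where [S] is nonzero as
   well. *)
have pick (P : R -> Prop) : (exists x, [/\ nrm (x - p0) < r2 / (8 * 8 * 8), G x != 0 & P (nrm (X x))]) ->
   (forall u, P u -> exists2 k : R, 0 < k & forall v, v < u + k -> u < v + k -> P v) ->
   exists x, [/\ nrm (x - p0) < r2 / (8 * 8 * 4), O x & P (nrm (X x))].
  move=> [x [xr Gx Px]] oP; have xr2 : nrm (x - p0) < r2.
    exact: lt_trans xr (proj1 (div_half_lt r20)).
  have [_ _ xe] := inr2 x xr2; have [dX _ _] := hX xe Gx.
  have [k k0 hk] := oP _ Px.
  have [k1 k10 hk1] := diff_cont dX k0.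
  have [|y [yk Gy Sy]] := @Odense x (Num.min k1 (r2 / (8 * 8 * 8))) xr2 Gx; first by rewrite lt_min k10.
  move: yk => /lt_min2[yk yr].
  have yp : nrm (y - p0) < r2 / (8 * 8 * 4).
    by rewrite -halves8; exact: nrm_sub_lt yr xr.
  have yr2 : nrm (y - p0) < r2 by exact: lt_trans yp (lt_trans (proj2 (div_half_lt r20)) (half_lt r20)).
  have h1 := hk1 y yk; have h2 := nrm_lt_add h1; rewrite nrmB in h1.
  exact: (ex_intro _ y (And3 yp (And3 yr2 Gy Sy) (hk _ h2 (nrm_lt_add h1)))).
have [x [xp Ox Xx]] : exists x, [/\ nrm (x - p0) < r2 / (8 * 8 * 4), O x & 10 < nrm (X x)].
  apply: (pick (fun u => 10 < u)); first exact: big.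
  exact: above_open.
have [y [yp Oy Xy]] : exists x, [/\ nrm (x - p0) < r2 / (8 * 8 * 4), O x & nrm (X x) < 1].
  apply: (pick (fun u => u < 1)); first exact: small.
  exact: below_open.
have xy : nrm (x - y) < r2 / (8 * 8 * 2).
  by rewrite -halves4; rewrite nrmB in yp; exact: nrm_sub_lt xp yp.
have r22 : 0 < r2 / 2 by rewrite divr_gt0.
have inO z : nrm (z - y) < r2 / 2 -> nrm (z - p0) < r2.
  move=> zy; have y2 : nrm (y - p0) < r2 / 2.
    exact: lt_trans yp (proj2 (div_half_lt r20)).
  by have := nrm_sub_lt zy y2; rewrite -splitr.
have := @schwarz_off _ _ chi (fun z => G z * S z) y x (r2 / 2) 1 r22.
have dGS z : nrm (z - y) < r2 / 2 -> differentiable (fun z => G z * S z) z.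
  move=> /inO zr; have [_ _ ze] := inr2 z zr; apply: dM_; [exact: dG|exact: dS].
have OGS z : nrm (z - y) < r2 / 2 -> G z * S z != 0 -> O z.
  by move=> /inO zr; rewrite mulf_eq0 negb_or => /andP[Gz Sz]; split.
have c1 z : nrm (z - y) < r2 / 2 -> G z * S z != 0 -> differentiable chi z.
  by move=> zy zn; exact: dchi (OGS z zy zn).
have c2 z : nrm (z - y) < r2 / 2 -> G z * S z != 0 -> nrm (chi z) <= 1 by [].
have Gx : G x * S x != 0 by have [_ h1 h2] := Ox; rewrite mulf_neq0.
have Gy : G y * S y != 0 by have [_ h1 h2] := Oy; rewrite mulf_neq0.
move/(_ dGS c1 c2 Gy Gx (chi_small r20 xy)).
have := chi_room r20 xy; move=> h1 h2; have := le_lt_trans h2 h1.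
have -> : chi x = 0.
  by rewrite /chi gt10_le4.
have -> : chi y = 1 by rewrite /chi lt1_le4.
by rewrite sub0r nrmN nrm1 ltxx.
Qed.

End Dichotomy.

Section LocalArith.
Variable R : realType.
Implicit Types e s x y z A p rho r c : R.

Lemma growth_const A e p x : 0 < A -> 0 < e -> 0 < p ->
  x / (p / (2 * A) * (p * e / (32 * A ^+ 2))) = x / ((2 * A)^-1 * (e / (32 * A ^+ 2))) / p ^+ 2.
Proof. by move=> A0 e0 p0; field; rewrite !gt_eqF. Qed.

Lemma step_small p e A : 0 <= p -> p <= A ^+ 2 -> 0 < e -> e <= 1 -> 1 <= A ->
  p * e / (32 * A ^+ 2) <= e / 2 / 8 /\ p * e / (32 * A ^+ 2) <= 1.
Proof.
move=> p0 pA e0 e1 A1; have A2 : 0 < A ^+ 2 by rewrite exprn_gt0 //; lra.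
have h : p * e <= A ^+ 2 * e by rewrite ler_wpM2r // ltW.
have h2 : p * e / (32 * A ^+ 2) <= e / 32.
  have P : 0 < 32 * A ^+ 2 by rewrite mulr_gt0.
  rewrite ler_pdivrMr // (_ : e / 32 * (32 * A ^+ 2) = A ^+ 2 * e) //.
  by field.
by split; move: h2; lra.
Qed.

Lemma lip_room p e A x y z : 0 < e -> 1 <= A -> 0 <= p -> x < p * e / (32 * A ^+ 2) ->
  y <= 6 * A / (e / 2) * x -> p <= A * z -> p / (2 * A) <= z - y.
Proof.
move=> e0 A1 p0 xs yx pz; have A0 : 0 < A by lra.
have h : 6 * A / (e / 2) * x <= 6 * A / (e / 2) * (p * e / (32 * A ^+ 2)).
  by rewrite ler_wpM2l ?divr_ge0 ?(ltW xs) //; lra.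
have E : 6 * A / (e / 2) * (p * e / (32 * A ^+ 2)) = 3 / 4 * (p / (2 * A)).
  by field; rewrite !gt_eqF.
have E2 : p / (2 * A) * 2 <= z.
  rewrite (_ : p / (2 * A) * 2 = p / A); last by field; rewrite gt_eqF.
  by rewrite ler_pdivrMr // mulrC.
have : 0 <= p / (2 * A) by rewrite divr_ge0 //; lra.
by move: h E2; rewrite E; move: (p / (2 * A)) => w; lra.
Qed.

Lemma case_low r rho x : 0 < r -> 1 <= rho -> x < r / (8 * 8 * 8) / rho ->
  x <= r / 2 / 8 /\ 6 * 10 / (r / 2) * x <= rho / 2.
Proof.
move=> r0 rho1 h; have q0 : 0 < rho by lra.
have h1 : x < r / (8 * 8 * 8).
  apply: (lt_le_trans h); rewrite ler_pdivrMr // ler_peMr //.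
  by rewrite divr_ge0 // ltW.
split; first by move: h1 r0; lra.
have -> : 6 * 10 / (r / 2) * x = 120 * x / r by field; rewrite gt_eqF.
have h3 : r * 1 <= r * rho by rewrite ler_wpM2l // ltW.
by rewrite ler_pdivrMr // mulrAC [rho * r]mulrC; move: h1 h3; move: (r * rho) => w; lra.
Qed.

Lemma case_high r rho x y z : 0 < r -> 1 <= rho -> x < r / (8 * 8 * 8) / rho ->
  0 < y -> 0 < z -> y <= rho / 2 -> y^-1 <= z^-1 + 6 * 1 / (r / 2) * x -> z <= rho.
Proof.
move=> r0 rho1 h y0 z0 yr; have q0 : 0 < rho by lra.
have h2 : 6 * 1 / (r / 2) * x <= rho^-1.
  apply: (@le_trans _ _ (6 * 1 / (r / 2) * (r / (8 * 8 * 8) / rho))).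
    by rewrite ler_wpM2l ?divr_ge0 ?(ltW h) //; lra.
  have -> : 6 * 1 / (r / 2) * (r / (8 * 8 * 8) / rho) = 12 / (8 * 8 * 8) * rho^-1.
    by field; rewrite !gt_eqF.
  have : 0 <= rho^-1 by rewrite invr_ge0 ltW.
  by move: (rho^-1) => w; lra.
have h3 : 2 * rho^-1 <= y^-1.
  have -> : 2 * rho^-1 = (rho / 2)^-1 by field; rewrite gt_eqF.
  by rewrite lef_pV2 // posrE divr_gt0.
move=> h4; have : rho^-1 <= z^-1 by lra.
by rewrite lef_pV2.
Qed.

End LocalArith.

(** * Local bounds on X off the zeros of P = F a_d *)

Section Local.
Variable R : realType.
Local Notation C := (Cx R).
Local Notation V2 := (C * C)%type.
Variables (d : nat) (a : V2 -> C) (a_ : nat -> V2 -> C) (F X : V2 -> C).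
Variables (p0 : V2) (e A : R).
Hypotheses (d2 : (2 <= d)%N) (e0 : 0 < e) (e1 : e <= 1) (A1 : 1 <= A).
Hypothesis ha : forall x, nrm (x - p0) < e -> differentiable a x /\ nrm (a x) <= A.
Hypothesis ha_ : forall i x, (i <= d)%N -> nrm (x - p0) < e ->
  differentiable (a_ i) x /\ nrm (a_ i x) <= A.
Hypothesis hF : forall x, nrm (x - p0) < e -> differentiable F x /\ nrm (F x) <= A.
Hypothesis hX : forall x, nrm (x - p0) < e -> F x != 0 ->
  differentiable X x /\ pde_at d a a_ X x.

Definition Pf (x : V2) : C := F x * a_ d x.

Let A0 : 0 < A. Proof. by apply: lt_le_trans A1. Qed.
Let e20 : 0 < e / 2. Proof. by rewrite divr_gt0. Qed.

Lemma Pf_diff x : nrm (x - p0) < e -> differentiable Pf x.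
Proof. by move=> xe; apply: dM_; [have [] := hF xe|have [] := ha_ (leqnn d) xe]. Qed.

Lemma Pf_le x : nrm (x - p0) < e ->
  [/\ nrm (Pf x) <= A ^+ 2, nrm (Pf x) <= A * nrm (F x) & nrm (Pf x) <= A * nrm (a_ d x)].
Proof.
move=> xe; have [_ F1] := hF xe; have [_ a1] := ha_ (leqnn d) xe.
rewrite /Pf nrmM expr2; split.
- by apply: ler_pM; rewrite ?nrm_ge0.
- by rewrite mulrC; apply: ler_wpM2r; rewrite ?nrm_ge0.
- by apply: ler_wpM2r; rewrite ?nrm_ge0.
Qed.

Definition KX : R := 20 * 20 * 4 * d%:R * A / ((2 * A)^-1 * (e / (32 * A ^+ 2))).

Lemma KX_ge0 : 0 <= KX.
Proof.
rewrite /KX divr_ge0 ?mulr_ge0 ?invr_ge0 ?mulr_ge0 ?exprn_ge0 ?ler0n ?(ltW A0) ?(ltW e0) //.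
Qed.

(** With p = [nrm (Pf q)], both [F] and [a_ d] are at least [p / A] at [q], and by Schwarz at least
    [p / (2 * A)] on a ball of radius proportional to p. So [growth] applies with [s] and [eta] both
    proportional to p, whence the exponent 2. *)
Lemma X_bound q : nrm (q - p0) < e / 2 -> Pf q != 0 -> nrm (X q) <= KX / nrm (Pf q) ^+ 2.
Proof.
move=> qe Pq; have qe' := lt_half e0 qe.
have [P1 P2 P3] := Pf_le qe'; have P0 := nrm_gt0 Pq.
set p := nrm (Pf q) in P0 P1 P2 P3 *.
have [s1 s2] := step_small (ltW P0) P1 e0 e1 A1.
set s := p * e / (32 * A ^+ 2) in s1 s2.
have s0 : 0 < s by rewrite /s divr_gt0 ?mulr_gt0 ?exprn_gt0.
have eta0 : 0 < p / (2 * A) by rewrite divr_gt0 ?mulr_gt0.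
have inB (y : V2) : nrm (y - q) < e / 2 -> nrm (y - p0) < e by exact: half_sub.
have lip (f : V2 -> C) x : (forall y, nrm (y - p0) < e -> differentiable f y /\ nrm (f y) <= A) ->
    p <= A * nrm (f q) -> nrm (x - q) < s -> p / (2 * A) <= nrm (f x).
  move=> hf pf xq.
  have l1 : nrm (x - q) <= e / 2 / 8 := le_trans (ltW xq) s1.
  have h := @schwarz_ball _ _ f q x (e / 2) A e20 (fun y yq => proj1 (hf y (inB y yq)))
    (fun y yq => proj2 (hf y (inB y yq))) l1.
  apply: (le_trans (lip_room e0 A1 (ltW P0) xq h pf)).
  by rewrite lerBlDr -lerBlDl [nrm (f x - _)]nrmB nrm_sub.
rewrite -growth_const //.
apply: (@growth _ d a a_ X d2 q s A (p / (2 * A))) => // x xq.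
have xe : nrm (x - q) < e / 2.
  apply: (lt_le_trans xq); apply: (le_trans s1); apply: ltW; rewrite ltr_pdivrMr // ltr_pMr //.
  by rewrite ltr1n.
have xp := inB x xe.
have Fx : F x != 0.
  by apply: contraTneq (lip F x hF P2 xq) => ->; rewrite nrm0 -ltNge.
have [dX px] := hX xp Fx.
split=> //; first by have [] := ha xp.
  by move=> i id; have [] := ha_ id xp.
exact: lip (fun y => ha_ (leqnn d)) P3 xq.
Qed.

(** Two factors of [Pf] absorb the growth of [X], and the two others provide the square needed by
    [diff_zero]. This is the origin of the power 4. *)
Lemma H_diff q : nrm (q - p0) < e / 2 -> differentiable (fun x => X x * Pf x ^+ 4) q.
Proof.
move=> qe; have qe' := lt_half e0 qe.
have [Pq|Pq] := eqVneq (Pf q) 0; last first.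
  have Fq : F q != 0 by move: Pq; rewrite /Pf mulf_eq0 negb_or => /andP[].
  have [dX _] := hX qe' Fq.
  by apply: dM_ => //; apply: dX_; exact: Pf_diff.
have r0 : 0 < e / 2 - nrm (q - p0) by rewrite subr_gt0.
apply: (@diff_zero _ _ _ q Pf KX _ r0) => //; last exact: Pf_diff.
move=> x xq; have xe : nrm (x - p0) < e / 2.
  by have := nrm_sub_le xq (lexx (nrm (q - p0))); rewrite subrK.
have [->|Px] := eqVneq (Pf x) 0; first by rewrite expr0n mulr0 nrm0 expr0n mulr0.
rewrite nrmM nrmX (_ : nrm (Pf x) ^+ 4 = nrm (Pf x) ^+ 2 * nrm (Pf x) ^+ 2); last by rewrite -exprD.
rewrite mulrA; apply: ler_wpM2r; first by rewrite exprn_ge0 ?nrm_ge0.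
by rewrite -ler_pdivlMr ?exprn_gt0 ?nrm_gt0 //; exact: X_bound.
Qed.

Lemma local_dichotomy : (forall r : R, 0 < r -> exists2 x, nrm (x - p0) < r & Pf x != 0) ->
  exists2 r : R, 0 < r & r <= e / 2 /\
    ((forall x, nrm (x - p0) < r -> Pf x != 0 -> nrm (X x) <= 10) \/
     (forall x, nrm (x - p0) < r -> Pf x != 0 -> 1 <= nrm (X x))).
Proof.
move=> Pne; pose G x := Pf x ^+ 4; pose H x := X x * Pf x ^+ 4.
have e2e x : nrm (x - p0) < e / 2 -> nrm (x - p0) < e by move=> h; exact: lt_half e0 h.
have GP x : (G x != 0) = (Pf x != 0) by rewrite /G expf_eq0.
have A8 : 1 <= A ^+ 8 by rewrite expr_ge1 // ltW.
have B1 : KX * A ^+ 4 <= KX * A ^+ 4 + A ^+ 8 by rewrite lerDl (le_trans ler01).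
have B2 : A ^+ 8 <= KX * A ^+ 4 + A ^+ 8.
  by rewrite lerDr mulr_ge0 ?KX_ge0 // exprn_ge0 // ltW.
have hG x : nrm (x - p0) < e / 2 -> differentiable G x /\ nrm (G x) <= KX * A ^+ 4 + A ^+ 8.
  move=> /e2e xe; split; first by apply: dX_; exact: Pf_diff.
  have [P1 _ _] := Pf_le xe; apply: le_trans B2.
  rewrite /G nrmX (_ : 8 = 2 * 4)%N // exprM; apply: lerXn2r => //; rewrite nnegrE ?nrm_ge0 //.
  by rewrite exprn_ge0 // ltW.
have hH x : nrm (x - p0) < e / 2 -> differentiable H x /\ nrm (H x) <= KX * A ^+ 4 + A ^+ 8.
  move=> xe; split; first exact: H_diff.
  have [P1 _ _] := Pf_le (e2e x xe); apply: le_trans B1.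
  have [Px|Px] := eqVneq (Pf x) 0.
    by rewrite /H Px expr0n mulr0 nrm0 mulr_ge0 ?KX_ge0 // exprn_ge0 // ltW.
  rewrite /H nrmM nrmX.
  have P20 : 0 < nrm (Pf x) ^+ 2 by rewrite exprn_gt0 // nrm_gt0.
  have h := X_bound xe Px; move: h; rewrite ler_pdivlMr // => h.
  rewrite (_ : nrm (Pf x) ^+ 4 = nrm (Pf x) ^+ 2 * nrm (Pf x) ^+ 2); last by rewrite -exprD.
  rewrite mulrA; apply: ler_pM => //; rewrite ?mulr_ge0 ?nrm_ge0 ?exprn_ge0 //.
  rewrite (_ : 4 = 2 * 2)%N // exprM; apply: lerXn2r => //; rewrite nnegrE ?nrm_ge0 //.
  by rewrite exprn_ge0 // ltW.
have hXX x : nrm (x - p0) < e / 2 -> G x != 0 ->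
    [/\ differentiable X x, pde_at d a a_ X x & H x = X x * G x].
  move=> /e2e xe; rewrite GP => Px.
  have Fx : F x != 0 by move: Px; rewrite /Pf mulf_eq0 negb_or => /andP[].
  by have [dX px] := hX xe Fx.
have e21 : e / 2 <= 1 by apply: le_trans e1; apply: ltW; rewrite ltr_pdivrMr // ltr_pMr // ltr1n.
have [|r r0 hr] := @dichotomy _ d a a_ p0 (e / 2) A e20 e21 A1 (fun x xe => ha (e2e x xe))
  (fun i x id xe => ha_ id (e2e x xe)) X H G _ hG hH hXX.
  by move=> r r0; have [x xr Px] := Pne r r0; exists x => //; rewrite GP.
exists (Num.min r (e / 2)); first by rewrite lt_min r0.
split; first by rewrite ge_min lexx orbT.
case: hr => hr; [left|right] => x; move=> /lt_min2[xr _] Px; apply: hr => //; rewrite GP //.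
Qed.

Lemma inv_swap (u v : C) (k : R) : nrm (v - u) <= k -> nrm (u - v) <= k.
Proof. by rewrite nrmB. Qed.

(** Where [X] is at most 10, its Lipschitz bound keeps it within [rho / 2] of [X p] on the small
    ball. Where it is at least 1, the inverse is Lipschitz: it has modulus at least 2 / rho at [p]
    and varies by at most 1 / rho, so it stays at least 1 / rho. *)
Lemma local_control : (forall r : R, 0 < r -> exists2 x, nrm (x - p0) < r & Pf x != 0) ->
  exists2 r : R, 0 < r & r <= e / 2 /\
    forall p rho x, nrm (p - p0) < r / 2 -> Pf p != 0 -> 1 <= rho -> nrm (X p) <= rho / 2 ->
      nrm (x - p) < r / (8 * 8 * 8) / rho -> Pf x != 0 -> nrm (X x) <= rho.
Proof.
move=> /local_dichotomy[r r0 [re hr]]; exists r => //; split=> // p rho x pr Pp rho1 Xp xp Px.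
have r20 : 0 < r / 2 by rewrite divr_gt0.
have inr (y : V2) : nrm (y - p) < r / 2 -> nrm (y - p0) < r by exact: half_sub.
have ine (y : V2) : nrm (y - p) < r / 2 -> nrm (y - p0) < e.
  by move=> /inr yr; exact: lt_half e0 (lt_le_trans yr re).
have dX (y : V2) : nrm (y - p) < r / 2 -> Pf y != 0 -> differentiable X y.
  move=> /ine ye Py; have Fy : F y != 0 by move: Py; rewrite /Pf mulf_eq0 negb_or => /andP[].
  by have [] := hX ye Fy.
have dP (y : V2) : nrm (y - p) < r / 2 -> differentiable Pf y by move=> /ine; exact: Pf_diff.
have [c1 c2] := case_low r0 rho1 xp.
case: hr => hr.
  have h := @schwarz_off _ _ X Pf p x (r / 2) 10 r20 dP dX (fun y yp => hr y (inr y yp)) Pp Px c1.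
  have := nrm_le_add (le_trans h c2); move/le_trans; apply.
  by rewrite [leRHS]splitr lerD2r.
have Xne (y : V2) : nrm (y - p) < r / 2 -> Pf y != 0 -> X y != 0.
  move=> yp Py; apply: contraTneq (hr y (inr y yp) Py) => ->.
  by rewrite nrm0 -ltNge.
have dY (y : V2) : nrm (y - p) < r / 2 -> Pf y != 0 -> differentiable (fun y => (X y)^-1) y.
  by move=> yp Py; apply: dV_; [exact: Xne|exact: dX].
have Y1 (y : V2) : nrm (y - p) < r / 2 -> Pf y != 0 -> nrm (X y)^-1 <= 1.
  move=> yp Py; rewrite nrmV invf_le1 ?nrm_gt0 ?Xne //; exact: hr (inr y yp) Py.
have h := @schwarz_off _ _ (fun y => (X y)^-1) Pf p x (r / 2) 1 r20 dP dY Y1 Pp Px c1.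
have xr : nrm (x - p) < r / 2.
  apply: (le_lt_trans c1); rewrite ltr_pdivrMr // ltr_pMr // ltr1n //.
have pp : nrm (p - p) < r / 2 by rewrite subrr nrm0.
apply: (case_high r0 rho1 xp (nrm_gt0 (Xne p pp Pp)) (nrm_gt0 (Xne x xr Px)) Xp).
have h' : nrm ((X p)^-1 - (X x)^-1) <= 6 * 1 / (r / 2) * nrm (x - p).
  move: h; move: ((X p)^-1) ((X x)^-1) => u v; exact: inv_swap.
have := nrm_le_add h'.
by rewrite (nrmV (X p)) (nrmV (X x)).
Qed.

End Local.

(** * Uniform control of X *)

Lemma convex_lt (R : realType) (x y r t : R) : x < r -> y < r -> 0 <= t -> t <= 1 ->
  (1 - t) * x + t * y < r.
Proof.
move=> xr yr t0 t1; have mr : Num.max x y < r by rewrite gt_max xr.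
apply: le_lt_trans mr.
have h1 : (1 - t) * x <= (1 - t) * Num.max x y by rewrite ler_wpM2l ?subr_ge0 // le_max lexx.
have h2 : t * y <= t * Num.max x y by rewrite ler_wpM2l // le_max lexx orbT.
by apply: (le_trans (lerD h1 h2)); rewrite -mulrDl subrK mul1r.
Qed.

Section Spread.
Variable R : realType.
Local Notation C := (Cx R).
Local Notation V2 := (C * C)%type.

Lemma seg_near (s t T k : R) : t < s -> s <= T + k -> T - k < t -> (- k <= s - T) && (s - T <= k).
Proof. by move=> h1 h2 h3; apply/andP; split; lra. Qed.

Lemma top_eq1 (T k : R) : 0 < k -> Num.min 1 (T + k) <= T -> Num.min 1 (T + k) = 1.
Proof.
move=> k0; rewrite ge_min => /orP[h|h]; last by move: h; lra.
by apply/min_idPl; lra.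
Qed.

Lemma good_radii (r w : R) : 0 < r -> w <= r / (8 * 8 * 8) ->
  [/\ 2 * w <= r / 8, w <= r / 8, r / 8 + r / 8 <= r / 2 & r / 2 <= r].
Proof. by move=> r0 h; split; lra. Qed.

(** The supremum of the initial part of the segment on which [I] holds is a limit of points of [I],
    so [I] holds beyond it. This is connectedness of the bidisc, for properties that hold near every
    limit of points where they hold. *)
Lemma segment_propagate (r : R) (I : V2 -> Prop) :
  (forall p, nrm p < r -> (forall e : R, 0 < e -> exists2 y, nrm (y - p) < e & I y) ->
     exists2 e : R, 0 < e & forall y, nrm (y - p) < e -> I y) ->
  forall p q, nrm p < r -> nrm q < r -> I p -> I q.
Proof.
move=> hI p q pr qr Ip.
pose g (t : R) : V2 := p + (t%:C : C) *: (q - p).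
pose D := nrm (q - p) + 1.
have D0 : 0 < D by rewrite ltr_wpDl ?nrm_ge0.
have gB s t : nrm (g s - g t) <= `|s - t| * D.
  have -> : g s - g t = ((s - t)%:C : C) *: (q - p).
    by rewrite /g opprD addrACA subrr add0r rmorphB scalerBl.
  by rewrite nrmZ nrm_real ler_wpM2l // lerDl.
have gr t : 0 <= t -> t <= 1 -> nrm (g t) < r.
  move=> t0 t1.
  have -> : g t = ((1 - t)%:C : C) *: p + (t%:C : C) *: q.
    by rewrite /g scalerBr rmorphB scalerBl scale1r addrA addrAC.
  apply: (le_lt_trans (nrmD _ _)); rewrite !nrmZ !nrm_real (ger0_norm t0) ger0_norm ?subr_ge0 //.
  exact: (convex_lt pr qr t0 t1).
pose S := [set t : R | [/\ 0 <= t, t <= 1 & forall s, 0 <= s -> s <= t -> I (g s)]].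
have S0 : S 0.
  split=> // s s0 s1; have -> : s = 0 by apply/eqP; rewrite eq_le s0 s1.
  by rewrite /g scale0r addr0.
have Sb : has_ubound S by exists 1 => t [].
have Ss : has_sup S by split; [exists 0|].
pose T := sup S.
have T0 : 0 <= T by apply: (ub_le_sup Sb).
have T1 : T <= 1 by apply: ge_sup; [exists 0|move=> t []].
have near (x : R) : 0 < x -> exists2 t, S t & T - x < t.
  by move=> x0; exact: sup_adherent.
have [|e e0 he] := hI (g T) (gr T T0 T1).
  move=> x x0; have [t St tT] := near _ (divr_gt0 x0 D0).
  have tT' : t <= T by apply: (ub_le_sup Sb).
  have [t0 _ hs] := St; exists (g t); last exact: hs.
  apply: (le_lt_trans (gB _ _)); rewrite -ltr_pdivlMr // distrC ger0_norm ?subr_ge0 //.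
  by rewrite ltrBlDr addrC -ltrBlDr.
pose k := e / D / 2.
have k0 : 0 < k by rewrite !divr_gt0.
have [t St tk] := near k k0; have [t0 _ ht] := St.
(* [T'] again belongs to [S], so it cannot exceed the supremum [T]; this forces [T' = 1]. *)
pose T' := Num.min 1 (T + k).
have ST' : S T'.
  split; first by rewrite le_min ler01 addr_ge0 // ltW.
    by rewrite ge_min lexx.
  move=> s s0; rewrite le_min => /andP[s1 sT].
  have [st|ts] := leP s t; first exact: ht.
  apply: he; apply: (le_lt_trans (gB _ _)); rewrite -ltr_pdivlMr //.
  have kk : k < e / D by rewrite /k ltr_pdivrMr // ltr_pMr ?divr_gt0 // ltr1n.
  apply: (le_lt_trans _ kk); rewrite ler_norml; exact: seg_near ts sT tk.
have T'T : T' <= T by apply: (ub_le_sup Sb).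
have T'1 : T' = 1.
  exact: top_eq1 k0 T'T.
have [_ _ hT] := ST'; have := hT 1 ler01; rewrite T'1 lexx => /(_ isT).
by rewrite /g scale1r addrC subrK.
Qed.

Lemma vanish_spread (F : V2 -> C) p (r : R) : 0 < r ->
  (forall x, nrm (x - p) < r -> differentiable F x) ->
  (forall e : R, 0 < e -> exists2 y, nrm (y - p) < e &
     exists2 d : R, 0 < d & forall x, nrm (x - y) < d -> F x = 0) ->
  exists2 e : R, 0 < e & forall x, nrm (x - p) < e -> F x = 0.
Proof.
move=> r0 dF h; have [s [M [s0 sr FM]]] := bounded_ball_near r0 dF.
have s320 : 0 < s / 32 by rewrite divr_gt0.
have [y yp [d d0 hd]] := h _ s320.
exists (s / 32) => //.
exact: (vanish_near s0 (fun x xs => dF x (lt_le_trans xs sr)) FM d0 yp hd).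
Qed.

Lemma vanish_from (U Theta : set V2) (F : V2 -> C) (y : V2) (r : R) : 0 < r ->
  (forall x, nrm (x - y) < r -> U x) -> holomorphic_on U F ->
  (forall x, U x -> Theta x -> F x = 0) ->
  (forall e : R, 0 < e -> exists2 z, nrm (z - y) < e &
     exists2 k : R, 0 < k & forall x, nrm (x - z) < k -> Theta x) ->
  exists2 e : R, 0 < e & forall x, nrm (x - y) < e -> F x = 0.
Proof.
move=> r0 hr hF UF hy; apply: (vanish_spread r0) => [x xy|k k0]; first by apply: hF; exact: hr.
have [|z zy [l l0 hl]] := hy (Num.min k r); first by rewrite lt_min k0.
have [zk zr] : nrm (z - y) < k /\ nrm (z - y) < r by apply/andP; rewrite -lt_min.
apply: (ex_intro2 _ _ z zk).
have m0 : 0 < Num.min l (r - nrm (z - y)) by rewrite lt_min l0 subr_gt0.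
exists (Num.min l (r - nrm (z - y))); first exact: m0.
move=> x /lt_min2[xl xr]; apply: UF (hl x xl).
by apply: hr; have := nrm_sub_le xr (lexx (nrm (z - y))); rewrite subrK.
Qed.

Lemma bounded_family n (f : nat -> V2 -> C) p (r : R) : 0 < r ->
  (forall i x, (i <= n)%N -> nrm (x - p) < r -> differentiable (f i) x) ->
  exists s M : R, [/\ 0 < s, s <= r & forall i x, (i <= n)%N -> nrm (x - p) < s -> nrm (f i x) <= M].
Proof.
move=> r0; elim: n => [|n IH] df.
  have [s [M [s0 sr FM]]] := bounded_ball_near r0 (fun x => df 0%N x (leqnn 0)).
  by exists s, M; split=> // i x; rewrite leqn0 => /eqP->; exact: FM.
have [s [M [s0 sr FM]]] := IH (fun i x ih => df i x (leqW ih)).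
have [s' [M' [s'0 s'r FM']]] := bounded_ball_near r0 (fun x => df n.+1 x (leqnn _)).
exists (Num.min s s'), (Num.max M M'); split; first by rewrite lt_min s0.
  by rewrite ge_min sr.
move=> i x; rewrite leq_eqVlt lt_min => ih /andP[xs xs']; rewrite le_max.
by move: ih => /orP[/eqP->|ih]; [rewrite FM' ?orbT|rewrite FM].
Qed.

Lemma bidiscP (r : R) (p : V2) : bidisc r p <-> nrm p < r.
Proof.
rewrite nrm_pairP; split=> [[/disc_nrm h1 /disc_nrm h2] //|[h1 h2]].
by split; apply/disc_nrm.
Qed.

Lemma cball_bidisc (r : R) (p : V2) : nrm p < r -> forall x, nrm (x - p) < r - nrm p -> nrm x < r.
Proof. by move=> pr x /nrm_lt_add; rewrite addrC subrK. Qed.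

End Spread.

Section Global.
Variable R : realType.
Local Notation C := (Cx R).
Local Notation V2 := (C * C)%type.
Variables (R' : R) (Theta : set V2) (d : nat) (a : V2 -> C) (a_ : nat -> V2 -> C) (X : V2 -> C).
Hypothesis d2 : (2 <= d)%N.
Hypothesis ha : holomorphic_on (bidisc R') a.
Hypothesis ha_ : forall i, (i <= d)%N -> holomorphic_on (bidisc R') (a_ i).
Hypothesis ad : exists2 q, bidisc R' q & a_ d q <> 0.
Hypothesis hT : analytic_variety (bidisc R') Theta.
Hypothesis hX : forall p, (bidisc R' `\` Theta) p -> differentiable X p /\ pde_at d a a_ X p.
Hypothesis Tne : exists2 q, bidisc R' q & ~ Theta q.

Lemma ad_dense p (e : R) : nrm p < R' -> 0 < e -> exists2 y, nrm (y - p) < e & a_ d y != 0.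
Proof.
move=> pR e0; apply: contrapT => nex.
pose I (y : V2) := exists2 k : R, 0 < k & forall x, nrm (x - y) < k -> a_ d x = 0.
have [q /bidiscP qR aq] := ad; apply: aq.
suff [k k0 hk] : I q by apply: hk; rewrite subrr nrm0.
apply: (segment_propagate _ pR qR); last first.
  exists e => // x xe; apply/eqP; apply: contrapT => /negP ax; apply: nex.
  by exists x.
move=> y yR hy.
have r0 : 0 < R' - nrm y by rewrite subr_gt0.
have [|e' e'0 he'] := @vanish_spread _ (a_ d) y _ r0 _ hy.
  by move=> x xy; apply: ha_ => //; apply/bidiscP; exact: cball_bidisc xy.
exists e' => // x xy; exists (e' - nrm (x - y)); first by rewrite subr_gt0.
by move=> z zx; apply: he'; have := nrm_sub_le zx (lexx (nrm (x - y))); rewrite subrK.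
Qed.

(** [Theta] has no interior point: otherwise [segment_propagate] would make it fill the bidisc.
    Hence one of its finitely many equations near [p0] does not vanish identically there, and the
    zeros of that single equation contain [Theta] locally. *)
Lemma theta_eq p0 : nrm p0 < R' -> exists (e : R) (F : V2 -> C),
  [/\ 0 < e, forall x, nrm (x - p0) < e -> nrm x < R' /\ differentiable F x,
   forall x, nrm (x - p0) < e -> F x != 0 -> ~ Theta x &
   forall k : R, 0 < k -> exists2 y, nrm (y - p0) < k & F y != 0].
Proof.
move=> pR; have [_ hT'] := hT.
pose I (y : V2) := exists2 k : R, 0 < k & forall x, nrm (x - y) < k -> Theta x.
have nearI (p : V2) : (\forall x \near p, Theta x) -> exists2 e : R, 0 < e & forall y, nrm (y - p) < e -> I y.
  move=> /nbhs_nrm[e e0 he]; exists e => // x xy; exists (e - nrm (x - p)); first by rewrite subr_gt0.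
  by move=> z zx; apply: he; have := nrm_sub_le zx (lexx (nrm (x - p))); rewrite subrK.
have noI p : nrm p < R' -> ~ I p.
  move=> pR1 Ip; have [q /bidiscP qR nTq] := Tne; apply: nTq.
  suff [k k0 hk] : I q by apply: hk; rewrite subrr nrm0.
  apply: (segment_propagate _ pR1 qR Ip) => y yR hy.
  have [U [oU Uy UD [n [F [hF UT]]]]] := hT' y (proj2 (bidiscP _ _) yR).
  apply: nearI.
  have [r r0 hr] := proj1 (open_nrm U) oU y Uy.
  have Fv (i : 'I_n) : \forall x \near y, F i x = 0.
    apply/nbhs_nrm; apply: (vanish_from (U := U) (Theta := Theta) r0 hr (hF i) _ hy).
    by move=> x Ux Tx; have UTx : (U `&` Theta) x := conj Ux Tx; move: UTx; rewrite UT => -[_]; exact.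
  have UN : \forall x \near y, U x by apply/nbhs_nrm; exists r.
  near=> x.
  have : (U `&` Theta) x.
    by rewrite UT; split; [near: x|near: x; exact: filter_forall].
  by case.
have [U [oU Up UD [n [F [hF UT]]]]] := hT' p0 (proj2 (bidiscP _ _) pR).
have [r r0 hr] := proj1 (open_nrm U) oU p0 Up.
apply: contrapT => nex; apply: (noI p0 pR).
have Fv (i : 'I_n) : \forall x \near p0, F i x = 0.
  apply/nbhs_nrm; apply: contrapT => nv; apply: nex; exists r, (F i).
  apply: (And4 r0).
  - by move=> x xr; split; [apply/bidiscP; exact: UD (hr x xr)|exact: hF (hr x xr)].
  - move=> x xr Fx Tx; have UTx : (U `&` Theta) x := conj (hr x xr) Tx.
    by move: UTx; rewrite UT => -[_ /(_ i) F0]; rewrite F0 eqxx in Fx.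
  - move=> k k0; apply: contrapT => nex2; apply: nv; apply: (ex_intro2 _ _ k k0) => x xk.
    apply/eqP; apply: contrapT => /negP Fx; apply: nex2; exact: (ex_intro2 _ _ x xk).
have UN : \forall x \near p0, U x by apply/nbhs_nrm; exists r.
suff /nearI[e e0 he] : \forall x \near p0, Theta x by apply: he; rewrite subrr nrm0.
near=> x.
have : (U `&` Theta) x.
  by rewrite UT; split; [near: x|near: x; exact: filter_forall].
by case.
Unshelve. all: by end_near. Qed.

(* The zero set of [G] contains [Theta] and the points where the local dichotomy is not
   available; it is negligible for the maximum principle. *)
Definition good (p : V2) (n : nat) := exists G : V2 -> C, [/\
  forall x, nrm (x - p) < 2 / n.+1%:R -> [/\ nrm x < R', differentiable G x & G x != 0 -> ~ Theta x],
  forall e : R, 0 < e -> exists2 y, nrm (y - p) < e & G y != 0 &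
  forall p' rho x, nrm (p' - p) < n.+1%:R^-1 -> G p' != 0 -> 1 <= rho -> nrm (X p') <= rho / 2 ->
    nrm (x - p') < n.+1%:R^-1 / rho -> G x != 0 -> nrm (X x) <= rho].

Lemma good_mono p m n : (m <= n)%N -> good p m -> good p n.
Proof.
move=> mn [G [h1 h2 h3]].
have inv : n.+1%:R^-1 <= m.+1%:R^-1 :> R by rewrite lef_pV2 ?posrE ?ltr0n // ler_nat.
exists G; split=> //.
  by move=> x xn; apply: h1; apply: (lt_le_trans xn); rewrite ler_wpM2l.
move=> p' rho x pp Gp rho1 Xp xp; apply: (h3 p' rho x (lt_le_trans pp inv) Gp rho1 Xp).
apply: (lt_le_trans xp); apply: ler_wpM2r inv; rewrite invr_ge0; exact: le_trans ler01 rho1.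
Qed.

Lemma good_near p0 : nrm p0 < R' -> exists2 k : R, 0 < k &
  exists n, forall y, nrm (y - p0) < k -> good y n.
Proof.
move=> pR; have [e1 [F [e10 hF hFT Fd]]] := theta_eq pR.
(* Collecting the coefficients [a_ i], [a] and [F] in one family gives a common radius and a common
   bound. *)
pose fam i := if i == d.+1 then a else if i == d.+2 then F else a_ i.
have dfam i x : (i <= d.+2)%N -> nrm (x - p0) < e1 -> differentiable (fam i) x.
  move=> id xe; have [xR dF] := hF x xe; rewrite /fam.
  case: eqP => [_|n1]; first by apply: ha; apply/bidiscP.
  case: eqP => [//|n2]; apply: ha_; last exact/bidiscP.
  by move/eqP: n1; move/eqP: n2; rewrite -ltnS => n2 n1; rewrite ltn_neqAle n1 -ltnS ltn_neqAle n2.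
have [s [M [s0 se1 fM]]] := bounded_family e10 dfam.
pose e := Num.min s 1; pose A := Num.max M 1.
have e0 : 0 < e by rewrite lt_min s0 ltr01.
have ee1 : e <= 1 by rewrite ge_min lexx orbT.
have A1 : 1 <= A by rewrite le_max lexx orbT.
have se x : nrm (x - p0) < e -> nrm (x - p0) < s by move=> /lt_min2[].
have fA i x : (i <= d.+2)%N -> nrm (x - p0) < e -> differentiable (fam i) x /\ nrm (fam i x) <= A.
  move=> id /se xs; split; first by apply: dfam => //; exact: lt_le_trans xs se1.
  by rewrite le_max fM.
have la x : nrm (x - p0) < e -> differentiable a x /\ nrm (a x) <= A.
  by move=> xe; have := fA d.+1 x (leqnSn _) xe; rewrite /fam eqxx.
have lF x : nrm (x - p0) < e -> differentiable F x /\ nrm (F x) <= A.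
  by move=> xe; have := fA d.+2 x (leqnn _) xe; rewrite /fam eqxx gtn_eqF.
have la_ i x : (i <= d)%N -> nrm (x - p0) < e -> differentiable (a_ i) x /\ nrm (a_ i x) <= A.
  move=> id xe; have := fA i x (leq_trans id (leqW (leqnSn _))) xe.
  by rewrite /fam !ltn_eqF ?ltnS // (leq_trans id).
have ee x : nrm (x - p0) < e -> nrm (x - p0) < e1 by move=> /se xs; exact: lt_le_trans xs se1.
have lX x : nrm (x - p0) < e -> F x != 0 -> differentiable X x /\ pde_at d a a_ X x.
  move=> /ee xe Fx; apply: hX; split; last exact: hFT.
  by apply/bidiscP; have [] := hF x xe.
have Pd k : 0 < k -> exists2 x, nrm (x - p0) < k & Pf d a_ F x != 0.
  move=> k0; have [|y] := Fd (Num.min (k / 2) e); first by rewrite lt_min e0 divr_gt0.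
  move=> /lt_min2[yk ye] Fy.
  have [dFy _] := lF y ye; have [l l0 hl] := diff_cont dFy (nrm_gt0 Fy).
  have [yR _] := hF y (ee y ye).
  have [|x] := @ad_dense y (Num.min (k / 2) l) yR; first by rewrite lt_min l0 divr_gt0.
  move=> /lt_min2[xk xl] ax; exists x.
    by have := nrm_sub_lt xk yk; rewrite -splitr.
  rewrite /Pf mulf_neq0 //; apply: contraTneq (hl x xl) => ->.
  by rewrite sub0r nrmN ltxx.
have [r r0 [re hr]] := local_control d2 e0 ee1 A1 la la_ lF lX Pd.
have r80 : 0 < Num.min (r / 8) (e / 32) by rewrite lt_min !divr_gt0.
exists (Num.min (r / 8) (e / 32)) => //.
have re' : r <= e by apply: (le_trans re); rewrite ler_pdivrMr // ler_peMr ?(ltW e0) // ler1n.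
have r5 : 0 < r / (8 * 8 * 8) by rewrite divr_gt0 ?mulr_gt0.
have [n hn] : exists n : nat, n.+1%:R^-1 <= r / (8 * 8 * 8).
  exists (Num.truncn (r / (8 * 8 * 8))^-1).
  rewrite -[leRHS]invrK lef_pV2 ?posrE ?invr_gt0 ?ltr0n //; apply: ltW; exact: truncnS_gt.
have [hn2 hn1 r82 r2r] := good_radii r0 hn.
exists n => y; move=> /lt_min2[yr ye].
exists (Pf d a_ F); split.
- move=> x xn; have xr : nrm (x - p0) < e.
    apply: (lt_le_trans (nrm_sub_lt xn yr)); apply: le_trans re'; apply: le_trans r2r.
    by apply: le_trans r82; rewrite lerD2r.
  split; first by have [] := hF x (ee x xr).
    exact: (Pf_diff la_ lF).
  by rewrite /Pf mulf_eq0 negb_or => /andP[Fx _]; apply: hFT Fx; exact: ee.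
- move=> k k0.
  have e320 : 0 < e / 32 by rewrite divr_gt0.
  have [q qe Pq] := Pd _ e320.
  apply: (nonzero_dense e0 (fun x => Pf_diff la_ lF (x := x)) _ qe Pq k0 ye).
  by move=> x xe; have [h _ _] := Pf_le la_ lF xe; exact: h.
move=> p' rho x pp Pp rho1 Xp xp Px; apply: (hr p' rho x _ Pp rho1 Xp _ Px).
  apply: (lt_le_trans (nrm_sub_lt pp yr)); apply: le_trans r82.
  by rewrite lerD2r.
by apply: (lt_le_trans xp); rewrite ler_wpM2r // invr_ge0 (le_trans ler01).
Qed.

(** Compactness is used on the closed bidisc, points of [Theta] included, and not on [K]. The
    resulting radius is what makes the final constants independent of [K]. *)
Lemma uniform_good (R0 : R) : R0 < R' -> exists n, forall p, nrm p <= R0 -> good p n.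
Proof.
move=> RR.
have cR : compact [set p : V2 | nrm p <= R0].
  have -> : [set p : V2 | nrm p <= R0] =
     [set z : C | nrm (z - 0) <= R0] `*` [set z : C | nrm (z - 0) <= R0].
    apply/seteqP; split => p /=; rewrite !subr0.
      by move=> /nrm_pairle[].
    by case=> h1 h2; apply/nrm_pairle.
  by apply: compact_setX; exact: compact_cdisc.
apply: (compact_unif cR) => [p m n|p /= pR]; first exact: good_mono.
have [k k0 [n hn]] := good_near (le_lt_trans pR RR).
exists n; exact: (proj2 (nbhs_nrm (p : V2) (fun y => good y n)) (ex_intro2 _ _ k k0 hn)).
Qed.

End Global.

(** * Estimates of the Taylor coefficients *)

Section TermArith.
Variable R : realType.
Implicit Types D L M Z b c r x y t rho tau theta : R.

Lemma binZ n i Z : n%:R <= Z -> (i <= n)%N -> 'C(n, i)%:R * i`!%:R <= Z ^+ i.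
Proof.
move=> nZ ih; rewrite -natrM bin_ffact; apply: (@le_trans _ _ (n%:R ^+ i)); last first.
  by apply: lerXn2r; rewrite ?nnegrE // (le_trans (ler0n _ n)).
rewrite -natrX ler_nat; elim: i ih => [|i IH] ih; first by rewrite ffactn0.
by rewrite ffactnSr expnSr leq_mul ?leq_subr // IH // ltnW.
Qed.

Lemma shrink_pow m : ((m.+2%:R : R) / m.+1%:R) ^+ m <= expR 1.
Proof.
have -> : (m.+2%:R : R) / m.+1%:R = 1 + m.+1%:R^-1.
  by rewrite -[m.+2]addn1 natrD mulrDl mul1r divff // pnatr_eq0.
apply: (@le_trans _ _ (expR (m.+1%:R^-1) ^+ m)).
  apply: lerXn2r; rewrite ?nnegrE ?expR_ge0 ?addr_ge0 ?invr_ge0 //.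
  exact: expR_ge1Dx.
rewrite -expRM_natl ler_expR -[leRHS](divff (_ : m.+1%:R != 0 :> R)) ?pnatr_eq0 //.
by rewrite ler_wpM2r ?invr_ge0 // ler_nat.
Qed.

Lemma pow_exp_fact n x : 0 <= x -> x ^+ n <= n`!%:R * expR x.
Proof.
move=> x0; have n0 : 0 < n`!%:R :> R by rewrite ltr0n fact_gt0.
rewrite mulrC -ler_pdivrMr //; case: n n0 => [|n] n0.
  by rewrite expr0 fact0 divr1; apply: le_trans (expR_ge1Dx x); rewrite lerDl.
by apply: le_trans (expR_ge1Dxn n x0); rewrite lerDr.
Qed.

Lemma shrink_eq m M L t w x y rho c : t != 0 -> c != 0 -> rho != 0 -> x != 0 ->
  6 * (M * ((L * (t * w)) ^+ m * y)) / (t^-1 * (c / rho) / x) =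
  w ^+ m * (6 / c * M * (rho * x * (L ^+ m * t ^+ m * y) * t)).
Proof. by move=> *; rewrite !exprMn; field; apply/and4P. Qed.

Lemma shrink_eq2 m M L t x y rho c k : 6 * k / c * M * (rho * x * ((L * t) ^+ m * y) * t) =
  k * (6 / c * M * (rho * x * (L ^+ m * t ^+ m * y) * t)).
Proof. by rewrite !exprMn; ring. Qed.

Lemma term_eq1 M b c f k p x y t : c * (f * (b * p) * (k * M * (x * y * t))) =
  M * (b * k) * (c * f * (p * x) * y * t).
Proof. ring. Qed.

Lemma term_eq2 M b c f p y : c * (f * (b * p) * (M * y)) = M * b * (c * f * p * y * 1).
Proof. ring. Qed.

Lemma term_eq3 M b k x y L : M * (b * k) * (x * (y / L)) + M * (b * k) * (x * (y / L)) + M * b * (x * (y / L)) =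
  M * x * (b * (2 * k + 1) / L) * y.
Proof. ring. Qed.

Lemma sum_eq M t q L n : M * t * (q / L) * 2 * n = M * t * (2 * n * q / L). Proof. ring. Qed.

Lemma deg_arith i k n S g : (i <= n)%N -> (k + g <= S)%N -> (i + g + (k + (n - i)) <= n + S)%N.
Proof. lia. Qed.

Lemma final_eq L2 f e n x : x * (f * (L2 ^+ n * e ^+ n)) = L2 ^+ n * (f * (e ^+ n * x)).
Proof. ring. Qed.

Section Term.
Variables (n i k S dm : nat) (D L M Z b rho tau : R).
Hypotheses (D0 : 0 <= D) (L1 : 1 <= L) (DL : 2 * D <= L) (M0 : 0 <= M) (b0 : 0 <= b).
Hypotheses (rho1 : 1 <= rho) (tau1 : 1 <= tau) (ih : (i <= n)%N) (kS : (k < S)%N).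
Hypothesis ZE : Z = (n + S)%:R + rho.

Let m := (k + (n - i))%N.
Let N := (n + S)%N.
Let L0 : 0 <= L. Proof. exact: le_trans L1. Qed.
Let Z1 : 1 <= Z. Proof. by rewrite ZE (le_trans rho1) // lerDr. Qed.
Let Z0 : 0 <= Z. Proof. exact: le_trans Z1. Qed.
Let tau0 : 0 <= tau. Proof. exact: le_trans tau1. Qed.
Let rho0 : 0 <= rho. Proof. exact: le_trans rho1. Qed.
Let mN : (m.+1 <= N)%N. Proof. by rewrite /m /N -addSn addnC leq_add // leq_subr. Qed.

(** The powers of [Z] add up to i + e + m <= N, where [u] carries those of [rho] and the cost of a
    derivative. Of the powers of [L], i absorb [D ^+ i] and leave 2^-i; one more is left over
    because m + i < N, and becomes the small factor [L^-1]. A derivative may also consume one power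
    of [tau], which [v] stands for. *)
Lemma base_term e (u v : R) : (i + e + m <= N)%N -> 0 <= u -> u <= Z ^+ e -> 0 <= v -> v <= tau ->
  'C(n, i)%:R * (i`!%:R * D ^+ i) * u * ((L * tau) ^+ m * (m%:R + rho) ^+ m) * v <=
  (L * tau) ^+ N * Z ^+ N * (2^-1 ^+ i / L).
Proof.
move=> eN u0 uZ v0 vt; have Lp : 0 < L by apply: lt_le_trans L1.
have mr0 : 0 <= m%:R + rho by rewrite addr_ge0.
have h1 : 'C(n, i)%:R * i`!%:R * u * (m%:R + rho) ^+ m <= Z ^+ N.
  apply: (@le_trans _ _ (Z ^+ i * Z ^+ e * Z ^+ m)); last first.
    by rewrite -!exprD; apply: ler_weXn2l.
  apply: ler_pM; rewrite ?mulr_ge0 ?exprn_ge0 //.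
    apply: ler_pM; rewrite ?mulr_ge0 //.
    by apply: binZ => //; rewrite ZE natrD -addrA lerDl addr_ge0.
  apply: lerXn2r; rewrite ?nnegrE //; rewrite ZE lerD2r ler_nat; exact: ltnW.
have h2 : D ^+ i * (L * tau) ^+ m * v <= (L * tau) ^+ N * (2^-1 ^+ i / L).
  rewrite !exprMn.
  have hD : D ^+ i <= L ^+ i * 2^-1 ^+ i.
    rewrite -exprMn; apply: lerXn2r; rewrite ?nnegrE ?mulr_ge0 ?invr_ge0 //.
    by rewrite ler_pdivlMr // mulrC.
  have hL : L ^+ i * L ^+ m <= L ^+ N / L.
    rewrite ler_pdivlMr // -!exprD -exprSr; apply: ler_weXn2l => //.
    by rewrite /m addnCA subnKC // /N addnC -addnS leq_add2l.
  have ht : tau ^+ m * v <= tau ^+ N.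
    apply: (@le_trans _ _ (tau ^+ m * tau)); first by rewrite ler_wpM2l ?exprn_ge0.
    by rewrite -exprSr; apply: ler_weXn2l.
  apply: (@le_trans _ _ (L ^+ i * 2^-1 ^+ i * (L ^+ m * (tau ^+ m * v)))).
    rewrite (_ : D ^+ i * (L ^+ m * tau ^+ m) * v = D ^+ i * (L ^+ m * (tau ^+ m * v))); last by ring.
    by apply: ler_wpM2r hD; rewrite !mulr_ge0 ?exprn_ge0.
  apply: (@le_trans _ _ (2^-1 ^+ i * (L ^+ N / L * tau ^+ N))).
    rewrite (_ : L ^+ i * 2^-1 ^+ i * _ = 2^-1 ^+ i * (L ^+ i * L ^+ m * (tau ^+ m * v))); last by ring.
    apply: ler_wpM2l; first by rewrite exprn_ge0 ?invr_ge0.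
    by apply: ler_pM; rewrite ?mulr_ge0 ?exprn_ge0.
  by rewrite le_eqVlt; apply/orP; left; apply/eqP; ring.
have -> : 'C(n, i)%:R * (i`!%:R * D ^+ i) * u * ((L * tau) ^+ m * (m%:R + rho) ^+ m) * v =
  ('C(n, i)%:R * i`!%:R * u * (m%:R + rho) ^+ m) * (D ^+ i * (L * tau) ^+ m * v) by ring.
rewrite [leRHS](_ : _ = Z ^+ N * ((L * tau) ^+ N * (2^-1 ^+ i / L))); last by ring.
by apply: ler_pM; rewrite ?mulr_ge0 ?exprn_ge0 ?mulr_ge0.
Qed.

End Term.
End TermArith.

Section Estimate.
Variable R : realType.
Local Notation C := (Cx R).
Local Notation V2 := (C * C)%type.
Variables (S : nat) (calS : seq nat) (dg : nat -> nat -> nat).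
Variables (B : nat -> nat -> nat -> V2 -> C) (y : nat -> V2 -> C) (G : V2 -> C) (p : V2).
Variables (M D beta L rho c : R).
Hypotheses (rho1 : 1 <= rho) (c0 : 0 < c) (D0 : 0 <= D) (beta0 : 0 <= beta) (M0 : 0 <= M).
Let r := c / rho.
Let K1 := 6 * expR 1 : R.
Hypotheses (L1 : 1 <= L) (DL : 2 * D <= L).
Hypothesis LK : 2 * (size calS)%:R * (beta * (2 * (K1 / c) + 1)) <= L.
Hypothesis calSS : forall k, k \in calS ->
  [/\ (k < S)%N, (k + dg 1 k + 2 <= S)%N, (k + dg 2 k + 2 <= S)%N & (k + dg 3 k <= S)%N].
Hypothesis dG : forall x, nrm (x - p) < r -> differentiable G x.
Hypothesis dy : forall n x, nrm (x - p) < r -> G x != 0 -> differentiable (y n) x.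
Hypothesis yS : forall n x, (n < S)%N -> nrm (x - p) < r -> G x != 0 -> nrm (y n x) <= M.
Hypothesis yrec : forall n x, nrm (x - p) < r -> G x != 0 ->
  y (n + S)%N x = \sum_(k <- calS) \sum_(i < n.+1) 'C(n, i)%:R *
    (B 1 k i x * dt (y (k + (n - i))%N) x + B 2 k i x * dz (y (k + (n - i))%N) x +
     B 3 k i x * y (k + (n - i))%N x).
Hypothesis BB : forall m k i x, (1 <= m <= 3)%N -> k \in calS -> nrm (x - p) < r -> G x != 0 ->
  nrm (B m k i x) <= i`!%:R * D ^+ i * (beta * rho ^+ dg m k).

Let L0 : 0 < L. Proof. exact: lt_le_trans L1. Qed.
Let rho0 : 0 < rho. Proof. exact: lt_le_trans rho1. Qed.
Let r0 : 0 < r. Proof. by rewrite /r divr_gt0. Qed.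
Let K10 : 0 <= K1. Proof. by rewrite /K1 mulr_ge0 // expR_ge0. Qed.

Lemma nrm_sum3 (u u' v v' w w' : C) :
  nrm (u * u' + v * v' + w * w') <= nrm u * nrm u' + nrm v * nrm v' + nrm w * nrm w'.
Proof.
rewrite -!nrmM; apply: (le_trans (nrmD _ _)); apply: lerD => //; exact: nrmD.
Qed.

(* [tau^-1] is the relative distance to the boundary of the ball of radius [r], so that
   each derivative costs a factor [tau] by the Cauchy estimates. *)
Definition claim n := forall tau q, 1 <= tau -> nrm (q - p) < (1 - tau^-1) * r -> G q != 0 ->
  nrm (y n q) <= M * ((L * tau) ^+ n * (n%:R + rho) ^+ n).

Lemma sub_ball tau q : 1 <= tau -> nrm (q - p) < (1 - tau^-1) * r -> nrm (q - p) < r.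
Proof.
move=> tau1; move/lt_le_trans; apply; rewrite ler_piMl ?(ltW r0) // lerBlDr lerDl invr_ge0.
exact: le_trans tau1.
Qed.

Lemma shrink_ball m (tau : R) : 1 <= tau ->
  tau^-1 * r / m.+2%:R + (1 - tau^-1) * r = (1 - (tau * (m.+2%:R / m.+1%:R))^-1) * r.
Proof.
move=> tau1; have m1 : 1 + m%:R != 0 :> R by rewrite nat1r pnatr_eq0.
have m2 : 2 + m%:R != 0 :> R by rewrite -natrD pnatr_eq0.
have -> : m.+2%:R = 2 + m%:R :> R by rewrite -natrD.
have -> : m.+1%:R = 1 + m%:R :> R by rewrite nat1r.
field; rewrite m1 m2 gt_eqF //; exact: lt_le_trans tau1.
Qed.

(** Cauchy's estimate on a ball of radius [s], chosen so that it lies in the domain of the claim for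
    [tau']. Its inverse radius yields [rho * m.+2%:R * tau], and replacing [tau] by [tau'] in a
    power [m] costs at most [expR 1] by [shrink_pow]. *)
Lemma claim_derive m v tau q : claim m -> nrm v = 1 -> 1 <= tau ->
  nrm (q - p) < (1 - tau^-1) * r -> G q != 0 ->
  nrm ('D_v (y m) q) <= K1 / c * M * ((rho * m.+2%:R) * ((L * tau) ^+ m * (m%:R + rho) ^+ m) * tau).
Proof.
move=> cm v1 tau1 qp Gq; have tau0 : 0 < tau by apply: lt_le_trans tau1.
pose s := tau^-1 * r / m.+2%:R.
have s0 : 0 < s by rewrite /s !mulr_gt0 // invr_gt0.
pose tau' := tau * (m.+2%:R / m.+1%:R).
have m12 : 1 <= m.+2%:R / m.+1%:R :> R by rewrite ler_pdivlMr ?ltr0n // mul1r ler_nat.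
have tau'1 : 1 <= tau' by rewrite mulr_ege1.
have inb x : nrm (x - q) < s -> nrm (x - p) < (1 - tau'^-1) * r.
  by move=> xq; have := nrm_sub_lt xq qp; rewrite shrink_ball.
pose M' := M * ((L * tau') ^+ m * (m%:R + rho) ^+ m).
have h := @cauchy_off _ _ (y m) G q v s M' s0
  (fun x xq => dG (sub_ball tau'1 (inb x xq)))
  (fun x xq Gx => dy m (sub_ball tau'1 (inb x xq)) Gx)
  (fun x xq Gx => cm _ x tau'1 (inb x xq) Gx) Gq.
apply: (le_trans h); rewrite v1 mulr1 /M'.
have P0 : 0 <= L ^+ m * tau ^+ m * (m%:R + rho) ^+ m.
  by rewrite !mulr_ge0 ?exprn_ge0 ?addr_ge0 ?(ltW L0) ?(ltW tau0) ?(ltW rho0).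
rewrite /s /tau' /r shrink_eq ?pnatr_eq0 ?(gt_eqF tau0) ?(gt_eqF c0) ?(gt_eqF rho0) //.
rewrite /K1 shrink_eq2.
apply: ler_wpM2r; last exact: shrink_pow.
have Q0 : 0 <= 6 / c * M by rewrite mulr_ge0 // divr_ge0 // ltW.
apply: mulr_ge0 => //; apply: mulr_ge0; last exact: ltW.
by apply: mulr_ge0 => //; apply: mulr_ge0 => //; exact: ltW.
Qed.

Lemma geo_le2 n : \sum_(i < n) (2^-1 : R) ^+ i <= 2.
Proof.
suff -> : \sum_(i < n) (2^-1 : R) ^+ i = 2 - 2 * 2^-1 ^+ n.
  by rewrite gerBl mulr_ge0 // exprn_ge0 // invr_ge0.
elim: n => [|n IH]; first by rewrite big_ord0 expr0 mulr1 subrr.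
by rewrite big_ord_recr /= IH exprS; field.
Qed.

Lemma term_bound n k i tau q : (forall m, (m < n + S)%N -> claim m) -> k \in calS -> (i <= n)%N ->
  1 <= tau -> nrm (q - p) < (1 - tau^-1) * r -> G q != 0 ->
  nrm ('C(n, i)%:R * (B 1 k i q * dt (y (k + (n - i))%N) q + B 2 k i q * dz (y (k + (n - i))%N) q +
     B 3 k i q * y (k + (n - i))%N q)) <=
  M * ((L * tau) ^+ (n + S) * ((n + S)%:R + rho) ^+ (n + S)) * (beta * (2 * (K1 / c) + 1) / L) * 2^-1 ^+ i.
Proof.
move=> IH kS ih tau1 qp Gq.
set m := (k + (n - i))%N; set N := (n + S)%N; set Z := N%:R + rho.
have [k1 k2 k3 k4] := calSS kS.
have mN : (m < N)%N by rewrite /m /N -addSn addnC leq_add // leq_subr.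
have tau0 : 0 < tau by apply: lt_le_trans tau1.
have Z1 : 1 <= Z by rewrite /Z (le_trans rho1) // lerDr.
have Z0 : 0 <= Z by apply: le_trans Z1.
have qr := sub_ball tau1 qp.
have base e u v := @base_term _ n i k S D L Z rho tau D0 L1 DL rho1 tau1 ih k1 erefl e u v.
set T := (L * tau) ^+ N * Z ^+ N * (2^-1 ^+ i / L).
have rZ j : rho ^+ j <= Z ^+ j.
  by apply: lerXn2r; rewrite ?nnegrE ?(ltW rho0) //; rewrite /Z lerDr.
have mZ : m.+2%:R <= Z.
  apply: (@le_trans _ _ (N%:R + 1)); last by rewrite lerD2l.
  by rewrite -[1]/(1%:R) -natrD ler_nat addn1 ltnS.
have dterm (j : nat) (v : V2) : (j == 1)%N || (j == 2)%N -> nrm v = 1 -> (k + dg j k + 2 <= S)%N ->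
    'C(n, i)%:R * (nrm (B j k i q) * nrm ('D_v (y m) q)) <= M * (beta * (K1 / c)) * T.
  move=> j12 v1 kd.
  have j3 : (1 <= j <= 3)%N by case/orP: j12 => /eqP->.
  have hB := BB i j3 kS qr Gq.
  have hD := claim_derive (IH m mN) v1 tau1 qp Gq.
  have c1 : 0 <= 'C(n, i)%:R :> R by rewrite ler0n.
  apply: (le_trans (ler_wpM2l c1 (ler_pM (nrm_ge0 _) (nrm_ge0 _) hB hD))).
  rewrite term_eq1.
  apply: ler_wpM2l; first by rewrite !mulr_ge0 ?invr_ge0 ?(ltW c0).
  (* The two additional powers of [Z] pay for the factors [rho] and [m.+2%:R] of the derivative. *)
  apply: (base (dg j k + 2)%N) => //.
  - by apply: deg_arith => //; rewrite addnA.
  - by rewrite !mulr_ge0 ?exprn_ge0 ?(ltW rho0).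
  - rewrite exprD expr2; apply: ler_pM; rewrite ?mulr_ge0 ?exprn_ge0 ?(ltW rho0) //.
    by apply: ler_pM; rewrite ?(ltW rho0) //; rewrite /Z lerDr.
  - exact: ltW.
have t1 := @dterm 1%N ((1, 0) : V2) erefl (nrm_e1 R) k2.
have t2 := @dterm 2%N ((0, 1) : V2) erefl (nrm_e2 R) k3.
have t3 : 'C(n, i)%:R * (nrm (B 3 k i q) * nrm (y m q)) <= M * beta * T.
  have hB := BB i (erefl : (1 <= 3 <= 3)%N) kS qr Gq.
  have hY := IH m mN tau q tau1 qp Gq.
  have c1 : 0 <= 'C(n, i)%:R :> R by rewrite ler0n.
  apply: (le_trans (ler_wpM2l c1 (ler_pM (nrm_ge0 _) (nrm_ge0 _) hB hY))).
  rewrite term_eq2.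
  apply: ler_wpM2l; first by rewrite mulr_ge0.
  apply: (base (dg 3 k)) => //; last by rewrite exprn_ge0 // ltW.
  exact: deg_arith.
rewrite nrmM nrm_nat.
apply: (@le_trans _ _ ('C(n, i)%:R * (nrm (B 1 k i q) * nrm (dt (y m) q) + nrm (B 2 k i q) * nrm (dz (y m) q) +
   nrm (B 3 k i q) * nrm (y m q)))).
  apply: ler_wpM2l; first by rewrite ler0n.
  exact: nrm_sum3.
rewrite mulrDr mulrDr; apply: (le_trans (lerD (lerD t1 t2) t3)).
by rewrite /T term_eq3.
Qed.

(** By strong induction: the factors [2^-1 ^+ i] sum to at most 2, the terms over [calS] contribute
    its size, and [LK] is the choice of [L] that makes the total factor at most 1. *)
Lemma claim_all n : claim n.
Proof.
have [N nN] := ubnP n; elim: N n nN => // N IH n; rewrite ltnS => nN tau q tau1 qp Gq.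
have tau0 : 0 < tau by apply: lt_le_trans tau1.
have Lt1 : 1 <= L * tau by rewrite mulr_ege1.
have [nS|Sn] := ltnP n S.
  apply: (le_trans (yS nS (sub_ball tau1 qp) Gq)); rewrite ler_peMr //.
  apply: mulr_ege1; apply: exprn_ege1 => //.
  by apply: (le_trans rho1); rewrite lerDr.
rewrite -(subnK Sn); set n' := (n - S)%N; rewrite yrec //; last exact: sub_ball tau1 qp.
have IH' m : (m < n' + S)%N -> claim m.
  by rewrite subnK // => mn; apply: IH; exact: leq_trans mn nN.
set T := (L * tau) ^+ (n' + S) * ((n' + S)%:R + rho) ^+ (n' + S).
have T0 : 0 <= M * T.
  have Lt0 : 0 <= L * tau := le_trans ler01 Lt1.
  apply: mulr_ge0 => //; apply: mulr_ge0; apply: exprn_ge0 => //.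
  by rewrite addr_ge0 ?ler0n // ltW.
pose Q := beta * (2 * (K1 / c) + 1).
have Q0 : 0 <= Q by rewrite /Q mulr_ge0 // addr_ge0 ?mulr_ge0 ?invr_ge0 ?(ltW c0).
apply: (le_trans (nrm_sum _ _ _)).
apply: (@le_trans _ _ (\sum_(k <- calS) M * T * (Q / L) * 2)).
  rewrite big_seq [leRHS]big_seq; apply: ler_sum => k kS.
  apply: (le_trans (nrm_sum _ _ _)).
  apply: (@le_trans _ _ (\sum_(i < n'.+1) M * T * (Q / L) * 2^-1 ^+ i)).
    by apply: ler_sum => i _; exact: (term_bound IH' kS (ltn_ord i : (i <= n')%N) tau1 qp Gq).
  rewrite -mulr_sumr; apply: ler_wpM2l (geo_le2 _).
  by rewrite mulr_ge0 // divr_ge0 // ltW.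
rewrite big_const_seq count_predT iter_addr_0 -[leLHS]mulr_natr.
rewrite sum_eq.
by rewrite ler_piMr // ler_pdivrMr // mul1r.
Qed.

(** At the centre any [tau > 1] is admissible, and 2 is taken. Then x^n <= n! e^x with x = n + rho
    separates the dependence on [rho]. *)
Lemma final_estimate n : G p != 0 -> nrm (y n p) <= M * expR rho * (n`!%:R * (L * 2 * expR 1) ^+ n).
Proof.
move=> Gp; have t2 : 1 <= 2 :> R by rewrite ler1n.
have h : nrm (p - p) < (1 - 2^-1) * r.
  by rewrite subrr nrm0 mulr_gt0 // subr_gt0 invf_lt1 // ltr1n.
apply: (le_trans (claim_all n t2 h Gp)); rewrite -mulrA; apply: ler_wpM2l => //.
have z0 : 0 <= n%:R + rho by rewrite addr_ge0 // ltW.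
have := pow_exp_fact n z0; rewrite expRD -[n%:R]mulr1 expRM_natl mulr1 => h2.
rewrite [in leRHS]exprMn.
rewrite final_eq.
by apply: ler_wpM2l h2; rewrite exprn_ge0 // mulr_ge0 // ltW.
Qed.

End Estimate.

(** * Polynomials bounded through their values at finitely many points *)

Section Interpolation.
Variable R : realType.
Local Notation C := (Cx R).

(** Nothing is known about how the coefficients of the polynomial in u_0 depend on (t, z, w), but
    compactness bounds its values at 0, ..., n. The induction is Newton interpolation: subtracting
    the value at [n.+1] and dividing by the linear factor, which has modulus at least 1 at the other
    nodes. *)
Lemma poly_bound n : exists2 K : R, 0 <= K & forall (q : {poly C}) (M : R), (size q <= n.+1)%N ->
  0 <= M -> (forall j, (j <= n)%N -> nrm q.[j%:R] <= M) -> forall u, nrm q.[u] <= K * M * (1 + nrm u) ^+ n.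
Proof.
elim: n => [|n [K K0 IH]].
  exists 1 => // q M /size1_polyC-> M0 h u; rewrite expr0 mulr1 mul1r hornerC.
  by have := h 0%N (leqnn 0); rewrite hornerC.
exists (1 + (1 + n.+1%:R) * (2 * K)); first by rewrite addr_ge0 ?mulr_ge0 ?addr_ge0.
move=> q M qs M0 h u; pose x : C := n.+1%:R; pose c := q.[x].
have /factor_theorem[q' qE] : root (q - c%:P) x by rewrite /root !hornerE subrr.
have qu v : q.[v] = c + q'.[v] * (v - x).
  by have := congr1 (fun p => p.[v]) qE; rewrite !hornerE => /eqP; rewrite subr_eq addrC => /eqP.
have cM : nrm c <= M by apply: h.
have q's : (size q' <= n.+1)%N.
  have [->|q'0] := eqVneq q' 0; first by rewrite size_poly0.
  have := size_Mmonic q'0 (monicXsubC x); rewrite size_XsubC addn2 /= => sE.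
  rewrite -ltnS -sE -qE; apply: (leq_trans (size_polyD _ _)); rewrite geq_max qs size_polyN /=.
  by apply: leq_trans (size_polyC_leq1 _) _.
have hq' j : (j <= n)%N -> nrm q'.[j%:R] <= 2 * M.
  move=> jn; have jx : 1 <= nrm (j%:R - x).
    by rewrite nrmB /x -natrB ?(leq_trans jn) // nrm_nat ler1n subn_gt0.
  have E : q'.[j%:R] * (j%:R - x) = q.[j%:R] - c by rewrite qu [c + _]addrC addrK.
  apply: (@le_trans _ _ (nrm (q'.[j%:R] * (j%:R - x)))).
    by rewrite nrmM ler_peMr ?nrm_ge0.
  rewrite E; apply: (le_trans (nrmD _ _)); rewrite nrmN mulr_natl mulr2n; apply: lerD => //.
  by apply: h; exact: leq_trans jn _.
have M20 : 0 <= 2 * M by rewrite mulr_ge0.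
have hu := IH q' (2 * M) q's M20 hq' u.
set T := 1 + nrm u in hu *; have T1 : 1 <= T by rewrite /T lerDl nrm_ge0.
have Tn : 1 <= T ^+ n.+1 by rewrite exprn_ege1.
have ux : nrm (u - x) <= (1 + n.+1%:R) * T.
  apply: (le_trans (nrmD _ _)); rewrite nrmN /x nrm_nat /T.
  have := nrm_ge0 u; have := ler0n R n.+1; move: (nrm u) (n.+1%:R) => v w w0 v0.
  have : 0 <= w * v by rewrite mulr_ge0.
  by rewrite mulrDl !mulrDr !mul1r !mulr1; move: (w * v) => z; lra.
rewrite qu; apply: (le_trans (nrmD _ _)); rewrite nrmM.
have -> : (1 + (1 + n.+1%:R) * (2 * K)) * M * T ^+ n.+1 = M * T ^+ n.+1 + (1 + n.+1%:R) * (2 * K) * M * T ^+ n.+1 by ring.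
apply: lerD; first by apply: (le_trans cM); rewrite ler_peMr.
apply: (@le_trans _ _ (K * (2 * M) * T ^+ n * ((1 + n.+1%:R) * T))).
  by apply: ler_pM; rewrite ?nrm_ge0.
by rewrite exprS le_eqVlt; apply/orP; left; apply/eqP; ring.
Qed.

End Interpolation.

(** * Convergence and positivity of the zeta series *)

Section Zeta.
Variable R : realType.

Lemma ln_step (x : R) : 0 < x -> (x + 1)^-1 <= ln (x + 1) - ln x.
Proof.
move=> x0; have x1 : 0 < x + 1 by rewrite addr_gt0.
have h : ln (x / (x + 1)) <= x / (x + 1) - 1.
  have q0 : 0 < x / (x + 1) by rewrite divr_gt0.
  have := le_ln1Dx (x := x / (x + 1) - 1); rewrite addrCA subrr addr0; apply.
  by rewrite ltrBrDr addrC subrr.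
have E : x / (x + 1) - 1 = - (x + 1)^-1 by field; rewrite gt_eqF.
rewrite E ln_div // in h; move: h; move: ((x + 1)^-1) (ln x) (ln (x + 1)) => u v w; lra.
Qed.

(** The exponentials are x^(1-b) and (x+1)^(1-b), so this is the integral comparison for x^(-b)
    written as a telescoping bound. *)
Lemma riemann_step (b x : R) : 1 < b -> 0 < x ->
  (b - 1) * ((x + 1) `^ b)^-1 <= expR (- (b - 1) * ln x) - expR (- (b - 1) * ln (x + 1)).
Proof.
move=> b1 x0; have x1 : 0 < x + 1 by rewrite addr_gt0.
have a0 : 0 < b - 1 by rewrite subr_gt0.
set f := expR (- (b - 1) * ln (x + 1)).
have f0 : 0 < f by exact: expR_gt0.
have -> : expR (- (b - 1) * ln x) = f * expR ((b - 1) * (ln (x + 1) - ln x)).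
  by rewrite -expRD; congr expR; ring.
have -> : ((x + 1) `^ b)^-1 = f * (x + 1)^-1.
  rewrite /powR gt_eqF // -expRN -[in RHS](lnK (x := x + 1)) ?posrE // -expRN -expRD.
  by congr expR; ring.
have h : 1 + (b - 1) * (x + 1)^-1 <= expR ((b - 1) * (ln (x + 1) - ln x)).
  apply: le_trans (expR_ge1Dx _); rewrite lerD2l ler_wpM2l ?(ltW a0) //; exact: ln_step.
have := ler_wpM2l (ltW f0) h; rewrite mulrDr mulr1.
rewrite [(b - 1) * (f * _)]mulrCA; move: (f * _) (f * expR _) => u v; lra.
Qed.

Lemma riemann_partial (b : R) n : 1 < b ->
  series (riemannR b) n.+1 <= 1 + (b - 1)^-1 * (1 - expR (- (b - 1) * ln n.+1%:R)).
Proof.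
move=> b1; have a0 : 0 < b - 1 by rewrite subr_gt0.
elim: n => [|n IH].
  rewrite seriesSr (_ : series _ 0%N = 0); last by rewrite seriesEnat /= big_geq.
  by rewrite add0r /riemannR powR1 invr1 ln1 mulr0 expR0 subrr mulr0 addr0.
rewrite seriesSr; apply: (le_trans (lerD IH (lexx _))).
have := @riemann_step b n.+1%:R b1 (ltr0Sn _ n); rewrite natr1.
rewrite -ler_pdivlMl // => h.
move: h; rewrite /riemannR; move: (_ `^ _)^-1 (expR (- (b - 1) * ln n.+1%:R)) (expR (- (b - 1) * ln n.+2%:R)) => u v w.
by rewrite !mulrBr mulr1; lra.
Qed.

(** [zetaR] is a [limn], which says something about the series only once it converges; the partial
    sums are therefore bounded first. *)
Lemma zeta_gt0 (b : R) : 1 < b -> 0 < zetaR b.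
Proof.
move=> b1; have a0 : 0 < b - 1 by rewrite subr_gt0.
have b0 : 0 <= b by rewrite (le_trans ler01) // ltW.
have nd : {homo series (riemannR b) : n m / (n <= m)%N >-> n <= m}.
  by apply: nondecreasing_series => n _ _; exact: ltW (riemannR_gt0 n b0).
have ub : has_ubound (range (series (riemannR b))).
  exists (1 + (b - 1)^-1) => _ [n _ <-].
  apply: (le_trans (nd n n.+1 (leqnSn n))); apply: (le_trans (riemann_partial n b1)).
  rewrite lerD2l ler_piMr ?invr_ge0 ?(ltW a0) // gerBl expR_ge0 //.
have cv := nondecreasing_is_cvgn nd ub.
apply: (@lt_le_trans _ _ (series (riemannR b) 1%N)).
  by rewrite seriesEnat /= big_nat1; exact: riemannR_gt0.
exact: nondecreasing_cvgn_le.
Qed.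

End Zeta.

(** * The recursion for the Taylor coefficients *)

Section Recursion.
Variable R : realType.
Local Notation C := (Cx R).
Local Notation V2 := (C * C)%type.
Variables (S : nat) (calS : seq nat) (om : nat -> V2 -> C).
Variable B : nat -> nat -> nat -> V2 -> C.
Hypotheses (S1 : (1 <= S)%N) (cS : forall k, k \in calS -> (k < S)%N).

Definition yterm (y : nat -> V2 -> C) (n k i : nat) (x : V2) : C := 'C(n, i)%:R *
  (B 1 k i x * dt (y (k + (n - i))%N) x + B 2 k i x * dz (y (k + (n - i))%N) x +
   B 3 k i x * y (k + (n - i))%N x).

(* The first argument is fuel: [n] is enough to compute the [n]-th coefficient. *)
Fixpoint yfuel (N n : nat) : V2 -> C :=
  if (n < S)%N then om n else
  if N is N'.+1 then fun x => \sum_(k <- calS) \sum_(i < (n - S).+1) yterm (yfuel N') (n - S) k i x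
  else fun=> 0.

Definition ycoef n := yfuel n n.

Lemma yfuel_stable N n : (n <= N)%N -> yfuel N n = ycoef n.
Proof.
have st : forall N N' n, (n <= N)%N -> (n <= N')%N -> yfuel N n = yfuel N' n.
  elim=> [|N1 IH] [|N2] m /=; rewrite ?leqn0.
  - by [].
  - by move=> /eqP-> _; rewrite S1.
  - by move=> _ /eqP->; rewrite S1.
  move=> m1 m2; case: ltnP => // Sm; apply/funext => x.
  rewrite big_seq [RHS]big_seq; apply: eq_bigr => k kS; apply: eq_bigr => i _.
  have km : (k + (m - S - i) < m)%N.
    by have := cS kS; have := ltn_ord i; lia.
  by rewrite /yterm (IH N2) // -ltnS; apply: leq_trans km _.
by move=> nN; apply: st.
Qed.

Lemma ycoef_init n : (n < S)%N -> ycoef n = om n.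
Proof. by rewrite /ycoef; case: n => [|n] /= ->. Qed.

Lemma ycoef_rec n x : ycoef (n + S)%N x =
  \sum_(k <- calS) \sum_(i < n.+1) yterm ycoef n k i x.
Proof.
have [N E] : exists N, (n + S = N.+1)%N by exists (n + S).-1; rewrite prednK // addn_gt0 S1 orbT.
rewrite /ycoef E /= -E ltnNge leq_addl /= addnK big_seq [RHS]big_seq.
apply: eq_bigr => k kS; apply: eq_bigr => i _.
have kN : (k + (n - i) <= N)%N by have := cS kS; have := ltn_ord i; lia.
by rewrite /yterm !yfuel_stable.
Qed.

Lemma ycoef_hol (O : set V2) : open O ->
  (forall n, (n < S)%N -> holomorphic_on O (om n)) ->
  (forall m k i, (1 <= m <= 3)%N -> k \in calS -> holomorphic_on O (B m k i)) ->
  forall n, holomorphic_on O (ycoef n).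
Proof.
move=> oO hom hB n; have [N nN] := ubnP n; elim: N n nN => // N IH n; rewrite ltnS => nN.
have [nS|Sn] := ltnP n S; first by rewrite ycoef_init //; exact: hom.
move=> x Ox; rewrite -(subnK Sn) (_ : ycoef _ = fun x => \sum_(k <- calS)
    \sum_(i < (n - S).+1) yterm ycoef (n - S) k i x); last first.
  by apply/funext => z; exact: ycoef_rec.
rewrite (_ : (fun x => _) = fun x => \sum_(k <- calS | k \in calS)
    \sum_(i < (n - S).+1) yterm ycoef (n - S) k i x); last by apply/funext => z; rewrite big_seq.
apply: dsum_ => k kS; apply: dsum_ => i _.
have hy : holomorphic_on O (ycoef (k + (n - S - i))).
  by apply: IH; apply: leq_trans nN; have := cS kS; have := ltn_ord i; lia.
apply: dM_; first exact: dcst_.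
apply: dD_; first apply: dD_; apply: dM_.
- exact: hB.
- exact: (hol_derive ((1, 0) : V2) oO hy).
- exact: hB.
- exact: (hol_derive ((0, 1) : V2) oO hy).
- exact: hB.
- exact: hy.
Qed.

End Recursion.

(** * The series solves the equation *)

Section SumDerivation.
Variable R : realType.
Local Notation C := (Cx R).
Variable V : normedModType C.
Variables (U : set V) (L : (V -> C) -> V -> C).
Hypothesis dL : derivation U L.

Lemma hol_cst (c : C) : holomorphic_on U (fun=> c).
Proof. by move=> x _; exact: dcst_. Qed.

Lemma der_zero x : U x -> L (fun=> 0) x = 0.
Proof.
move=> Ux; have := deriv_mul dL (hol_cst 0) (hol_cst 0) Ux.
rewrite (_ : (fun _ => 0 * 0) = fun=> 0 :> C); last by apply/funext => y; rewrite mul0r.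
by rewrite mulr0 mul0r addr0.
Qed.

Lemma der_iter_zero n x : U x -> iter n L (fun=> 0) x = 0.
Proof.
elim: n x => [//|n IH] x Ux; rewrite iterS -[RHS](der_zero Ux).
by apply: (der_eq dL) => // y; exact: IH.
Qed.

Lemma hol_sum (I : eqType) (s : seq I) (F : I -> V -> C) :
  (forall i, i \in s -> holomorphic_on U (F i)) ->
  holomorphic_on U (fun x => \sum_(i <- s) F i x).
Proof.
move=> hF x Ux; rewrite (_ : (fun x => _) = fun x => \sum_(i <- s | i \in s) F i x).
  by apply: dsum_ => i si; exact: hF.
by apply/funext => y; rewrite big_seq.
Qed.

Lemma der_iter_sum (I : eqType) n (s : seq I) (F : I -> V -> C) x :
  (forall i, i \in s -> holomorphic_on U (F i)) -> U x ->
  iter n L (fun x => \sum_(i <- s) F i x) x = \sum_(i <- s) iter n L (F i) x.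
Proof.
move=> hF Ux; elim: s hF => [|i s IH] hF.
  rewrite big_nil -[RHS](der_iter_zero n Ux).
  by apply: (der_iter_eq dL) => // y _; rewrite big_nil.
have hs : forall i, i \in s -> holomorphic_on U (F i).
  by move=> j js; apply: hF; rewrite inE js orbT.
have hi : holomorphic_on U (F i) by apply: hF; rewrite inE eqxx.
rewrite big_cons -IH // -(der_iter_add dL n hi (hol_sum hs)) //.
by apply: (der_iter_eq dL) => // y _; rewrite big_cons.
Qed.

End SumDerivation.

Section Pde.
Variable R : realType.
Local Notation C := (Cx R).
Local Notation V2 := (C * C)%type.
Local Notation V3 := (C * C * C)%type.

Let e3 : V3 := (0, 0, 1).

Lemma nderive_fiber (f : V3 -> C) (x : V2) i w :
  nderive e3 i f (x, w) = nderive (1 : C) i (fun w => f (x, w)) w.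
Proof.
have step (g : V3 -> C) v : 'D_e3 g (x, v) = 'D_(1 : C) (fun w => g (x, w)) v.
  apply: derive_ext => h; congr g; congr (_, _).
  by rewrite /= -[RHS]add0r; congr (_ + _); exact: scaler0.
elim: i w => [//|i IH] w; rewrite /nderive !iterS step.
by congr ('D_(1 : C) _ w); apply/funext => v; exact: IH.
Qed.

(** Only the fibre over [x] enters, so a bound of the coefficient at this single [x] suffices;
    [nagumo] is applied in the variable w. *)
Lemma coef_bound (f : V3 -> C) (x : V2) (w1 M : R) i : 0 < w1 ->
  (forall w, nrm w < w1 -> differentiable f (x, w)) ->
  (forall w, nrm w < w1 -> nrm (f (x, w)) <= M) ->
  nrm (iter i (@dw3 R) f (x, 0)) <= i`!%:R * (6 * expR 1 / w1) ^+ i * M.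
Proof.
move=> w10 df fM.
have -> : iter i (@dw3 R) f (x, 0) = nderive (1 : C) i (fun w => f (x, w)) 0 := nderive_fiber f x i 0.
have dg w : nrm (w - 0) < w1 -> differentiable (fun w => f (x, w)) w.
  rewrite subr0 => ww; apply: (@dcomp_ _ C V3 (fun w => (x, w)) f); last exact: df.
  by apply: (@differentiable_pair _ _ _ _ (fun=> x) id); [exact: differentiable_cst|exact: did_].
have gM w : nrm (w - 0) < w1 -> nrm (f (x, w)) <= M by rewrite subr0; exact: fM.
apply: (@nagumo _ _ (fun F : C -> C => 'D_1 F) (fun w => f (x, w)) 0 w1 6 M i w10) => //.
- by move=> G s sw dG; exact: ball_diff_derive.
- move=> G z s B s0 _ dG GB; have := cauchy_est (1 : C) s0 dG GB.
  by rewrite nrm1 mulr1.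
Qed.

Lemma adm_shiftn (U : set V2) rho c k : adm U rho c -> adm U rho (fun n => c (k + n)%N).
Proof.
move=> hc; elim: k => [|k IH]; first exact: hc.
by have := adm_shift IH; congr adm; apply/funext => n; rewrite addSnnS.
Qed.

Variables (S : nat) (calS : seq nat) (beta : nat -> nat -> V3 -> C) (y : nat -> V2 -> C).
Variables (O : set V2) (w0 : R).
Let U3 : set V3 := [set q | O q.1 /\ 2 * nrm q.2 < w0].
Let Y : V3 -> C := pser y.
Let B m k i x : C := iter i (@dw3 R) (beta m k) (x, 0).
Hypotheses (w00 : 0 < w0) (oO : open O) (ady : adm O w0 y).
Hypothesis hb : forall m k, (1 <= m <= 3)%N -> k \in calS -> holomorphic_on U3 (beta m k).
Hypothesis yrec : forall n x, O x ->
  y (n + S)%N x = \sum_(k <- calS) \sum_(i < n.+1) yterm B y n k i x.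

Lemma leib3 (c b1 b2 b3 y1 y2 y3 : C) :
  c * b1 * y1 + c * b2 * y2 + c * b3 * y3 = c * (b1 * y1 + b2 * y2 + b3 * y3).
Proof. ring. Qed.

Lemma open_U3 : open U3.
Proof.
apply/open_nrm => q [Oq qw]; have [r r0 hr] := proj1 (open_nrm O) oO _ Oq.
exists (Num.min r ((w0 - 2 * nrm q.2) / 2)).
  by rewrite lt_min r0 /= divr_gt0 // subr_gt0.
move=> x /nrm_pairP[] /lt_min2[h1 _] /lt_min2[_ h2].
by split; [exact: hr|exact: half_room (nrm_lt_add (h2 : nrm (x.2 - q.2) < _))].
Qed.

Let dD := derivation_D e3 open_U3.

Lemma hol_Y : holomorphic_on U3 Y.
Proof. by move=> q [Oq qw]; have [] := pser_diff ady Oq qw. Qed.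

Let hk k : holomorphic_on U3 (iter k (@dw3 R) Y) := der_iter_hol dD k hol_Y.

Lemma shift_Y k q : U3 q -> iter k (@dw3 R) Y q = pser (fun n => y (k + n)%N) q.
Proof. by move=> [Oq qw]; exact: (pser_iter k ady Oq qw). Qed.

Lemma deriv_Y (v : V2) k q : U3 q ->
  'D_((v, 0) : V3) (iter k (@dw3 R) Y) q = pser (fun n => 'D_v (y (k + n)%N)) q.
Proof.
move=> Uq; have [r r0 hr] := proj1 (open_nrm U3) open_U3 q Uq.
rewrite (derive_near (g := pser (fun n => y (k + n)%N)) _ r0); last first.
  by move=> x /hr; exact: shift_Y.
by have [Oq qw] := Uq; have [_ _] := pser_diff (adm_shiftn k ady) Oq qw; exact.
Qed.

Lemma mem0 p : O p -> U3 (p, 0).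
Proof. by move=> Op; split=> //=; rewrite nrm0 mulr0. Qed.

Lemma jet_Y k j p : O p -> iter j (@dw3 R) (iter k (@dw3 R) Y) (p, 0) = y (k + j)%N p.
Proof.
move=> Op; rewrite -iterD (shift_Y _ (mem0 Op)) pser0 addn0 addnC //.
Qed.

Lemma jet_DY (v : V2) k j p : O p ->
  iter j (@dw3 R) ('D_((v, 0) : V3) (iter k (@dw3 R) Y)) (p, 0) = 'D_v (y (k + j)%N) p.
Proof.
move=> Op; rewrite (der_iter_eq dD j (deriv_Y v k) (mem0 Op)).
have [Oq qw] := mem0 Op.
by rewrite (pser_iter j (adm_derive v (adm_shiftn k ady)) Oq qw) pser0 addn0.
Qed.

Lemma jet_dt k j p : O p ->
  iter j (@dw3 R) (dt3 (iter k (@dw3 R) Y)) (p, 0) = dt (y (k + j)%N) p.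
Proof. exact: (jet_DY ((1, 0) : V2) k j). Qed.

Lemma jet_dz k j p : O p ->
  iter j (@dw3 R) (dz3 (iter k (@dw3 R) Y)) (p, 0) = dz (y (k + j)%N) p.
Proof. exact: (jet_DY ((0, 1) : V2) k j). Qed.

Let rhs k q : C := beta 1 k q * dt3 (iter k (@dw3 R) Y) q + beta 2 k q * dz3 (iter k (@dw3 R) Y) q
  + beta 3 k q * iter k (@dw3 R) Y q.

Let hT k : holomorphic_on U3 (dt3 (iter k (@dw3 R) Y)) := hol_derive ((1, 0, 0) : V3) open_U3 (hk k).
Let hZ k : holomorphic_on U3 (dz3 (iter k (@dw3 R) Y)) := hol_derive ((0, 1, 0) : V3) open_U3 (hk k).

Lemma hol_rhs k : k \in calS -> holomorphic_on U3 (rhs k).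
Proof.
move=> kS q Uq; apply: dD_; first apply: dD_; apply: dM_.
- exact: hb.
- exact: hT.
- exact: hb.
- exact: hZ.
- exact: hb.
- exact: hk.
Qed.

Lemma jet_rhs k j p : k \in calS -> O p ->
  iter j (@dw3 R) (rhs k) (p, 0) = \sum_(i < j.+1) yterm B y j k i p.
Proof.
move=> kS Op; have U0 := mem0 Op.
have h1 := hol_mul (hb (erefl : (1 <= 1 <= 3)%N) kS) (hT k).
have h2 := hol_mul (hb (erefl : (1 <= 2 <= 3)%N) kS) (hZ k).
have h3 := hol_mul (hb (erefl : (1 <= 3 <= 3)%N) kS) (hk k).
have l0 := der_iter_add dD j (hol_add h1 h2) h3 U0.
have l12 := der_iter_add dD j h1 h2 U0.
have l1 := der_leibniz dD j (hb (erefl : (1 <= 1 <= 3)%N) kS) (hT k) U0.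
have l2 := der_leibniz dD j (hb (erefl : (1 <= 2 <= 3)%N) kS) (hZ k) U0.
have l3 := der_leibniz dD j (hb (erefl : (1 <= 3 <= 3)%N) kS) (hk k) U0.
apply: (etrans l0); apply: (etrans (congr2 _ l12 erefl)).
apply: (etrans (congr2 _ (congr2 _ l1 l2) l3)).
rewrite -!big_split; apply: eq_bigr => i _ /=.
apply: etrans (leib3 _ _ _ _ _ _ _); congr (_ * _ + _ * _ + _ * _).
- exact: jet_dt.
- exact: jet_dz.
- exact: jet_Y.
Qed.

(** The recursion says that both sides have the same w-jet at w = 0, and the identity theorem
    applies on the fibre over [p]. The fibre is bounded on the closed disc of radius [w0 / 4], of
    which [flat_line] keeps one eighth. *)
Lemma pser_pde p w : O p -> nrm w < w0 / 4 / 8 ->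
  iter S (@dw3 R) Y (p, w) = \sum_(k <- calS) rhs k (p, w).
Proof.
move=> Op ww; pose Phi q := \sum_(k <- calS) rhs k q.
pose f q := iter S (@dw3 R) Y q - Phi q.
have hP : holomorphic_on U3 Phi by apply: hol_sum => k kS; exact: hol_rhs.
have hf : holomorphic_on U3 f by move=> q Uq; apply: dB_; [exact: hk|exact: hP].
have w40 : 0 < w0 / 4 by rewrite divr_gt0.
have E (l : C) : ((p, 0) : V3) + l *: e3 = (p, l).
  congr (_, _); rewrite /= ?add0r; last exact: mulr1.
  by rewrite scaler0 addr0.
have inU (l : C) : nrm (l - 0) <= w0 / 4 -> U3 (p, l).
  by rewrite subr0 => ll; split=> //=; move: ll w00; move: (nrm l) => x; lra.
have U0 := mem0 Op.
have dline (l : C) : nrm (l - 0) <= w0 / 4 -> differentiable (fun l : C => f (p, l)) l.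
  move=> /inU Ul; apply: (@dcomp_ _ C V3 (fun l => (p, l)) f); last exact: hf.
  by apply: (@differentiable_pair _ _ _ _ (fun=> p) id); [exact: differentiable_cst|exact: did_].
have [M M0 hM] := bounded_cdisc dline.
suff : f (p, w) = 0 by move=> /eqP; rewrite subr_eq0 => /eqP.
rewrite -E; apply: (@flat_line _ _ f (p, 0) e3 (w0 / 4) M w40); [| | | |exact: ww].
- by move=> l ll; rewrite E; apply/hf/inU; rewrite subr0 ltW.
- by move=> l ll; rewrite E; apply: hM; rewrite subr0 ltW.
- have [r r0 hr] := proj1 (open_nrm U3) open_U3 _ U0.
  exact: (ex_intro2 _ _ r r0 (fun x xr => hf x (hr x xr))).
move=> j.
have EE : iter j (@dw3 R) (iter S (@dw3 R) Y) (p, 0) = nderive e3 j f (p, 0) + iter j (@dw3 R) Phi (p, 0).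
  rewrite /nderive -(der_iter_add dD j hf hP) //; apply: (der_iter_eq dD) => //.
  by move=> q _; rewrite /f subrK.
have P : iter j (@dw3 R) Phi (p, 0) = \sum_(k <- calS) \sum_(i < j.+1) yterm B y j k i p.
  rewrite (der_iter_sum dD j (fun k kS => hol_rhs kS) U0) big_seq [RHS]big_seq.
  by apply: eq_bigr => k kS; exact: jet_rhs.
move: EE; rewrite (jet_Y S j Op) (addnC S j) (yrec j Op) P.
by rewrite -{1}[\sum_(k <- calS) _]add0r => /addIr <-.
Qed.

End Pde.

Section OpenComplement.
Variable R : realType.
Local Notation C := (Cx R).
Local Notation V2 := (C * C)%type.

Lemma open_compl_variety (r : R) (Theta : set V2) : analytic_variety (bidisc r) Theta ->
  open (bidisc r `\` Theta).
Proof.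
move=> [_ hT]; apply/open_nrm => p [Dp nTp].
have [U [oU Up UD [n [F [hF UT]]]]] := hT p Dp.
have [i Fi] : exists i, F i p != 0.
  apply: contrapT => nex; apply: nTp; suff : (U `&` Theta) p by case.
  rewrite UT; split=> // i; apply/eqP; apply: contrapT => /negP h.
  by apply: nex; exists i.
have [e1 e10 h1] := diff_cont (hF i p Up) (nrm_gt0 Fi).
have [e2 e20 h2] := proj1 (open_nrm U) oU p Up.
exists (Num.min e1 e2); first by rewrite lt_min e10.
move=> q /lt_min2[q1 q2]; split; first exact/UD/h2.
move=> Tq; have UTq : (U `&` Theta) q := conj (h2 q q2) Tq.
move: UTq; rewrite UT => -[_ /(_ i) F0].
by have := h1 q q1; rewrite F0 sub0r nrmN ltxx.
Qed.

End OpenComplement.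

(** * Bounds on the coefficients of the linear problem *)

Section Coefficients.
Variable R : realType.
Local Notation C := (Cx R).
Local Notation V2 := (C * C)%type.
Local Notation V3 := (C * C * C)%type.

Lemma diff_fst_proj (V W : normedModType C) (q : V * W) : differentiable (fun q : V * W => q.1) q.
Proof.
have lin : linear (fun v : V * W => v.1) by [].
apply: (proj1 (@diffI _ _ _ (fun q : V * W => q.1) q (fun v => v.1) 1 lin _ _)).
- by move=> v; rewrite mul1r; exact: nrm_fst_le.
- by move=> e e0; exists 1 => // v _; rewrite /= -addrA -opprD subrr nrm0 mulr_ge0 ?nrm_ge0 // ltW.
Qed.

Lemma diff_snd_proj (V W : normedModType C) (q : V * W) : differentiable (fun q : V * W => q.2) q.
Proof.
have lin : linear (fun v : V * W => v.2) by [].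
apply: (proj1 (@diffI _ _ _ (fun q : V * W => q.2) q (fun v => v.2) 1 lin _ _)).
- by move=> v; rewrite mul1r; exact: nrm_snd_le.
- by move=> e e0; exists 1 => // v _; rewrite /= -addrA -opprD subrr nrm0 mulr_ge0 ?nrm_ge0 // ltW.
Qed.

Lemma bounded_compact (V : normedModType C) (F : V -> C) (A : set V) : compact A ->
  (forall x, A x -> differentiable F x) -> exists2 M : R, 0 <= M & forall x, A x -> nrm (F x) <= M.
Proof.
move=> cA dF.
have [n hn] : exists n, forall x, A x -> nrm (F x) <= n%:R.
  apply: (compact_unif cA); first by move=> x m n mn h; apply: (le_trans h); rewrite ler_nat.
  move=> x Ax; exists (Num.truncn (nrm (F x) + 1)).+1.
  have [d d0 hd] := diff_cont (dF x Ax) (@ltr01 R).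
  apply/nbhs_nrm; exists d => // q qd.
  by apply: ltW; apply: lt_trans (truncnS_gt _); exact: nrm_lt_add (hd q qd).
by exists n%:R.
Qed.

Lemma compact_cbidisc (r : R) : compact [set p : V2 | nrm p <= r].
Proof.
have -> : [set p : V2 | nrm p <= r] =
   [set z : C | nrm (z - 0) <= r] `*` [set z : C | nrm (z - 0) <= r].
  apply/seteqP; split => p /=; rewrite !subr0.
    by move=> /nrm_pairle[].
  by case=> h1 h2; apply/nrm_pairle.
by apply: compact_setX; exact: compact_cdisc.
Qed.

Lemma family_bound (T : eqType) (s : seq T) (P : T -> R -> Prop) :
  (forall t x y, x <= y -> P t x -> P t y) -> (forall t, t \in s -> exists x, P t x) ->
  exists2 x, 0 <= x & forall t, t \in s -> P t x.
Proof.
move=> mono; elim: s => [|t s IH] h; first by exists 0.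
have [x x0 hx] := IH (fun u us => h u (mem_behead (s := t :: s) us)).
have [y hy] := h t (mem_head t s).
exists (Num.max x y); first by rewrite le_max x0.
move=> u; rewrite inE => /orP[/eqP->|us].
  by apply: mono hy; rewrite le_max lexx orbT.
by apply: mono (hx u us); rewrite le_max lexx.
Qed.

Variables (R' wbar : R) (g : C * C * C * C -> C) (n : nat).
Hypothesis hg : holomorphic_on (bidisc R' `*` setT `*` disc wbar) g.
Hypothesis pg : polynomial_in_u0 (bidisc R') (disc wbar) n g.

(** Compactness in (t, z, w) bounds [g] at the nodes u = 0, ..., n, and [poly_bound] extends this to
    all u; finally 1 + |u| <= 2 rho. *)
Lemma coef_growth (R1 w1 : R) : R1 < R' -> w1 < wbar -> exists2 M : R, 0 <= M &
  forall (p : V2) u w rho, nrm p <= R1 -> nrm w <= w1 -> nrm u <= rho -> 1 <= rho ->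
    nrm (g (p, u, w)) <= M * rho ^+ n.
Proof.
move=> RR ww; have [K K0 hK] := poly_bound R n.
pose A : set V3 := [set p : V2 | nrm p <= R1] `*` [set w : C | nrm (w - 0) <= w1].
have cA : compact A by apply: compact_setX; [exact: compact_cbidisc|exact: compact_cdisc].
pose Q (j : nat) (M : R) := forall q, A q -> nrm (g (q.1, j%:R, q.2)) <= M.
have [M M0 hM] : exists2 M, 0 <= M & forall j, j \in iota 0 n.+1 -> Q j M.
  apply: family_bound => [j x y xy h q Aq|j _]; first by apply: (le_trans (h q Aq)).
  have [q [q1 q2]|M M0 hM] := @bounded_compact _ (fun q : V3 => g (q.1, j%:R, q.2)) A cA.
    apply: (@dcomp_ _ V3 (C * C * C * C)%type (fun q => (q.1, j%:R, q.2)) g); last first.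
      apply: hg; split=> /=; last by apply/disc_nrm; move: q2; rewrite /= subr0 => /le_lt_trans; apply.
      by split=> //; apply/bidiscP; exact: le_lt_trans q1 RR.
    apply: (@differentiable_pair _ _ _ _ (fun q : V3 => (q.1, j%:R : C)) snd).
      apply: (@differentiable_pair _ _ _ _ fst (fun=> j%:R : C)); last exact: differentiable_cst.
      exact: diff_fst_proj.
    exact: diff_snd_proj.
  by exists M.
exists (K * M * 2 ^+ n); first by rewrite !mulr_ge0 ?exprn_ge0.
move=> p u w rho pR wW ur rho1.
have Dp : bidisc R' (p.1, p.2) by rewrite -surjective_pairing; apply/bidiscP; exact: le_lt_trans pR RR.
have Dw : disc wbar w by apply/disc_nrm; exact: le_lt_trans wW ww.
have [q qs qE] := pg Dp Dw.
have E v : g (p, v, w) = q.[v] by rewrite -qE -surjective_pairing.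
rewrite E; apply: (le_trans (hK q M qs M0 _ u)).
  move=> j jn; rewrite -E; apply: (hM j _ (p, w)); first by rewrite mem_iota.
  by split=> //=; rewrite subr0.
rewrite -[K * M * _ * _]mulrA -exprMn; apply: ler_wpM2l; first by rewrite mulr_ge0.
apply: lerXn2r; rewrite ?nnegrE ?addr_ge0 ?nrm_ge0 //; first by rewrite mulr_ge0 // (le_trans ler01).
by rewrite mulr_natl mulr2n lerD.
Qed.

Lemma coef_hol (Om : set V2) (X : V2 -> C) : Om `<=` bidisc R' -> holomorphic_on Om X ->
  forall q : V3, Om q.1 -> nrm q.2 < wbar -> differentiable (fun q : V3 => g (q.1, X q.1, q.2)) q.
Proof.
move=> OD hX q Oq qw.
apply: (@dcomp_ _ V3 (C * C * C * C)%type (fun q => (q.1, X q.1, q.2)) g); last first.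
  by apply: hg; split=> /=; [split=> //; exact: OD|apply/disc_nrm].
have [dX _] := diff_fst (q := q) (hX _ Oq).
apply: (@differentiable_pair _ _ _ _ (fun q : V3 => (q.1, X q.1)) snd).
  apply: (@differentiable_pair _ _ _ _ fst (fun q : V3 => X q.1)) => //.
  exact: diff_fst_proj.
exact: diff_snd_proj.
Qed.

End Coefficients.

Section Assembly.
Variable R : realType.
Local Notation C := (Cx R).
Local Notation V2 := (C * C)%type.
Local Notation V3 := (C * C * C)%type.

Lemma supnorm_ge T (A : set T) (f : T -> C) x : A x -> ((nrm (f x))%:E <= supnorm A f)%E.
Proof. by move=> Ax; apply: ereal_sup_ubound; exists x. Qed.

Lemma supnorm_nonneg T (A : set T) (f : T -> C) : A !=set0 -> (0 <= supnorm A f)%E.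
Proof.
move=> [x Ax]; apply: le_trans (supnorm_ge f Ax); rewrite lee_fin; exact: nrm_ge0.
Qed.

Lemma adm_of_bound (O : set V2) (y : nat -> V2 -> C) (M Q w0 : R) : open O -> 0 < Q -> w0 <= Q^-1 -> 0 <= M ->
  (forall n, holomorphic_on O (y n)) ->
  (forall n x, O x -> nrm (y n x) <= M * (n`!%:R * Q ^+ n)) -> adm O w0 y.
Proof.
move=> oO Q0 wQ M0 hy hM p Op; have [r r0 hr] := proj1 (open_nrm O) oO p Op.
exists r; split=> // [n x xr|s s0 sw]; first exact/hy/hr.
exists M => n x xr; apply: (@le_trans _ _ (M * (n`!%:R * Q ^+ n) * s ^+ n)).
  by apply: ler_wpM2r; [exact/exprn_ge0/ltW|exact: hM (hr x xr)].
rewrite -!mulrA; apply: ler_wpM2l => //; rewrite ler_piMr //.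
rewrite -exprMn exprn_ile1 ?mulr_ge0 ?(ltW Q0) ?(ltW s0) //.
by rewrite mulrC -ler_pdivlMr // mul1r ltW // (lt_le_trans sw).
Qed.

Lemma pser_le (O : set V2) (y : nat -> V2 -> C) (M Q w0 : R) p w : open O -> 0 < Q -> 0 < w0 -> w0 <= Q^-1 -> 0 <= M ->
  (forall n, holomorphic_on O (y n)) ->
  (forall n x, O x -> nrm (y n x) <= M * (n`!%:R * Q ^+ n)) -> O p -> 2 * nrm w <= w0 ->
  nrm (pser y (p, w)) <= 2 * M.
Proof.
move=> oO Q0 w00 wQ M0 hy hM Op ww.
apply: (@pser_bound _ O w0 y p M w0 w (adm_of_bound oO Q0 wQ M0 hy hM) Op w00) => // n.
apply: (@le_trans _ _ (M * (n`!%:R * Q ^+ n) * w0 ^+ n)).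
  by rewrite ler_wpM2r ?exprn_ge0 ?(ltW w00) // hM.
rewrite -!mulrA; apply: ler_wpM2l => //; rewrite ler_piMr //.
rewrite -exprMn exprn_ile1 ?mulr_ge0 ?(ltW Q0) ?(ltW w00) //.
by rewrite mulrC -ler_pdivlMr // mul1r.
Qed.

Lemma dense_false (u v M : R) : v <= M -> u < v + (u - M) -> False. Proof. lra. Qed.

Lemma le_by_dense (f : V2 -> C) p (M : R) (P : V2 -> Prop) : differentiable f p ->
  (forall e : R, 0 < e -> exists2 x, nrm (x - p) < e & P x) ->
  (forall x, P x -> nrm (f x) <= M) -> nrm (f p) <= M.
Proof.
move=> df hP fM; rewrite leNgt; apply/negP => h.
have e0 : 0 < nrm (f p) - M by rewrite subr_gt0.
have [d d0 hd] := diff_cont df e0.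
have [x xp Px] := hP d d0.
have := hd x xp; rewrite nrmB => /nrm_lt_add; have := fM x Px.
exact: dense_false.
Qed.

End Assembly.

(** * Estimates of the coefficients with constants independent of the open set *)

Section Main.
Variable R : realType.
Local Notation C := (Cx R).
Local Notation V2 := (C * C)%type.
Local Notation V3 := (C * C * C)%type.
Variables (R' : R) (Theta : set V2) (d : nat) (a : V2 -> C) (a_ : nat -> V2 -> C) (X : V2 -> C).
Variables (calS : seq nat) (S : nat) (wbar : R).
Variables (b_ : nat -> nat -> C * C * C * C -> C) (d_ : nat -> nat -> nat) (om : nat -> V2 -> C).
Hypothesis d2 : (2 <= d)%N.
Hypothesis ha : holomorphic_on (bidisc R') a.
Hypothesis ha_ : forall i, (i <= d)%N -> holomorphic_on (bidisc R') (a_ i).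
Hypothesis ad : exists2 q, bidisc R' q & a_ d q <> 0.
Hypothesis hT : analytic_variety (bidisc R') Theta.
Hypothesis hX : forall p, (bidisc R' `\` Theta) p -> differentiable X p /\ pde_at d a a_ X p.
Hypothesis Tne : exists2 q, bidisc R' q & ~ Theta q.
Hypotheses (S1 : (1 <= S)%N) (wbar0 : 0 < wbar).
Hypothesis hb : forall m k, (1 <= m <= 3)%N -> k \in calS ->
  holomorphic_on (bidisc R' `*` setT `*` disc wbar) (b_ m k) /\
  polynomial_in_u0 (bidisc R') (disc wbar) (d_ m k) (b_ m k).
Hypothesis calSS : forall k, k \in calS ->
  [/\ (k < S)%N, (k + d_ 1 k + 2 <= S)%N, (k + d_ 2 k + 2 <= S)%N & (k + d_ 3 k <= S)%N].
Hypothesis hom : forall j, (j < S)%N -> holomorphic_on (bidisc R') (om j).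

Definition Omega : set V2 := bidisc R' `\` Theta.
Definition bX m k (q : V3) : C := b_ m k (q.1, X q.1, q.2).
Definition BX m k i x : C := iter i (@dw3 R) (bX m k) (x, 0).
Definition ysol : nat -> V2 -> C := ycoef S calS om BX.

Let oOm : open Omega := open_compl_variety hT.
Let OmD : Omega `<=` bidisc R'. Proof. by move=> x []. Qed.
Let XOm : holomorphic_on Omega X. Proof. by move=> x /hX[]. Qed.
Let cS k : k \in calS -> (k < S)%N. Proof. by move=> /calSS[]. Qed.

Let W : set V3 := [set q | Omega q.1 /\ nrm q.2 < wbar].

Let oW : open W.
Proof.
apply/open_nrm => q [Oq qw]; have [r r0 hr] := proj1 (open_nrm Omega) oOm _ Oq.
exists (Num.min r (wbar - nrm q.2)); first by rewrite lt_min r0 subr_gt0.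
move=> x /nrm_pairP[] /lt_min2[h1 _] /lt_min2[_ h2].
split; first exact: hr.
by have := nrm_lt_add (h2 : nrm (x.2 - q.2) < _); rewrite addrC subrK.
Qed.

Lemma bX_hol m k : (1 <= m <= 3)%N -> k \in calS -> holomorphic_on W (bX m k).
Proof.
by move=> m3 kS q [Oq qw]; exact: (coef_hol (proj1 (hb m3 kS)) OmD XOm Oq qw).
Qed.

Lemma BX_hol m k i : (1 <= m <= 3)%N -> k \in calS -> holomorphic_on Omega (BX m k i).
Proof.
move=> m3 kS x Ox; have hW := der_iter_hol (derivation_D ((0, 0, 1) : V3) oW) i (bX_hol m3 kS).
apply: (@dcomp_ _ V2 V3 (fun x => (x, 0)) (iter i (@dw3 R) (bX m k))); last first.
  by apply: hW; split=> //=; rewrite nrm0.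
by apply: (@differentiable_pair _ _ _ _ id (fun=> 0 : C)); [exact: did_|exact: dcst_].
Qed.

Lemma ysol_hol n : holomorphic_on Omega (ysol n).
Proof.
apply: (ycoef_hol S1 cS oOm) => [j jS x Ox|m k i m3 kS]; last exact: BX_hol.
exact: hom jS _ (OmD Ox).
Qed.

Lemma ysol_rec n x : ysol (n + S)%N x = \sum_(k <- calS) \sum_(i < n.+1) yterm BX ysol n k i x.
Proof. exact: ycoef_rec. Qed.

Lemma uniform_coefficients (R0 : R) : 0 < R0 -> R0 < R' -> exists M Q : R, [/\ 0 <= M, 0 < Q &
  forall (O : set V2) (rho : R), open O -> O `<=` bidisc R0 `\` Theta -> 1 <= rho ->
    (forall p, O p -> nrm (X p) <= rho / 2) ->
    forall n p, O p -> nrm (ysol n p) <= M * expR rho * (n`!%:R * Q ^+ n)].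
Proof.
move=> R00 RR.
have [n0 hgood] := uniform_good d2 ha ha_ ad hT hX Tne RR.
pose R1 := (R0 + R') / 2.
have [R01 R1R] : R0 < R1 /\ R1 < R' by rewrite /R1; split; move: RR; lra.
pose w1 := wbar / 2.
have [w10 w1w] : 0 < w1 /\ w1 < wbar by rewrite /w1; split; move: wbar0; lra.
(* A ball of radius [c / rho] about a point of [O] may leave [O] and meet [Theta]. It has to stay
   within the reach of [good] and inside the bidisc of radius [R1], on which the data are
   bounded. *)
pose c := Num.min (n0.+1%:R^-1) (R1 - R0).
have c0 : 0 < c by rewrite lt_min invr_gt0 ltr0n subr_gt0.
have cn : c <= n0.+1%:R^-1 by rewrite ge_min lexx.
have cR : c <= R1 - R0 by rewrite ge_min lexx orbT.
pose D : R := 6 * expR 1 / w1.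
have D0 : 0 <= D by rewrite /D divr_ge0 ?(ltW w10) // mulr_ge0 // expR_ge0.
pose P (mk : nat * nat) (be : R) := forall (p : V2) u w rho, nrm p <= R1 -> nrm w <= w1 ->
  nrm u <= rho -> 1 <= rho -> nrm (b_ mk.1 mk.2 (p, u, w)) <= be * rho ^+ d_ mk.1 mk.2.
have [be be0 hbe] : exists2 be, 0 <= be &
    forall mk, mk \in [seq (m, k) | m <- iota 1 3, k <- calS] -> P mk be.
  apply: family_bound => [mk x z xz h p u w rho pR wW ur rho1|mk].
    by apply: (le_trans (h p u w rho pR wW ur rho1)); rewrite ler_wpM2r // exprn_ge0 // (le_trans ler01).
  case/allpairsP => -[m k] [m3 kS ->] /=; move: m3; rewrite mem_iota => m3.
  have [h1 h2] := hb m3 kS.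
  by have [M M0 hM] := coef_growth h1 h2 R1R w1w; exists M.
have [M M0 hM] : exists2 M, 0 <= M &
    forall j, j \in iota 0 S -> forall p : V2, nrm p <= R1 -> nrm (om j p) <= M.
  apply: family_bound => [j x z xz h p pR|j]; first exact: le_trans (h p pR) xz.
  rewrite mem_iota => jS; have [p pR|M M0 hM] := @bounded_compact _ _ (om j) _ (@compact_cbidisc R R1).
    by apply: hom => //; apply/bidiscP; exact: le_lt_trans pR R1R.
  by exists M.
pose K1 : R := 2 * (size calS)%:R * (be * (2 * (6 * expR 1 / c) + 1)).
have K10 : 0 <= K1.
  have e6 : 0 <= 6 * expR 1 / c by rewrite divr_ge0 ?(ltW c0) // mulr_ge0 // expR_ge0.
  apply: mulr_ge0; first by rewrite mulr_ge0 // ler0n.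
  by apply: mulr_ge0 => //; apply: addr_ge0 => //; apply: mulr_ge0.
(* The sum meets the three requirements on [L] at once. *)
pose L := 1 + 2 * D + K1.
have D20 : 0 <= 2 * D by rewrite mulr_ge0.
have L1 : 1 <= L by rewrite /L -addrA lerDl addr_ge0.
have DL : 2 * D <= L by rewrite /L addrAC lerDr addr_ge0.
have LK : K1 <= L by rewrite /L lerDr addr_ge0.
exists M, (L * 2 * expR 1); split=> //.
  by rewrite !mulr_gt0 ?expR_gt0 // (lt_le_trans ltr01).
move=> O rho oO OT rho1 hXO n p Op.
have rho0 : 0 < rho by rewrite (lt_le_trans ltr01).
have OR x : O x -> nrm x < R0 by move=> /OT[/bidiscP].
have OOm x : O x -> Omega x.
  move=> Ox; have [h1 h2] := OT x Ox; split=> //; apply/bidiscP.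
  exact: lt_trans (OR x Ox) RR.
have [G [g1 g2 g3]] := hgood p (ltW (OR p Op)).
have in0 : 0 < n0.+1%:R^-1 :> R by rewrite invr_gt0 ltr0n.
(* [final_estimate] must be centred where [G] is nonzero; [p] itself is reached by continuity. *)
apply: (@le_by_dense _ (ysol n) p _ (fun x => [/\ O x, nrm (x - p) < n0.+1%:R^-1 & G x != 0])).
- exact: ysol_hol (OOm p Op).
- move=> e e0; have [r r0 hr] := proj1 (open_nrm O) oO p Op.
  have m0 : 0 < Num.min e (Num.min r n0.+1%:R^-1) by rewrite !lt_min e0 r0.
  have [x xp Gx] := g2 _ m0.
  have [x1 x2 x3] : [/\ nrm (x - p) < e, nrm (x - p) < r & nrm (x - p) < n0.+1%:R^-1].
    by apply/and3P; rewrite -!lt_min.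
  by exists x => //; split=> //; exact: hr.
move=> q [Oq qp Gq].
have cr : c / rho <= n0.+1%:R^-1.
  by apply: le_trans cn; rewrite ler_pdivrMr // ler_peMr // ltW.
have crn : c / rho <= n0.+1%:R^-1 / rho by rewrite ler_wpM2r // invr_ge0 ltW.
have crR : c / rho <= R1 - R0.
  by apply: le_trans cR; rewrite ler_pdivrMr // ler_peMr // ltW.
have near x : nrm (x - q) < c / rho -> [/\ nrm x <= R1, nrm x < R', differentiable G x &
    G x != 0 -> Omega x /\ nrm (X x) <= rho].
  move=> xq; have xp : nrm (x - p) < 2 / n0.+1%:R.
    by rewrite mulrDl mul1r; exact: nrm_sub_lt (lt_le_trans xq cr) qp.
  have [xR dGx Tx] := g1 x xp; split=> //.
    apply: ltW; apply: (lt_le_trans (nrm_lt_add xq)); rewrite -lerBrDl.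
    by apply: (le_trans crR); rewrite lerD2l lerN2 ltW // OR.
  move=> Gx; split; first by split; [apply/bidiscP|exact: Tx].
  exact: (g3 q rho x qp Gq rho1 (hXO q Oq) (lt_le_trans xq crn) Gx).
apply: (@final_estimate _ S calS d_ BX ysol G q M D be L rho c rho1 c0 D0 be0 M0 L1 DL LK calSS) => //.
- by move=> x /near[].
- by move=> k x /near[_ _ _ h] /h[Ox _]; exact: ysol_hol.
- move=> j x jS /near[xR _ _ _] _; rewrite /ysol ycoef_init //.
  by apply: hM xR; rewrite mem_iota.
- by move=> k x _ _; exact: ysol_rec.
move=> m k i x m3 kS /near[xR _ _ h] /h[Ox Xx].
apply: coef_bound => //.
- by move=> w ww; apply: bX_hol => //; split=> //=; exact: lt_trans ww w1w.
- move=> w ww; have := hbe (m, k) _ x (X x) w rho xR (ltW ww) Xx rho1; apply.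
  by apply/allpairsP; exists (m, k); split=> //; rewrite mem_iota.
Qed.

End Main.

Section Degrees.
Variable R : realType.

(** Since b > 1, each product b x is at least x, and the constants leave two units for each first
    derivative. *)
Lemma degree_bounds (k S d d1 d2 d3 : nat) (b : R) : 1 < b ->
  S%:R >= k%:R + 1 + Num.max (b * (d1%:R + 2) + 3) (d%:R + 1 + b * (d%:R + d1%:R + 1)) ->
  S%:R >= k%:R + 3 + b * (2 + d2%:R) -> S%:R >= k%:R + b * d3%:R ->
  [/\ (k + d1 + 2 <= S)%N, (k + d2 + 2 <= S)%N & (k + d3 <= S)%N].
Proof.
move=> b1 h1 h2 h3.
have hb (x : R) : 0 <= x -> x <= b * x by move=> x0; rewrite ler_peMl // ltW.
have c1 := hb (d1%:R + 2) (addr_ge0 (ler0n _ _) (ler0n _ _)).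
have c2 := hb (2 + d2%:R) (addr_ge0 (ler0n _ _) (ler0n _ _)).
have c3 := hb d3%:R (ler0n _ _).
have m1 : b * (d1%:R + 2) + 3 <= Num.max (b * (d1%:R + 2) + 3) (d%:R + 1 + b * (d%:R + d1%:R + 1)).
  by rewrite le_max lexx.
split; rewrite -(ler_nat R) !natrD.
- apply: le_trans h1; move: m1; move: (Num.max _ _) => x; lra.
- by apply: le_trans h2; lra.
- by apply: le_trans h3; lra.
Qed.

End Degrees.

Section Final.
Variable R : realType.
Local Notation C := (Cx R).
Local Notation V2 := (C * C)%type.

(** The instance h = 0 of the Cauchy estimates. *)
Lemma X_half (X : V2 -> C) (K : set V2) (nu rho : R) : cauchy_estimate X K nu rho ->
  forall p, interior K p -> nrm (X p) <= rho / 2.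
Proof.
move=> /(_ 0%N) h p Kp; rewrite -lee_fin; apply: le_trans h.
apply: (le_trans _ (supnorm_ge _ Kp)) => /=.
by rewrite fact0 expr0 mulr1 divr1.
Qed.

Lemma rhs_bound (sigma z rho M N : R) (s : \bar R) : z != 0 -> sigma = z^-1 -> 0 <= N -> N <= M * expR rho ->
  (0 <= s)%E -> (N%:E <= (M * expR (sigma * z * rho))%:E + s)%E.
Proof.
move=> z0 -> N0 NM s0; rewrite mulVf // mul1r.
by apply: (@le_trans _ _ (M * expR rho)%:E); [rewrite lee_fin|exact: leeDl].
Qed.

End Final.

Theorem theorem1 (R : realType) (R' : R) (Theta : set (Cx R * Cx R)) (d : nat)
    (a : Cx R * Cx R -> Cx R) (a_ : nat -> Cx R * Cx R -> Cx R)
    (f : Cx R -> Cx R) (X : Cx R * Cx R -> Cx R)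
    (calS : {fset nat}) (S : nat) (wbar : R)
    (b_ : nat -> nat -> Cx R * Cx R * Cx R * Cx R -> Cx R)
    (d_ : nat -> nat -> nat)
    (b : R) (omega : nat -> Cx R * Cx R -> Cx R) :
  0 < R' ->
  (2 <= d)%N ->
  holomorphic_on (bidisc R') a ->
  (forall p, (p <= d)%N -> holomorphic_on (bidisc R') (a_ p)) ->
  (exists2 q, bidisc R' q & a_ d q <> 0) ->
  holomorphic_on (disc R') f ->
  analytic_variety (bidisc R') Theta ->
  solves_X R' Theta d a a_ f X ->
  (1 <= S)%N ->
  (forall k, k \in calS -> (k < S)%N) ->
  0 < wbar ->
  (forall m k, (1 <= m <= 3)%N -> k \in calS ->
    holomorphic_on (bidisc R' `*` setT `*` disc wbar) (b_ m k) /\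
    polynomial_in_u0 (bidisc R') (disc wbar) (d_ m k) (b_ m k)) ->
  1 < b ->
  (forall k, k \in calS ->
    [/\ S%:R >= k%:R + 1 +
          Num.max (b * ((d_ 1%N k)%:R + 2) + 3)
                  (d%:R + 1 + b * (d%:R + (d_ 1%N k)%:R + 1)),
        S%:R >= k%:R + 3 + b * (2 + (d_ 2%N k)%:R),
        S%:R >= k%:R + 1 + b * Num.max (d_ 1%N k)%:R (d_ 2%N k)%:R &
        S%:R >= k%:R + b * (d_ 3%N k)%:R]) ->
  (forall j, (j < S)%N ->
    holomorphic_on (bidisc R') (omega j) /\
    (supnorm (bidisc R') (omega j) < +oo)%E) ->
  forall R0 : R, 0 < R0 -> R0 < R' ->
  exists sigma Wbar C12 : R,
    [/\ 0 < sigma, 0 < Wbar, 0 < C12, Wbar / 2 <= wbar &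
    forall (K : set (Cx R * Cx R)) (nu rho : R),
      compact K ->
      K `<=` bidisc R0 `\` Theta ->
      K° !=set0 ->
      cauchy_rate (bidisc R0 `\` Theta) X K nu ->
      1 < rho ->
      cauchy_estimate X K nu rho ->
      exists Y : Cx R * Cx R * Cx R -> Cx R,
        [/\ holomorphic_on (K° `*` disc (Wbar / 2)) Y,
            forall (t z w : Cx R), K° (t, z) -> disc (Wbar / 2) w ->
              iter S (@dw3 R) Y (t, z, w) =
              \sum_(k <- calS)
                (b_ 1%N k (t, z, X (t, z), w) * dt3 (iter k (@dw3 R) Y) (t, z, w)
                 + b_ 2%N k (t, z, X (t, z), w) * dz3 (iter k (@dw3 R) Y) (t, z, w)
                 + b_ 3%N k (t, z, X (t, z), w) * iter k (@dw3 R) Y (t, z, w)),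
            forall j, (j < S)%N -> forall (t z : Cx R), K° (t, z) ->
              iter j (@dw3 R) Y (t, z, 0) = omega j (t, z) &
            (supnorm (K° `*` disc (Wbar / 2)) Y <=
               (C12 * expR (sigma * zetaR b * rho))%:E +
               \sum_(0 <= j < S)
                 supnorm K° (omega j) * ((Wbar / 2) ^+ j / j`!%:R)%:E)%E]].
Proof.
move=> R'0 d2 ha ha_ ad hf hT [XOm Xpde _] S1 cS wbar0 hb b1 hS hom R0 R00 RR.
have hX p : (bidisc R' `\` Theta) p -> differentiable X p /\ pde_at d a a_ X p.
  by move=> Op; split; [exact: XOm|exact: Xpde].
have z0 := zeta_gt0 b1.
have [Tne|nT] := pselect (exists2 q, bidisc R' q & ~ Theta q); last first.
  (* If [Theta] fills the bidisc there is no [K] with interior points, so any constants will do. *)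
  exists 1, wbar, 1; split=> //; first by rewrite ler_pdivrMr // ler_peMr ?(ltW wbar0) // ler1n.
  move=> K nu rho _ KO [q Kq] _ _ _; case: nT.
  have [/bidiscP qR Tq] := KO q (interior_subset Kq).
  by exists q => //; apply/bidiscP; exact: lt_trans qR RR.
have calSS k : k \in enum_fset calS ->
    [/\ (k < S)%N, (k + d_ 1%N k + 2 <= S)%N, (k + d_ 2%N k + 2 <= S)%N & (k + d_ 3%N k <= S)%N].
  move=> kS; have [h1 h2 _ h3] := hS k kS.
  by have [] := degree_bounds b1 h1 h2 h3; split=> //; exact: cS.
have homD j : (j < S)%N -> holomorphic_on (bidisc R') (omega j) by move=> /hom[].
have [M [Q [M0 Q0 hy]]] := uniform_coefficients d2 ha ha_ ad hT hX Tne S1 wbar0 hb calSS homD R00 RR.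
pose y := ysol X (enum_fset calS) S b_ omega.
(* [Q^-1] is the radius of convergence granted by the coefficient bound; [wbar] is where the
   [b_ m k] are defined. *)
pose w0 := Num.min Q^-1 wbar.
have w00 : 0 < w0 by rewrite lt_min invr_gt0 Q0.
have wQ : w0 <= Q^-1 by rewrite ge_min lexx.
have ww : w0 <= wbar by rewrite ge_min lexx orbT.
have E32 : w0 / (8 * 2) / 2 = w0 / 4 / 8 by field.
(* With this [sigma] the exponent is exactly [rho]. Half of [w0 / (8 * 2)] is the radius
   [w0 / 4 / 8] of [pser_pde]. The sum of the series is at most [2 * M * expR rho], and 1 is added
   because [M] may be 0. *)
exists (zetaR b)^-1, (w0 / (8 * 2)), (2 * M + 1); split.
- by rewrite invr_gt0.
- by rewrite divr_gt0 // mulr_gt0.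
- by rewrite ltr_wpDl // mulr_ge0.
- by rewrite E32; apply: le_trans ww; move: w00; lra.
move=> K nu rho cK KO [k0 Kk0] _ rho1 cest; rewrite E32.
pose O := interior K.
have oO : open O by exact: open_interior.
have OK : O `<=` bidisc R0 `\` Theta by move=> p /interior_subset /KO.
have OOm p : O p -> Omega R' Theta p.
  by move=> /OK[/bidiscP pR Tp]; split=> //; apply/bidiscP; exact: lt_trans pR RR.
have Xr := X_half cest.
have yb := hy O rho oO OK (ltW rho1) Xr.
have hyO n : holomorphic_on O (y n).
  by move=> p /OOm Op; exact: (ysol_hol hT hX S1 wbar0 hb calSS homD n Op).
have Me0 : 0 <= M * expR rho by rewrite mulr_ge0 // expR_ge0.
have ady := adm_of_bound oO Q0 wQ Me0 hyO yb.
have small (w : Cx R) : nrm w < w0 / 4 / 8 -> 2 * nrm w < w0.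
  by move=> h; move: h w00; move: (nrm w) => x; lra.
exists (pser y); split.
- move=> q [Oq /disc_nrm qw]; have [h _ _] := pser_diff ady Oq (small _ qw); exact: h.
- move=> t z w Op /disc_nrm wr.
  have hbX m k : (1 <= m <= 3)%N -> k \in enum_fset calS ->
      holomorphic_on [set q : Cx R * Cx R * Cx R | O q.1 /\ 2 * nrm q.2 < w0] (bX X b_ m k).
    move=> m3 kS q [Oq qw]; apply: (bX_hol hX hb m3 kS); split; first exact: OOm.
    by apply: (lt_le_trans _ ww); move: qw (nrm_ge0 q.2); move: (nrm q.2) => x; lra.
  have yr n x : O x -> y (n + S)%N x = \sum_(k <- enum_fset calS) \sum_(i < n.+1) yterm (BX X b_) y n k i x.
    by move=> _; exact: (ysol_rec X b_ omega S1 calSS n x).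
  exact: (pser_pde w00 oO ady hbX yr Op wr).
- move=> j jS t z Op.
  have Op' : O ((t, z, 0) : Cx R * Cx R * Cx R).1 by exact: Op.
  have w00' : 2 * nrm ((t, z, 0) : Cx R * Cx R * Cx R).2 < w0 by rewrite /= nrm0 mulr0.
  by rewrite (pser_iter j ady Op' w00') pser0 addn0 /y /ysol ycoef_init.
apply: ub_ereal_sup => _ [[p w] [/= Op /disc_nrm wr] <-].
(* The first term already bounds [Y], since [M] also dominates the initial data; the sum of their
   suprema is nonnegative. *)
apply: (@rhs_bound _ _ _ _ _ (nrm (pser y (p, w)))); rewrite ?nrm_ge0 ?gt_eqF //.
  apply: (le_trans (pser_le oO Q0 w00 wQ Me0 hyO yb Op (ltW (small _ wr)))).
  by rewrite mulrA ler_wpM2r ?expR_ge0 // lerDl.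
apply: sume_ge0 => j _; apply: mule_ge0; first by apply: supnorm_nonneg; exists k0.
by rewrite lee_fin divr_ge0 // exprn_ge0 // !divr_ge0 // ltW.
Qed.
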